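(* Let $n\ge3$, $\sigma_0>0$, let $M$ be an $n$-dimensional asymptotically conic manifold, let $V:M\to\mathbf{R}$ be a short-range potential, and let $H:=-\Delta_M+V$. Then the spectrum of $H$ on $(0,+\infty)$ is purely absolutely continuous.
   Context: Asymptotically conic manifold (with $n\ge3$, $\sigma_0>0$): a smooth connected $n$-dimensional Riemannian manifold $(M,g)$ which, outside a compact set $K_0\subset M$, is parameterized as $M\setminus K_0=\{(r,\omega): r>R_0,\ \omega\in\partial M\}$ for some $R_0>1$, where $(\partial M,h)$ is a smooth compact $(n-1)$-dimensional Riemannian manifold, and there $g=dr^2+r^2h[r]_{ab}(\omega)\,d\omega^a d\omega^b$ with $h[r]_{ab}=h_{ab}(\omega)+r^{-2\sigma_0}e_{ab}(r,\omega)$, where $|e_{ab}(r,y)|+r|\partial_re_{ab}(r,y)|+|\nabla_ye_{ab}(r,y)|_h\le C$ on $M\setminus K_0$; qualitatively, $e_{ab}(1/s,y)$ is also assumed to extend smoothly to $[0,1/R_0]\times\partial M$. The weight $\langle x\rangle$ equals $r$ on $M\setminus K_0$ and is extended smoothly to $K_0$ so that it stays between $R_0/2$ and $R_0$ there. $L^2(M)$ is with respect to the Riemannian measure; $\Delta_M$ is the Laplace–Beltrami operator. A short-range potential is a real function $V$ on $M$ with $\langle x\rangle^{1+2\sigma_0}V\in L^\infty(M)$. $H$ is essentially self-adjoint on $L^2(M)$. *)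

(* Defs.v *)
From HB Require Import structures.
From mathcomp Require Import all_boot all_order all_algebra.
From mathcomp Require Import all_classical all_reals all_analysis.
From mathcomp Require Import complex.

Set Implicit Arguments.
Unset Strict Implicit.
Unset Printing Implicit Defensive.

Import Order.TTheory GRing.Theory Num.Theory.
Import numFieldNormedType.Exports.

Local Open Scope classical_set_scope.
Local Open Scope ring_scope.

(** * Calculus on R^n (row vectors) *)

Section Calculus.
Context {R : realType}.

Definition partial {n} {W : normedModType R} (i : 'I_n) (f : 'rV[R]_n -> W) :
  'rV[R]_n -> W := fun x => 'D_(delta_mx 0 i) f x.

(* C^oo on the open set U: every iterated partial derivative is continuous at,
   and has all its partial derivatives at, each point of U. *)
Definition smooth_on {n} {W : normedModType R} (U : set 'rV[R]_n)
    (f : 'rV[R]_n -> W) : Prop :=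
  forall (s : seq 'I_n) (x : 'rV[R]_n), U x ->
    {for x, continuous (foldr partial f s)} /\
    forall i : 'I_n, derivable (foldr partial f s) x (delta_mx 0 i).

(* 'J F q acts on row vectors (v *m 'J F q is the differential at v), so this
   is the matrix of the pull-back by F of the bilinear form G. *)
Definition pullback {m n} (F : 'rV[R]_m -> 'rV[R]_n) (G : 'rV[R]_n -> 'M[R]_n)
    (q : 'rV[R]_m) : 'M[R]_m :=
  'J F q *m G (F q) *m ('J F q)^T.

(* Integral of a nonnegative Borel function against Lebesgue measure on R^n,
   as an iterated integral (Tonelli). *)
Fixpoint int_rV n : ('rV[R]_n -> \bar R) -> \bar R :=
  match n with
  | 0 => fun f => f 0
  | n'.+1 => fun f =>
      (\int[lebesgue_measure]_(t in [set: R])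
         int_rV (fun v : 'rV[R]_n' => f (row_mx (const_mx t : 'rV[R]_1) v)))%E
  end.

(* Gamma^d_{ca} of the metric with coordinate matrix h. *)
Definition christoffel {n} (h : 'rV[R]_n -> 'M[R]_n) (y : 'rV[R]_n)
    (d c a : 'I_n) : R :=
  2^-1 * \sum_(b < n) invmx (h y) d b *
    (partial c h y b a + partial a h y b c - partial b h y c a).

(* Matrix (a, b) |-> (nabla_c T)_{ab} for the Levi-Civita connection of h. *)
Definition cov_deriv {n} (h T : 'rV[R]_n -> 'M[R]_n) (y : 'rV[R]_n) (c : 'I_n) :
  'M[R]_n :=
  \matrix_(a, b) (partial c T y a b
    - \sum_(d < n) christoffel h y d c a * T y d b
    - \sum_(d < n) christoffel h y d c b * T y a d).

(* h^{ac} h^{bd} S_{ab} T_{cd} *)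
Definition tensor_dot {n} (h S T : 'M[R]_n) : R :=
  \tr (invmx h *m S *m invmx h *m T^T).

Definition tensor_norm {n} (h S : 'M[R]_n) : R := Num.sqrt (tensor_dot h S S).

Definition cov_deriv_norm {n} (h T : 'rV[R]_n -> 'M[R]_n) (y : 'rV[R]_n) : R :=
  Num.sqrt (\sum_(c < n) \sum_(d < n) invmx (h y) c d *
    tensor_dot (h y) (cov_deriv h T y c) (cov_deriv h T y d)).

Definition vol_density {n} (g : 'rV[R]_n -> 'M[R]_n) (p : 'rV[R]_n) : R :=
  Num.sqrt (\det (g p)).

Definition laplace_beltrami {n} (g : 'rV[R]_n -> 'M[R]_n) (f : 'rV[R]_n -> R)
    (p : 'rV[R]_n) : R :=
  (vol_density g p)^-1 * \sum_(k < n)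
    partial k (fun q => vol_density g q *
      \sum_(l < n) invmx (g q) k l * partial l (f : 'rV[R]_n -> R^o) q : R^o) p.

End Calculus.

(** * Smooth and Riemannian manifolds *)

Section Manifolds.
Context {R : realType}.

Record atlas (n : nat) (T : topologicalType) := Atlas {
  index : Type ;
  dom : index -> set T ;
  chart : index -> T -> 'rV[R]_n ;
  param : index -> 'rV[R]_n -> T (* inverse of the chart *)
}.

Definition img {n T} (A : atlas n T) (i : index A) : set 'rV[R]_n :=
  chart i @` dom i.

Record is_chart n T (A : atlas n T) (i : index A) : Prop := IsChart {
  dom_open : open (dom i) ;
  img_open : open (img i) ;
  chartK : forall x, dom i x -> param i (chart i x) = x ;
  chart_continuous : forall x, dom i x -> {for x, continuous (chart i)} ;
  param_continuous : forall p, img i p -> {for p, continuous (param i)}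
}.

Record smooth_manifold n (T : topologicalType) (A : atlas n T) : Prop :=
  SmoothManifold {
  mfd_hausdorff : hausdorff_space T ;
  mfd_second_countable : @second_countable T ;
  mfd_chart : forall i : index A, is_chart i ;
  mfd_cover : forall x : T, exists i : index A, dom i x ;
  mfd_transition : forall i j : index A,
    smooth_on (chart i @` (dom i `&` dom j)) (chart j \o param i)
}.

Definition smooth_map m n (S T : topologicalType) (A : atlas m S)
    (B : atlas n T) (U : set S) (f : S -> T) : Prop :=
  (forall x, U x -> {for x, continuous f}) /\
  forall (i : index A) (j : index B),
    smooth_on (chart i @` (dom i `&` U `&` f @^-1` dom j))
              (chart j \o f \o param i).

Definition smooth_fun n (T : topologicalType) (A : atlas n T) (f : T -> R) :
  Prop := forall i : index A, smooth_on (img i) (f \o param i : _ -> R^o).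

(* The atlas of R x T whose coordinates are (r, y). *)
Definition cyl_atlas n (T : topologicalType) (A : atlas n T) :
    atlas n.+1 (R * T)%type := {|
  index := index A ;
  dom := fun i => [set z | dom i z.2] ;
  chart := fun i z => row_mx (const_mx z.1 : 'rV[R]_1) (chart i z.2) ;
  param := fun i q => let q' : 'rV[R]_(1 + n) := q in
    (lsubmx q' 0 0, param i (rsubmx q')) |}.

(* Covariant 2-tensor fields, by their matrices in each chart. *)
Definition field2 n T (A : atlas n T) := index A -> 'rV[R]_n -> 'M[R]_n.

Definition is_tensor2 n T (A : atlas n T) (G : field2 A) : Prop :=
  forall (i j : index A) (p : 'rV[R]_n), (chart i @` (dom i `&` dom j)) p ->
    G i p = pullback (chart j \o param i) (G j) p.

Record is_metric n T (A : atlas n T) (G : field2 A) : Prop := IsMetric {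
  metric_tensor : is_tensor2 G ;
  metric_smooth : forall i, smooth_on (img i) (G i) ;
  metric_sym : forall i p, img i p -> (G i p)^T = G i p ;
  metric_pos : forall i p (v : 'rV[R]_n), img i p -> v != 0 ->
    0 < (v *m G i p *m v^T) 0 0
}.

Record riemannian_manifold (n : nat) := RiemannianManifold {
  carrier :> ptopologicalType ;
  charts : atlas n carrier ;
  metric : field2 charts ;
  charts_smooth : smooth_manifold charts ;
  metricP : is_metric metric
}.

Definition borel (T : ptopologicalType) := g_sigma_algebraType (@open T).

Definition riemannian_measure n (M : riemannian_manifold n)
    (mu : {measure set (borel M) -> \bar R}) : Prop :=
  forall (i : index (charts M)) (B : set (borel M)),
    measurable B -> B `<=` dom i ->
    mu B = int_rV (fun p =>
      (vol_density (metric i) p * \1_((chart i : M -> _) @` B) p)%:E).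

Definition is_laplacian n (M : riemannian_manifold n) (f w : M -> R) : Prop :=
  forall (i : index (charts M)) (x : M), dom i x ->
    w x = laplace_beltrami (metric i) (f \o param i) (chart i x).

End Manifolds.

Arguments atlas R n T : clear implicits.
Arguments riemannian_manifold R n : clear implicits.

(** * Asymptotically conic manifolds *)

Section Conic.
Context {R : realType}.

(* The end is [conic_map : (r, w) |-> x], a diffeomorphism from
   {r > R0} x N onto M \ K0 with inverse [conic_polar]; N is the boundary at
   infinity, nonempty because its carrier is pointed. *)
Record asymptotically_conic (m : nat) (sigma0 : R)
    (M : riemannian_manifold R m.+1) := AsymptoticallyConic {
  conic_connected : connected [set: M] ;
  conic_core : set M ;
  conic_radius : R ;
  conic_boundary : riemannian_manifold R m ;
  conic_map : R * conic_boundary -> M ;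
  conic_polar : M -> R * conic_boundary ;
  conic_error : R -> field2 (charts conic_boundary) ;
  conic_core_compact : compact conic_core ;
  conic_radius_gt1 : 1 < conic_radius ;
  conic_boundary_compact : compact [set: conic_boundary] ;
  conic_mapP : forall z, conic_radius < z.1 ->
    ~ conic_core (conic_map z) /\ conic_polar (conic_map z) = z ;
  conic_polarP : forall x, ~ conic_core x ->
    conic_radius < (conic_polar x).1 /\ conic_map (conic_polar x) = x ;
  conic_map_smooth : smooth_map (cyl_atlas (charts conic_boundary)) (charts M)
    [set z | conic_radius < z.1] conic_map ;
  conic_polar_smooth : smooth_map (charts M)
    (cyl_atlas (charts conic_boundary)) (~` conic_core) conic_polar ;
  (* The end is attached to the core along r = R0, so that M is complete. *)
  conic_proper : forall rho : R, compact
    (conic_core `|`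
     conic_map @` [set z | conic_radius < z.1 /\ z.1 <= rho]) ;
  (* g = dr^2 + r^2 (h + r^(-2 sigma0) e) *)
  conic_metric : forall (i : index (charts M))
      (a : index (charts conic_boundary)) (r : R) (y : 'rV[R]_m),
    conic_radius < r -> img a y -> dom i (conic_map (r, param a y)) ->
    pullback (chart i \o conic_map \o
              param (a : index (cyl_atlas (charts conic_boundary))))
        (metric i) (row_mx (const_mx r : 'rV[R]_1) y) =
      block_mx (1%:M : 'M[R]_1) 0 0
        (r ^+ 2 *: (metric a y + r `^ (- (2 * sigma0)) *: conic_error r a y)) ;
  conic_error_tensor : forall r, conic_radius < r -> is_tensor2 (conic_error r) ;
  conic_error_bound : exists C : R,
    forall (a : index (charts conic_boundary)) (r : R) (y : 'rV[R]_m),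
    conic_radius < r -> img a y ->
    tensor_norm (metric a y) (conic_error r a y)
    + r * tensor_norm (metric a y) (derive1 (fun t => conic_error t a y) r)
    + cov_deriv_norm (metric a) (conic_error r a) y <= C ;
  (* e(1/s, y) is smooth up to the boundary on [0, 1/R0] x N *)
  conic_error_smooth : forall a : index (charts conic_boundary),
    exists (W : set 'rV[R]_(1 + m)) (F : 'rV[R]_(1 + m) -> 'M[R]_m),
    [/\ open W,
        (forall (s : R) y, 0 <= s <= conic_radius^-1 -> img a y ->
           W (row_mx (const_mx s) y)),
        smooth_on W F &
        forall (s : R) y, 0 < s < conic_radius^-1 -> img a y ->
          F (row_mx (const_mx s) y) = conic_error s^-1 a y]
}.

Definition is_weight m sigma0 (M : riemannian_manifold R m.+1)
    (X : asymptotically_conic sigma0 M) (w : M -> R) : Prop :=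
  [/\ smooth_fun (charts M) w,
      (forall x, ~ conic_core X x -> w x = (conic_polar X x).1) &
      forall x, conic_core X x ->
        conic_radius X / 2 <= w x <= conic_radius X].

Definition short_range m sigma0 (M : riemannian_manifold R m.+1)
    (mu : {measure set (borel M) -> \bar R}) (w V : M -> R) : Prop :=
  ((fun x => w x `^ (1 + 2 * sigma0) * V x) : borel M -> R)
    \in Lfun mu +oo%E.

End Conic.

(** * Unbounded operators on complex L^2 *)

Section L2.
Context {d : measure_display} {T : measurableType d} {R : realType}.
Variable mu : {measure set T -> \bar R}.
Local Notation Re := (@complex.Re R).
Local Notation Im := (@complex.Im R).

Implicit Types u v w : T -> R[i].

Definition norm2 u : \bar R :=
  (\int[mu]_x (Re (u x) ^+ 2 + Im (u x) ^+ 2)%:E)%E.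

(* Elements of L^2 are handled through representatives. *)
Definition L2 u : Prop :=
  [/\ measurable_fun [set: T] (Re \o u),
      measurable_fun [set: T] (Im \o u) & (norm2 u < +oo)%E].

Definition inner u v : R[i] :=
  Complex (\int[mu]_x Re (u x * (v x)^*%C))%R
          (\int[mu]_x Im (u x * (v x)^*%C))%R.

Definition L2_cvg (us : nat -> T -> R[i]) u : Prop :=
  (fun k => norm2 (fun x => us k x - u x)) @ \oo --> 0%E.

(* An operator is given by its graph: S u w means that u is in the domain of S
   and S u = w. *)
Definition operator := (T -> R[i]) -> (T -> R[i]) -> Prop.

Definition op_closure (S : operator) : operator := fun u w =>
  [/\ L2 u, L2 w & exists us ws : nat -> T -> R[i],
    [/\ forall k, S (us k) (ws k), L2_cvg us u & L2_cvg ws w]].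

Definition op_adjoint (S : operator) : operator := fun u w =>
  [/\ L2 u, L2 w & forall v z, S v z -> inner z u = inner v w].

Definition self_adjoint (S : operator) : Prop :=
  forall u w, op_adjoint S u w <-> S u w.

Definition essentially_self_adjoint (S : operator) : Prop :=
  self_adjoint (op_closure S).

Record orthogonal_projection (P : (T -> R[i]) -> T -> R[i]) : Prop :=
  OrthogonalProjection {
  proj_L2 : forall u, L2 u -> L2 (P u) ;
  proj_linear : forall (c : R[i]) u v, L2 u -> L2 v ->
    {ae mu, forall x, P (fun t => c * u t + v t) x = c * P u x + P v x} ;
  proj_idem : forall u, L2 u -> {ae mu, forall x, P (P u) x = P u x} ;
  proj_sym : forall u v, L2 u -> L2 v -> inner (P u) v = inner u (P v)
}.

(* E is the projection-valued measure with S = \int lambda dE(lambda), and nu u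
   is the scalar spectral measure A |-> <E(A) u, u>. That nu u is a measure
   expresses the countable additivity of E; <S u, u> determines S by
   polarization. *)
Record spectral_resolution (S : operator)
    (E : set R -> (T -> R[i]) -> T -> R[i])
    (nu : (T -> R[i]) -> {measure set (measurableTypeR R) -> \bar R}) : Prop :=
  SpectralResolution {
  spec_proj : forall A : set (measurableTypeR R),
    measurable A -> orthogonal_projection (E A) ;
  spec_total : forall u, L2 u -> {ae mu, forall x, E [set: R] u x = u x} ;
  spec_measure : forall u (A : set (measurableTypeR R)), L2 u -> measurable A ->
    nu u A = (Re (inner (E A u) u))%:E ;
  spec_domain : forall u, L2 u ->
    (exists w, S u w) <-> (\int[nu u]_l (l ^+ 2)%:E < +oo)%E ;
  spec_value : forall u w, S u w ->
    inner w u = (\int[nu u]_l l)%:C%C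
}.

(* All spectral measures of S are absolutely continuous on I with respect to
   Lebesgue measure. *)
Definition purely_absolutely_continuous (S : operator)
    (I : set (measurableTypeR R)) : Prop :=
  forall E nu, spectral_resolution S E nu ->
  forall u (A : set (measurableTypeR R)), L2 u -> measurable A -> A `<=` I ->
    lebesgue_measure A = 0%E -> nu u A = 0%E.

End L2.

(** * The Schroedinger operator *)

Section Schrodinger.
Context {R : realType}.
Local Notation Re := (@complex.Re R).
Local Notation Im := (@complex.Im R).

Definition test_function n (M : riemannian_manifold R n) (u : M -> R[i]) :
  Prop :=
  [/\ smooth_fun (charts M) (Re \o u),
      smooth_fun (charts M) (Im \o u) &
      exists2 K : set M, compact K & forall x, ~ K x -> u x = 0].

(* - Laplacian + V, with domain the complex test functions *)
Definition schrodinger n (M : riemannian_manifold R n) (V : M -> R) :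
  @operator _ (borel M) R := fun u w =>
  test_function (u : M -> R[i]) /\
  exists2 D : M -> R[i],
    is_laplacian (Re \o u : M -> R) (Re \o D) /\
    is_laplacian (Im \o u : M -> R) (Im \o D) &
    forall x, w x = - D x + (V x)%:C%C * u x.

End Schrodinger.

(* Main.v *)
(* The resolvent estimate behind the theorem is quantitative unique continuation
   from infinity. On the conic end a Carleman estimate with weight
   exp(phi(w)), where phi increases to a finite limit and is convex enough for
   the Morawetz multiplier w d/dw, bounds a quasimode (H - lambda) v = G on
   {A + 3 <= w <= rho} by C exp(-c tau) times its mass on {w <= A + 3}, up to
   errors eps |v|^2 + |G|^2 / eps. An interior Carleman estimate, chained along
   the connected manifold, bounds the mass on a compact set by a fixed multiple
   of the mass on {A + 3 < w < A + 4}; taking tau large absorbs it, whence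
     |v|^2_{w <= rho} <= C (eps |v|^2 + |G|^2 / eps), lambda in [l1, l2].
   Applied to v = E(J) f with |J| = eps, where |G| <= eps |v|, and to f supported
   in {w <= rho}, it gives <E(J) f, f> <= C eps |f|^2: the spectral measure of f
   is bounded by a multiple of Lebesgue measure on [l1, l2]. *)

From HB Require Import structures.
From mathcomp Require Import all_boot all_order all_algebra perm.
From mathcomp Require Import all_classical all_reals all_analysis.
From mathcomp Require Import complex measurable_realfun ring lra.
Require Import Defs.

Set Implicit Arguments.
Unset Strict Implicit.
Unset Printing Implicit Defensive.

Import Order.TTheory GRing.Theory Num.Theory.
Import numFieldNormedType.Exports.

Local Open Scope classical_set_scope.
Local Open Scope ring_scope.

(** No resolvent is constructed: all estimates are a priori estimates for test functions, split into
    real and imaginary parts, and they reach E(J) f through the closure. As E(J) f is only a limit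
    of test functions with growing supports, no constant may depend on the support of v; this is why
    phi and the radial multiplier must be bounded. They regularize r^(3/4) and r d/dr by a parameter
    [ell]. Where [ell] acts, convexity is lost, at the cost of a term in phi'^2 that only the
    positive energy lambda can pay for; hence [ell] is of order lambda / tau^2, and the gain exp(-c
    tau) between two fixed radii has to be uniform in [ell]. The exponent 3/4 exceeds 1/2, which
    gives positivity, and is below 1, which keeps phi' bounded. The regularization is a function of
    r^(1/(4k)) with 1/(4k) < 2 sigma, so that its losses stay within the short-range decay. The
    Laplacian is given in arbitrary charts; its independence of the chart and its value along the
    end are obtained from test functions and the intrinsic Hessian form instead of by transforming
    second derivatives. *)

Lemma le_of_eq {d : Order.disp_t} {T : porderType d} (x y : T) : x = y -> (x <= y)%O.
Proof. by move=> ->. Qed.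

Lemma nbhs_of_open {T : topologicalType} (U : set T) (x : T) : open U -> U x -> nbhs x U.
Proof. by move=> oU Ux; exact: open_nbhs_nbhs. Qed.

Lemma near_dist {R : realType} {T : topologicalType} (f : T -> R) (x : T) (e : R) :
  {for x, continuous f} -> 0 < e -> nbhs x [set y | `|f y - f x| < e].
Proof.
move=> cf e0; have /cvgrPdist_lt/(_ e e0) h := cf.
by apply: filterS h => y /=; rewrite distrC.
Qed.

Lemma nbhs_forall {T : topologicalType} {I : finType} (x : T) (P : I -> set T) :
  (forall i, nbhs x (P i)) -> nbhs x [set y | forall i, P i y].
Proof. by move=> h; apply: filter_forall. Qed.

Lemma addr_subK {V : zmodType} (x a b : V) : x + a + b - x = a + b.
Proof. by rewrite -[x + a + b]addrA [x + _]addrC addrK. Qed.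

Lemma close2 {R : realType} (a b a' b' e : R) : a' = b' ->
  `|a' - a| < e -> `|b' - b| < e -> `|a - b| <= 2 * e.
Proof. by move=> <-; rewrite !ltr_distl ler_distl => /andP[? ?] /andP[? ?]; lra. Qed.

(** * Functions of class C^k along a family of directions *)

Section Ck.
Context {R : realType} {V : normedModType R} {I : Type} (d : I -> V).
Implicit Types (U : set V) (f g : V -> R).

(** The family of directions is a parameter so that one calculus covers coordinate partial
    derivatives and, with the single direction 1, functions of one variable ([Ck1]). The derivatives
    are those of the global function [f], required to exist on [U] only. *)
Fixpoint Ck (k : nat) U f : Prop :=
  (forall x, U x -> {for x, continuous f}) /\
  if k is k'.+1 then
    forall i, (forall x, U x -> derivable f x (d i)) /\ Ck k' U ('D_(d i) f)
  else True.

Definition Coo U f := forall k, Ck k U f.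

Lemma Ck_cont k U f x : Ck k U f -> U x -> {for x, continuous f}.
Proof. by case: k => [|k] [h _]; apply: h. Qed.

Lemma Ck_der k U f i x : Ck k.+1 U f -> U x -> derivable f x (d i).
Proof. by move=> [_ /(_ i)[h _]]; apply: h. Qed.

Lemma Ck_partial k U f i : Ck k.+1 U f -> Ck k U ('D_(d i) f).
Proof. by move=> [_ /(_ i)[_ h]]. Qed.

Arguments Ck_der {k U f} i {x}.
Arguments Ck_partial {k U f} i.

Lemma CkS k U f : Ck k.+1 U f -> Ck k U f.
Proof.
elim: k f => [|k IH] f; first by move=> [h _].
move=> [h hd]; split => // i; have [h1 h2] := hd i; split => //; exact: IH.
Qed.

Lemma Ck_le k l U f : (l <= k)%N -> Ck k U f -> Ck l U f.
Proof.
by move=> /subnK <-; elim: (k - l)%N => [//|j IH]; rewrite addSn => /CkS.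
Qed.

Lemma Ck_subset k U U' f : U' `<=` U -> Ck k U f -> Ck k U' f.
Proof.
move=> UU'; elim: k f => [|k IH] f [h hd]; split => //.
- by move=> x /UU'; apply: h.
- by move=> x /UU'; apply: h.
- by move=> i; have [h1 h2] := hd i; split; [move=> x /UU'; apply: h1|exact: IH].
Qed.

(** All derivatives are taken of one global function, so the pieces need no compatibility. *)
Lemma Ck_local k U f :
  (forall x, U x -> exists2 U', U' x & Ck k U' f) -> Ck k U f.
Proof.
elim: k f => [|k IH] f h; split => //.
- by move=> x /h[U' U'x hU']; apply: (Ck_cont hU').
- by move=> x /h[U' U'x hU']; apply: (Ck_cont hU').
- move=> i; split; first by move=> x /h[U' U'x hU']; apply: Ck_der _ hU' _.
  by apply: IH => x /h[U' U'x hU']; exists U' => //; exact: Ck_partial.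
Qed.

Lemma open_near U f g x : open U -> U x -> {in U, f =1 g} ->
  \near x, f x = g x.
Proof.
move=> oU Ux fg; have nU : nbhs x U by apply: open_nbhs_nbhs.
by apply: filterS nU => y Uy; apply: fg; rewrite inE.
Qed.

Lemma Ck_eq k U f g : open U -> {in U, f =1 g} -> Ck k U f -> Ck k U g.
Proof.
move=> oU; elim: k f g => [|k IH] f g fg [h hd].
- split => // x Ux; have nfg := open_near oU Ux fg.
  have fgx : f x = g x by apply: fg; rewrite inE.
  by rewrite /prop_for /continuous_at -fgx; apply: cvg_trans (h x Ux); apply: near_eq_cvg.
- split.
    move=> x Ux; have nfg := open_near oU Ux fg.
    have fgx : f x = g x by apply: fg; rewrite inE.
    by rewrite /prop_for /continuous_at -fgx; apply: cvg_trans (h x Ux); apply: near_eq_cvg.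
  move=> i; have [h1 h2] := hd i; split.
    move=> x Ux; apply: near_eq_derivable (h1 x Ux); exact: open_near fg.
  apply: IH h2 => x /set_mem Ux; apply: near_eq_derive; exact: open_near fg.
Qed.

Lemma Ck_cst k U (c : R) : Ck k U (cst c).
Proof.
elim: k c => [|k IH] c; split => //.
- by move=> x _; apply: cvg_cst.
- by move=> x _; apply: cvg_cst.
- move=> i; split; first by move=> x _.
  rewrite (_ : 'D_(d i) (cst c) = cst 0); first exact: IH.
  by apply/funext => x; rewrite derive_cst.
Qed.

Lemma CkD k U f g : open U -> Ck k U f -> Ck k U g ->
  Ck k U (fun x => f x + g x).
Proof.
move=> oU; elim: k f g => [|k IH] f g hf hg; split => //.
- by move=> x Ux; apply: continuousD; [apply: Ck_cont hf _|apply: Ck_cont hg _].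
- by move=> x Ux; apply: continuousD; [apply: Ck_cont hf _|apply: Ck_cont hg _].
- move=> i; split.
    by move=> x Ux; apply: derivableD; [apply: Ck_der _ hf _|apply: Ck_der _ hg _].
  have := IH _ _ (Ck_partial i hf) (Ck_partial i hg).
  apply: Ck_eq => // x /set_mem Ux.
  by rewrite -[RHS]/('D_(d i) (f + g) x) deriveD//; [apply: Ck_der _ hf _|apply: Ck_der _ hg _].
Qed.

Lemma CkN k U f : open U -> Ck k U f -> Ck k U (fun x => - f x).
Proof.
move=> oU; elim: k f => [|k IH] f hf; (split;
  first by move=> x Ux; apply: continuousN; apply: Ck_cont hf _).
- by [].
- move=> i; split; first by move=> x Ux; apply: derivableN; apply: Ck_der _ hf _.
  have := IH _ (Ck_partial i hf); apply: Ck_eq => // x /set_mem Ux.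
  by rewrite -[RHS]/('D_(d i) (- f) x) deriveN//; apply: Ck_der _ hf _.
Qed.

Lemma CkB k U f g : open U -> Ck k U f -> Ck k U g ->
  Ck k U (fun x => f x - g x).
Proof. by move=> oU hf hg; apply: CkD => //; apply: CkN. Qed.

Lemma CkM k U f g : open U -> Ck k U f -> Ck k U g ->
  Ck k U (fun x => f x * g x).
Proof.
move=> oU; elim: k f g => [|k IH] f g hf hg; split => //.
- by move=> x Ux; apply: continuousM; [apply: Ck_cont hf _|apply: Ck_cont hg _].
- by move=> x Ux; apply: continuousM; [apply: Ck_cont hf _|apply: Ck_cont hg _].
- move=> i; split.
    by move=> x Ux; apply: derivableM; [apply: Ck_der _ hf _|apply: Ck_der _ hg _].
  have := CkD oU (IH _ _ (CkS hf) (Ck_partial i hg))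
                 (IH _ _ (CkS hg) (Ck_partial i hf)).
  apply: Ck_eq => // x /set_mem Ux.
  by rewrite -[RHS]/('D_(d i) (f * g) x) deriveM//; [apply: Ck_der _ hf _|apply: Ck_der _ hg _].
Qed.

Lemma Ck_sum k U (J : Type) (r : seq J) (P : pred J) (F : J -> V -> R) :
  open U -> (forall j, P j -> Ck k U (F j)) ->
  Ck k U (fun x => \sum_(j <- r | P j) F j x).
Proof.
move=> oU hF; elim: r => [|j r IH].
  by apply: Ck_eq (Ck_cst k U 0) => // x _; rewrite big_nil.
case: (boolP (P j)) => Pj; last first.
  by apply: Ck_eq IH => // x _; rewrite big_cons (negPf Pj).
by apply: Ck_eq (CkD oU (hF _ Pj) IH) => // x _; rewrite big_cons Pj.
Qed.

Lemma Ck_prod k U (J : Type) (r : seq J) (P : pred J) (F : J -> V -> R) :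
  open U -> (forall j, P j -> Ck k U (F j)) ->
  Ck k U (fun x => \prod_(j <- r | P j) F j x).
Proof.
move=> oU hF; elim: r => [|j r IH].
  by apply: Ck_eq (Ck_cst k U 1) => // x _; rewrite big_nil.
case: (boolP (P j)) => Pj; last first.
  by apply: Ck_eq IH => // x _; rewrite big_cons (negPf Pj).
by apply: Ck_eq (CkM oU (hF _ Pj) IH) => // x _; rewrite big_cons Pj.
Qed.

End Ck.

Arguments Ck_der {R V I d k U f} i {x}.
Arguments Ck_partial {R V I d k U f} i.

Definition Ck1 {R : realType} k (J : set R) (a : R -> R) :=
  Ck (fun _ : unit => 1 : R) k J a.

(** * Derivatives along lines, mean value theorem, symmetry of second derivatives *)

Section Line.
Context {R : realType} {V W : normedModType R}.

Lemma derive_lineE (f : V -> W) (z v : V) (t : R) :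
  'D_1 (fun t : R => f (z + t *: v)) t = 'D_v f (z + t *: v) /\
  (derivable f (z + t *: v) v -> derivable (fun t : R => f (z + t *: v)) t 1).
Proof.
have e : (fun h : R => h^-1 *: (f (z + (h *: (1 : R) + t) *: v) - f (z + t *: v)))
   = (fun h : R => h^-1 *: (f (h *: v + (z + t *: v)) - f (z + t *: v))).
  apply/funext => h; rewrite scalerDl [h *: 1]mulr1.
  by congr (_ *: (f _ - _)); rewrite addrCA.
by split; rewrite /derive /derivable /shift /comp /= e.
Qed.

Lemma is_derive_lineP (f : V -> W) (z v : V) (t : R) (D : W) :
  is_derive t 1 (fun t : R => f (z + t *: v)) D <-> is_derive (z + t *: v) v f D.
Proof.
have e : (fun h : R => h^-1 *: (f (z + (h *: (1 : R) + t) *: v) - f (z + t *: v)))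
   = (fun h : R => h^-1 *: (f (h *: v + (z + t *: v)) - f (z + t *: v))).
  apply/funext => h; rewrite scalerDl [h *: 1]mulr1.
  by congr (_ *: (f _ - _)); rewrite addrCA.
by split=> -[h1 h2]; split; move: h1 h2; rewrite /derive /derivable /shift /comp /= e.
Qed.

Lemma derive_shiftE (f : V -> W) (c y v : V) :
  'D_v (fun p => f (p + c)) y = 'D_v f (y + c) /\
  (derivable f (y + c) v -> derivable (fun p => f (p + c)) y v).
Proof.
have e : (fun h : R => h^-1 *: (f (h *: v + y + c) - f (y + c)))
   = (fun h : R => h^-1 *: (f (h *: v + (y + c)) - f (y + c))).
  by apply/funext => h; rewrite addrA.
by split; rewrite /derive /derivable /shift /comp /= e.
Qed.

Lemma is_derive_line (f : V -> W) (z v : V) (t : R) :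
  derivable f (z + t *: v) v ->
  is_derive t 1 (fun t : R => f (z + t *: v)) ('D_v f (z + t *: v)).
Proof.
by move=> h; have [<- h2] := derive_lineE f z v t; apply: derivableP; apply: h2.
Qed.

End Line.

Section Line2.
Context {R : realType} {V : normedModType R}.

(** The mean value theorem for [t |-> f (z + t s v)] on the unit interval; this parametrization
    covers both signs of [s]. *)
Lemma line_mvt (f : V -> R) (z v : V) (s : R) :
  (forall t : R, `|t| <= `|s| -> derivable f (z + t *: v) v) ->
  exists2 t : R, `|t| <= `|s| & f (z + s *: v) - f z = s * 'D_v f (z + t *: v).
Proof.
move=> hd.
have ts (t : R) : 0 <= t <= 1 -> `|t * s| <= `|s|.
  by move=> /andP[t0 t1]; rewrite normrM ger0_norm// ler_piMl.
pose g (t : R) := f (z + t *: (s *: v)).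
have hg (t : R) : 0 <= t <= 1 ->
    is_derive t 1 g (s * 'D_v f (z + (t * s) *: v)).
  move=> t01; have h := is_derive_line (hd _ (ts _ t01)).
  have -> : g = (fun t : R => f (z + t *: v)) \o ( *%R^~ s).
    by apply/funext => u; rewrite /g /= scalerA.
  have h2 : is_derive t (1:R) ( *%R^~ s) s.
    have -> : ( *%R^~ s) = (fun y : R => s *: y).
      by apply/funext => y; rewrite mulrC.
    by apply: is_derive_eq; rewrite [_ *: _]mulr1.
  rewrite mulrC; exact: is_derive1_comp.
have [|||c c01 e] := @MVT_segment R g (fun t => s * 'D_v f (z + (t * s) *: v)) 0 1.
- by [].
- by move=> x; rewrite in_itv /= => /andP[x0 x1]; apply: hg; rewrite !ltW.
- apply: derivable_within_continuous => x; rewrite in_itv /= => x01.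
  by have [] := hg x x01.
exists (c * s); first by apply: ts; move: c01; rewrite in_itv.
by move: e; rewrite /g scale1r scale0r addr0 subr0 mulr1.
Qed.

(** The second difference over a small parallelogram is symmetric in [v] and [w]. Two applications
    of the mean value theorem turn it into [s ^+ 2] times a mixed derivative at some point of the
    parallelogram, in either order, and continuity at [x] compares the two. *)
Lemma clairaut (U : set V) (f : V -> R) (x v w : V) : open U -> U x ->
  (forall y, U y -> derivable f y v /\ derivable f y w) ->
  (forall y, U y -> derivable ('D_v f) y w /\ derivable ('D_w f) y v) ->
  {for x, continuous ('D_w ('D_v f))} -> {for x, continuous ('D_v ('D_w f))} ->
  'D_w ('D_v f) x = 'D_v ('D_w f) x.
Proof.
move=> oU Ux hd1 hd2 c1 c2.
suff main (e : R) : 0 < e -> `|'D_w ('D_v f) x - 'D_v ('D_w f) x| <= 2 * e.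
  apply/eqP; rewrite -subr_eq0 -normr_eq0; apply/eqP/le_anti.
  rewrite normr_ge0 andbT; apply/ler_addgt0Pl => e e0; rewrite addr0.
  by rewrite (le_trans (main (e / 2) _))// ?divr_gt0// mulrC divfK.
move=> e0.
pose B : set V := U `&` [set y | `|'D_w ('D_v f) y - 'D_w ('D_v f) x| < e]
   `&` [set y | `|'D_v ('D_w f) y - 'D_v ('D_w f) x| < e].
have nB : nbhs x B.
  apply: filterI; first (apply: filterI; first exact: open_nbhs_nbhs).
    exact: (near_dist c1 e0).
  exact: (near_dist c2 e0).
have [r r0 hr] : exists2 r : R, 0 < r & forall y, `|y - x| < r -> B y.
  move/nbhs_ballP : nB => [r /= r0 hr]; exists r => // y yx; apply: hr.
  by rewrite -ball_normE /ball_ /= distrC.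
(* So small that the parallelogram spanned by [s v] and [s w] stays in the ball of radius [r]; the
   [+ 1] covers [v = w = 0]. *)
pose s := r / 2 / (`|v| + `|w| + 1).
have p0 : 0 < `|v| + `|w| + 1 by rewrite ltr_wpDl// addr_ge0.
have s0 : 0 < s by rewrite !divr_gt0.
have inB (a b : R) : `|a| <= `|s| -> `|b| <= `|s| -> B (x + a *: v + b *: w).
  move=> ha hb; apply: hr; rewrite addr_subK.
  rewrite (le_lt_trans (ler_normD _ _))// !normrZ.
  apply: (@le_lt_trans _ _ (s * (`|v| + `|w| + 1))).
    rewrite 2!mulrDr mulr1 -[X in X <= _]addr0 lerD//; last exact: ltW.
    move: ha hb; rewrite (gtr0_norm s0) => ha hb.
    by rewrite lerD// ler_wpM2r.
  by rewrite /s divfK ?gt_eqF// ltr_pdivrMr// ltr_pMr// ltr1n.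
have inB' (a b : R) : `|a| <= `|s| -> `|b| <= `|s| -> B (x + b *: w + a *: v).
  by move=> ha hb; rewrite -addrA [_ *: w + _]addrC addrA; apply: inB.
have z0 : `|0 : R| <= `|s| by rewrite normr0.
pose D := f (x + s *: v + s *: w) - f (x + s *: v) - f (x + s *: w) + f x.
have step (v' w' : V) : 
    (forall a b : R, `|a| <= `|s| -> `|b| <= `|s| -> U (x + a *: v' + b *: w')) ->
    (forall y, U y -> derivable f y v') ->
    (forall y, U y -> derivable ('D_v' f) y w') ->
    f (x + s *: v' + s *: w') - f (x + s *: v') - f (x + s *: w') + f x = D ->
    exists a b, [/\ `|a| <= `|s|, `|b| <= `|s| &
      D = s * (s * 'D_w' ('D_v' f) (x + a *: v' + b *: w'))].
  move=> hin hd hd' eD.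
  pose g p := f (p + s *: w') - f p.
  have e_g y : 'D_v' (fun p => f (p + s *: w')) y = 'D_v' f (y + s *: w') /\
     (derivable f (y + s *: w') v' -> derivable (fun p => f (p + s *: w')) y v').
    exact: derive_shiftE.
  have hgd (a : R) : `|a| <= `|s| -> derivable g (x + a *: v') v' /\
      'D_v' g (x + a *: v') = 'D_v' f (x + a *: v' + s *: w') - 'D_v' f (x + a *: v').
    move=> ha; have [e1 h1] := e_g (x + a *: v').
    have d1 := h1 (hd _ (hin _ _ ha (lexx _))).
    have d2 : derivable f (x + a *: v') v'.
      by apply: hd; have := hin a 0 ha z0; rewrite scale0r addr0.
    split; first exact: derivableB.
    by rewrite -e1 -deriveB.
  have [a ha ea] := @line_mvt g x v' s (fun t ht => (hgd t ht).1).
  have [b hb eb] := @line_mvt ('D_v' f) (x + a *: v') w' s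
    (fun t ht => hd' _ (hin _ _ ha ht)).
  exists a, b; split => //; rewrite -eb -(hgd a ha).2 -ea -eD /g.
  by ring.
have [||||a [b [ha hb e1]]] := step v w.
- by move=> a b ha hb; have [[]] := inB a b ha hb.
- by move=> y /hd1[].
- by move=> y /hd2[].
- by [].
have [||||a' [b' [ha' hb' e2]]] := step w v.
- by move=> a' b' ha' hb'; have [[]] := inB' b' a' hb' ha'.
- by move=> y /hd1[].
- by move=> y /hd2[].
- rewrite /D [x + s *: w + s *: v]addrAC; by ring.
have E : 'D_w ('D_v f) (x + a *: v + b *: w) = 'D_v ('D_w f) (x + a' *: w + b' *: v).
  by move: e2; rewrite e1 => /(mulfI (lt0r_neq0 s0))/(mulfI (lt0r_neq0 s0)).
have [[_ /= h1] _] := inB a b ha hb.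
have [_ /= h2] := inB' b' a' hb' ha'.
exact: close2 E h1 h2.
Qed.

End Line2.

(** * Continuously differentiable functions are differentiable *)

Section Partial.
Context {R : realType}.
Notation e_ j := (delta_mx 0 j).

Lemma row_norm_le n (h : 'rV[R]_n) (j : 'I_n) : `|h 0 j| <= `|h|.
Proof.
rewrite /Num.norm /= mx_normrE; exact: (le_bigmax _ (fun ij => `|h ij.1 ij.2|) (ord0, j)).
Qed.

Lemma row_normP n (h : 'rV[R]_n) (c : R) : 0 <= c ->
  (forall j, `|h 0 j| <= c) -> `|h| <= c.
Proof.
move=> c0 hc; rewrite /Num.norm /= mx_normrE; apply: bigmax_le => //.
by case=> i j _ /=; rewrite ord1.
Qed.

(** The corners of the path from 0 to [h] that moves one coordinate at a time. *)
Definition trunc n (h : 'rV[R]_n) (j : nat) : 'rV[R]_n :=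
  \row_i (if (i < j)%N then h 0 i else 0).

Lemma truncS n (h : 'rV[R]_n) (j : 'I_n) :
  trunc h j.+1 = trunc h j + h 0 j *: e_ j.
Proof.
apply/rowP => i; rewrite !mxE eqxx /= ltnS leq_eqVlt.
case: (eqVneq i j) => [->|ij]; first by rewrite eqxx ltnn /= add0r mulr1.
have -> : (i == j :> nat) = false by apply/negbTE.
by rewrite /= mulr0 addr0.
Qed.

Lemma trunc_norm n (h : 'rV[R]_n) (j : 'I_n) (t : R) : `|t| <= `|h 0 j| ->
  `|trunc h j + t *: e_ j| <= `|h|.
Proof.
move=> ht; apply: row_normP => // i; rewrite !mxE eqxx /=.
case: (eqVneq i j) => [->|ij]; first rewrite ltnn add0r mulr1.
  exact: le_trans ht (row_norm_le _ _).
rewrite mulr0 addr0; case: ifP => _; first exact: row_norm_le.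
by rewrite normr0.
Qed.

(** The increment is telescoped along the coordinate path [trunc h j]; on each edge the mean value
    theorem replaces it by a partial derivative close to its value at [x]. *)
Lemma C1_differentiable n (U : set 'rV[R]_n) (f : 'rV[R]_n -> R) x :
  open U -> U x -> Ck (fun j => e_ j) 1 U f -> differentiable f x.
Proof.
move=> oU Ux hf.
pose g := \col_j 'D_(e_ j) f x.
pose df : 'rV[R]_n -> R := fun h => (h *m g) 0 0.
have dfE h : df h = \sum_j h 0 j * 'D_(e_ j) f x.
  by rewrite /df mxE; apply: eq_bigr => j _; rewrite mxE.
have lin : linear df.
  by move=> c u v; rewrite !dfE scaler_sumr -big_split /=; apply: eq_bigr => j _;
     rewrite !mxE mulrDl -mulrA.
pose L : {linear 'rV[R]_n -> R} := HB.pack df (GRing.isLinear.Build _ _ _ _ df lin).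
have cL : continuous L.
  move=> y; apply: differentiable_continuous.
  rewrite (_ : (L : 'rV[R]_n -> R) = \sum_(j < n) (fun h : 'rV[R]_n => h 0 j * 'D_(e_ j) f x)).
    apply: differentiable_sum => j; apply: differentiableM => //.
    exact: differentiable_coord.
  by apply/funext => h; rewrite fct_sumE -dfE.
have main : f \o shift x = cst (f x) + L +o_ (0 : 'rV[R]_n) id.
  apply/eqaddoP => e e0.
  (* [n.+1] and not [n], which may be 0. *)
  pose e' := e / n.+1%:R.
  have e'0 : 0 < e' by rewrite divr_gt0.
  have nB : nbhs x (U `&` [set y | forall j, `|'D_(e_ j) f y - 'D_(e_ j) f x| < e']).
    apply: filterI; first exact: open_nbhs_nbhs.
    apply: (@nbhs_forall _ 'I_n _ (fun j => [set y | `|'D_(e_ j) f y - 'D_(e_ j) f x| < e'])) => j.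
    apply: near_dist => //.
    exact: (Ck_cont (Ck_partial j hf) Ux).
  have [r r0 hr] : exists2 r : R, 0 < r & forall y, `|y - x| < r -> 
      (U `&` [set y | forall j, `|'D_(e_ j) f y - 'D_(e_ j) f x| < e']) y.
    move/nbhs_ballP : nB => [r /= r0 hr]; exists r => // y yx; apply: hr.
    by rewrite -ball_normE /ball_ /= distrC.
  apply/nbhs_ballP; exists r => //= h; rewrite -ball_normE /ball_ /= sub0r normrN => hr'.
  have tel : f (h + x) - f x = \sum_(j < n) (f (x + trunc h j.+1) - f (x + trunc h j)).
    rewrite -(big_mkord xpredT (fun j => f (x + trunc h j.+1) - f (x + trunc h j))).
    rewrite telescope_sumr//; congr (f _ - f _).
      by rewrite addrC; congr (_ + _); apply/rowP => i; rewrite mxE ltn_ord.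
    by rewrite (_ : trunc h 0 = 0) ?addr0//; apply/rowP => i; rewrite !mxE.
  rewrite (_ : (f \o shift x - (cst (f x) + (L : 'rV[R]_n -> R))) h =
      \sum_(j < n) (f (x + trunc h j.+1) - f (x + trunc h j) - h 0 j * 'D_(e_ j) f x)); last first.
    by rewrite sumrB -tel -dfE !fctE /=; ring.
  apply: le_trans (ler_norm_sum _ _ _) _.
  apply: (@le_trans _ _ (\sum_(j < n) e' * `|h|)); last first.
    rewrite sumr_const card_ord -mulr_natr mulrAC ler_wpM2r//.
    by rewrite /e' mulrAC ler_pdivrMr// ler_pM2l// ler_nat.
  apply: ler_sum => j _.
  have inU (t : R) : `|t| <= `|h 0 j| -> `|x + trunc h j + t *: e_ j - x| < r.
    move=> ht; rewrite addr_subK.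
    exact: le_lt_trans (trunc_norm ht) hr'.
  have [t ht] := @line_mvt R _ f (x + trunc h j) (e_ j) (h 0 j)
     (fun t ht => Ck_der j hf (hr _ (inU t ht)).1).
  rewrite -addrA -truncS => ->.
  rewrite -mulrBr normrM mulrC ler_pM// ?row_norm_le//.
  by apply/ltW; have [_ /(_ j)] := hr _ (inU t ht).
have dE : 'd f x = df :> (_ -> _) by exact: diff_unique main.
by apply/diff_locallyP; split; rewrite dE.
Qed.

End Partial.

(** * Chain rules *)

Section Compose.
Context {R : realType}.
Notation e_ j := (delta_mx 0 j).

Lemma is_derive_comp1 (V : normedModType R) (f : V -> R) (a : R -> R) x v df da :
  is_derive x v f df -> is_derive (f x) 1 a da ->
  is_derive x v (fun y => a (f y)) (da * df).
Proof.
have e0 : x = x + (0 : R) *: v by rewrite scale0r addr0.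
move=> hf ha; rewrite e0; apply/is_derive_lineP.
apply: (@is_derive1_comp R a (fun t : R => f (x + t *: v)) 0); first by rewrite -e0.
by apply/is_derive_lineP; rewrite -e0.
Qed.

Lemma rV_continuous (T : topologicalType) n (F : T -> 'rV[R]_n) x :
  (forall j, {for x, continuous (fun y => F y 0 j)}) -> {for x, continuous F}.
Proof.
move=> h; apply/cvgrPdist_le => e e0; near=> y.
apply: row_normP; first exact: ltW.
move=> j; rewrite !mxE distrC ltW//; move: j; near: y.
apply: (@nbhs_forall _ 'I_n _ (fun j => [set y | `|F y 0 j - F x 0 j| < e])) => j.
exact: (near_dist (h j) e0).
Unshelve. all: by end_near. Qed.

Lemma derive_sum_partial n (f : 'rV[R]_n -> R) p u : differentiable f p ->
  'D_u f p = \sum_l u 0 l * 'D_(e_ l) f p.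
Proof.
move=> df; rewrite deriveE// {1}[u]row_sum_delta linear_sum.
by apply: eq_bigr => l _; rewrite linearZ deriveE.
Qed.

(** Only directional derivatives of the coordinates of [T] are available, so the chain rule is
    applied to the curve [t |-> T (x + t v)], which is differentiable as a function of one
    variable. *)
Lemma is_derive_comp (V : normedModType R) n (T : V -> 'rV[R]_n)
    (f : 'rV[R]_n -> R) x v :
  (forall l, derivable (fun y => T y 0 l) x v) -> differentiable f (T x) ->
  is_derive x v (fun y => f (T y))
    (\sum_l 'D_(e_ l) f (T x) * 'D_v (fun y => T y 0 l) x).
Proof.
move=> hT df.
have e0 : x = x + (0 : R) *: v by rewrite scale0r addr0.
have dT : derivable T x v by apply/derivable_mxP => i j; rewrite ord1.
have /is_derive_lineP hg : is_derive (x + (0 : R) *: v) v T ('D_v T x).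
  by rewrite -e0; apply: derivableP.
set g := (fun t : R => T (x + t *: v)) in hg.
have dg : differentiable g 0 by apply/derivable1_diffP; case: hg.
have df' : differentiable f (g 0) by rewrite /g -e0.
have dfg : differentiable (f \o g) 0 by exact: differentiable_comp.
rewrite [in is_derive _ _ _]e0; apply/is_derive_lineP.
rewrite -[fun t : R => _]/(f \o g); apply: DeriveDef; first exact/derivable1_diffP.
rewrite deriveE// diff_comp//= -deriveE//; case: hg => _ hg.
have e1 : 'd g 0 1 = 'D_v T x by rewrite -hg deriveE.
rewrite e1 derive_sum_partial; last by rewrite /g -e0.
apply: eq_bigr => l _; rewrite mulrC /g -e0; congr (_ * _).
by rewrite derive_mx// mxE.
Qed.

Context {V : normedModType R} {I : Type} (d : I -> V).

Lemma Ck_comp1 k (U : set V) (J : set R) (f : V -> R) (a : R -> R) : open U ->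
  (forall x, U x -> J (f x)) -> Ck d k U f -> Ck1 k J a ->
  Ck d k U (fun x => a (f x)).
Proof.
move=> oU hJ; elim: k a => [|k IH] a hf ha; (split;
  first by move=> x Ux; apply: continuous_comp (Ck_cont hf Ux) (Ck_cont ha (hJ _ Ux))).
  by [].
move=> i.
have hd x : U x -> is_derive x (d i) (fun x => a (f x)) ('D_1 a (f x) * 'D_(d i) f x).
  move=> Ux; apply: is_derive_comp1; apply: derivableP.
    exact: (Ck_der i hf).
  exact: (Ck_der tt ha (hJ _ Ux)).
split; first by move=> x /hd[].
apply: Ck_eq (CkM oU (IH _ (CkS hf) (Ck_partial tt ha)) (Ck_partial i hf)) => //.
by move=> x /set_mem /hd[_ ->].
Qed.

Lemma Ck_comp n k (U : set V) (W : set 'rV[R]_n) (T : V -> 'rV[R]_n)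
    (f : 'rV[R]_n -> R) : open U -> open W ->
  (forall x, U x -> W (T x)) -> (forall l, Ck d k U (fun x => T x 0 l)) ->
  Ck (fun j => e_ j) k W f -> Ck d k U (fun x => f (T x)).
Proof.
move=> oU oW hW; elim: k f => [|k IH] f hT hf; (split;
  first by move=> x Ux; apply: continuous_comp (Ck_cont hf (hW _ Ux));
   apply: rV_continuous => l; exact: (Ck_cont (hT l) Ux)).
  by [].
move=> i.
have hd x (Ux : U x) := @is_derive_comp V n T f x (d i)
  (fun l => Ck_der i (hT l) Ux)
  (C1_differentiable oW (hW _ Ux) (Ck_le (isT : 0 < k.+1)%N hf)).
split; first by move=> x /hd[].
have : Ck d k U (fun x => \sum_l 'D_(e_ l) f (T x) * 'D_(d i) (fun y => T y 0 l) x).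
  apply: Ck_sum => // l _; apply: CkM => //; last exact: Ck_partial (hT l).
  exact: (IH _ (fun l' => CkS (hT l')) (Ck_partial l hf)).
by apply: Ck_eq => // x /set_mem /hd[_ ->].
Qed.

Lemma clairaut_Ck (U : set V) (f : V -> R) x i j : open U -> U x -> Ck d 2 U f ->
  'D_(d j) ('D_(d i) f) x = 'D_(d i) ('D_(d j) f) x.
Proof.
move=> oU Ux hf; apply: (clairaut oU Ux).
- by move=> y Uy; split; exact: Ck_der _ hf Uy.
- by move=> y Uy; split; apply: (Ck_der _ (Ck_partial _ hf) Uy).
- exact: (Ck_cont (Ck_partial j (Ck_partial i hf)) Ux).
- exact: (Ck_cont (Ck_partial i (Ck_partial j hf)) Ux).
Qed.

End Compose.

(** * Comparison of [smooth_on] with [Coo] *)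

Section SmoothOn.
Context {R : realType}.
Notation e_ j := (delta_mx 0 j).

Lemma smooth_onE n (U : set 'rV[R]_n) (f : 'rV[R]_n -> R) :
  smooth_on U (f : _ -> R^o) <-> Coo (fun j => e_ j) U f.
Proof.
split=> [h k|].
  have : forall (s : seq 'I_n), Ck (fun j => e_ j) k U (foldr partial (f : _ -> R^o) s).
    elim: k => [|k IH] s; (split; first by move=> x Ux; have [] := h s x Ux).
      by [].
    move=> i; split; first by move=> x Ux; have [_ /(_ i)] := h s x Ux.
    exact: (IH (i :: s)).
  by move=> /(_ [::]).
move=> h s x Ux.
have hs : Coo (fun j => e_ j) U (foldr partial (f : _ -> R^o) s).
  elim: s => [|i s IH]; first exact: h.
  by move=> k; apply: (Ck_partial i (IH k.+1)).
by split; [exact: (Ck_cont (hs 0%N) Ux)|move=> i; exact: (Ck_der i (hs 1%N) Ux)].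
Qed.

Lemma smooth_on_coord n m p (U : set 'rV[R]_n) (F : 'rV[R]_n -> 'M[R]_(m, p)) a b :
  open U -> smooth_on U F -> Coo (fun j => e_ j) U (fun x => F x a b).
Proof.
move=> oU h k.
have : forall (s : seq 'I_n), Ck (fun j => e_ j) k U (fun x => foldr partial F s x a b).
  elim: k => [|k IH] s; (split; first (move=> x Ux; have [c _] := h s x Ux;
    exact: (continuous_comp c (@coord_continuous _ _ _ a b _)))).
    by [].
  have hd i x : U x -> is_derive x (e_ i) (fun x => foldr partial F s x a b)
      (foldr partial F (i :: s) x a b).
    move=> Ux; have [_ /(_ i) dd] := h s x Ux; apply: DeriveDef.
      by move/derivable_mxP : dd.
    by rewrite /= /partial derive_mx// mxE.
  move=> i; split; first by move=> x Ux; have [] := hd i x Ux.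
  by apply: Ck_eq (IH (i :: s)) => // x /set_mem Ux; have [_ ->] := hd i x Ux.
by move=> /(_ [::]).
Qed.

End SmoothOn.

(** * Lebesgue measure on R^n *)

Section Borel.
Context {R : realType} {T : ptopologicalType}.

Lemma open_borel (A : set T) : open A -> measurable (A : set (borel T)).
Proof. by move=> oA; apply: sub_sigma_algebra. Qed.

Lemma closed_borel (A : set T) : closed A -> measurable (A : set (borel T)).
Proof.
move=> cA; rewrite -[A]setCK; apply: measurableC; apply: open_borel.
exact: closed_openC.
Qed.

Lemma continuous_borel (f : T -> R) : continuous f ->
  measurable_fun [set: borel T] (f : borel T -> R).
Proof.
move=> cf; apply: (measurability _ (measurable_realfun.RGenOpens.measurableE R)).
move=> _ [_ [a [b ->] <-]]; rewrite setTI; apply: open_borel.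
by apply: open_comp => [x _|]; [exact: cf|exact: interval_open].
Qed.

End Borel.

Lemma row_lt {R : realType} n (h : 'rV[R]_n) (c : R) : 0 < c ->
  (forall j, `|h 0 j| < c) -> `|h| < c.
Proof.
move=> c0 hc; rewrite /Num.norm /= mx_normrE; apply/bigmax_ltP; split => //.
by case=> i j _ /=; rewrite ord1.
Qed.

(** * Splitting off the first coordinate *)

Section Cons.
Context {R : realType} (n : nat).

Definition rcons_row (z : R * 'rV[R]_n) : 'rV[R]_(1 + n) :=
  row_mx (const_mx z.1 : 'rV[R]_1) z.2.

Lemma rcons_row0 z : rcons_row z 0 (lshift n 0) = z.1.
Proof.
by rewrite /rcons_row row_mxEl mxE.
Qed.

Lemma rcons_rowS z (i : 'I_n) : rcons_row z 0 (rshift 1 i) = z.2 0 i.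
Proof. by rewrite row_mxEr. Qed.

Lemma rcons_row_norm z : `|rcons_row z| = Num.max `|z.1| `|z.2|.
Proof.
apply/le_anti/andP; split.
  apply: row_normP; first by rewrite le_max normr_ge0.
  move=> j; case: (split_ordP j) => k ->.
    by rewrite row_mxEl mxE le_max lexx.
  by rewrite row_mxEr le_max row_norm_le orbT.
rewrite ge_max; apply/andP; split.
  by rewrite -rcons_row0 row_norm_le.
by apply: row_normP => // i; rewrite -rcons_rowS row_norm_le.
Qed.

Lemma rcons_rowB z z' : rcons_row z - rcons_row z' = rcons_row (z - z').
Proof.
rewrite /rcons_row opp_row_mx add_row_mx; congr row_mx.
by apply/rowP => i; rewrite !mxE.
Qed.

Lemma rcons_rowK (v : 'rV[R]_(1 + n)) : rcons_row (v 0 (lshift n 0), rsubmx v) = v.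
Proof.
rewrite -[RHS]hsubmxK; congr row_mx; apply/rowP => i.
by rewrite !mxE ord1; congr (v _ _); apply/val_inj.
Qed.

Lemma continuous_rcons_row1 (v : 'rV[R]_n) : continuous (fun t : R => rcons_row (t, v)).
Proof.
move=> t; apply/cvgrPdist_lt => e e0; near=> s.
rewrite rcons_rowB rcons_row_norm gt_max /= subrr normr0 e0 andbT.
near: s; exact: cvgr_dist_lt.
Unshelve. all: by end_near. Qed.

Lemma continuous_rcons_row2 (t : R) : continuous (fun v : 'rV[R]_n => rcons_row (t, v)).
Proof.
move=> v; apply: rV_continuous => j; case: (split_ordP j) => k ->.
  rewrite (_ : (fun y => _) = cst t); first exact: cst_continuous.
  by apply/funext => y; rewrite ord1 rcons_row0.
rewrite (_ : (fun y => _) = fun y : 'rV[R]_n => y 0 k); first by apply: coord_continuous.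
by apply/funext => y; rewrite rcons_rowS.
Qed.

(** The domain carries the product sigma-algebra, so continuity is not enough: the preimage of an
    open set is written as a countable union of boxes with rational centres and radii
    [1 / (N + 1)]. *)
Lemma measurable_rcons_row :
  measurable_fun [set: (measurableTypeR R * borel 'rV[R]_n)%type]
    (rcons_row : _ -> borel 'rV[R]_(1 + n)).
Proof.
have e : @measurable _ (borel 'rV[R]_(1 + n)) = <<s @open 'rV[R]_(1 + n) >> by [].
apply: (measurability _ e).
move=> _ [A oA <-]; rewrite setTI.
pose Q : Type := (rat * 'rV[rat]_n * nat)%type.
pose rr (c : 'rV[rat]_n) : 'rV[R]_n := map_mx ratr c.
pose b1 (q : Q) : set R := [set t : R | `|t - ratr q.1.1| < q.2.+1%:R^-1].
pose b2 (q : Q) : set 'rV[R]_n := [set v | `|v - rr q.1.2| < q.2.+1%:R^-1].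
have ob1 q : measurable (b1 q : set (measurableTypeR R)).
  apply: open_measurable; rewrite (_ : b1 q = ball (ratr q.1.1 : R) q.2.+1%:R^-1).
    exact: ball_open.
  by rewrite -ball_normE /ball_; apply/seteqP; split => x /=; rewrite distrC.
have ob2 q : measurable (b2 q : set (borel 'rV[R]_n)).
  apply: open_borel; rewrite (_ : b2 q = ball (rr q.1.2) q.2.+1%:R^-1).
    exact: ball_open.
  by rewrite -ball_normE /ball_; apply/seteqP; split => x /=; rewrite distrC.
pose D : set Q := [set q | b1 q `*` b2 q `<=` rcons_row @^-1` A].
have -> : rcons_row @^-1` A = \bigcup_(q in D) (b1 q `*` b2 q).
  apply/seteqP; split => [z Az|z [q Dq]]; last exact: Dq.
  have : nbhs (rcons_row z) A by exact: open_nbhs_nbhs.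
  move=> /nbhs_ballP[r /= r0 hr].
  (* The box through [z] is centred at a nearby rational point and not at [z], hence the factor
     2. *)
  have [N hN] : exists N : nat, 2 * N.+1%:R^-1 < r.
    have [N _ hN] := near_infty_natSinv_lt (PosNum (divr_gt0 r0 (ltr0Sn R 1))).
    by exists N; have := hN _ (leqnn N); rewrite /= ltr_pdivlMr// mulrC.
  have s0 : 0 < N.+1%:R^-1 :> R by [].
  have rat_near (t : R) : exists c : rat, `|t - ratr c| < N.+1%:R^-1.
    have /rat_in_itvoo[c] : t < t + N.+1%:R^-1 by rewrite ltrDl.
    rewrite in_itv /= => /andP[c1 c2]; exists c.
    by rewrite ltr0_norm ?subr_lt0// opprB ltrBlDl.
  have [c hc] := rat_near z.1.
  have /choice[g hg] : forall i, exists c : rat, `|z.2 0 i - ratr c| < N.+1%:R^-1.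
    by move=> i; apply: rat_near.
  exists (c, \row_i g i, N) => /=.
    move=> y [/= y1 y2]; apply: hr; rewrite -ball_normE /ball_ /=.
    rewrite rcons_rowB rcons_row_norm gt_max; apply/andP; split.
      apply: lt_trans hN; rewrite mulr_natl mulr2n.
      rewrite (_ : (z - y).1 = (z.1 - ratr c) - (y.1 - ratr c)); last first.
        by rewrite opprB addrA subrK.
      by rewrite (le_lt_trans (ler_normB _ _))// ltrD.
    apply: lt_trans hN; rewrite mulr_natl mulr2n.
    rewrite (_ : (z - y).2 = (z.2 - rr (\row_i g i)) - (y.2 - rr (\row_i g i))); last first.
      by rewrite opprB addrA subrK.
    rewrite (le_lt_trans (ler_normB _ _))// ltrD//.
    apply: row_lt => // i; rewrite !mxE; exact: hg.
  split => //=; apply: row_lt => // i; rewrite !mxE; exact: hg.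
rewrite bigcup_mkcond; apply: countable_bigcupT_measurable => [|q].
  exact: countableP.
by case: ifP => _; [exact: measurableX|exact: measurable0].
Qed.

End Cons.

Section Leb.
Context {R : realType}.
Notation e_ j := (delta_mx 0 j).

Definition C1c n (F : 'rV[R]_n -> R) :=
  Ck (fun j => e_ j) 1 setT F /\ exists rho : R, forall x, rho < `|x| -> F x = 0.

(** [int_rV] is an iterated integral and not a measure. These are the properties of Lebesgue measure
    on which the sequel relies; the last one is the divergence theorem, one component at a time. *)
Record is_leb n (m : {measure set (borel 'rV[R]_n) -> \bar R}) : Prop := IsLeb {
  leb_int : forall f : borel 'rV[R]_n -> \bar R, measurable_fun setT f ->
    (forall x, (0 <= f x)%E) -> (\int[m]_x f x)%E = int_rV f ;
  leb_bounded : forall rho : R, (m [set x : 'rV[R]_n | (`|x| <= rho)%R] < +oo)%E ;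
  leb_ball : forall (c : 'rV[R]_n) (r : R), 0 < r ->
    (0 < m [set x : 'rV[R]_n | `|x - c| < r]%R)%E ;
  leb_div : forall (F : 'rV[R]_n -> R) k, C1c F ->
    (\int[m]_x ('D_(e_ k) F x)%:E = 0)%E
}.

Lemma closed_norm n (rho : R) :
  measurable ([set x | `|x| <= rho] : set (borel 'rV[R]_n)).
Proof.
apply: closed_borel; rewrite (_ : [set x | _] = Num.norm @^-1` [set t : R | t <= rho])//.
by apply: closed_comp => [x _|]; [exact: norm_continuous|exact: closed_le].
Qed.

Lemma open_norm n (c : 'rV[R]_n) (r : R) :
  open [set x : 'rV[R]_n | `|x - c| < r].
Proof.
rewrite (_ : [set x | _] = ball c r); first exact: ball_open.
by rewrite -ball_normE /ball_; apply/seteqP; split => x /=; rewrite distrC.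
Qed.

Lemma leb_sigma_finite n (m : {measure set (borel 'rV[R]_n) -> \bar R}) :
  is_leb m -> sigma_finite setT m.
Proof.
move=> lm; exists (fun k : nat => [set x : 'rV[R]_n | `|x| <= k%:R]).
  apply/seteqP; split => // x _.
  have [k hk] : exists k : nat, `|x| <= k%:R.
    by exists (Num.truncn `|x|).+1; rewrite ltW// truncnS_gt.
  by exists k.
by move=> k; split; [exact: closed_norm|exact: leb_bounded].
Qed.

Lemma FTC_compact (g : R -> R) (rho : R) : (forall t, derivable g t 1) ->
  continuous ('D_1 g) -> (forall t, rho < `|t| -> g t = 0) ->
  (\int[lebesgue_measure]_t ('D_1 g t)%:E = 0)%E.
Proof.
move=> dg cg g0.
(* [rho] may be negative, while [[- r, r]] has to be a proper interval. *)
pose r : R := `|rho| + 1.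
have r0 : 0 < r by rewrite ltr_wpDl.
have rr : rho < r by rewrite (le_lt_trans (ler_norm _))// ltrDl.
have g0' (t : R) : r <= `|t| -> g t = 0 by move=> h; apply: g0; exact: lt_le_trans h.
have cgg : continuous g.
  by move=> t; apply: differentiable_continuous; apply/derivable1_diffP.
have dg0 t : t \notin `[- r, r] -> 'D_1 g t = 0.
  rewrite in_itv /= -ler_norml -ltNge => ht.
  have -> : 'D_1 g t = 'D_1 (cst 0) t; last by rewrite derive_cst.
  apply: near_eq_derive; have : nbhs t (Num.norm @^-1` [set s : R | r < s]).
    apply: nbhs_of_open => //=; apply: open_comp => [x _|]; last exact: open_gt.
    exact: norm_continuous.
  by apply: filterS => s /= hs; rewrite g0'// ltW.
pose D : set R := [set` `[- r, r]%R].
rewrite (_ : (\int[_]_t _)%E = (\int[lebesgue_measure]_(t in D) ('D_1 g t)%:E)%E).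
  rewrite (@continuous_FTC2 R ('D_1 g) g).
  - by rewrite !g0' ?normrN ?ler_norm// sube0.
  - by rewrite gtrN.
  - exact: continuous_subspaceT.
  - split; first by move=> x _.
      exact: cvg_at_right_filter (cgg _).
    exact: cvg_at_left_filter (cgg _).
  - by move=> x _; rewrite derive1E.
rewrite [RHS]integral_mkcond; apply: eq_integral => t _.
rewrite patchE; case: ifPn => // /negP ht; rewrite dg0//.
by apply/negP => h; apply: ht; rewrite inE.
Qed.

Lemma leb0 : is_leb (\d_(0 : borel 'rV[R]_0) : {measure set (borel 'rV[R]_0) -> \bar R}).
Proof.
split.
- by move=> f mf f0; rewrite integral_dirac// diracT mul1e.
- by move=> rho; rewrite /= diracE; case: (_ \in _); rewrite ltry.
- move=> c r r0; rewrite /= diracE (_ : _ \in _ = true) ?lte01//.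
  by apply/mem_set; rewrite /= (_ : 0 - c = 0) ?normr0//; apply/rowP; case.
- by move=> F [].
Qed.

Lemma partial_rcons0 n (F : 'rV[R]_(1 + n) -> R) t (v : 'rV[R]_n) :
  (forall x, derivable F x (e_ (lshift n 0))) ->
  is_derive t (1 : R) (fun t => F (rcons_row (t, v))) ('D_(e_ (lshift n 0)) F (rcons_row (t, v))).
Proof.
move=> dF.
have e (s : R) : rcons_row (s, v) = rcons_row (0, v) + s *: e_ (lshift n 0).
  apply/rowP => j; rewrite !mxE eqxx /=; case: (split_ordP j) => k ->.
    by rewrite !ord1 eq_refl !mxE add0r mulr1.
  by rewrite eq_rlshift mulr0 addr0.
rewrite (funext (fun t => congr1 F (e t))) (e t); apply/is_derive_lineP.
exact: derivableP.
Qed.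

Lemma partial_rconsS n (F : 'rV[R]_(1 + n) -> R) t (v : 'rV[R]_n) i :
  (forall x, derivable F x (e_ (rshift 1 i))) ->
  is_derive v (e_ i) (fun v => F (rcons_row (t, v))) ('D_(e_ (rshift 1 i)) F (rcons_row (t, v))).
Proof.
move=> dF.
have e (s : R) : rcons_row (t, v + s *: e_ i) = rcons_row (t, v) + s *: e_ (rshift 1 i).
  apply/rowP => j; rewrite !mxE eqxx /=; case: (split_ordP j) => k ->.
    by rewrite eq_lrshift !mxE mulr0 addr0.
  by rewrite eq_rshift !mxE eqxx.
have e0 : v = v + (0 : R) *: e_ i by rewrite scale0r addr0.
rewrite [in is_derive _ _ _]e0 [X in 'D__ F X](_ : _ = rcons_row (t, v) + (0 : R) *: e_ (rshift 1 i)); last first.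
  by rewrite scale0r addr0.
apply/(is_derive_lineP (fun v => F (rcons_row (t, v)))).
rewrite (funext (fun s => congr1 F (e s))); apply/is_derive_lineP.
exact: derivableP.
Qed.

Lemma bounded_integrable d (T : measurableType d) (mu : {measure set T -> \bar R})
    (f : T -> R) (A : set T) (C : R) :
  measurable A -> (mu A < +oo)%E -> measurable_fun setT f ->
  (forall x, `|f x| <= C) -> (forall x, ~ A x -> f x = 0) ->
  mu.-integrable setT (EFin \o f).
Proof.
move=> mA muA mf fC f0; apply/integrableP; split; first exact/measurable_EFinP.
apply: (@le_lt_trans _ _ (\int[mu]_x (C%:E * (\1_A x)%:E))%E); last first.
  have C0 : 0 <= C := le_trans (normr_ge0 _) (fC point).
  rewrite ge0_integralZl ?integral_indic ?setIT ?lte_mul_pinfty//.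
  by apply/measurable_EFinP; exact: measurable_indic.
apply: ge0_le_integral => //.
- by apply/measurableT_comp => //; exact/measurable_EFinP.
- apply/measurable_EFinP; apply: measurable_funM => //; exact: measurable_indic.
move=> x _; rewrite -EFinM /= lee_fin.
have [xA|xA] := pselect (A x); first by rewrite indicE mem_set// mulr1.
by rewrite f0// normr0 mulr_ge0// (le_trans (normr_ge0 _) (fC x)).
Qed.

Lemma compact_support_bounded n (f : 'rV[R]_n -> R) (rho : R) : continuous f ->
  (forall x, rho < `|x| -> f x = 0) ->
  exists C : R, (forall x, `|f x| <= C).
Proof.
move=> cf f0.
pose A := [set x : 'rV[R]_n | `|x| <= `|rho|].
have cA : compact A.
  apply: bounded_closed_compact.
    by exists `|rho|; split => // M hM x /= hx; rewrite (le_trans hx)// ltW.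
  rewrite (_ : A = Num.norm @^-1` [set t : R | t <= `|rho|])//.
  by apply: closed_comp => [x _|]; [exact: norm_continuous|exact: closed_le].
have A0 : A !=set0 by exists 0; rewrite /A /= normr0.
have [|c _ hc] := compact_EVT_max (f := fun x => `|f x|) A0 cA.
  by apply: continuous_subspaceT => x; apply: continuous_comp (cf x) _;
    exact: norm_continuous.
exists `|f c| => x.
have [xA|xA] := lerP `|x| `|rho|; first by apply: hc; rewrite inE.
by rewrite f0 ?normr0//; exact: le_lt_trans (ler_norm _) xA.
Qed.

Lemma derive_outside n (F : 'rV[R]_n -> R) (rho : R) v x :
  (forall x, rho < `|x| -> F x = 0) -> rho < `|x| -> 'D_v F x = 0.
Proof.
move=> F0 hx; have -> : 'D_v F x = 'D_v (cst 0) x; last by rewrite derive_cst.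
apply: near_eq_derive; have : nbhs x (Num.norm @^-1` [set s : R | rho < s]).
  apply: nbhs_of_open => //=; apply: open_comp => [y _|]; last exact: open_gt.
  exact: norm_continuous.
by apply: filterS => y /=; exact: F0.
Qed.

Lemma norm_setE (c r : R) : [set t : R | `|t - c| < r] = ball c r.
Proof. by rewrite -ball_normE /ball_; apply/seteqP; split => x /=; rewrite distrC. Qed.

Lemma norm_itvE (r : R) : [set t : R | `|t| <= r] = [set` `[- r, r]%R].
Proof. by apply/seteqP; split => x /=; rewrite in_itv /= ler_norml. Qed.

End Leb.

Section LebSucc.
Context {R : realType} {n : nat} (m : {measure set (borel 'rV[R]_n) -> \bar R})
  (lm : is_leb m).
Notation e_ j := (delta_mx 0 j).

(** A copy of [m] that depends on the proof [lm], so that the sigma-finite structure required by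
    product measures can be attached to it. *)
Definition leb_sf (_ : is_leb m) : set (borel 'rV[R]_n) -> \bar R := m.
HB.instance Definition _ := Measure.on (leb_sf lm).
HB.instance Definition _ :=
  Measure_isSigmaFinite.Build _ _ _ (leb_sf lm) (leb_sigma_finite lm).

(** The product of one-dimensional Lebesgue measure with [m], pushed forward by [rcons_row]. For the
    divergence theorem, Fubini integrates first over the factor containing the direction of
    differentiation: the fundamental theorem of calculus settles the new coordinate, the hypothesis
    on [m] the others. *)
Lemma leb_succ :
  exists m' : {measure set (borel 'rV[R]_(1 + n)) -> \bar R}, is_leb m'.
Proof.
pose s := [the {sigma_finite_measure set (borel 'rV[R]_n) -> \bar R} of leb_sf lm].
pose L : {sigma_finite_measure set (measurableTypeR R) -> \bar R} :=
  [the {sigma_finite_measure set _ -> \bar R} of @lebesgue_measure R].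
pose pm := (L \x s)%E.
pose m' := measure_function_pushforward__canonical__measure_function_Measure pm
  (@measurable_rcons_row R n).
have mc := @measurable_rcons_row R n.
have mI (r : R) : measurable ([set t : R | `|t| <= r] : set (measurableTypeR R)).
  by rewrite norm_itvE; exact: measurable_itv.
have box (rho : R) : (pm ([set t : R | (`|t| <= rho)%R] `*` [set v : 'rV[R]_n | (`|v| <= rho)%R]) < +oo)%E.
  rewrite /pm (product_measure1E L s (mI rho) (closed_norm _)).
  apply: lte_mul_pinfty; [exact: measure_ge0| |exact: (leb_bounded lm rho)].
  rewrite norm_itvE /= lebesgue_measure_itv /=; by case: ifP.
exists m'; split.
- move=> f mf f0; rewrite ge0_integral_pushforward//= preimage_setT.
  rewrite fubini_tonelli1//; last exact: measurableT_comp mf mc.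
  apply: eq_integral => t _; rewrite /fubini_F -(leb_int lm)//.
  exact: measurableT_comp (measurableT_comp mf mc) (pair1_measurable t).
- move=> rho; rewrite /= /pushforward.
  rewrite (_ : _ @^-1` _ = [set t : R | `|t| <= rho] `*` [set v : 'rV[R]_n | `|v| <= rho])//.
  apply/seteqP; split => z /=; rewrite rcons_row_norm ge_max; first by move=> /andP.
  by move=> [-> ->].
- move=> c r r0; rewrite /= /pushforward -(rcons_rowK c).
  set c' : R * 'rV[R]_n := (c 0 (lshift n 0), rsubmx c); rewrite (_ : _ @^-1` _ = [set t : R | `|t - c'.1| < r] `*` [set v : 'rV[R]_n | `|v - c'.2| < r]).
    rewrite (product_measure1E L s).
    + apply: mule_gt0; last exact: (leb_ball lm c'.2 r0).
      suff e : lebesgue_measure [set t : R | `|t - c'.1| < r] = (r *+ 2)%:E.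
        by apply: (@lt_le_trans _ _ (r *+ 2)%:E); [rewrite lte_fin pmulrn_lgt0|rewrite -e].
      by rewrite norm_setE; apply: lebesgue_measure_ball; exact: ltW.
    + by rewrite norm_setE; apply: open_measurable; exact: ball_open.
    + exact: (@open_borel 'rV[R]_n _ (@open_norm R n c'.2 r)).
  apply/seteqP; split => z /=; rewrite rcons_rowB rcons_row_norm gt_max; first by move=> /andP.
  by move=> [-> ->].
move=> F k [hF [rho F0]].
have dF j x : derivable F x (e_ j) by apply: (Ck_der j hF).
have cF j x : {for x, continuous ('D_(e_ j) F)} by apply: (Ck_cont (Ck_partial j hF)).
have mF : measurable_fun [set: borel 'rV[R]_(1 + n)] ('D_(e_ k) F : borel _ -> R).
  by apply: continuous_borel => x; exact: cF.
have DF0 x : rho < `|x| -> 'D_(e_ k) F x = 0 by exact: derive_outside.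
have [C hC] := compact_support_bounded (fun x => cF k x) DF0.
have ipm : pm.-integrable setT (fun z => ('D_(e_ k) F (rcons_row z))%:E).
  apply: (@bounded_integrable R _ _ [the {measure set _ -> \bar R} of (L \x s)%E]
    (fun z => 'D_(e_ k) F (rcons_row z))
    ([set t : R | `|t| <= rho] `*` [set v : 'rV[R]_n | `|v| <= rho]) C) => //.
  - by apply: measurableX => //; exact: closed_norm.
  - exact: measurableT_comp mF mc.
  - move=> z hz; apply: DF0; rewrite rcons_row_norm lt_max ltNge [X in _ || X]ltNge.
    by rewrite -negb_and; apply/negP => /andP[z1 z2]; apply: hz.
rewrite integral_pushforward//; last exact/measurable_EFinP.
rewrite preimage_setT -integral12_prod_meas1//.
case: (split_ordP k) => i ki.
  rewrite Fubini// (eq_integral (cst 0%E)) ?integral0// => v _.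
  rewrite ki ord1; set g := fun t => F (rcons_row (t, v)).
  have hg (t : R) : is_derive t (1 : R) g ('D_(e_ (lshift n 0)) F (rcons_row (t, v))).
    by apply: partial_rcons0.
  transitivity (\int[lebesgue_measure]_t ('D_1 g t)%:E)%E.
    by apply: eq_integral => t _; have [_ ->] := hg t.
  apply: (@FTC_compact _ _ rho); first by move=> t; have [] := hg t.
  - rewrite (_ : 'D_1 g = 'D_(e_ (lshift n 0)) F \o (fun t => rcons_row (t, v))).
      move=> t; apply: continuous_comp; last exact: cF.
      exact: continuous_rcons_row1.
    by apply/funext => t; have [_ ->] := hg t.
  - by move=> t ht; apply: F0; rewrite rcons_row_norm lt_max ht.
rewrite (eq_integral (cst 0%E)) ?integral0// => t _.
rewrite /fubini_F ki; set g := fun v => F (rcons_row (t, v)).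
have hg j (v : 'rV[R]_n) : is_derive v (e_ j) g ('D_(e_ (rshift 1 j)) F (rcons_row (t, v))).
  by apply: partial_rconsS.
transitivity (\int[m]_v ('D_(e_ i) g v)%:E)%E.
  by apply: eq_integral => v _; have [_ ->] := hg i v.
have ct (v : 'rV[R]_n) : {for v, continuous (fun v => rcons_row (t, v))}.
  exact: continuous_rcons_row2.
apply: (leb_div lm); split.
  split; first by move=> v _; apply: continuous_comp (ct v) _; exact: (Ck_cont hF).
  move=> j; split; first by move=> v _; have [] := hg j v.
  split => // v _.
  rewrite (_ : 'D_(e_ j) g = 'D_(e_ (rshift 1 j)) F \o (fun v => rcons_row (t, v))).
    by apply: continuous_comp (ct v) _; exact: cF.
  by apply/funext => u; have [_ ->] := hg j u.
by exists rho => v hv; apply: F0; rewrite rcons_row_norm lt_max hv orbT.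
Qed.

End LebSucc.

Lemma leb_exists (R : realType) n :
  exists m : {measure set (borel 'rV[R]_n) -> \bar R}, is_leb m.
Proof.
elim: n => [|n [m lm]]; last exact: leb_succ lm.
by exists (\d_(0 : borel 'rV[R]_0)); exact: leb0.
Qed.

(** * Smooth functions of one variable *)

Section OneVar.
Context {R : realType}.

Lemma Ck1_step k (J : set R) (a b : R -> R) : open J ->
  (forall t, J t -> is_derive t (1 : R) a (b t)) -> Ck1 k J b -> Ck1 k.+1 J a.
Proof.
move=> oJ ab hb; split.
  move=> t /ab[da _]; apply: differentiable_continuous; exact/derivable1_diffP.
move=> i; split; first by move=> t /ab[].
by apply: Ck_eq hb => // t /set_mem /ab[_ ->].
Qed.

Lemma Ck1_id k (J : set R) : open J -> Ck1 k J id.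
Proof.
move=> oJ; case: k => [|k]; first by split => // t _; exact: cvg_id.
apply: (@Ck1_step _ _ _ (cst 1)) => //; exact: Ck_cst.
Qed.

Lemma Ck1_expR k (J : set R) : open J -> Ck1 k J expR.
Proof.
move=> oJ; elim: k => [|k IH]; first by split => // t _; exact: continuous_expR.
by apply: (@Ck1_step _ _ _ expR).
Qed.

Lemma open_neq0 : open [set t : R | t != 0].
Proof.
have -> : [set t : R | t != 0] = [set t | 0 < t] `|` [set t | t < 0].
  by apply/seteqP; split => t /=; rewrite neq_lt; [case/orP; [right|left]|
    case => ->; rewrite ?orbT].
by apply: openU; [exact: open_gt|exact: open_lt].
Qed.

Lemma Ck1_inv k : Ck1 k [set t : R | t != 0] (fun t => t^-1).
Proof.
have hd (t : R) : t != 0 -> is_derive t (1 : R) (fun t => t^-1) (- (t^-1 * t^-1)).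
  move=> t0; apply: DeriveDef; first by apply: derivableV => //.
  by rewrite deriveV// derive_id expr2 invfM [_ *: _]mulr1.
elim: k => [|k IH].
  by split => // t /hd[dt _]; apply: differentiable_continuous; exact/derivable1_diffP.
apply: (Ck1_step open_neq0 hd); apply: CkN; first exact: open_neq0.
by apply: CkM => //; exact: open_neq0.
Qed.

Lemma open_pos : open [set t : R | 0 < t].
Proof. exact: open_gt. Qed.

Lemma Ck1_powR k (p : R) : Ck1 k [set t : R | 0 < t] (fun t => t `^ p).
Proof.
have hd (q t : R) : 0 < t -> is_derive t (1 : R) (fun t => t `^ q) (q * t `^ (q - 1)).
  exact: is_derive1_powR.
elim: k p => [|k IH] p.
  by split => // t /(hd p)[dt _]; apply: differentiable_continuous; exact/derivable1_diffP.
apply: (Ck1_step open_pos (hd p)).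
by apply: CkM; [exact: open_pos|exact: Ck_cst|exact: IH].
Qed.

Lemma Ck1_sqrt k : Ck1 k [set t : R | 0 < t] Num.sqrt.
Proof.
apply: Ck_eq (Ck1_powR k 2^-1); first exact: open_pos.
by move=> t /set_mem /= t0; rewrite -powR12_sqrt ?ltW.
Qed.

(* The flat functions p(1/t) exp(-1/t), extended by 0 to t <= 0, are stable
   under differentiation. *)
Definition flatp (p : {poly R}) (t : R) : R :=
  if 0 < t then p.[t^-1] * expR (- t^-1) else 0.

(** Each monomial is bounded by raising [x <= exp x], taken at [x = s / i.+1], to the power [i]. *)
Lemma poly_expR_bound (p : {poly R}) :
  exists C : R, forall s, 0 <= s -> `|p.[s]| <= C * expR s.
Proof.
have mono (i : nat) (s : R) : 0 <= s -> s ^+ i <= i.+1%:R ^+ i * expR s.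
  move=> s0; have h : s / i.+1%:R <= expR (s / i.+1%:R).
    by apply: le_trans (expR_ge1Dx _); rewrite lerDr.
  have /(lerXn2r i) : (s / i.+1%:R) <= expR (s / i.+1%:R) by [].
  rewrite !nnegrE expR_ge0 divr_ge0// => /(_ isT isT).
  rewrite expr_div_n ler_pdivrMr ?exprn_gt0// => h'.
  apply: le_trans h' _; rewrite mulrC ler_wpM2l// ?exprn_ge0//.
  rewrite -expRM_natl ler_expR mulrC mulrAC ler_pdivrMr// ler_wpM2l// ler_nat.
  exact: leqnSn.
exists (\sum_(i < size p) `|p`_i| * i.+1%:R ^+ i) => s s0.
rewrite horner_coef mulr_suml (le_trans (ler_norm_sum _ _ _))//.
apply: ler_sum => i _; rewrite normrM -mulrA ler_wpM2l//.
by rewrite ger0_norm ?exprn_ge0//; exact: mono.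
Qed.

Lemma flatp_derive (p : {poly R}) (t : R) :
  is_derive t (1 : R) (flatp p) (flatp ('X^2 * (p - p^`())) t).
Proof.
have [t0|t0|t0] := ltgtP t 0.
- have nt : \near t, cst 0 t = flatp p t.
    have : nbhs t [set s : R | s < 0] by apply: nbhs_of_open => //; exact: open_lt.
    by apply: filterS => s /= s0; rewrite /flatp ltNge ltW.
  rewrite {2}/flatp ltNge ltW//=.
  exact: near_eq_is_derive nt (is_derive_cst _ _ _).
- have nt : \near t, p.[t^-1] * expR (- t^-1) = flatp p t.
    have : nbhs t [set s : R | 0 < s] by apply: nbhs_of_open => //; exact: open_gt.
    by apply: filterS => s /= s0; rewrite /flatp s0.
  apply: near_eq_is_derive nt _; rewrite /flatp t0.
  have hi : is_derive t (1 : R) (fun t => t^-1) (- (t^-1 * t^-1)).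
    apply: DeriveDef; first by apply: derivableV => //; rewrite gt_eqF.
    by rewrite deriveV ?gt_eqF// derive_id expr2 invfM [_ *: _]mulr1.
  have h1 : is_derive t (1 : R) (fun t => p.[t^-1]) (p^`().[t^-1] * (- (t^-1 * t^-1))).
    by apply: (is_derive_comp1 hi); exact: is_derive_poly.
  have h2 : is_derive t (1 : R) (fun t => expR (- t^-1)) (expR (- t^-1) * (t^-1 * t^-1)).
    have hn : is_derive t (1 : R) (fun t => - t^-1) (t^-1 * t^-1).
      by rewrite -[X in is_derive _ _ _ X]opprK; exact: is_deriveN.
    exact: (is_derive_comp1 hn).
  refine (is_derive_eq (is_deriveM h1 h2) _).
  rewrite !hornerE /GRing.scale /= expr2; ring.
- rewrite t0 {2}/flatp ltxx.
  (* The extra factor [X^2] bounds the difference quotient at 0 by [C * h]. *)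
  have [C hC] := poly_expR_bound ('X^2 * p).
  have C0 : 0 <= C.
    have := hC 0 (lexx _); rewrite expR0 mulr1; exact: le_trans.
  have lim : (fun h : R => h^-1 *: (flatp p (h *: (1 : R) + 0) - flatp p 0)) @ 0^' --> (0 : R).
    apply/cvgrPdist_le => e e0.
    exists (e / (C + 1)); first by rewrite /= divr_gt0// ltr_wpDl.
    move=> h /=; rewrite sub0r normrN => he h0.
    rewrite sub0r normrN addr0 [h *: 1]mulr1 /flatp ltxx subr0.
    case: ifPn => hp; last by rewrite scaler0 normr0 ltW.
    rewrite /GRing.scale /= normrM normrM [`|expR _|]ger0_norm ?expR_ge0// normfV.
    have hi0 : 0 <= h^-1 by rewrite invr_ge0 ltW.
    have := hC h^-1 hi0; rewrite !hornerE normrM expRN.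
    rewrite ger0_norm ?exprn_ge0// (gtr0_norm hp) => hb.
    have : `|p.[h^-1]| <= h ^+ 2 * (C * expR h^-1).
      by rewrite -ler_pdivrMl ?exprn_gt0// -exprVn.
    move=> hb'; apply: (@le_trans _ _ (h * C)).
      rewrite -[X in X <= _]/(h^-1 * `|p.[h^-1]| * (expR h^-1)^-1).
      rewrite ler_pdivrMr ?expR_gt0// ler_pdivrMl//.
      by apply: le_trans hb' _; rewrite expr2 -!mulrA.
    apply: ltW; rewrite (gtr0_norm hp) in he.
    rewrite (le_lt_trans (y := h * (C + 1)))// ?ler_wpM2l ?lerDl// ?ltW//.
    by rewrite -ltr_pdivlMr// ltr_wpDl.
  apply: DeriveDef; first by rewrite /derivable; apply/cvg_ex; exists 0.
  exact: cvg_lim lim.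
Qed.

Definition flat : R -> R := flatp 1.

(** The induction runs over all [flatp p], since differentiation changes the polynomial. *)
Lemma Ck1_flat k (J : set R) : open J -> Ck1 k J flat.
Proof.
move=> oJ; rewrite /flat; elim: k {1}1 => [|k IH] p.
  split => // t _; apply: differentiable_continuous; apply/derivable1_diffP.
  by have [] := flatp_derive p t.
exact: (Ck1_step oJ (fun t _ => flatp_derive p t)).
Qed.

Lemma flat_gt0 t : 0 < t -> 0 < flat t.
Proof. by move=> t0; rewrite /flat /flatp t0 hornerE mul1r expR_gt0. Qed.

Lemma flat_le0 t : t <= 0 -> flat t = 0.
Proof. by move=> t0; rewrite /flat /flatp ltNge t0. Qed.

Lemma flat_ge0 t : 0 <= flat t.
Proof. by case: (ltP 0 t) => [/flat_gt0/ltW//|/flat_le0 ->]. Qed.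

(** The standard smooth transition from 0 to 1; its denominator is positive because [t] and [1 - t]
    are never both nonpositive. *)
Definition smoothstep (t : R) : R := flat t / (flat t + flat (1 - t)).

Lemma smoothstep_den t : 0 < flat t + flat (1 - t).
Proof.
case: (ltP 0 t) => t0; first by rewrite ltr_wpDr ?flat_ge0 ?flat_gt0.
by rewrite ltr_wpDl ?flat_ge0 ?flat_gt0// subr_gt0 (le_lt_trans t0).
Qed.

Lemma smoothstep0 t : t <= 0 -> smoothstep t = 0.
Proof. by move=> t0; rewrite /smoothstep flat_le0// mul0r. Qed.

Lemma smoothstep1 t : 1 <= t -> smoothstep t = 1.
Proof.
move=> t1; have := smoothstep_den t; rewrite /smoothstep [flat (1 - t)]flat_le0 ?subr_le0//.
by rewrite addr0 => h; rewrite divff// gt_eqF.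
Qed.

Lemma smoothstep_itv t : 0 <= smoothstep t <= 1.
Proof.
rewrite /smoothstep divr_ge0 ?flat_ge0 ?(ltW (smoothstep_den t))//=.
by rewrite ler_pdivrMr ?smoothstep_den// mul1r lerDl flat_ge0.
Qed.

Lemma Ck1_smoothstep k (J : set R) : open J -> Ck1 k J smoothstep.
Proof.
move=> oJ; apply: CkM => //; first exact: Ck1_flat.
apply: (@Ck_comp1 R R unit (fun=> 1) k J [set t | t != 0]
  (fun t => flat t + flat (1 - t)) (fun t => t^-1)) => //.
- by move=> t _ /=; rewrite gt_eqF// smoothstep_den.
- apply: CkD => //; first exact: Ck1_flat.
  apply: (@Ck_comp1 R R unit (fun=> 1) k J setT (fun t => 1 - t) flat) => //.
    by apply: CkB => //; [exact: Ck_cst|exact: Ck1_id].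
  by apply: Ck1_flat; exact: openT.
- exact: Ck1_inv.
Qed.

End OneVar.

(* Both are stated in [R] rather than in the normed module [R], which keeps the
   ring operations on derivatives in the expected structure. *)
HB.lock Definition pd {R : realType} {n} (k : 'I_n) (f : 'rV[R]_n -> R) (p : 'rV[R]_n) : R :=
  'D_(delta_mx 0 k) f p.

HB.lock Definition der {R : realType} (a : R -> R) (t : R) : R := 'D_1 a t.

Section DerivativeRules.
Context {R : realType} {V : normedModType R}.

Lemma is_deriveMp (f g : V -> R) x v df dg : is_derive x v f df ->
  is_derive x v g dg -> is_derive x v (fun y => f y * g y) (df * g x + f x * dg).
Proof.
move=> hf hg; apply: (is_derive_eq (is_deriveM hf hg)).
by rewrite /GRing.scale /= addrC [g x * _]mulrC.
Qed.

Lemma is_deriveDp (f g : V -> R) x v df dg : is_derive x v f df ->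
  is_derive x v g dg -> is_derive x v (fun y => f y + g y) (df + dg).
Proof. by move=> hf hg; exact: is_deriveD. Qed.

Lemma Ck1_der k (J : set R) a t : Ck1 k.+1 J a -> J t ->
  is_derive t (1 : R) a (der a t).
Proof. by move=> ha Jt; rewrite der.unlock; apply: derivableP; exact: (Ck_der tt ha Jt). Qed.

Lemma Ck1_D1 k (J : set R) a : Ck1 k.+1 J a -> Ck1 k J (der a).
Proof.
move=> ha; rewrite (_ : der a = 'D_1 a); first exact: (Ck_partial tt ha).
by apply/funext => t; rewrite der.unlock.
Qed.

Lemma pd_val n k (f : 'rV[R]_n -> R) p D : is_derive p (delta_mx 0 k) f D -> pd k f p = D.
Proof. by move=> [_ h]; rewrite pd.unlock. Qed.

Lemma pdE n k (f : 'rV[R]_n -> R) : pd k f = 'D_(delta_mx 0 k) f.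
Proof. by apply/funext => p; rewrite pd.unlock. Qed.

Lemma pd_eq n k (U : set 'rV[R]_n) (f g : 'rV[R]_n -> R) p : open U -> U p ->
  {in U, f =1 g} -> pd k f p = pd k g p.
Proof. by move=> oU Up fg; rewrite !pdE; apply: near_eq_derive; exact: (open_near oU Up fg). Qed.

Lemma Ck_pdP n (U : set 'rV[R]_n) f p l i : Ck (fun j => delta_mx 0 j) l.+1 U f ->
  U p -> is_derive p (delta_mx 0 i) f (pd i f p).
Proof. by move=> hf Up; rewrite pdE; apply: derivableP; exact: (Ck_der i hf Up). Qed.

Lemma Ck_pd n (U : set 'rV[R]_n) f l i : Ck (fun j => delta_mx 0 j) l.+1 U f ->
  Ck (fun j => delta_mx 0 j) l U (pd i f).
Proof. by move=> hf; rewrite pdE; exact: Ck_partial hf. Qed.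

Lemma der_val (a : R -> R) t D : is_derive t (1 : R) a D -> der a t = D.
Proof. by move=> [_ h]; rewrite der.unlock. Qed.

End DerivativeRules.

(** * Positive definite matrices *)

Section PosDef.
Context {R : realType}.

Definition posdef n (G : 'M[R]_n) :=
  G^T = G /\ forall v : 'rV[R]_n, v != 0 -> 0 < (v *m G *m v^T) 0 0.

(** The dual metric, on covectors; hence the inverse matrix. *)
Definition gdot n (G : 'M[R]_n) (a b : 'rV[R]_n) : R := (a *m invmx G *m b^T) 0 0.

Lemma invmx_mul n (A B : 'M[R]_n) : A \in unitmx -> B \in unitmx ->
  invmx (A *m B) = invmx B *m invmx A.
Proof.
move=> uA uB; have uAB : A *m B \in unitmx by rewrite unitmx_mul uA.
by rewrite -[RHS](mulKmx uAB) -mulmxA (mulmxA B) mulmxV// mul1mx mulmxV// mulmx1.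
Qed.

Lemma invmx_tr n (A : 'M[R]_n) : invmx A^T = (invmx A)^T.
Proof. by rewrite trmx_inv. Qed.

Lemma mx11_tr (A : 'M[R]_1) : A^T 0 0 = A 0 0.
Proof. by rewrite mxE. Qed.

Lemma mx11D (A B : 'M[R]_1) : (A + B) 0 0 = A 0 0 + B 0 0.
Proof. by rewrite mxE. Qed.

Lemma mx11Z (c : R) (A : 'M[R]_1) : (c *: A) 0 0 = c * A 0 0.
Proof. by rewrite mxE. Qed.

Lemma mx11_scalar00 (c : R) : (c%:M : 'M[R]_1) 0 0 = c.
Proof. by rewrite mxE eqxx mulr1n. Qed.

Lemma sqnormE n (v : 'rV[R]_n) : (v *m v^T) 0 0 = \sum_j v 0 j ^+ 2.
Proof. by rewrite mxE; apply: eq_bigr => j _; rewrite mxE expr2. Qed.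

Lemma sqnorm_ge0 n (v : 'rV[R]_n) : 0 <= (v *m v^T) 0 0.
Proof. by rewrite sqnormE sumr_ge0// => j _; rewrite sqr_ge0. Qed.

Lemma sqnorm_eq0 n (v : 'rV[R]_n) : (v *m v^T) 0 0 = 0 -> v = 0.
Proof.
rewrite sqnormE => /eqP; rewrite psumr_eq0; last by move=> j _; rewrite sqr_ge0.
move=> /allP h; apply/rowP => j; rewrite mxE.
by have := h j (mem_index_enum _); rewrite /= sqrf_eq0 => /eqP.
Qed.

(** Induction on the dimension through the Schur complement [S] of the corner entry. *)
Lemma cholesky n (G : 'M[R]_n) : posdef G ->
  exists2 L : 'M[R]_n, L \in unitmx & G = L *m L^T.
Proof.
elim: n G => [|n IH] G [sG pG].
  by exists 1%:M; [exact: unitmx1|rewrite [LHS]flatmx0 [RHS]flatmx0].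
pose G' : 'M[R]_(1 + n) := G.
pose a := G' (lshift n 0) (lshift n 0); pose b := ursubmx G'; pose D := drsubmx G'.
have ulG : ulsubmx G' = a%:M.
  by apply/matrixP => i j; rewrite !mxE !ord1 eqxx mulr1n.
have dlG : dlsubmx G' = b^T.
  by rewrite /b trmx_ursub (sG : G'^T = G').
have sD : D^T = D by rewrite /D trmx_drsub (sG : G'^T = G').
have bG : G' = block_mx a%:M b b^T D by rewrite -ulG -dlG submxK.
have quad (s : R) (w : 'rV[R]_n) :
    (row_mx s%:M w *m G' *m (row_mx s%:M w)^T) 0 0 =
    s ^+ 2 * a + 2 * s * (w *m b^T) 0 0 + (w *m D *m w^T) 0 0.
  have e : (b *m w^T) 0 0 = (w *m b^T) 0 0.
    by rewrite -[RHS]mx11_tr trmx_mul trmxK.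
  rewrite bG mul_row_block tr_row_mx mul_row_col tr_scalar_mx !mulmxDl.
  rewrite -!scalar_mxM !mul_scalar_mx !mul_mx_scalar -scalemxAl.
  rewrite !mx11D !mx11Z mx11_scalar00 e; ring.
have a0 : 0 < a.
  have := pG (row_mx (1 : R)%:M 0 : 'rV_(1 + n)).
  rewrite (quad 1 0) !mul0mx !mxE expr1n mul1r mulr0 !addr0; apply.
  apply/eqP => /(congr1 (fun v : 'rV[R]_(1 + n) => v 0 (lshift n 0))).
  by rewrite row_mxEl !mxE eqxx => /eqP; rewrite oner_eq0.
pose S := D - a^-1 *: (b^T *m b).
have [|L' uL' eL'] := IH S.
  split; first by rewrite /S linearB /= sD linearZ /= trmx_mul trmxK.
  (* The first coordinate that minimizes the quadratic form for fixed [w]; the minimum is the form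
     of [S]. *)
  move=> w w0; pose s := - (w *m b^T) 0 0 / a.
  have := pG (row_mx s%:M w : 'rV_(1 + n)); rewrite (quad s w).
  have -> : (w *m S *m w^T) 0 0 = s ^+ 2 * a + 2 * s * (w *m b^T) 0 0 + (w *m D *m w^T) 0 0.
    rewrite /S mulmxBr mulmxBl -scaleN1r mx11D mx11Z -scalemxAr -scalemxAl mx11Z.
    have -> : (w *m (b^T *m b) *m w^T) = ((w *m b^T) 0 0 ^+ 2)%:M.
      rewrite !mulmxA -(mulmxA _ b) -[b *m w^T]trmxK trmx_mul trmxK.
      by rewrite {1 2}[w *m b^T]mx11_scalar tr_scalar_mx -scalar_mxM expr2.
    rewrite mx11_scalar00 /s.
    have an : a != 0 by rewrite gt_eqF.
    by field.
  apply; apply: contra w0 => /eqP h; apply/eqP.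
  by rewrite -(row_mxKr (s%:M : 'M[R]_1) w) h linear0.
pose s := Num.sqrt a.
have s0 : s != 0 by rewrite gt_eqF// sqrtr_gt0.
have ss : s * s = a by rewrite -expr2 sqr_sqrtr// ltW.
exists (block_mx s%:M 0 (s^-1 *: b^T) L' : 'M[R]_(1 + n)).
  have e := @det_lblock R 1 n s%:M (s^-1 *: b^T) L'.
  by rewrite unitmxE e det_scalar1 unitrMl -?unitmxE// unitfE.
rewrite -[LHS]/G' bG (@tr_block_mx _ 1 n 1 n) (@mulmx_block _ 1 n 1 n 1 n).
rewrite tr_scalar_mx trmx0 linearZ /= trmxK.
rewrite !mul0mx !mulmx0 !addr0 -scalar_mxM ss mul_scalar_mx mul_mx_scalar.
rewrite !scalerA mulfV// !scale1r -eL' /S -scalemxAl -scalemxAr scalerA.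
by rewrite -invfM ss addrC subrK.
Qed.

Lemma posdef_det n (G : 'M[R]_n) : posdef G -> 0 < \det G.
Proof.
move=> /cholesky[L uL ->]; rewrite det_mulmx det_tr -expr2 exprn_even_gt0//=.
by rewrite -unitfE -unitmxE.
Qed.

Lemma posdef_unit n (G : 'M[R]_n) : posdef G -> G \in unitmx.
Proof. by move=> /posdef_det h; rewrite unitmxE unitfE gt_eqF. Qed.

Lemma gdotE n (G L : 'M[R]_n) a b : L \in unitmx -> G = L *m L^T ->
  gdot G a b = ((a *m invmx L^T) *m (b *m invmx L^T)^T) 0 0.
Proof.
move=> uL ->; rewrite /gdot invmx_mul ?unitmx_tr// trmx_mul -invmx_tr trmxK.
by rewrite !mulmxA.
Qed.

Lemma gdot_ge0 n (G : 'M[R]_n) a : posdef G -> 0 <= gdot G a a.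
Proof. by move=> /cholesky[L uL eL]; rewrite (gdotE _ _ uL eL) sqnorm_ge0. Qed.

Lemma gdot_eq0 n (G : 'M[R]_n) a : posdef G -> gdot G a a = 0 -> a = 0.
Proof.
move=> /cholesky[L uL eL]; rewrite (gdotE _ _ uL eL) => /sqnorm_eq0 h.
have u : L^T \in unitmx by rewrite unitmx_tr.
by rewrite -[a](mulmxKV u) h mul0mx.
Qed.

Lemma gdotC n (G : 'M[R]_n) a b : G^T = G -> gdot G a b = gdot G b a.
Proof.
move=> sG; rewrite /gdot -[RHS]mx11_tr.
by rewrite !trmx_mul trmxK -invmx_tr sG mulmxA.
Qed.

Lemma gdotDl n (G : 'M[R]_n) a a' b : gdot G (a + a') b = gdot G a b + gdot G a' b.
Proof. by rewrite /gdot !mulmxDl mxE. Qed.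

Lemma gdotZl n (G : 'M[R]_n) c a b : gdot G (c *: a) b = c * gdot G a b.
Proof. by rewrite /gdot -!scalemxAl mxE. Qed.

(** The sign of [C] is part of what is proved: for [C = 0] the form is affine in [t], and for
    [C < 0] an explicit large [t] would make it negative. *)
Lemma cauchy_schwarz_form (A B C : R) : (forall t, 0 <= A + 2 * t * B + t ^+ 2 * C) ->
  B ^+ 2 <= A * C.
Proof.
move=> h; have [C0|C0] := eqVneq C 0.
  rewrite C0 mulr0; have [->|B0] := eqVneq B 0; first by rewrite expr0n.
  have := h (- (A + 1) / (2 * B)); rewrite C0 mulr0 addr0.
  have -> : A + 2 * (- (A + 1) / (2 * B)) * B = - 1 by field; rewrite B0.
  by rewrite lerNr oppr0 ler10.
have Cp : 0 < C.
  rewrite lt_neqAle eq_sym C0 /=; rewrite leNgt; apply/negP => Cn.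
  have h0 := h 0; have := h ((2 * `|B| + A + 1) / - C + 1).
  have A0 : 0 <= A by move: h0; rewrite mulr0 mul0r expr0n mul0r !addr0.
  apply/negP; rewrite -ltNge.
  set t := _ + 1.
  have tC : t * C = - (2 * `|B| + A + 1) + C by rewrite /t; field.
  have t1 : 1 <= t.
    by rewrite /t lerDr divr_ge0 ?oppr_ge0 ?(ltW Cn)// addr_ge0// addr_ge0// mulr_ge0.
  have -> : A + 2 * t * B + t ^+ 2 * C = A + t * (2 * B - 2 * `|B| - A - 1 + C).
    have -> : t ^+ 2 * C = t * (t * C) by ring.
    rewrite tC; ring.
  have hB := ler_norm B.
  have : t * (2 * B - 2 * `|B| - A - 1 + C) <= 2 * B - 2 * `|B| - A - 1 + C.
    rewrite -[X in _ <= X]mul1r ler_wnM2r//; lra.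
  lra.
have := h (- B / C).
have -> : A + 2 * (- B / C) * B + (- B / C) ^+ 2 * C = A - B ^+ 2 / C by field.
by rewrite subr_ge0 ler_pdivrMr.
Qed.

Lemma gdot_cs n (G : 'M[R]_n) a b : posdef G ->
  gdot G a b ^+ 2 <= gdot G a a * gdot G b b.
Proof.
move=> pG; apply: cauchy_schwarz_form => t.
have sG := pG.1; have := gdot_ge0 (a + t *: b) pG.
rewrite gdotDl gdotZl !(gdotC _ (a + _) sG) !gdotDl !gdotZl (gdotC b a sG).
by move=> h; apply: le_trans h _; apply: le_of_eq; ring.
Qed.

(** [J *m G *m J^T] is a pulled-back metric and [a *m J^T] a pulled-back covector: the dual metric
    is invariant. *)
Lemma gdot_transfer n (G J : 'M[R]_n) a b : J *m G *m J^T \in unitmx ->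
  gdot (J *m G *m J^T) (a *m J^T) (b *m J^T) = gdot G a b.
Proof.
rewrite !unitmx_mul unitmx_tr => /andP[/andP[uJ uG] _].
rewrite /gdot !invmx_mul ?unitmx_mul ?uJ ?unitmx_tr// trmx_mul trmxK.
rewrite !mulmxA mulmxK ?unitmx_tr// -(mulmxA _ _ J) mulVmx// mulmx1.
by [].
Qed.

End PosDef.

(** * Smooth dependence of determinants and inverses *)

Section Det.
Context {R : realType} {V : normedModType R} {I : Type} (d : I -> V).

Lemma Ck_det k n (U : set V) (A : V -> 'M[R]_n) : open U ->
  (forall i j, Ck d k U (fun x => A x i j)) -> Ck d k U (fun x => \det (A x)).
Proof.
move=> oU hA; rewrite /determinant; apply: Ck_sum => // s _.
by apply: CkM => //; [exact: Ck_cst|apply: Ck_prod].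
Qed.

(** Cramer's formula writes the inverse as a quotient of polynomials in the entries. *)
Lemma Ck_invmx k n (U : set V) (A : V -> 'M[R]_n) i j : open U ->
  (forall x, U x -> A x \in unitmx) ->
  (forall i j, Ck d k U (fun x => A x i j)) -> Ck d k U (fun x => invmx (A x) i j).
Proof.
move=> oU uA hA.
apply: (@Ck_eq _ _ _ d k U (fun x => (\det (A x))^-1 * cofactor (A x) j i)) => //.
  by move=> x /set_mem /uA u; rewrite /invmx u !mxE.
apply: CkM => //.
  apply: (@Ck_comp1 R V I d k U [set t | t != 0] (fun x => \det (A x)) (fun t => t^-1)) => //.
  - by move=> x /uA; rewrite unitmxE unitfE.
  - exact: Ck_det.
  - exact: Ck1_inv.
apply: CkM => //; first exact: Ck_cst.
apply: Ck_det => // i' j'; have := hA (lift j i') (lift i j').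
by apply: Ck_eq => // x _; rewrite !mxE.
Qed.

End Det.

(** * The gradient form and the Laplacian in a chart *)

Lemma sum_split2 {R : realType} n (D A B : 'I_n -> R) :
  (forall k, D k = A k + B k) -> \sum_k D k = \sum_k A k + \sum_k B k.
Proof. by move=> h; rewrite (eq_bigr _ (fun k _ => h k)) big_split. Qed.

Lemma sum_mulr {R : realType} n (c : R) (A : 'I_n -> R) :
  \sum_k (c * A k) = c * \sum_k A k.
Proof. by rewrite mulr_sumr. Qed.

Section ChartCalculus.
Context {R : realType} {n : nat} (U : set 'rV[R]_n) (G : 'rV[R]_n -> 'M[R]_n).
Notation e_ j := (delta_mx 0 j).
Notation C k f := (Ck (fun j => e_ j) k U f).
Hypotheses (oU : open U) (sG : forall k i j, C k (fun p => G p i j))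
  (pG : forall p, U p -> posdef (G p)).
Implicit Types (f h : 'rV[R]_n -> R).

Definition grad f p : 'rV[R]_n := \row_k pd k f p.

Definition gam f h p : R := gdot (G p) (grad f p) (grad h p).

(* The density times the gradient; its divergence over the density is the
   Laplacian. *)
Definition flux f k p : R :=
  vol_density G p * \sum_l invmx (G p) k l * pd l f p.

Lemma gamE f h p :
  gam f h p = \sum_k pd k f p * \sum_l invmx (G p) k l * pd l h p.
Proof.
rewrite /gam /gdot -mulmxA mxE; apply: eq_bigr => k _; rewrite !mxE.
by congr (_ * _); apply: eq_bigr => l _; rewrite !mxE.
Qed.

Lemma lapE f p : laplace_beltrami G f p =
  (vol_density G p)^-1 * \sum_k pd k (flux f k) p.
Proof. by rewrite /laplace_beltrami; congr (_ * _); apply: eq_bigr => k _; rewrite pdE; congr ('D__ _ _); apply/funext => q; rewrite /flux; congr (_ * _); apply: eq_bigr => l _; rewrite pdE. Qed.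

Lemma Ck_ginv k i j : C k (fun p => invmx (G p) i j).
Proof. by apply: Ck_invmx => // p /pG; exact: posdef_unit. Qed.

Lemma vol_gt0 p : U p -> 0 < vol_density G p.
Proof. by move=> Up; rewrite sqrtr_gt0 posdef_det//; exact: pG. Qed.

Lemma Ck_vol k : C k (vol_density G).
Proof.
apply: (@Ck_comp1 R _ _ _ k U [set t | 0 < t] (fun p => \det (G p)) Num.sqrt) => //.
- by move=> p Up /=; rewrite posdef_det//; exact: pG.
- exact: Ck_det.
- exact: Ck1_sqrt.
Qed.

Lemma Ck_flux k f i : C k.+1 f -> C k (flux f i).
Proof.
move=> hf; apply: CkM => //; first exact: Ck_vol.
apply: Ck_sum => // l _; apply: CkM => //; first exact: Ck_ginv.
exact: Ck_pd hf.
Qed.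

Lemma Ck_gam k f h : C k.+1 f -> C k.+1 h -> C k (gam f h).
Proof.
move=> hf hh; apply: Ck_eq (_ : C k (fun p => \sum_i pd i f p *
  \sum_l invmx (G p) i l * pd l h p)) => //.
  by move=> p _; rewrite gamE.
apply: Ck_sum => // i _; apply: CkM => //; first exact: Ck_pd hf.
apply: Ck_sum => // l _; apply: CkM => //; first exact: Ck_ginv.
exact: Ck_pd hh.
Qed.

Lemma Ck_lap k f : C k.+2 f -> C k (laplace_beltrami G f).
Proof.
move=> hf; rewrite (funext (lapE f)); apply: CkM => //; last first.
  by apply: Ck_sum => // i _; exact: Ck_pd (Ck_flux i hf).
apply: (@Ck_comp1 R _ _ _ k U [set t | t != 0] (vol_density G) (fun t => t^-1)) => //.
- by move=> p /vol_gt0 v0 /=; rewrite gt_eqF.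
- exact: Ck_vol.
- exact: Ck1_inv.
Qed.

Lemma gradM f h p : U p -> C 1 f -> C 1 h ->
  grad (fun p => f p * h p) p = f p *: grad h p + h p *: grad f p.
Proof.
move=> Up hf hh; apply/rowP => k; rewrite !mxE.
by rewrite (pd_val (is_deriveMp (Ck_pdP k hf Up) (Ck_pdP k hh Up))) addrC [h p * _]mulrC.
Qed.

Lemma grad_comp1 f (a : R -> R) (a' : R) p : U p -> C 1 f ->
  is_derive (f p) (1 : R) a a' -> grad (fun p => a (f p)) p = a' *: grad f p.
Proof.
move=> Up hf ha; apply/rowP => k; rewrite !mxE.
exact: pd_val (is_derive_comp1 (Ck_pdP k hf Up) ha).
Qed.

Lemma fluxE f k p : flux f k p =
  vol_density G p * \sum_l invmx (G p) k l * grad f p 0 l.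
Proof. by congr (_ * _); apply: eq_bigr => l _; rewrite mxE. Qed.

Lemma gam_flux f h p : U p -> \sum_k pd k f p * flux h k p =
  vol_density G p * gam f h p.
Proof.
move=> Up; rewrite gamE mulr_sumr; apply: eq_bigr => k _.
by rewrite /flux mulrCA.
Qed.

(** The [flux] satisfies a Leibniz rule; differentiating it once more gives the two Laplacians and
    two equal cross terms, without expanding the coefficients of the metric. *)
Lemma lap_prod f h p : U p -> C 2 f -> C 2 h ->
  laplace_beltrami G (fun p => f p * h p) p =
  f p * laplace_beltrami G h p + h p * laplace_beltrami G f p + 2 * gam f h p.
Proof.
move=> Up hf hh; have v0 := vol_gt0 Up.
have fluxM k : {in U, (fun p => f p * flux h k p + h p * flux f k p) =1
    flux (fun p => f p * h p) k}.
  move=> q /set_mem Uq; rewrite !fluxE gradM//; [|exact: CkS|exact: CkS].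
  rewrite (mulrCA (f q)) (mulrCA (h q)) -mulrDr; congr (_ * _).
  rewrite !mulr_sumr -big_split /=.
  by apply: eq_bigr => l _; rewrite !mxE; ring.
have dM k : pd k (flux (fun p => f p * h p) k) p =
    (pd k f p * flux h k p + f p * pd k (flux h k) p) +
    (pd k h p * flux f k p + h p * pd k (flux f k) p).
  rewrite -(pd_eq k oU Up (fluxM k)).
  exact: pd_val (is_deriveDp
    (is_deriveMp (Ck_pdP k hf Up) (Ck_pdP k (Ck_flux k hh) Up))
    (is_deriveMp (Ck_pdP k hh Up) (Ck_pdP k (Ck_flux k hf) Up))).
have S : \sum_k pd k (flux (fun p => f p * h p) k) p =
   vol_density G p * gam f h p + f p * \sum_k pd k (flux h k) p +
   (vol_density G p * gam h f p + h p * \sum_k pd k (flux f k) p).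
  apply: etrans (sum_split2 dM) _; congr (_ + _).
    apply: etrans (sum_split2 (fun k => erefl)) _.
    by congr (_ + _); [exact: gam_flux|exact: sum_mulr].
  apply: etrans (sum_split2 (fun k => erefl)) _.
  by congr (_ + _); [exact: gam_flux|exact: sum_mulr].
have gC : gam h f p = gam f h p by rewrite /gam gdotC//; exact: (pG Up).1.
rewrite !lapE S gC; move: (\sum_k _) (\sum_k _) => A B.
by field; rewrite gt_eqF.
Qed.

Lemma lap_comp1 f (a : R -> R) (J : set R) p : U p -> C 2 f ->
  (forall p, U p -> J (f p)) -> open J -> Ck1 2 J a ->
  laplace_beltrami G (fun p => a (f p)) p =
  der a (f p) * laplace_beltrami G f p + der (der a) (f p) * gam f f p.
Proof.
move=> Up hf hJ oJ ha; have v0 := vol_gt0 Up.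
have fl k : {in U, (fun p => der a (f p) * flux f k p) =1 flux (fun p => a (f p)) k}.
  move=> q /set_mem Uq; rewrite !fluxE (grad_comp1 Uq (CkS hf) (Ck1_der ha (hJ _ Uq))).
  rewrite mulrCA mulr_sumr; congr (_ * _).
  by apply: eq_bigr => l _; rewrite !mxE mulrCA.
have dM k : pd k (flux (fun p => a (f p)) k) p =
    der a (f p) * pd k (flux f k) p + der (der a) (f p) * (pd k f p * flux f k p).
  rewrite -(pd_eq k oU Up (fl k)).
  have d1 := is_derive_comp1 (Ck_pdP k hf Up) (Ck1_der (Ck1_D1 ha) (hJ _ Up)).
  rewrite (pd_val (is_deriveMp d1 (Ck_pdP k (Ck_flux k hf) Up))); by ring.
have S : \sum_k pd k (flux (fun p => a (f p)) k) p =
   der a (f p) * \sum_k pd k (flux f k) p +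
   der (der a) (f p) * (vol_density G p * gam f f p).
  apply: etrans (sum_split2 dM) _; congr (_ + _); first exact: sum_mulr.
  by apply: etrans (sum_mulr _ _) _; rewrite -(gam_flux f f Up).
rewrite !lapE S; move: (\sum_k _) (gam _ _ _) => A B.
by field; rewrite gt_eqF.
Qed.

End ChartCalculus.

(** * Integrals through a chart *)

Section Density.
Context {R : realType} d1 d2 (T1 : measurableType d1) (T2 : measurableType d2)
  (mu1 : {measure set T1 -> \bar R}) (mu2 : {measure set T2 -> \bar R})
  (D : set T1) (P : T2 -> T1) (W : T2 -> R).
Hypotheses (W0 : forall p, 0 <= W p)
  (mWB : forall B, measurable B -> B `<=` D ->
    measurable_fun setT (fun p => W p * \1_B (P p)))
  (hB : forall B, measurable B -> B `<=` D ->
    mu1 B = (\int[mu2]_p (W p * \1_B (P p))%:E)%E).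

Import HBNNSimple.

(** The level sets of a simple function reduce the identity to indicators, where it is [hB]. *)
Lemma density_nnsfun (h : {nnsfun T1 >-> R}) : (forall x, ~ D x -> h x = 0) ->
  measurable_fun setT (fun p => W p * h (P p)) /\
  (\int[mu1]_x (h x)%:E = \int[mu2]_p (W p * h (P p))%:E)%E.
Proof.
move=> h0.
have term y : measurable_fun setT (fun p => W p * (y * \1_(h @^-1` [set y]) (P p))) /\
   (0 <= y -> (y%:E * mu1 (h @^-1` [set y]) =
   \int[mu2]_p (W p * (y * \1_(h @^-1` [set y]) (P p)))%:E)%E).
  (* The level set of 0 need not lie in [D], but its coefficient vanishes. *)
  have [->|y0] := eqVneq y 0.
    split; first by under eq_fun do rewrite mul0r mulr0; exact: measurable_cst.
    by move=> _; rewrite mul0e; under eq_integral do rewrite mul0r mulr0; rewrite integral0.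
  have sD : h @^-1` [set y] `<=` D.
    by move=> x /= hx; apply: contrapT => /h0 e; move: y0; rewrite -hx e eqxx.
  have mB : measurable (h @^-1` [set y]) by [].
  have e p : W p * (y * \1_(h @^-1` [set y]) (P p)) = y * (W p * \1_(h @^-1` [set y]) (P p)).
    by rewrite mulrCA.
  split.
    under eq_fun do rewrite e; apply: measurable_funM => //; exact: mWB.
  move=> y0'; rewrite hB//; under [RHS]eq_integral do rewrite e EFinM.
  rewrite ge0_integralZl//; first exact/measurable_EFinP/mWB.
  by move=> p _; rewrite lee_fin mulr_ge0.
have e p : W p * h (P p) = \sum_(y \in range h) (W p * (y * \1_(h @^-1` [set y]) (P p))).
  rewrite {1}(fimfunE h (P p)) !fsbig_finite//=; exact: mulr_sumr.
split.
  under eq_fun do rewrite e fsbig_finite//=.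
  by apply: measurable_sum => y; exact: (term y).1.
rewrite integralT_nnsfun sintegralE.
under [RHS]eq_integral do rewrite e -fsumEFin//.
rewrite ge0_integral_fsum//; last 2 first.
- by move=> y; apply/measurable_EFinP; exact: (term y).1.
- move=> y p _; rewrite lee_fin.
  rewrite indicE; case: (boolP (_ \in _)) => [|_]; last by rewrite !mulr0.
  by rewrite inE /= => <-; rewrite mulr1 mulr_ge0// fun_ge0.
apply: eq_fsbigr => y; rewrite inE => -[x _ <-].
by apply: (term _).2; exact: fun_ge0.
Qed.

(** Monotone convergence; the approximating simple functions lie below [g] and so vanish off [D] as
    well. *)
Lemma density_ge0 (g : T1 -> R) : measurable_fun setT g -> (forall x, 0 <= g x) ->
  (forall x, ~ D x -> g x = 0) ->
  measurable_fun setT (fun p => W p * g (P p)) /\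
  (\int[mu1]_x (g x)%:E = \int[mu2]_p (W p * g (P p))%:E)%E.
Proof.
move=> mg g0 gD.
have mg' : measurable_fun setT (EFin \o g) by exact/measurable_EFinP.
pose h := nnsfun_approx measurableT mg'.
have hc x : (h ^~ x) @ \oo --> g x.
  have := @cvg_nnsfun_approx _ _ _ _ measurableT _ mg' (fun x _ => g0 x) x I.
  by move/fine_cvgP => [_]; apply: cvg_trans.
have hn x : {homo h^~ x : k l / (k <= l)%N >-> k <= l}.
  by move=> k l kl; have /lefP := nd_nnsfun_approx measurableT mg' kl; apply.
have hg k x : h k x <= g x.
  rewrite -(cvg_lim _ (hc x))//; apply: (@nondecreasing_cvgn_le _ (h ^~ x)).
    by move=> a b ab; exact: hn.
  by apply/cvg_ex; exists (g x); exact: hc.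
have hD k x : ~ D x -> h k x = 0.
  by move=> /gD gx; apply/le_anti; rewrite fun_ge0 andbT -gx hg.
have hk k := density_nnsfun (hD k).
have Wc p : (fun k => W p * h k (P p)) @ \oo --> W p * g (P p).
  by apply: cvgM; [exact: cvg_cst|exact: hc].
split.
  by apply: (measurable_fun_cvg (fun k => (hk k).1)) => p _; exact: Wc.
have c1 : (\int[mu1]_x (h k x)%:E)%E @[k --> \oo] --> (\int[mu1]_x (g x)%:E)%E.
  have -> : (\int[mu1]_x (g x)%:E = \int[mu1]_x limn (fun k => (h k x)%:E))%E.
    apply: eq_integral => x _; apply/esym/cvg_lim => //.
    by apply: cvg_EFin; [exact: nearW|exact: hc].
  apply: cvg_monotone_convergence => //.
  - by move=> k; exact/measurable_EFinP.
  - by move=> k x _; rewrite lee_fin fun_ge0.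
  - by move=> x _ k l kl; rewrite lee_fin; exact: hn.
have c2 : (\int[mu2]_p (W p * h k (P p))%:E)%E @[k --> \oo] --> (\int[mu2]_p (W p * g (P p))%:E)%E.
  have -> : (\int[mu2]_p (W p * g (P p))%:E = \int[mu2]_p limn (fun k => (W p * h k (P p))%:E))%E.
    apply: eq_integral => x _; apply/esym/cvg_lim => //.
    by apply: cvg_EFin; [exact: nearW|exact: Wc].
  apply: cvg_monotone_convergence => //.
  - by move=> k; exact/measurable_EFinP/(hk k).1.
  - by move=> k x _; rewrite lee_fin mulr_ge0// fun_ge0.
  - by move=> x _ k l kl; rewrite lee_fin ler_wpM2l//; exact: hn.
rewrite (funext (fun k => (hk k).2)) in c1.
exact: (cvg_unique _ c1 c2).
Qed.

Lemma density_integral (g : T1 -> R) : measurable_fun setT g ->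
  (forall x, ~ D x -> g x = 0) ->
  measurable_fun setT (fun p => W p * g (P p)) /\
  (\int[mu1]_x (g x)%:E = \int[mu2]_p (W p * g (P p))%:E)%E.
Proof.
move=> mg gD.
have [|||m1 e1] := @density_ge0 (g ^\+).
- exact: measurable_funrpos.
- by move=> x; exact: funrpos_ge0.
- by move=> x /gD gx; rewrite /funrpos gx maxxx.
have [|||m2 e2] := @density_ge0 (g ^\-).
- exact: measurable_funrneg.
- by move=> x; exact: funrneg_ge0.
- by move=> x /gD gx; rewrite /funrneg gx oppr0 maxxx.
have ep p : Num.max (W p * g (P p)) 0 = W p * g ^\+ (P p).
  by rewrite /funrpos maxr_pMr// mulr0.
have en p : Num.max (- (W p * g (P p))) 0 = W p * g ^\- (P p).
  by rewrite /funrneg maxr_pMr// mulr0 mulrN.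
split.
  have -> : (fun p => W p * g (P p)) = (fun p => W p * g ^\+ (P p) - W p * g ^\- (P p)).
    apply/funext => p; rewrite -ep -en; case: (leP 0 (W p * g (P p))) => h.
      by rewrite max_r ?subr0// oppr_le0.
    by rewrite max_l ?sub0r ?opprK// oppr_ge0 ltW.
  exact: measurable_funB.
rewrite [LHS]integralE [RHS]integralE; congr (_ - _)%E.
  transitivity (\int[mu1]_x (g ^\+ x)%:E)%E; first by apply: eq_integral => x _; rewrite funeposE EFin_max.
  by rewrite e1; apply: eq_integral => p _; rewrite funeposE -ep EFin_max.
transitivity (\int[mu1]_x (g ^\- x)%:E)%E; first by apply: eq_integral => x _; rewrite funenegE EFin_max.
by rewrite e2; apply: eq_integral => p _; rewrite funenegE -en EFin_max.
Qed.

End Density.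

(** * Smooth functions on a manifold *)

Section Mfd.
Context {R : realType} {n : nat} (M : riemannian_manifold R n).
Notation ix := (index (charts M)).
Notation e_ := (fun j => delta_mx 0 j).
Implicit Types (i j : ix) (f h : M -> R) (O : set M) (p : 'rV[R]_n).

Definition cimg i O : set 'rV[R]_n := chart i @` (dom i `&` O).

Lemma chartM i : is_chart i. Proof. exact: (mfd_chart (charts_smooth M)). Qed.

Lemma cimgP i O p : cimg i O p <-> img i p /\ O (param i p).
Proof.
split=> [[x [dx Ox] <-]|[[x dx <-] Ox]].
  by rewrite (chartK (chartM i) dx); split => //; exists x.
by exists x => //; split => //; rewrite -(chartK (chartM i) dx).
Qed.

Lemma cimgT i : cimg i setT = img i. Proof. by rewrite /cimg setIT. Qed.

Lemma paramK i p : img i p -> chart i (param i p) = p /\ dom i (param i p).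
Proof. by move=> [x dx <-]; rewrite (chartK (chartM i) dx). Qed.

Lemma cimg_open i O : open O -> open (cimg i O).
Proof.
move=> oO; rewrite openE => p /cimgP[ip Op]; rewrite /interior.
have h1 : nbhs p (img i) by apply: nbhs_of_open => //; exact: (img_open (chartM i)).
have h2 : nbhs p (param i @^-1` O).
  by apply: (param_continuous (chartM i) ip); apply: open_nbhs_nbhs.
by apply: filterS2 h1 h2 => q q1 q2; apply/cimgP.
Qed.

Lemma cimg_chart i O x : dom i x -> O x -> cimg i O (chart i x).
Proof. by move=> dx Ox; exists x. Qed.

Definition smO O f := forall i, Coo e_ (cimg i O) (f \o param i).

Lemma smO_smooth_fun f : smooth_fun (charts M) f <-> smO setT f.
Proof.
by split=> h i; have := h i; rewrite cimgT => /smooth_onE.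
Qed.

Lemma smO_sub O O' f : O' `<=` O -> smO O f -> smO O' f.
Proof.
move=> s h i k; apply: Ck_subset (h i k) => p /cimgP[ip Op].
by apply/cimgP; split => //; exact: s.
Qed.

Lemma smO_cst O (c : R) : smO O (cst c).
Proof. by move=> i k; exact: Ck_cst. Qed.

Lemma smOD O f h : open O -> smO O f -> smO O h -> smO O (fun x => f x + h x).
Proof.
by move=> oO hf hh i k; apply: CkD (hf i k) (hh i k); exact: cimg_open.
Qed.

Lemma smON O f : open O -> smO O f -> smO O (fun x => - f x).
Proof. by move=> oO hf i k; apply: CkN (hf i k); exact: cimg_open. Qed.

Lemma smOB O f h : open O -> smO O f -> smO O h -> smO O (fun x => f x - h x).
Proof. by move=> oO hf hh; apply: smOD => //; exact: smON. Qed.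

Lemma smOM O f h : open O -> smO O f -> smO O h -> smO O (fun x => f x * h x).
Proof.
by move=> oO hf hh i k; apply: CkM (hf i k) (hh i k); exact: cimg_open.
Qed.

Lemma smO_sum O (J : Type) (r : seq J) (P : pred J) (F : J -> M -> R) : open O ->
  (forall a, P a -> smO O (F a)) -> smO O (fun x => \sum_(a <- r | P a) F a x).
Proof.
move=> oO hF i k; apply: (@Ck_sum _ _ _ _ _ _ _ r P (fun a p => F a (param i p))).
  exact: cimg_open.
by move=> a Pa; exact: hF.
Qed.

Lemma smO_comp1 O (J : set R) f (a : R -> R) : open O -> (forall x, O x -> J (f x)) ->
  smO O f -> (forall k, Ck1 k J a) -> smO O (fun x => a (f x)).
Proof.
move=> oO hJ hf ha i k; apply: (Ck_comp1 _ _ (hf i k) (ha k)).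
  exact: cimg_open.
by move=> p /cimgP[_ /hJ].
Qed.

Lemma smO_eq O f h : open O -> {in O, f =1 h} -> smO O f -> smO O h.
Proof.
move=> oO fh hf i k; apply: Ck_eq (hf i k); first exact: cimg_open.
by move=> p /set_mem/cimgP[_ Op]; apply: fh; rewrite inE.
Qed.

Lemma smO_local O f : (forall x, O x -> exists2 O', O' x & smO O' f) -> smO O f.
Proof.
move=> h i k; apply: Ck_local => p /cimgP[ip Op]; case: (h _ Op) => [B Bx hB].
by exists (cimg i B); [apply/cimgP|exact: hB].
Qed.

Lemma transition_Coo i j l :
  Coo e_ (cimg i (dom j)) (fun p => chart j (param i p) 0 l).
Proof.
have h := @mfd_transition _ _ _ _ (charts_smooth M) i j.
exact: (@smooth_on_coord _ _ _ _ _ _ 0 l (@cimg_open i _ (dom_open (chartM j))) h).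
Qed.

(** Transition maps are smooth, so a single chart containing [O] decides for all charts. *)
Lemma smO_of_chart i O f : open O -> O `<=` dom i -> Coo e_ (cimg i O) (f \o param i) ->
  smO O f.
Proof.
move=> oO Od hf j k.
apply: (@Ck_eq _ _ _ _ k _ (fun p => (f \o param i) (chart i (param j p)))).
- exact: cimg_open.
- move=> p /set_mem/cimgP[_ /Od d] /=; by rewrite (chartK (chartM i) d).
apply: (Ck_comp (W := cimg i O) _ _ _ _ (hf k)).
- exact: cimg_open.
- exact: cimg_open.
- move=> p /cimgP[_ Op]; apply: cimg_chart => //; exact: Od.
- move=> l; apply: Ck_subset (@transition_Coo j i l k) => p /cimgP[ip /Od Op].
  exact/cimgP.
Qed.

Lemma chart_coord_smO i l : smO (dom i) (fun x => chart i x 0 l).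
Proof.
apply: (@smO_of_chart i) => //; first exact: (dom_open (chartM i)).
by move=> k; apply: Ck_subset (@transition_Coo i i l k).
Qed.

Lemma smO_continuous O f x : open O -> O x -> smO O f -> {for x, continuous f}.
Proof.
move=> oO Ox hf; have [i dx] := mfd_cover (charts_smooth M) x.
have c1 : {for x, continuous ((f \o param i) \o chart i)}.
  apply: continuous_comp; first exact: (chart_continuous (chartM i) dx).
  by apply: (Ck_cont (hf i 0%N)); apply: cimg_chart.
have nd : nbhs x (dom i) by apply: nbhs_of_open => //; exact: (dom_open (chartM i)).
have e : \near x, ((f \o param i) \o chart i) x = f x.
  by apply: filterS nd => y dy /=; rewrite (chartK (chartM i) dy).
rewrite /prop_for /continuous_at -[f x]/(f x) -{2}(chartK (chartM i) dx).
by apply: cvg_trans c1; exact: near_eq_cvg.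
Qed.

Lemma metric_posdef i p : img i p -> posdef (metric i p).
Proof.
move=> ip; split; first exact: (metric_sym (metricP M) ip).
by move=> v v0; exact: (metric_pos (metricP M) ip v0).
Qed.

Lemma metric_Coo i a b : Coo e_ (img i) (fun p => metric i p a b).
Proof.
apply: smooth_on_coord; first exact: (img_open (chartM i)).
by move=> s x; exact: (metric_smooth (metricP M) (i := i)).
Qed.

Lemma jacobianE m (F : 'rV[R]_m -> 'rV[R]_n) (U : set 'rV[R]_m) (p : 'rV[R]_m) a b : open U -> U p ->
  (forall l, Ck e_ 1 U (fun q => F q 0 l)) -> ('J F p) a b = pd a (fun q => F q 0 b) p.
Proof.
move=> oU Up hF.
have dF : differentiable F p.
  have -> : F = \sum_(l < n) (fun q => F q 0 l *: (delta_mx 0 l : 'rV[R]_n)).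
    by apply/funext => q; rewrite fct_sumE {1}[F q]row_sum_delta.
  apply: differentiable_sum => l; apply: differentiableZl.
  exact: C1_differentiable oU Up (hF l).
have := deriveEjacobian (delta_mx 0 a) dF; rewrite -rowE => /rowP/(_ b).
rewrite !mxE => <-; rewrite derive_mx ?mxE ?pdE//; exact: diff_derivable.
Qed.

Lemma grad_pullback m (F : 'rV[R]_m -> 'rV[R]_n) (U : set 'rV[R]_m) (W : set 'rV[R]_n)
    (u : 'rV[R]_n -> R) (p : 'rV[R]_m) : open U -> U p -> open W -> W (F p) ->
  (forall l, Ck e_ 1 U (fun q => F q 0 l)) -> Ck e_ 1 W u ->
  grad (fun q => u (F q)) p = grad u (F p) *m ('J F p)^T.
Proof.
move=> oU Up oW WF hF hu; apply/rowP => k; rewrite !mxE.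
rewrite (pd_val (is_derive_comp (fun l => Ck_der k (hF l) Up) (C1_differentiable oW WF hu))).
apply: eq_bigr => l _; rewrite [grad _ _ _ _]mxE [_^T _ _]mxE (jacobianE _ _ oU Up hF).
by rewrite !pdE.
Qed.

(** A chosen chart around each point. The choice has no regularity in [x], so [Gam] and [Lap] become
    usable only once independence of the chart is known. *)
Definition cidx (x : M) : ix := projT1 (cid (mfd_cover (charts_smooth M) x)).

Lemma cidxP x : dom (cidx x) x.
Proof. exact: projT2 (cid (mfd_cover (charts_smooth M) x)). Qed.

(* The squared gradient form <grad f, grad h>, and the Laplacian, read in some
   chart at each point. *)
Definition Gam_in i f h x : R :=
  gam (metric i) (f \o param i) (h \o param i) (chart i x).

Definition Gam f h x := Gam_in (cidx x) f h x.

Definition Lap_in i f x : R := laplace_beltrami (metric i) (f \o param i) (chart i x).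

Definition Lap f x := Lap_in (cidx x) f x.

(** Gradients transform by the Jacobian of the transition map and the metric by its tensor law,
    which is the situation of [gdot_transfer]. *)
Lemma Gam_in_indep i j O f h x : open O -> O x -> smO O f -> smO O h ->
  dom i x -> dom j x -> Gam_in i f h x = Gam_in j f h x.
Proof.
move=> oO Ox hf hh di dj.
have oD : open (dom j `&` O) by apply: openI => //; exact: (dom_open (chartM j)).
have oU := @cimg_open i _ oD; set U := cimg i _ in oU.
have oW := @cimg_open j _ oO; set W := cimg j _ in oW.
pose F := chart j \o param i.
have Up : U (chart i x) by apply: cimg_chart.
have UW q : U q -> W (F q).
  by move=> /cimgP[_ [d o]]; apply: cimg_chart.
have hF l : Ck e_ 1 U (fun q => F q 0 l).
  by apply: Ck_subset (@transition_Coo i j l 1) => q /cimgP[iq [d _]]; apply/cimgP.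
have tr u : smO O u -> grad (u \o param i) (chart i x) =
    grad (u \o param j) (F (chart i x)) *m ('J F (chart i x))^T.
  move=> hu; rewrite -(grad_pullback oU Up oW (UW _ Up) hF (hu j 1%N)).
  apply/rowP => k; rewrite !mxE; apply: (pd_eq k oU Up) => q /set_mem/cimgP[iq [d _]].
  by rewrite /F /= (chartK (chartM j)).
have mt : metric i (chart i x) = 'J F (chart i x) *m metric j (F (chart i x)) *m ('J F (chart i x))^T.
  by apply: (metric_tensor (metricP M)); exists x.
have Fx : F (chart i x) = chart j x by rewrite /F /= (chartK (chartM i)).
have ui : metric i (chart i x) \in unitmx by apply/posdef_unit/metric_posdef; exists x.
rewrite /Gam_in /gam !tr// mt gdot_transfer ?Fx//.
by rewrite -Fx -mt.
Qed.

Lemma GamE i O f h x : open O -> O x -> smO O f -> smO O h -> dom i x ->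
  Gam f h x = Gam_in i f h x.
Proof. by move=> oO Ox hf hh di; apply: (Gam_in_indep oO) => //; exact: cidxP. Qed.

Lemma smO_Gam O f h : open O -> smO O f -> smO O h -> smO O (Gam f h).
Proof.
move=> oO hf hh i k.
have hg := @Ck_gam R n (cimg i O) (metric i) (@cimg_open i _ oO) _ _ k _ _ (hf i k.+1) (hh i k.+1).
apply: Ck_eq (hg _ _); first exact: cimg_open.
- move=> p /set_mem/cimgP[ip Op] /=; have [c d] := paramK ip.
  by rewrite (GamE oO Op hf hh d) /Gam_in c.
- move=> l a b; apply: (Ck_subset _ (@metric_Coo i a b l)) => p /cimgP[]//.
- by move=> p /cimgP[ip _]; exact: metric_posdef.
Qed.

Lemma Lap_in_smooth i O f : open O -> O `<=` dom i -> smO O f -> smO O (Lap_in i f).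
Proof.
move=> oO Od hf; apply: (smO_of_chart (i := i)) => // k.
have hl := @Ck_lap R n (cimg i O) (metric i) (@cimg_open i _ oO) _ _ k _ (hf i k.+2).
apply: Ck_eq (hl _ _); first exact: cimg_open.
- by move=> p /set_mem/cimgP[ip Op] /=; rewrite /Lap_in (paramK ip).1.
- move=> l a b; apply: (Ck_subset _ (@metric_Coo i a b l)) => p /cimgP[]//.
- by move=> p /cimgP[ip _]; exact: metric_posdef.
Qed.

End Mfd.

(** Otherwise the sets [A] for which [P] holds on [K] minus [A] form a proper filter containing [K].
    Near a cluster point in [K] some neighbourhood [U] satisfies [P], so its complement belongs to
    the filter, although it misses [U]. *)
Lemma compact_ind (T : topologicalType) (K : set T) (P : set T -> Prop) :
  compact K -> P set0 -> (forall A B, P A -> P B -> P (A `|` B)) ->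
  (forall A B, A `<=` B -> P B -> P A) ->
  (forall x, K x -> exists2 U, nbhs x U & P U) -> P K.
Proof.
move=> cK P0 PU Ps hK; apply: contrapT => nPK.
pose F : set_system T := [set A | P (K `\` A)].
have FF : ProperFilter F.
  split; first by rewrite /F /= setD0.
  split; first by rewrite /F /= setDT.
    by move=> A B PA PB; rewrite /F /= setDIr; exact: PU.
  by move=> A B AB; apply: Ps => x [Kx nB]; split => // /AB.
have [|x [Kx cx]] := cK F FF; first by rewrite /F /= setDv.
have [U nU PU'] := hK x Kx.
have [|y [nUy Uy]] := cx (~` U) U _ nU; last exact: nUy.
by rewrite /F /= setDE setCK; apply: Ps PU' => y [].
Qed.

(** * Compact supports and bump functions *)

Section Support.
Context {R : realType} {n : nat} (M : riemannian_manifold R n).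
Notation ix := (index (charts M)).
Notation e_ := (fun j => delta_mx 0 j).
Implicit Types (i j : ix) (f h : M -> R) (O : set M) (p : 'rV[R]_n).

Definition supp_in (K : set M) f := forall x, ~ K x -> f x = 0.

Definition cs f := exists2 K : set M, compact K & supp_in K f.

Lemma compact_closedM (K : set M) : compact K -> closed K.
Proof. by apply: compact_closed; exact: (mfd_hausdorff (charts_smooth M)). Qed.

Definition ext O f : M -> R := fun x => if pselect (O x) then f x else 0.

Lemma extE O f x : O x -> ext O f x = f x.
Proof. by rewrite /ext; case: pselect. Qed.

Lemma ext_out O f x : ~ O x -> ext O f x = 0.
Proof. by rewrite /ext; case: pselect. Qed.

(** [O] and the complement of [K], which is closed by the Hausdorff property, cover the manifold;
    the extension is smooth on each. *)
Lemma ext_smooth O (K : set M) f : open O -> compact K -> K `<=` O ->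
  (forall x, O x -> ~ K x -> f x = 0) -> smO O f ->
  smO setT (ext O f) /\ supp_in K (ext O f).
Proof.
move=> oO cK KO f0 hf.
have s0 : supp_in K (ext O f).
  by move=> x nK; rewrite /ext; case: pselect => // Ox; exact: f0.
split => //; apply: smO_local => x _.
have [Kx|nKx] := pselect (K x).
  exists O; first exact: KO.
  by apply: smO_eq hf => // y /set_mem Oy; rewrite extE.
exists (~` K) => //; apply: (smO_eq (f := cst 0)).
- by apply: closed_openC; exact: compact_closedM.
- by move=> y /set_mem /s0 ->.
- exact: smO_cst.
Qed.

Lemma param_compact i (A : set 'rV[R]_n) : compact A -> A `<=` img i ->
  compact (param i @` A) /\ param i @` A `<=` dom i.
Proof.
move=> cA Ai; split; last by move=> _ [p /Ai/paramK[_ d] <-].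
apply: continuous_compact => //; apply: continuous_in_subspaceT => p /set_mem/Ai ip.
exact: (param_continuous (chartM i) ip).
Qed.

Definition cball (p : 'rV[R]_n) (r : R) : set 'rV[R]_n := [set q | `|q - p| <= r].

Lemma cball_compact p r : compact (cball p r).
Proof.
apply: bounded_closed_compact.
  exists (`|p| + `|r|); split => // A hA q hq /=; apply: ltW.
  apply: le_lt_trans hA; rewrite -[q](subrK p) addrC (le_trans (ler_normD _ _))//.
  by rewrite lerD2l (le_trans hq)// ler_norm.
rewrite (_ : cball p r = (fun q => `|q - p|) @^-1` [set t : R | t <= r])//.
apply: closed_comp => [q _|]; last exact: closed_le.
apply: continuous_comp; last exact: norm_continuous.
by apply: continuousB; [exact: cvg_id|exact: cst_continuous].
Qed.

Lemma cball_in (U : set 'rV[R]_n) p : open U -> U p ->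
  exists2 r : R, 0 < r & cball p r `<=` U.
Proof.
move=> oU Up; have /nbhs_ballP[r /= r0 hr] : nbhs p U by exact: open_nbhs_nbhs.
exists (r / 2); first by rewrite divr_gt0.
move=> q; rewrite /cball /= => hq; apply: hr; rewrite -ball_normE /ball_ /= distrC.
by rewrite (le_lt_trans hq)// ltr_pdivrMr// ltr_pMr// ltr1n.
Qed.

(** The norm of row vectors is the sup norm, which is not smooth; the Euclidean square is smooth and
    dominates it. *)
Definition sqd i (p : 'rV[R]_n) (x : M) : R := \sum_l (chart i x 0 l - p 0 l) ^+ 2.

Lemma sqd_smooth i p : smO (dom i) (sqd i p).
Proof.
have oD := dom_open (chartM i).
apply: smO_sum => // l _.
have h : smO (dom i) (fun x => chart i x 0 l - p 0 l).
  by apply: smOB => //; [exact: chart_coord_smO|exact: smO_cst].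
by under eq_fun do rewrite expr2; exact: smOM.
Qed.

Lemma sqd_norm i p x (r : R) : 0 <= r -> sqd i p x <= r ^+ 2 -> cball p r (chart i x).
Proof.
move=> r0 h; apply: row_normP => // l; rewrite !mxE.
rewrite -(@ler_pXn2r _ 2) ?nnegrE// real_normK ?num_real//.
apply: le_trans h; rewrite /sqd (bigD1 l)//= lerDl.
by apply: sumr_ge0 => k _; exact: sqr_ge0.
Qed.

(* Functions of the coordinate distance to p, cut off inside the chart. *)
Lemma radial_ext i p (r : R) (a : R -> R) : 0 < r -> cball p r `<=` img i ->
  (forall k, Ck1 k setT a) -> (forall t, r ^+ 2 <= t -> a t = 0) ->
  let f := ext (dom i) (fun x => a (sqd i p x)) in
  smO setT f /\ supp_in (param i @` cball p r) f.
Proof.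
move=> r0 pr ha a0 f.
have [cK Kd] := param_compact (@cball_compact p r) pr.
apply: ext_smooth => //; first exact: (dom_open (chartM i)).
  move=> x dx nK; apply: a0; rewrite leNgt; apply/negP => /ltW/(sqd_norm (ltW r0)) h.
  by apply: nK; exists (chart i x) => //; rewrite (chartK (chartM i)).
apply: (smO_comp1 (J := setT)) => //; first exact: (dom_open (chartM i)).
exact: sqd_smooth.
Qed.

Lemma bump_exists O x : open O -> O x ->
  exists (K : set M) f, [/\ compact K, K `<=` O, smO setT f, supp_in K f &
    [/\ forall y, 0 <= f y, f x = flat 1 & 0 < f x] ].
Proof.
move=> oO Ox; pose i := cidx x; have di : dom i x := cidxP x.
have Up : cimg i O (chart i x) by apply: cimg_chart.
have [r r0 hr] := cball_in (cimg_open oO) Up.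
have hri : cball (chart i x) r `<=` img i by move=> q /hr/cimgP[].
pose a t := flat (1 - t / r ^+ 2).
have ha k : Ck1 k setT a.
  apply: (@Ck_comp1 R R unit (fun=> 1) k setT setT (fun t => 1 - t / r ^+ 2) flat) => //.
  - exact: openT.
  - apply: CkB; [exact: openT|exact: Ck_cst|].
    by apply: CkM; [exact: openT|apply: Ck1_id; exact: openT|exact: Ck_cst].
  - apply: Ck1_flat; exact: openT.
have a0 t : r ^+ 2 <= t -> a t = 0.
  by move=> h; rewrite /a flat_le0// subr_le0 ler_pdivlMr ?exprn_gt0// mul1r.
have [sf s0] := radial_ext r0 hri ha a0.
have [cK Kd] := param_compact (@cball_compact (chart i x) r) hri.
exists (param i @` cball (chart i x) r), (ext (dom i) (fun y => a (sqd i (chart i x) y))).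
have ex : ext (dom i) (fun y => a (sqd i (chart i x) y)) x = flat 1.
  rewrite extE// /a /sqd big1 ?mul0r ?subr0// => l _.
  by rewrite subrr expr0n.
split => //; first by move=> _ [q /hr/cimgP[iq Oq] <-].
split => //; last by rewrite ex flat_gt0.
by move=> y; rewrite /ext; case: pselect => dy //=; exact: flat_ge0.
Qed.

End Support.

(** * Integration in charts and Green's identity in one chart *)

Section Integration.
Context {R : realType} {n : nat} (M : riemannian_manifold R n)
  (mu : {measure set (borel M) -> \bar R}) (hmu : riemannian_measure mu).
Notation ix := (index (charts M)).
Notation e_ := (fun j => delta_mx 0 j).
Implicit Types (i j : ix) (f h : M -> R) (O : set M) (p : 'rV[R]_n).

Definition leb : {measure set (borel 'rV[R]_n) -> \bar R} := projT1 (cid (leb_exists R n)).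
Lemma lebP : is_leb leb. Proof. exact: projT2 (cid (leb_exists R n)). Qed.

(** Zero off the image of the chart, where the values of [metric i] are arbitrary. *)
Definition dens i p : R := if pselect (img i p) then vol_density (metric i) p else 0.

Lemma dens_ge0 i p : 0 <= dens i p.
Proof. by rewrite /dens; case: pselect => ip //=; exact: sqrtr_ge0. Qed.

Lemma vol_Coo i : Coo e_ (img i) (vol_density (metric i)).
Proof.
move=> k; apply: Ck_vol.
- exact: (img_open (chartM i)).
- by move=> l a b; exact: metric_Coo.
- by move=> p; exact: metric_posdef.
Qed.

Lemma measurable_open_ext (T : ptopologicalType) (U B : set T) (g : T -> R) :
  open U -> measurable (B : set (borel T)) -> B `<=` U ->
  (forall x, U x -> {for x, continuous g}) ->
  measurable_fun [set: borel T] (fun x : borel T => if pselect (B x) then g x else 0).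
Proof.
move=> oU mB BU cg.
have mU : measurable (U : set (borel T)) by exact: open_borel.
have mg : measurable_fun (U : set (borel T)) (g : borel T -> R).
  apply: (measurability _ (RGenOpens.measurableE R)).
  move=> _ [_ [a [b ->] <-]]; apply: open_borel.
  rewrite openE => x [Ux gx]; apply: filterI; first exact: open_nbhs_nbhs.
  by apply: (cg x Ux); apply: nbhs_of_open => //; exact: interval_open.
have mgB : measurable_fun (B : set (borel T)) (g : borel T -> R).
  exact: measurable_funS mU BU mg.
have /(measurable_restrictT _ mB) := mgB.
apply: eq_measurable_fun => x _; rewrite patchE; case: pselect => /= Bx.
  by rewrite mem_set.
by rewrite memNset.
Qed.

Lemma cimg_measurable i (B : set M) : measurable (B : set (borel M)) -> B `<=` dom i ->
  measurable (cimg i B : set (borel 'rV[R]_n)).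
Proof.
move=> mB Bd.
have mI : measurable (img i : set (borel 'rV[R]_n)).
  by apply: open_borel; exact: (img_open (chartM i)).
have mp : measurable_fun (img i : set (borel 'rV[R]_n)) (param i : borel 'rV[R]_n -> borel M).
  have e : @measurable _ (borel M) = <<s @open M >> by [].
  apply: (measurability _ e) => _ [A oA <-]; apply: open_borel.
  rewrite openE => x [Ux gx]; apply: filterI.
    by apply: nbhs_of_open => //; exact: (img_open (chartM i)).
  by apply: (param_continuous (chartM i) Ux); apply: open_nbhs_nbhs.
have -> : cimg i B = img i `&` param i @^-1` B.
  by apply/seteqP; split => p /cimgP.
exact: mp.
Qed.

Lemma chart_density i :
  (forall B : set (borel M), measurable B -> B `<=` dom i ->
    measurable_fun [set: borel 'rV[R]_n] (fun p => dens i p * \1_B (param i p))) /\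
  (forall B : set (borel M), measurable B -> B `<=` dom i ->
    mu B = (\int[leb]_p (dens i p * \1_B (param i p))%:E)%E).
Proof.
have key (B : set (borel M)) : measurable B -> B `<=` dom i ->
   (fun p => dens i p * \1_B (param i p)) =
   (fun p => if pselect (cimg i B p) then vol_density (metric i) p else 0) /\
   (fun p => dens i p * \1_B (param i p)) =
   (fun p => vol_density (metric i) p * \1_((chart i : M -> _) @` B) p).
  move=> mB Bd.
  have e : (chart i : M -> _) @` B = cimg i B.
    by rewrite /cimg; congr (_ @` _); apply/seteqP; split => [x Bx|x []//]; split => //; exact: Bd.
  split; apply/funext => p; rewrite /dens !indicE ?e; case: pselect => /= [ip|nip].
  - case: pselect => /= [/cimgP[_ Bp]|nB]; first by rewrite mem_set// mulr1.
    by rewrite memNset ?mulr0// => Bp; apply: nB; apply/cimgP.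
  - by case: pselect => /= [/cimgP[]//|_]; rewrite mul0r.
  - have [Bp|nBp] := pselect (B (param i p)).
      by rewrite !mem_set//; apply/cimgP.
    by rewrite !memNset// => /cimgP[].
  - by rewrite mul0r memNset ?mulr0// => /cimgP[].
have mk B (mB : measurable (B : set (borel M))) (Bd : B `<=` dom i) :
    measurable_fun [set: borel 'rV[R]_n] (fun p => dens i p * \1_B (param i p)).
  rewrite (key B mB Bd).1; apply: (@measurable_open_ext _ (img i)).
  - exact: (img_open (chartM i)).
  - exact: cimg_measurable.
  - by move=> p /cimgP[].
  - by move=> p ip; exact: (Ck_cont (@vol_Coo i 0%N)).
split => // B mB Bd; rewrite (hmu mB Bd) (leb_int lebP).
- by congr int_rV; apply/funext => p; rewrite -(congr1 (fun g => g p) (key B mB Bd).2).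
- by have h := mk B mB Bd; exact/measurable_EFinP.
- by move=> p; rewrite lee_fin mulr_ge0// dens_ge0.
Qed.

Lemma chart_integral i (g : M -> R) : measurable_fun [set: borel M] (g : borel M -> R) ->
  (forall x, ~ dom i x -> g x = 0) ->
  (\int[mu]_x (g x)%:E = \int[leb]_p (dens i p * g (param i p))%:E)%E.
Proof.
move=> mg g0; have [h1 h2] := chart_density i.
by have [_] := @density_integral R _ _ (borel M) (borel 'rV[R]_n) mu leb (dom i)
  (param i) (dens i) (@dens_ge0 i) h1 h2 g mg g0.
Qed.

Lemma leb_sum (F : 'I_n -> 'rV[R]_n -> R) :
  (forall k, leb.-integrable setT (EFin \o F k)) ->
  (\int[leb]_p (\sum_k F k p)%:E = \sum_k \int[leb]_p (F k p)%:E)%E.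
Proof.
move=> hF; under eq_integral do rewrite -sumEFin.
by rewrite integral_sum// => k; exact: hF.
Qed.

Lemma derive_zero_near k (F : 'rV[R]_n -> R) p (U : set 'rV[R]_n) : open U -> U p ->
  {in U, F =1 cst 0} -> pd k F p = 0.
Proof.
by move=> oU Up F0; rewrite (pd_eq k oU Up F0) pdE derive_cst.
Qed.

Lemma Lap_in_cs i f : smO (dom i) f -> smO (dom i) (Lap_in i f).
Proof. by move=> hf; apply: Lap_in_smooth => //; exact: (dom_open (chartM i)). Qed.

Lemma Gam_in_smooth i f h : smO (dom i) f -> smO (dom i) h -> smO (dom i) (Gam_in i f h).
Proof.
move=> hf hh; have oD := dom_open (chartM i).
by apply: smO_eq (smO_Gam oD hf hh) => // x /set_mem dx; exact: (GamE oD).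
Qed.

Lemma Gam_in_out i f h (K : set M) x : closed K -> supp_in K f -> dom i x -> ~ K x ->
  Gam_in i f h x = 0.
Proof.
move=> cK f0 dx nK; rewrite /Gam_in gamE big1// => k _.
rewrite (@derive_zero_near k _ _ (cimg i (~` K))) ?mul0r//.
- by apply: cimg_open; exact: closed_openC.
- exact: cimg_chart.
- by move=> q /set_mem/cimgP[_ nKq] /=; exact: f0.
Qed.

(** Times the density, the integrand is the divergence of [z] times the [flux] of [f], which has
    compact support in the chart, so that each component integrates to 0. The Laplacian is that of
    the chart [i], since its independence of the chart is deduced from this very identity. *)
Lemma chart_green i z f (K : set M) : compact K -> K `<=` dom i -> supp_in K z ->
  smO setT z -> smO (dom i) f ->
  (\int[mu]_x (ext (dom i) (fun x => z x * Lap_in i f x + Gam_in i z f x) x)%:E = 0)%E.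
Proof.
move=> cK Kd z0 hz hf.
have oD := dom_open (chartM i); have oI := img_open (chartM i).
have cKc : closed K by exact: compact_closedM.
have hzd : smO (dom i) z by apply: smO_sub hz.
have hs : smO (dom i) (fun x => z x * Lap_in i f x + Gam_in i z f x).
  by apply: smOD => //; [apply: smOM => //; exact: Lap_in_cs|exact: Gam_in_smooth].
have hs0 x : dom i x -> ~ K x -> z x * Lap_in i f x + Gam_in i z f x = 0.
  by move=> dx nK; rewrite z0// mul0r add0r (Gam_in_out f cKc).
have [hL _] := ext_smooth oD cK Kd hs0 hs.
rewrite (chart_integral (i := i)); last 2 first.
- by apply: continuous_borel => x; apply: smO_continuous hL => //; exact: openT.
- by move=> x nx; rewrite ext_out.
pose A := chart i @` K.
have cA : compact A.
  apply: continuous_compact => //; apply: continuous_in_subspaceT => x /set_mem/Kd dx.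
  exact: (chart_continuous (chartM i) dx).
have AI : A `<=` img i by move=> _ [x /Kd dx <-]; exists x.
have clA : closed A by apply: compact_closed => //; exact: norm_hausdorff.
have mA : measurable (A : set (borel 'rV[R]_n)) by exact: closed_borel.
pose zp := z \o param i; pose fl k := flux (metric i) (f \o param i) k.
pose F k p := if pselect (img i p) then zp p * fl k p else 0.
have F0 k : {in ~` A, F k =1 cst 0}.
  move=> p /set_mem nA; rewrite /F; case: pselect => //= ip.
  rewrite [zp p]z0 ?mul0r//= => Kq; apply: nA; exists (param i p) => //.
  exact: (paramK ip).1.
have hfl k l : Ck e_ l (img i) (fl k).
  apply: Ck_flux => //.
  - by move=> l' a b; exact: metric_Coo.
  - by move=> p; exact: metric_posdef.
  - have := hf i l.+1; rewrite (_ : cimg i (dom i) = img i)//.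
    by rewrite /cimg setIid.
have hzp l : Ck e_ l (img i) zp by have := hz i l; rewrite cimgT.
have oA : open (~` A) by exact: closed_openC.
have hF k l : Ck e_ l setT (F k).
  apply: Ck_local => p _; have [ip|nip] := pselect (img i p).
    exists (img i) => //; apply: Ck_eq (CkM oI (hzp l) (hfl k l)) => //.
    by move=> q /set_mem iq; rewrite /F; case: pselect.
  exists (~` A); first by move=> /AI.
  by apply: (Ck_eq oA (f := cst 0)); [move=> q /F0 ->|exact: Ck_cst].
have [B [B0 hB]] : exists B : R, 0 <= B /\ forall p, A p -> `|p| <= B.
  have [B [_ hB]] := compact_bounded cA; exists (`|B| + 1); split.
    by rewrite addr_ge0.
  by move=> p Ap; apply: (hB (`|B| + 1)) => //; rewrite (le_lt_trans (ler_norm _))// ltrDl.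
have c1 k : C1c (F k).
  split; first exact: hF.
  exists B => p hp; apply: F0; rewrite inE => /hB; by rewrite leNgt hp.
have mF k : leb.-integrable setT (EFin \o pd k (F k)).
  have cp : continuous (pd k (F k)) by move=> p; exact: (Ck_cont (Ck_pd k (hF k 1%N))).
  have pd0 p : ~ A p -> pd k (F k) p = 0.
    by move=> nA; apply: (@derive_zero_near _ _ _ (~` A)).
  have pdB p : B < `|p| -> pd k (F k) p = 0.
    by move=> hp; apply: pd0 => /hB; rewrite leNgt hp.
  have [C hC] := compact_support_bounded cp pdB.
  apply: (@bounded_integrable R _ _ leb (pd k (F k)) A C) => //.
  - apply: le_lt_trans (leb_bounded lebP B); apply: le_measure.
    + by rewrite inE.
    + by rewrite inE; exact: closed_norm.
    + by move=> p /hB.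
  - by apply: continuous_borel.
transitivity (\int[leb]_p (\sum_k pd k (F k) p)%:E)%E.
  apply: eq_integral => p _; congr EFin; rewrite /dens; case: pselect => /= [ip|nip].
    have [c d] := paramK ip.
    have v0 : vol_density (metric i) p != 0.
      by rewrite gt_eqF// sqrtr_gt0 posdef_det//; exact: metric_posdef.
    have pE k : pd k (F k) p = zp p * pd k (fl k) p + pd k zp p * fl k p.
      rewrite (pd_eq k (g := fun p => zp p * fl k p) oI ip).
        apply: etrans (pd_val (is_deriveMp (Ck_pdP k (hzp 1%N) ip) (Ck_pdP k (hfl k 1%N) ip))) _.
        exact: addrC.
      by move=> q /set_mem iq; rewrite /F; case: pselect.
    have gf : \sum_k pd k zp p * fl k p =
        vol_density (metric i) p * gam (metric i) zp (f \o param i) p.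
      by apply: (@gam_flux _ _ (img i)).
    rewrite (sum_split2 pE) sum_mulr gf extE// /Lap_in /Gam_in c lapE.
    rewrite mulrDr; congr (_ + _).
    by rewrite mulrCA mulVKf.
  rewrite mul0r big1// => k _; apply: (@derive_zero_near _ _ _ (~` A)) => //.
  by move=> /AI.
rewrite leb_sum// big1// => k _.
have := leb_div lebP k (c1 k); congr (_ = _); apply: eq_integral => p _; by rewrite pdE.
Qed.

End Integration.

Lemma int_scaled_indic d (T : measurableType d) {R : realType}
    (m : {measure set T -> \bar R}) (A : set T) (c : R) : measurable A -> 0 <= c ->
  (\int[m]_x (c * \1_A x)%:E = c%:E * m A)%E.
Proof.
move=> mA c0; under eq_integral do rewrite EFinM.
rewrite ge0_integralZl//; first by rewrite integral_indic// setIT.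
by apply/measurable_EFinP; exact: measurable_indic.
Qed.

(** * Bounded functions with compact support; the intrinsic Laplacian *)

Section Functional.
Context {R : realType} {n : nat} (M : riemannian_manifold R n)
  (mu : {measure set (borel M) -> \bar R}) (hmu : riemannian_measure mu).
Notation ix := (index (charts M)).
Notation e_ := (fun j => delta_mx 0 j).
Implicit Types (i j : ix) (f h g : M -> R) (O : set M) (p : 'rV[R]_n).

Lemma compact_borel (K : set M) : compact K -> measurable (K : set (borel M)).
Proof. by move=> cK; apply: closed_borel; exact: compact_closedM. Qed.

(** Near [x] the density lies between two positive constants, so [mu] is comparable with Lebesgue
    measure on a small coordinate ball. *)
Lemma mu_local O x : open O -> O x ->
  exists B : set M, [/\ nbhs x B, B `<=` O, measurable (B : set (borel M)),
    (0 < mu B)%E & (mu B < +oo)%E].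
Proof.
move=> oO Ox; pose i := cidx x; have di : dom i x := cidxP x.
have ip : img i (chart i x) by exists x.
have Up : cimg i O (chart i x) by apply: cimg_chart.
set p := chart i x in ip Up.
have v0 : 0 < vol_density (metric i) p.
  by rewrite sqrtr_gt0 posdef_det//; exact: metric_posdef.
set v := vol_density (metric i) p in v0.
have cv : {for p, continuous (vol_density (metric i))} := Ck_cont (@vol_Coo R n M i 0%N) ip.
have hn : nbhs p (cimg i O `&` [set q | v / 2 < vol_density (metric i) q < v + 1]).
  apply: filterI; first by apply: nbhs_of_open => //; exact: cimg_open.
  have : nbhs v `]v / 2, v + 1[%classic.
    apply: near_in_itvoo; rewrite in_itv /= ltrDl ltr01 andbT.
    by rewrite ltr_pdivrMr// ltr_pMr// ltr1n.
  move=> hv; apply: (@filterS _ _ _ (vol_density (metric i) @^-1` `]v / 2, v + 1[%classic)); last exact: (cv _ hv).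
  by move=> q /=; rewrite in_itv.
have /nbhs_ballP[r /= r0 hr] := hn.
pose A := cball p (r / 2).
have Ar q : A q -> cimg i O q /\ v / 2 < vol_density (metric i) q < v + 1.
  move=> Aq; apply: hr; rewrite -ball_normE /ball_ /= distrC.
  by rewrite (le_lt_trans Aq)// ltr_pdivrMr// ltr_pMr// ltr1n.
have AI : A `<=` img i by move=> q /Ar[/cimgP[]].
have [cK Kd] := param_compact (@cball_compact _ _ p (r / 2)) AI.
pose B := param i @` A; have mB : measurable (B : set (borel M)) by exact: compact_borel.
have BA q : img i q -> B (param i q) -> A q.
  move=> iq [q' Aq' e]; rewrite -(paramK iq).1 -e (paramK (AI _ Aq')).1//.
have mA : measurable (A : set (borel 'rV[R]_n)).
  by apply: closed_borel; apply: compact_closed; [exact: norm_hausdorff|exact: cball_compact].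
have [h1 h2] := chart_density hmu i.
have iA (c : R) : 0 <= c -> (\int[leb]_q (c * \1_A q)%:E = c%:E * leb A)%E.
  by move=> c0; exact: int_scaled_indic.
have mcA (c : R) : measurable_fun [set: borel 'rV[R]_n] (fun q => (c * \1_A q)%:E).
  by apply/measurable_EFinP; apply: measurable_funM => //; exact: measurable_indic.
have dB q : A q -> dens i q * \1_B (param i q) = vol_density (metric i) q.
  move=> Aq; rewrite /dens; case: pselect => /= iq; last by case: iq; exact: AI.
  by rewrite indicE mem_set ?mulr1//; exists q.
have dB0 q : ~ A q -> dens i q * \1_B (param i q) = 0.
  move=> nA; rewrite /dens; case: pselect => /= iq; last by rewrite mul0r.
  by rewrite indicE memNset ?mulr0// => /(BA _ iq).
exists B; split => //.
- apply: (@filterS _ _ _ (dom i `&` chart i @^-1` ball p (r / 2))).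
    move=> y [dy hy]; exists (chart i y); last by rewrite (chartK (chartM i)).
    by move: hy; rewrite /A /cball /= -ball_normE /ball_ /= distrC => /ltW.
  apply: filterI; first by apply: nbhs_of_open => //; exact: (dom_open (chartM i)).
  by apply: (chart_continuous (chartM i) di); apply: nbhsx_ballx; rewrite divr_gt0.
- by move=> _ [q /Ar[/cimgP[]] _ ? _ <-].
- rewrite h2//; apply: (@lt_le_trans _ _ ((v / 2)%:E * leb A)%E).
    apply: mule_gt0; first by rewrite lte_fin divr_gt0.
    apply: lt_le_trans (leb_ball (lebP) p (divr_gt0 r0 (ltr0n _ 2))) _.
    apply: le_measure; rewrite ?inE//.
      by apply: open_borel; exact: open_norm.
    by move=> q /=; exact: ltW.
  rewrite -(iA (v / 2)); last by rewrite divr_ge0// ltW.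
  apply: ge0_le_integral => //.
  + by move=> q _; rewrite lee_fin mulr_ge0// ltW// divr_gt0.
  + by apply/measurable_EFinP; exact: h1.
  + move=> q _; rewrite lee_fin indicE; have [Aq|nA] := pselect (A q).
      by rewrite mem_set// mulr1 dB//; have [_ /andP[/ltW]] := Ar q Aq.
    by rewrite memNset// mulr0 mulr_ge0// dens_ge0.
- rewrite h2//; apply: (@le_lt_trans _ _ ((v + 1)%:E * leb A)%E).
    rewrite -(iA (v + 1)); last by rewrite addr_ge0// ltW.
    apply: ge0_le_integral => //.
    + by move=> q _; rewrite lee_fin mulr_ge0// dens_ge0.
    + by apply/measurable_EFinP; exact: h1.
    + move=> q _; rewrite lee_fin [\1_A _]indicE; have [Aq|nA] := pselect (A q).
        by rewrite mem_set// mulr1 dB//; have [_ /andP[_ /ltW]] := Ar q Aq.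
      by rewrite memNset// mulr0 dB0.
  have lA : (leb A < +oo)%E.
    apply: le_lt_trans (leb_bounded (lebP) (`|p| + r / 2)); apply: le_measure; rewrite ?inE//.
      exact: closed_norm.
    move=> q /=; rewrite /A /cball /= => hq; rewrite -[q](subrK p) addrC.
    by apply: le_trans (ler_normD _ _) _; rewrite lerD2l.
  by rewrite lte_mul_pinfty// lee_fin addr_ge0// ltW.
Qed.

(** [compact_ind] ranges over arbitrary sets, so the property asks for a measurable superset of
    finite measure. *)
Lemma mu_compact (K : set M) : compact K -> (mu K < +oo)%E.
Proof.
move=> cK; suff [B [mB KB fB]] : exists B, [/\ measurable (B : set (borel M)), K `<=` B & (mu B < +oo)%E].
  by apply: le_lt_trans fB; apply: le_measure; rewrite ?inE//; exact: compact_borel.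
apply: (compact_ind (P := fun A => exists B, [/\ measurable (B : set (borel M)), A `<=` B & (mu B < +oo)%E])) cK _ _ _ _.
- by exists set0; split; [exact: measurable0| |rewrite measure0 ltry].
- move=> A1 A2 [B1 [m1 s1 f1]] [B2 [m2 s2 f2]]; exists (B1 `|` B2); split.
  + exact: measurableU.
  + exact: setUSS.
  + by apply: le_lt_trans (measureU2 _ _ _) _ => //; rewrite lte_add_pinfty.
- by move=> A1 A2 s [B [m1 s1 f1]]; exists B; split => // x /s/s1.
- move=> x Kx; have [B [nB _ mB _ fB]] := mu_local (@openT M) (I : setT x).
  by exists B => //; exists B; split.
Qed.

Definition sm f := smO setT f.

Lemma sm_cont f : sm f -> continuous f.
Proof. by move=> hf x; apply: smO_continuous hf => //; exact: openT. Qed.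

Lemma sm_meas f : sm f -> measurable_fun [set: borel M] (f : borel M -> R).
Proof. by move=> /sm_cont; exact: continuous_borel. Qed.

(** Wide enough for the potential and for indicators, which are not smooth, and closed under the
    operations that occur, so that [II] is linear and monotone without separate integrability
    conditions. *)
Record bcs f : Prop := IsBcs {
  bcs_meas : measurable_fun [set: borel M] (f : borel M -> R) ;
  bcs_bound : exists C : R, forall x, `|f x| <= C ;
  bcs_supp : cs f }.

Definition II f : R := fine (\int[mu]_x (f x)%:E)%E.

Lemma bcs_integrable f : bcs f -> mu.-integrable setT (EFin \o (f : borel M -> R)).
Proof.
move=> [mf [C hC] [K cK K0]].
by apply: (@bounded_integrable R _ _ mu (f : borel M -> R) K C) => //;
  [exact: compact_borel|exact: mu_compact].
Qed.

Lemma csD f h : cs f -> cs h -> cs (fun x => f x + h x).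
Proof.
move=> [K cK f0] [L cL h0]; exists (K `|` L); first exact: compactU.
by move=> x nx; rewrite f0 ?h0 ?addr0// => ?; apply: nx; [right|left].
Qed.

Lemma csM f h : cs f -> cs (fun x => f x * h x).
Proof. by move=> [K cK f0]; exists K => // x /f0 ->; rewrite mul0r. Qed.

Lemma csMr f h : cs f -> cs (fun x => h x * f x).
Proof. by move=> [K cK f0]; exists K => // x /f0 ->; rewrite mulr0. Qed.

Lemma bcsD f h : bcs f -> bcs h -> bcs (fun x => f x + h x).
Proof.
move=> [mf [C hC] sf] [mh [D hD] sh]; split; [exact: measurable_funD| |exact: csD].
by exists (C + D) => x; apply: le_trans (ler_normD _ _) _; exact: lerD.
Qed.

Lemma bcsM f h : measurable_fun [set: borel M] (h : borel M -> R) ->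
  (exists C : R, forall x, `|h x| <= C) -> bcs f -> bcs (fun x => h x * f x).
Proof.
move=> mh [D hD] [mf [C hC] sf]; split; [exact: measurable_funM| |exact: csMr].
by exists (D * C) => x; rewrite normrM ler_pM.
Qed.

Lemma bcsZ c f : bcs f -> bcs (fun x => c * f x).
Proof. by apply: bcsM => //; exists `|c|. Qed.

Lemma bcsN f : bcs f -> bcs (fun x => - f x).
Proof.
move=> hf; have := bcsZ (-1) hf; congr bcs; apply/funext => x; exact: mulN1r.
Qed.

Lemma bcsB f h : bcs f -> bcs h -> bcs (fun x => f x - h x).
Proof. by move=> hf hh; apply: bcsD => //; exact: bcsN. Qed.

Lemma bcs_contM f h : continuous h -> bcs f -> bcs (fun x => h x * f x).
Proof.
move=> ch [mf [C hC] [K cK f0]]; split.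
- by apply: measurable_funM => //; exact: continuous_borel.
- have [D [_ hD]] : bounded_set (h @` K).
    apply: compact_bounded; apply: continuous_compact => //.
    exact: continuous_subspaceT.
  exists ((`|D| + 1) * C) => x; have [Kx|/f0 ->] := pselect (K x).
    rewrite normrM ler_pM//; apply: (hD (`|D| + 1)); last by exists x.
    by rewrite (le_lt_trans (ler_norm _))// ltrDl.
  by rewrite mulr0 normr0 mulr_ge0// ?addr_ge0// (le_trans (normr_ge0 (f x))).
- by apply: csMr; exists K.
Qed.

Lemma bcs_sm f : sm f -> cs f -> bcs f.
Proof.
move=> sf [K cK f0]; have b1 : bcs (\1_K : M -> R).
  split; first by apply: measurable_indic; exact: compact_borel.
  - by exists 1 => x; rewrite indicE; case: (_ \in _); rewrite ?normr1 ?normr0 ?ler01.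
  - by exists K => // x nK; rewrite indicE memNset.
have := bcs_contM (sm_cont sf) b1; congr bcs; apply/funext => x.
by rewrite indicE; have [/mem_set ->|nK] := pselect (K x); [rewrite mulr1|rewrite f0 ?mul0r].
Qed.

Lemma IIE f : bcs f -> (\int[mu]_x (f x)%:E = (II f)%:E)%E.
Proof.
move=> /bcs_integrable hf; rewrite /II fineK//; exact: integrable_fin_num.
Qed.

Lemma IID f h : bcs f -> bcs h -> II (fun x => f x + h x) = II f + II h.
Proof.
move=> hf hh; apply: EFin_inj; rewrite -IIE; last exact: bcsD.
rewrite EFinD -!IIE//; under eq_integral do rewrite EFinD.
by apply: integralD => //; exact: bcs_integrable.
Qed.

Lemma IIZ c f : bcs f -> II (fun x => c * f x) = c * II f.
Proof.
move=> hf; apply: EFin_inj; rewrite -IIE; last exact: bcsZ.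
rewrite EFinM -!IIE//; under eq_integral do rewrite EFinM.
by apply: integralZl => //; exact: bcs_integrable.
Qed.

Lemma IIN f : bcs f -> II (fun x => - f x) = - II f.
Proof.
move=> hf; rewrite -mulN1r -IIZ//; congr II; apply/funext => x; by rewrite mulN1r.
Qed.

Lemma IIB f h : bcs f -> bcs h -> II (fun x => f x - h x) = II f - II h.
Proof. by move=> hf hh; rewrite IID ?IIN//; exact: bcsN. Qed.

Lemma II_ge0 f : (forall x, 0 <= f x) -> 0 <= II f.
Proof. by move=> f0; apply: fine_ge0; apply: integral_ge0 => x _; rewrite lee_fin. Qed.

Lemma II_le f h : bcs f -> bcs h -> (forall x, f x <= h x) -> II f <= II h.
Proof.
move=> hf hh fh; rewrite -subr_ge0 -IIB//; apply: II_ge0 => x.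
by rewrite subr_ge0.
Qed.

Lemma II_gt0 f x : continuous f -> bcs f -> (forall y, 0 <= f y) -> 0 < f x -> 0 < II f.
Proof.
move=> cf hf f0 fx0; pose O := [set y | f x / 2 < f y].
have oO : open O.
  rewrite (_ : O = f @^-1` [set t : R | f x / 2 < t])//.
  by apply: open_comp => [y _|]; [exact: cf|exact: open_gt].
have Ox : O x by rewrite /O /= ltr_pdivrMr// ltr_pMr// ltr1n.
have [B [nB BO mB B0 Bf]] := mu_local oO Ox.
have e : (\int[mu]_y (f x / 2 * \1_B y)%:E = (f x / 2)%:E * mu B)%E.
  by apply: int_scaled_indic => //; rewrite divr_ge0// ltW.
rewrite -lte_fin -IIE//; apply: (@lt_le_trans _ _ ((f x / 2)%:E * mu B)%E).
  by apply: mule_gt0; rewrite ?lte_fin ?divr_gt0.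
rewrite -e; apply: ge0_le_integral => //.
- by move=> y _; rewrite lee_fin mulr_ge0// divr_ge0// ltW.
- by apply/measurable_EFinP; apply: measurable_funM => //; exact: measurable_indic.
- by apply/measurable_EFinP; exact: bcs_meas.
- move=> y _; rewrite lee_fin indicE; have [By|nB'] := pselect (B y).
    by rewrite mem_set// mulr1; apply: ltW; exact: BO.
  by rewrite memNset// mulr0.
Qed.

Lemma smE f h : (forall x, f x = h x) -> sm f -> sm h.
Proof. by move=> /funext ->. Qed.
Lemma smD f h : sm f -> sm h -> sm (fun x => f x + h x).
Proof. by apply: smOD; exact: openT. Qed.
Lemma smB f h : sm f -> sm h -> sm (fun x => f x - h x).
Proof. by apply: smOB; exact: openT. Qed.
Lemma smN f : sm f -> sm (fun x => - f x).
Proof. by apply: smON; exact: openT. Qed.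
Lemma smM f h : sm f -> sm h -> sm (fun x => f x * h x).
Proof. by apply: smOM; exact: openT. Qed.
Lemma sm_cst (c : R) : sm (fun=> c).
Proof. exact: smO_cst. Qed.
Lemma smX f k : sm f -> sm (fun x => f x ^+ k).
Proof.
move=> hf; elim: k => [|k IH]; first by apply: smE (sm_cst 1) => x; rewrite expr0.
by apply: (@smE (fun x => f x * f x ^+ k)); [move=> x; rewrite exprS|exact: smM].
Qed.
Lemma sm_comp1 (J : set R) f (a : R -> R) : (forall x, J (f x)) -> sm f ->
  (forall k, Ck1 k J a) -> sm (fun x => a (f x)).
Proof. by move=> hJ; apply: smO_comp1 => //; exact: openT. Qed.

(** If two charts gave different values at [y], a bump [z] supported where the difference has a sign
    would detect it: Green's identity holds in both charts and the gradient terms agree, so the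
    integral of [z] times the difference is 0. *)
Lemma Lap_in_indep i j f x : sm f -> dom i x -> dom j x -> Lap_in i f x = Lap_in j f x.
Proof.
move=> sf.
suff key i' j' y : dom i' y -> dom j' y -> ~ 0 < Lap_in i' f y - Lap_in j' f y.
  move=> di dj; apply/eqP; rewrite eq_le; apply/andP; split; rewrite leNgt; apply/negP => h.
    by apply: (key _ _ _ di dj); rewrite subr_gt0.
  by apply: (key _ _ _ dj di); rewrite subr_gt0.
move=> {i j x} di dj; set i := i' in di *; set j := j' in dj *; move=> d0.
have oi := dom_open (chartM i); have oj := dom_open (chartM j).
have si : smO (dom i) f by apply: smO_sub sf.
have sj : smO (dom j) f by apply: smO_sub sf.
pose O := dom i `&` dom j; have oO : open O by exact: openI.
pose dd x := Lap_in i f x - Lap_in j f x.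
have hd : smO O dd.
  apply: smOB => //; first by apply: smO_sub (Lap_in_cs si) => x [].
  by apply: smO_sub (Lap_in_cs sj) => x [].
pose O1 := O `&` [set x | 0 < ext O dd x].
have oO1 : open O1.
  rewrite openE => x [Ox hx]; apply: filterI; first exact: open_nbhs_nbhs.
  have cx : {for x, continuous (ext O dd)}.
    apply: (smO_continuous oO Ox); apply: smO_eq hd => //.
    by move=> z /set_mem Oz; rewrite extE.
  by apply: (cx [set t : R | 0 < t]); apply: nbhs_of_open => //; exact: open_gt.
have O1y : O1 y by split => //=; rewrite extE.
have [K [z [cK KO sz z0 [zp _ zy]]]] := bump_exists oO1 O1y.
have Ki : K `<=` dom i by move=> x /KO[[]].
have Kj : K `<=` dom j by move=> x /KO[[]].
have loc l (ol : open (dom l)) (sl : smO (dom l) f) (Kl : K `<=` dom l) :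
    sm (ext (dom l) (fun x => z x * Lap_in l f x + Gam_in l z f x)) /\
    supp_in K (ext (dom l) (fun x => z x * Lap_in l f x + Gam_in l z f x)).
  have zl : smO (dom l) z by apply: smO_sub sz.
  apply: (ext_smooth ol cK Kl).
    move=> x dx nK; rewrite z0// mul0r add0r; apply: Gam_in_out dx nK => //.
    exact: compact_closedM.
  by apply: smOD => //; [apply: smOM => //; exact: Lap_in_cs|exact: Gam_in_smooth].
have [Si Si0] := loc i oi si Ki; have [Sj Sj0] := loc j oj sj Kj.
have Gi := chart_green hmu cK Ki z0 sz si; have Gj := chart_green hmu cK Kj z0 sz sj.
have bi := bcs_sm Si (ex_intro2 _ _ K cK Si0).
have bj := bcs_sm Sj (ex_intro2 _ _ K cK Sj0).
have e x : O x -> ext (dom i) (fun x => z x * Lap_in i f x + Gam_in i z f x) x -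
   ext (dom j) (fun x => z x * Lap_in j f x + Gam_in j z f x) x = z x * dd x.
  move=> [dx ex]; rewrite !extE//.
  rewrite (Gam_in_indep (j := j) (@openT M) _ sz sf dx ex)// /dd.
  by move: (Lap_in i f x) (Lap_in j f x) (Gam_in j z f x) (z x) => a b c e'; ring.
have : 0 < II (fun x => ext (dom i) (fun x => z x * Lap_in i f x + Gam_in i z f x) x -
   ext (dom j) (fun x => z x * Lap_in j f x + Gam_in j z f x) x).
  apply: (@II_gt0 _ y).
  - by apply: sm_cont; exact: smB.
  - exact: bcsB.
  - move=> x; have [Kx|nK] := pselect (K x); last by rewrite Si0// Sj0// subrr.
    have [Ox hx] := KO _ Kx; rewrite (e x Ox); apply: mulr_ge0; first exact: zp.
    by rewrite -(extE dd Ox); exact: ltW hx.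
  - by rewrite (e y O1y.1) mulr_gt0.
by rewrite IIB// /II Gi Gj subrr ltxx.
Qed.

Lemma LapE i f x : sm f -> dom i x -> Lap f x = Lap_in i f x.
Proof. by move=> sf dx; apply: Lap_in_indep => //; exact: cidxP. Qed.

Lemma sm_Lap f : sm f -> sm (Lap f).
Proof.
move=> sf; apply: smO_local => x _; exists (dom (cidx x)); first exact: cidxP.
have o := dom_open (chartM (cidx x)).
apply: (smO_eq o (f := Lap_in (cidx x) f)).
  by move=> y /set_mem dy; rewrite (LapE sf dy).
by apply: Lap_in_cs; apply: smO_sub sf.
Qed.

Lemma sm_Gam f h : sm f -> sm h -> sm (Gam f h).
Proof. by apply: smO_Gam; exact: openT. Qed.

Lemma GamE' i f h x : sm f -> sm h -> dom i x -> Gam f h x = Gam_in i f h x.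
Proof. by move=> sf sh; apply: (GamE (@openT M)). Qed.

Lemma laplacianE f v : sm f -> is_laplacian f v -> forall x, v x = Lap f x.
Proof. by move=> sf hv x; apply: hv; exact: cidxP. Qed.

Lemma cs_Gam f h : cs f -> cs (Gam f h).
Proof.
move=> [K cK f0]; exists K => // x nK; apply: Gam_in_out (cidxP x) nK => //.
exact: compact_closedM.
Qed.

End Functional.

Section ChartLinear.
Context {R : realType} {n : nat} (U : set 'rV[R]_n) (G : 'rV[R]_n -> 'M[R]_n).
Notation e_ j := (delta_mx 0 j).
Notation C k f := (Ck (fun j => e_ j) k U f).
Hypotheses (oU : open U) (sG : forall k i j, C k (fun p => G p i j))
  (pG : forall p, U p -> posdef (G p)).
Implicit Types (f h : 'rV[R]_n -> R).

Lemma pdD k f h p : U p -> C 1 f -> C 1 h ->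
  pd k (fun p => f p + h p) p = pd k f p + pd k h p.
Proof.
by move=> Up hf hh; exact: (pd_val (is_deriveDp (Ck_pdP k hf Up) (Ck_pdP k hh Up))).
Qed.

Lemma gradD f h p : U p -> C 1 f -> C 1 h ->
  grad (fun p => f p + h p) p = grad f p + grad h p.
Proof. by move=> Up hf hh; apply/rowP => k; rewrite !mxE pdD. Qed.

Lemma pd_cst (k : 'I_n) (c : R) (p : 'rV[R]_n) : pd k (fun=> c) p = 0.
Proof. by rewrite pdE derive_cst. Qed.

Lemma grad_cst (c : R) p : grad (fun=> c) p = (0 : 'rV[R]_n).
Proof. by apply/rowP => k; rewrite !mxE pd_cst. Qed.

Lemma lap_cst (c : R) p : laplace_beltrami G (fun=> c) p = 0.
Proof.
have fl k : flux G (fun=> c) k = (fun=> 0).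
  apply/funext => q; rewrite fluxE grad_cst big1 ?mulr0// => l _.
  by rewrite mxE mulr0.
by rewrite lapE big1 ?mulr0// => k _; rewrite fl pd_cst.
Qed.

End ChartLinear.

Lemma gdot0l {R : realType} n (G : 'M[R]_n) b : gdot G 0 b = 0.
Proof. by rewrite /gdot !mul0mx mxE. Qed.

(** * Leibniz and chain rules for [Gam] and [Lap] *)

Section Calculus.
Context {R : realType} {n : nat} (M : riemannian_manifold R n).
Notation e_ := (fun j => delta_mx 0 j).
Implicit Types (f h g : M -> R) (x : M).

Section AtPoint.
Variable x : M.
Let i := cidx x.
Let p := chart i x.
Lemma ipx : img i p. Proof. by exists x => //; exact: cidxP. Qed.
Lemma ppx : param i p = x. Proof. by rewrite (chartK (chartM i))//; exact: cidxP. Qed.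
Lemma sm_img f (k : nat) : sm f -> Ck e_ k (img i) (f \o param i).
Proof. by move=> sf; have := sf i k; rewrite cimgT. Qed.

End AtPoint.

Lemma GamC f h x : Gam f h x = Gam h f x.
Proof. by rewrite /Gam /Gam_in /gam gdotC//; exact: (metric_posdef (ipx x)).1. Qed.

Lemma cs_Gamr f h : cs f -> cs (Gam h f).
Proof. by move=> cf; rewrite (_ : Gam h f = Gam f h) ?funeqE; [exact: cs_Gam|move=> x; exact: GamC]. Qed.

Lemma csN f : cs f -> cs (fun x => - f x).
Proof. by move=> [K cK f0]; exists K => // x /f0 ->; rewrite oppr0. Qed.

Lemma GamDl f h k x : sm f -> sm h -> Gam (fun y => f y + h y) k x = Gam f k x + Gam h k x.
Proof.
move=> sf sh; rewrite /Gam /Gam_in /gam -gdotDl.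
by rewrite -(gradD (ipx x) (sm_img x 1 sf) (sm_img x 1 sh)).
Qed.

Lemma GamMl f h k x : sm f -> sm h ->
  Gam (fun y => f y * h y) k x = f x * Gam h k x + h x * Gam f k x.
Proof.
move=> sf sh; rewrite /Gam /Gam_in /gam -!gdotZl -gdotDl.
have := gradM (ipx x) (sm_img x 1 sf) (sm_img x 1 sh).
by rewrite [(f \o _) _]/= [(h \o _) _]/= ppx => <-.
Qed.

Lemma Gam_cstl c k x : Gam (fun=> c) k x = 0.
Proof. by rewrite /Gam /Gam_in /gam grad_cst gdot0l. Qed.

Lemma GamZl c f k x : sm f -> Gam (fun y => c * f y) k x = c * Gam f k x.
Proof.
by move=> sf; rewrite (GamMl _ _ (sm_cst c) sf) Gam_cstl mulr0 addr0.
Qed.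

Lemma GamNl f k x : sm f -> Gam (fun y => - f y) k x = - Gam f k x.
Proof.
move=> sf; rewrite -mulN1r -GamZl//; congr Gam; apply/funext => y.
by rewrite mulN1r.
Qed.

Lemma Gam_comp1 (J : set R) (a : R -> R) f k x : (forall x, J (f x)) ->
  (forall k, Ck1 k J a) -> sm f -> Gam (fun y => a (f y)) k x = der a (f x) * Gam f k x.
Proof.
move=> hJ ha sf; rewrite /Gam /Gam_in /gam -gdotZl.
have := grad_comp1 (ipx x) (sm_img x 1 sf) (Ck1_der (ha 1%N) (hJ _)).
by rewrite ppx => <-.
Qed.

Lemma Gam_ge0 f x : 0 <= Gam f f x.
Proof. by apply: gdot_ge0; exact: metric_posdef (ipx x). Qed.

Lemma Gam_cs f h x : Gam f h x ^+ 2 <= Gam f f x * Gam h h x.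
Proof. by apply: gdot_cs; exact: metric_posdef (ipx x). Qed.

Let sG (i : index (charts M)) k a b : Ck e_ k (img i) (fun p => metric i p a b).
Proof. exact: metric_Coo. Qed.
Let pG (i : index (charts M)) p : img i p -> posdef (metric i p).
Proof. exact: metric_posdef. Qed.
Let oI (i : index (charts M)) := img_open (chartM i).

Lemma LapM f h x : sm f -> sm h ->
  Lap (fun y => f y * h y) x = f x * Lap h x + h x * Lap f x + 2 * Gam f h x.
Proof.
move=> sf sh.
have := lap_prod (@oI _) (@sG _) (@pG _) (ipx x) (sm_img x 2 sf) (sm_img x 2 sh).
by rewrite [(f \o _) _]/= [(h \o _) _]/= ppx.
Qed.

Lemma LapZ c f x : sm f -> Lap (fun y => c * f y) x = c * Lap f x.
Proof.
move=> sf; rewrite (LapM _ (sm_cst c) sf) Gam_cstl mulr0 addr0.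
by rewrite [X in _ + _ * X](_ : _ = 0) ?mulr0 ?addr0//; exact: lap_cst.
Qed.

Lemma Lap_comp1 (J : set R) (a : R -> R) f x : open J -> (forall x, J (f x)) ->
  (forall k, Ck1 k J a) -> sm f ->
  Lap (fun y => a (f y)) x = der a (f x) * Lap f x + der (der a) (f x) * Gam f f x.
Proof.
move=> oJ hJ ha sf.
have := lap_comp1 (@oI _) (@sG _) (@pG _) (ipx x) (sm_img x 2 sf) (fun p _ => hJ _) oJ (ha 2%N).
by rewrite [(f \o _) _]/= ppx.
Qed.

End Calculus.

Ltac sm_c := repeat first [assumption | exact: sm_cst | apply: sm_Gam
  | match goal with H : riemannian_measure _ |- _ => apply: (sm_Lap H) end
  | apply: smD | apply: smB | apply: smM | apply: smN | apply: smX ].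

Ltac cs_c := first [assumption
  | apply: csM; cs_c | apply: csMr; cs_c | apply: csD; cs_c | apply: csN; cs_c | apply: cs_Gam; cs_c | apply: cs_Gamr; cs_c ].

(** * Green's identity on the manifold and the multiplier identity *)

Section Green.
Context {R : realType} {n : nat} (M : riemannian_manifold R n)
  (mu : {measure set (borel M) -> \bar R}) (hmu : riemannian_measure mu).
Implicit Types (f h g k z u : M -> R) (x : M).
Notation II := (II mu).

Let Good z := forall f, sm f -> II (fun x => z x * Lap f x + Gam z f x) = 0.

Let bcs_green z f : sm z -> cs z -> sm f -> bcs (fun x => z x * Lap f x + Gam z f x).
Proof. by move=> sz cz sf; apply: bcs_sm; [sm_c|cs_c]. Qed.

Let green_chart (i : index (charts M)) z (K : set M) : compact K -> K `<=` dom i -> supp_in K z -> sm z -> Good z.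
Proof.
move=> cK Kd z0 sz f sf.
have := chart_green hmu cK Kd z0 sz (smO_sub (@subsetT _ _) sf).
move=> e0; rewrite -[RHS]/(fine 0%E) -e0; congr fine; apply: eq_integral => x _; congr EFin.
have [dx|nx] := pselect (dom i x).
  by rewrite extE// (LapE hmu sf dx) (GamE' sz sf dx).
rewrite ext_out// z0 ?mul0r ?add0r; last by move/Kd.
by apply: (Gam_in_out _ (compact_closedM cK) z0 (cidxP x)); move/Kd.
Qed.

Let GoodD z1 z2 : sm z1 -> sm z2 -> cs z1 -> cs z2 -> Good z1 -> Good z2 ->
  Good (fun x => z1 x + z2 x).
Proof.
move=> s1 s2 c1 c2 g1 g2 f sf.
rewrite -[RHS]addr0 -[X in X + _](g1 f sf) -[X in _ + X](g2 f sf).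
rewrite -(IID hmu (bcs_green s1 c1 sf) (bcs_green s2 c2 sf)); congr II; apply/funext => x.
by rewrite GamDl// mulrDl addrACA.
Qed.

(** In place of a partition of unity, [compact_ind] yields a function [S >= 0], positive on [K], for
    which the identity holds with every product [S * eta]; then [z] is written as [S * (z / S)]. *)
Lemma green z f : sm z -> cs z -> sm f ->
  II (fun x => z x * Lap f x + Gam z f x) = 0.
Proof.
move=> sz [K cK z0]; move: f.
pose P (A : set M) := exists S, [/\ sm S, cs S, forall x, 0 <= S x,
  forall x, A x -> 0 < S x & forall eta, sm eta -> Good (fun x => S x * eta x)].
have [S [sS cS S0 SK gS]] : P K.
  apply: (compact_ind (P := P)) cK _ _ _ _.
  - exists (fun=> 0); split => //; first exact: sm_cst.
    + by exists set0; first exact: compact0.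
    + move=> eta se; have [[c [->]]|] := @pselect (exists c : R, (fun x => 0 * eta x) = (fun=> c) /\ c = 0).
        move=> -> f sf; rewrite /II (_ : (fun _ => _) = (fun=> 0%E)) ?integral0//.
        by apply/funext => x; rewrite mul0r Gam_cstl addr0.
      by case; exists 0; split => //; apply/funext => x; rewrite mul0r.
  - move=> A B [S [sS cS S0 SA gS]] [T [sT cT T0 TB gT]].
    exists (fun x => S x + T x); split.
    + by sm_c.
    + exact: csD.
    + by move=> x; rewrite addr_ge0.
    + by move=> x [/SA|/TB] h; [rewrite ltr_wpDr|rewrite ltr_wpDl].
    + move=> eta se; rewrite (_ : (fun x => _) = (fun x => S x * eta x + T x * eta x)).
        by apply: GoodD; [sm_c|sm_c|cs_c|cs_c|exact: gS|exact: gT].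
      by apply/funext => x; rewrite mulrDl.
  - move=> A B AB [S [sS cS S0 SA gS]]; exists S; split => // x /AB; exact: SA.
  - move=> x Kx; have [L [b [cL Ld sb b0 [bp _ bx]]]] := bump_exists (dom_open (chartM (cidx x))) (cidxP x).
    exists [set y | 0 < b y].
      by apply: (@sm_cont _ _ _ _ sb x [set t : R | 0 < t]); apply: nbhs_of_open => //; exact: open_gt.
    exists b; split => //; first by exists L.
    move=> eta se; apply: (green_chart cL Ld); last by sm_c.
    by move=> y /b0 ->; rewrite mul0r.
pose O := [set x | 0 < S x].
have oO : open O.
  rewrite (_ : O = S @^-1` [set t : R | 0 < t])//.
  by apply: open_comp => [y _|]; [exact: (sm_cont sS)|exact: open_gt].
have [se _] : smO setT (ext O (fun x => z x * (S x)^-1)) /\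
    supp_in K (ext O (fun x => z x * (S x)^-1)).
  apply: ext_smooth => //; first by move=> x _ /z0 ->; rewrite mul0r.
  apply: smOM => //; first by apply: smO_sub sz.
  apply: (smO_comp1 (J := [set t | t != 0])) => //; last exact: Ck1_inv.
  - by move=> x; rewrite /O /= => h; rewrite gt_eqF.
  - by apply: smO_sub sS.
rewrite (_ : z = fun x => S x * ext O (fun x => z x * (S x)^-1) x); first exact: gS.
apply/funext => x; have [Ox|nO] := pselect (O x).
  by rewrite extE// mulrCA mulfV ?mulr1// gt_eqF.
by rewrite ext_out// mulr0 z0// => /SK.
Qed.

(** The Hessian of [h] evaluated twice on the gradient of [u]. Written with [Gam] alone it is
    independent of coordinates, and no connection has to be introduced. *)
Definition Hs h u x := Gam u (Gam h u) x - 2^-1 * Gam h (Gam u u) x.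

Section Multiplier.
Variables (h b q phi c u : M -> R).
Hypotheses (sh : sm h) (sb : sm b) (sq : sm q) (sphi : sm phi) (sc : sm c)
  (su : sm u) (cu : cs u).

(** For [c = lambda + |grad phi|^2 - Lap phi] this is the conjugate of [Lap + lambda] by [exp phi];
    see [conj_lap]. *)
Definition P0 x := Lap u x - 2 * Gam phi u x + c x * u x.
Definition Mu x := b x * Gam h u x + q x * u x.
(** The coefficient of [u ^+ 2] once every product of [u] with one of its derivatives has been
    integrated by parts. *)
Definition Bpot x := - (2^-1 * Lap q x) - Gam q phi x - q x * Lap phi x
  + 2^-1 * (b x * Gam h c x) + 2^-1 * (c x * (b x * Lap h x + Gam b h x)) - c x * q x.
Definition Qform x := b x * Hs h u x + Gam b u x * Gam h u x
  + (q x - 2^-1 * (b x * Lap h x + Gam b h x)) * Gam u u x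
  + 2 * (b x * (Gam phi u x * Gam h u x)) + Bpot x * u x ^+ 2.

(** The two integrands differ by [E], a combination of expressions [G z f], the divergences of
    [z grad f], whose integrals vanish. *)
Lemma multiplier : II (fun x => - (P0 x * Mu x)) = II Qform.
Proof.
pose G z f x := z x * Lap f x + Gam z f x.
have bG z f : sm z -> cs z -> sm f -> bcs (G z f).
  by move=> *; apply: bcs_sm; rewrite /G; [sm_c|cs_c].
have GI z f : sm z -> cs z -> sm f -> II (G z f) = 0 by exact: green.
pose z2 x := b x * Gam u u x; pose z3 x := u x * u x.
pose z4 x := q x * (u x * u x); pose z5 x := b x * (c x * (u x * u x)).
have sM : sm Mu by rewrite /Mu; sm_c. 
have cM : cs Mu by rewrite /Mu; cs_c.
have s2 : sm z2 by rewrite /z2; sm_c.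
have c2 : cs z2 by rewrite /z2; cs_c.
have s3 : sm z3 by rewrite /z3; sm_c.
have c3 : cs z3 by rewrite /z3; cs_c.
have s4 : sm z4 by rewrite /z4; sm_c.
have c4 : cs z4 by rewrite /z4; cs_c.
have s5 : sm z5 by rewrite /z5; sm_c.
have c5 : cs z5 by rewrite /z5; cs_c.
(* The five fields are [Mu grad u], [b |grad u|^2 grad h], [u^2 grad q], [q u^2 grad phi] and
   [b c u^2 grad h]; each removes one kind of term that has no place in [Qform]. *)
pose E x := ((G Mu u x - 2^-1 * G z2 h x) - 2^-1 * G z3 q x) + (- G z4 phi x + 2^-1 * G z5 h x).
have bE : bcs E.
  apply: (bcsD (bcsB (bcsB _ _) _) (bcsD _ _)); [| | | apply: bcsN |];
  try (apply: bcsZ); by apply: bG.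
have IE : II E = 0.
  rewrite (IID hmu (bcsB (bcsB _ _) _) (bcsD _ _)); last 5 first.
  - exact: bG.
  - by apply: bcsZ; exact: bG.
  - by apply: bcsZ; exact: bG.
  - by apply: bcsN; exact: bG.
  - by apply: bcsZ; exact: bG.
  rewrite (IIB hmu (bcsB _ _)); last 3 first.
  - exact: bG.
  - by apply: bcsZ; exact: bG.
  - by apply: bcsZ; exact: bG.
  rewrite (IIB hmu); last 2 first.
  - exact: bG.
  - by apply: bcsZ; exact: bG.
  rewrite (IID hmu); last 2 first.
  - by apply: bcsN; exact: bG.
  - by apply: bcsZ; exact: bG.
  rewrite !(IIZ hmu) ?(IIN hmu); try exact: bG.
  by rewrite !GI// !mulr0 !(subr0, oppr0, addr0).
have bP : bcs (fun x => - (P0 x * Mu x)).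
  by apply: bcs_sm; [rewrite /P0 /Mu; sm_c|rewrite /P0 /Mu; apply: csN; cs_c].
rewrite -[LHS]addr0 -IE -(IID hmu bP bE); congr II; apply/funext => x.
have sGuu : sm (Gam u u) by sm_c.
have sGhu : sm (Gam h u) by sm_c.
have d2 : Gam z2 h x = b x * Gam h (Gam u u) x + Gam u u x * Gam b h x.
  by rewrite /z2 GamMl// [Gam (Gam u u) h x]GamC.
have d3 k : Gam z3 k x = 2 * u x * Gam u k x by rewrite /z3 GamMl//; ring.
have sz3 : sm (fun x => u x * u x) by sm_c.
have d4 : Gam z4 phi x = q x * (2 * u x * Gam phi u x) + u x ^+ 2 * Gam q phi x.
  by rewrite /z4 GamMl// d3 [Gam u phi x]GamC expr2.
have d5 : Gam z5 h x = b x * (c x * (2 * u x * Gam h u x) + u x ^+ 2 * Gam h c x) +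
    c x * u x ^+ 2 * Gam b h x.
  rewrite /z5 GamMl//; last by sm_c.
  by rewrite GamMl// d3 [Gam u h x]GamC [Gam c h x]GamC !expr2.
have d1 : Gam Mu u x = b x * Gam u (Gam h u) x + Gam h u x * Gam b u x +
    (q x * Gam u u x + u x * Gam q u x).
  rewrite /Mu GamDl; [|sm_c|sm_c].
  by rewrite !GamMl// [Gam (Gam h u) u x]GamC.
rewrite /E /Qform /Bpot /Hs /G d1 d2 d3 d4 d5 /P0 /Mu /z2 /z3 /z4 /z5 [Gam u q x]GamC.
move: (Gam u (Gam h u) x) (Gam h (Gam u u) x) (Gam u u x) (Gam h u x) (Gam b u x)
  (Gam q u x) (Gam phi u x) (Gam q phi x) (Gam h c x) (Gam b h x) (Lap u x) (Lap h x)
  (Lap q x) (Lap phi x) (b x) (q x) (c x) (u x).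
by move=> *; field.
Qed.

End Multiplier.

End Green.

(** * The Hessian and the geometry of the end *)

(** The second derivatives [u2] enter twice with opposite signs and cancel, which leaves a quadratic
    form in the first derivatives [u]. *)
Lemma hess_sums {R : realType} n (u b a : 'I_n -> R) (u2 da inv : 'I_n -> 'I_n -> R)
    (dinv : 'I_n -> 'I_n -> 'I_n -> R) :
  (forall i j, inv i j = inv j i) -> (forall i j, u2 i j = u2 j i) ->
  (forall k, b k = \sum_i inv k i * u i) ->
  \sum_k (\sum_l (u2 k l * a l + u l * da k l)) * b k
  - 2^-1 * \sum_l (\sum_i (u2 l i * b i + u i * \sum_j (dinv l i j * u j + inv i j * u2 l j))) * a l
  = \sum_i \sum_j (\sum_k inv i k * da k j - 2^-1 * \sum_l a l * dinv l i j) * (u i * u j).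
Proof.
move=> invC u2C bE.
pose X := \sum_k \sum_l u2 k l * a l * b k.
pose Y := \sum_i \sum_j (\sum_k inv i k * da k j) * (u i * u j).
pose Z := \sum_i \sum_j (\sum_l a l * dinv l i j) * (u i * u j).
have e1 : \sum_k (\sum_l (u2 k l * a l + u l * da k l)) * b k = X + Y.
  transitivity (X + \sum_k \sum_l u l * da k l * b k).
    rewrite -big_split; apply: eq_bigr => k _; rewrite big_split /= mulrDl.
    by rewrite !mulr_suml.
  congr (_ + _); rewrite /Y.
  transitivity (\sum_k \sum_l \sum_i u l * da k l * (inv i k * u i)).
    apply: eq_bigr => k _; apply: eq_bigr => l _; rewrite bE mulr_sumr.
    by apply: eq_bigr => i _; rewrite invC.
  transitivity (\sum_i \sum_k \sum_l u l * da k l * (inv i k * u i)).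
    rewrite [RHS]exchange_big; apply: eq_bigr => k _; exact: exchange_big.
  apply: eq_bigr => i _; rewrite exchange_big; apply: eq_bigr => l _.
  by rewrite mulr_suml; apply: eq_bigr => k _; ring.
have e2 l : \sum_i (u2 l i * b i + u i * \sum_j (dinv l i j * u j + inv i j * u2 l j)) =
    2 * (\sum_i u2 l i * b i) + \sum_i \sum_j dinv l i j * (u i * u j).
  rewrite big_split /=.
  have -> : \sum_i u i * (\sum_j (dinv l i j * u j + inv i j * u2 l j)) =
     \sum_i \sum_j dinv l i j * (u i * u j) + \sum_i u2 l i * b i.
    transitivity (\sum_i (\sum_j dinv l i j * (u i * u j) + \sum_j u i * (inv i j * u2 l j))).
      apply: eq_bigr => i _; rewrite mulr_sumr -big_split; apply: eq_bigr => j _ /=.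
      by ring.
    rewrite big_split /=; congr (_ + _); rewrite exchange_big; apply: eq_bigr => j _.
    by rewrite bE mulr_sumr; apply: eq_bigr => i _; rewrite (invC i j); ring.
  by ring.
have e3 : \sum_l (\sum_i (u2 l i * b i + u i * \sum_j (dinv l i j * u j + inv i j * u2 l j))) * a l
    = 2 * X + Z.
  transitivity (\sum_l (2 * (\sum_i u2 l i * a l * b i) + \sum_i \sum_j a l * dinv l i j * (u i * u j))).
    apply: eq_bigr => l _; rewrite e2 mulrDl -mulrA mulr_suml; congr (_ + _).
      by congr (_ * _); apply: eq_bigr => i _; ring.
    rewrite mulr_suml; apply: eq_bigr => i _; rewrite mulr_suml; apply: eq_bigr => j _.
    by ring.
  rewrite big_split /= -mulr_sumr; congr (_ * _ + _).
    rewrite /X exchange_big; apply: eq_bigr => l _; apply: eq_bigr => i _.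
    by rewrite u2C.
  rewrite /Z exchange_big; apply: eq_bigr => i _; rewrite exchange_big; apply: eq_bigr => j _.
  by rewrite mulr_suml.
rewrite e1 e3.
transitivity (Y - 2^-1 * Z); first by field.
rewrite /Y /Z mulr_sumr -sumrB; apply: eq_bigr => i _; rewrite mulr_sumr -sumrB.
by apply: eq_bigr => j _; ring.
Qed.

(** Polarization makes [A] antisymmetric, and transposition then turns the trace into its
    opposite. *)
Lemma quad_trace {R : realType} n (G A : 'M[R]_n) : G^T = G ->
  (forall xi : 'rV[R]_n, (xi *m A *m xi^T) 0 0 = 0) -> \tr (G *m A) = 0.
Proof.
move=> Gs hA.
have e i j : A i j = - A j i.
  have q (k l : 'I_n) : ((delta_mx 0 k : 'rV[R]_n) *m A *m (delta_mx 0 l : 'rV[R]_n)^T) 0 0 = A k l.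
    by rewrite trmx_delta -rowE -colE !mxE.
  have := hA (delta_mx 0 i + delta_mx 0 j).
  rewrite linearD /= !mulmxDl !mulmxDr mx11D [X in X + _]mx11D [X in _ + X]mx11D !q.
  have := hA (delta_mx 0 i); have := hA (delta_mx 0 j); rewrite !q => -> ->.
  by rewrite add0r addr0 => /eqP; rewrite addr_eq0 => /eqP.
have h : \tr (G *m A) = - \tr (G *m A).
  rewrite -{1}mxtrace_tr trmx_mul Gs mxtrace_mulC /mxtrace -sumrN; apply: eq_bigr => i _.
  by rewrite !mxE -sumrN; apply: eq_bigr => j _; rewrite mxE e mulrN.
by move: h => /eqP; rewrite -subr_eq0 opprK -mulr2n mulrn_eq0 => /eqP.
Qed.

Lemma is_derive_prod {R : realType} {V : normedModType R} (J : eqType) (r : seq J)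
    (f : J -> V -> R) (df : J -> R) x v : uniq r ->
  (forall j, is_derive x v (f j) (df j)) ->
  is_derive x v (fun y => \prod_(j <- r) f j y) (\sum_(i <- r) df i * \prod_(j <- r | j != i) f j x).
Proof.
move=> + hf; elim: r => [|a r IH] /=.
  move=> _; rewrite big_nil (_ : (fun y => _) = cst 1); first exact: is_derive_cst.
  by apply/funext => y; rewrite big_nil.
case/andP => ar ur; have h := is_deriveMp (hf a) (IH ur).
rewrite (_ : (fun y => _) = (fun y => f a y * \prod_(j <- r) f j y)).
  apply: (is_derive_eq h); rewrite [RHS]big_cons big_cons eqxx /=; congr (_ + _).
    congr (_ * _); rewrite [LHS]big_seq_cond [RHS]big_seq_cond; apply: eq_bigl => j.
    by rewrite andbT; case: (boolP (j \in r)) => //= jr; apply/esym; apply: contraNneq ar => <-.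
  rewrite mulr_sumr; apply: eq_big_seq => i ir.
  rewrite [in RHS]big_cons (_ : a != i); last by apply: contraNneq ar => ->.
  by rewrite mulrCA.
by apply/funext => y; rewrite big_cons.
Qed.

(** Jacobi's formula: differentiating row by row gives determinants [B i] with one row replaced,
    which are expanded along that row. *)
Lemma is_derive_det {R : realType} {V : normedModType R} n (A : V -> 'M[R]_n) (dA : 'M[R]_n) x v :
  (forall i j, is_derive x v (fun y => A y i j) (dA i j)) ->
  is_derive x v (fun y => \det (A y)) (\sum_i \sum_j dA i j * cofactor (A x) i j).
Proof.
move=> hA; rewrite /determinant.
have hs (s : {perm 'I_n}) : is_derive x v (fun y => (-1) ^+ s * \prod_i A y i (s i))
   ((-1) ^+ s * \sum_i dA i (s i) * \prod_(j | j != i) A x j (s j)).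
  have h := is_derive_prod (index_enum_uniq 'I_n) (fun i => hA i (s i)).
  apply: (is_derive_eq (is_deriveMp (is_derive_cst ((-1) ^+ s : R) x v) h)).
  by rewrite mul0r add0r.
have hsum : is_derive x v (fun y => \sum_(s : {perm 'I_n}) (-1) ^+ s * \prod_i A y i (s i))
   (\sum_(s : {perm 'I_n}) (-1) ^+ s * \sum_i dA i (s i) * \prod_(j | j != i) A x j (s j)).
  elim: (index_enum _) => [|s r IH].
    rewrite big_nil (_ : (fun y => _) = cst 0); first exact: is_derive_cst.
    by apply/funext => y; rewrite big_nil.
  rewrite big_cons (_ : (fun y => _) = (fun y => (-1) ^+ s * \prod_i A y i (s i) +
    \sum_(s <- r) (-1) ^+ s * \prod_i A y i (s i))); last by apply/funext => y; rewrite big_cons.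
  exact: is_deriveDp.
apply: (is_derive_eq hsum).
pose B i := \matrix_(k, l) (if k == i then dA k l else A x k l).
transitivity (\sum_i \det (B i)).
  rewrite /determinant exchange_big; apply: eq_bigr => s _.
  rewrite mulr_sumr; apply: eq_bigr => i _; congr (_ * _).
  rewrite [RHS](bigD1 i)//= mxE eqxx; congr (_ * _); apply: eq_bigr => j ji.
  by rewrite mxE (negbTE ji).
apply: eq_bigr => i _; rewrite (expand_det_row _ i); apply: eq_bigr => j _.
rewrite mxE eqxx; congr (_ * (_ * \det _)).
by apply/matrixP => k l; rewrite !mxE eq_sym (negbTE (neq_lift _ _)).
Qed.

Lemma cofactor_invmx {R : realType} n (A : 'M[R]_n) i j : A \in unitmx ->
  cofactor A i j = \det A * invmx A j i.
Proof.
move=> uA; rewrite /invmx uA mxE mulrA mulfV; last by rewrite unitmxE unitfE in uA.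
by rewrite mul1r mxE.
Qed.

Lemma norm_mul_le {R : realType} (x y A B : R) : x ^+ 2 <= A -> y ^+ 2 <= B ->
  `|x| * `|y| <= A + B.
Proof.
move=> hx hy; apply: le_trans (lerD hx hy).
rewrite -(real_normK (num_real x)) -(real_normK (num_real y)).
have := sqr_ge0 (`|x| - `|y|); move: `|x| `|y| (normr_ge0 x) (normr_ge0 y) => a b a0 b0.
by rewrite sqrrB; have := mulr_ge0 a0 b0; lra.
Qed.

Section HessChart.
Context {R : realType} {n : nat} (U : set 'rV[R]_n) (G : 'rV[R]_n -> 'M[R]_n).
Notation e_ j := (delta_mx 0 j).
Notation C k f := (Ck (fun j => e_ j) k U f).
Hypotheses (oU : open U) (sG : forall k i j, C k (fun p => G p i j))
  (pG : forall p, U p -> posdef (G p)).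
Implicit Types (f h u : 'rV[R]_n -> R) (p : 'rV[R]_n).

Definition gv h l p := \sum_k invmx (G p) l k * pd k h p.

(** Coefficients of the Hessian of [h] as a quadratic form in [du], that is, with both indices
    raised. The matrix is not symmetrized; it enters through its quadratic form and its trace
    against the metric. *)
Definition HT h p i j : R := \sum_k invmx (G p) i k * pd k (gv h j) p
  - 2^-1 * \sum_l gv h l p * pd l (fun q => invmx (G q) i j) p.

Definition hess h u p := gam G u (gam G h u) p - 2^-1 * gam G h (gam G u u) p.

Lemma gamC f h p : U p -> gam G f h p = gam G h f p.
Proof. by move=> Up; rewrite /gam gdotC//; exact: (pG Up).1. Qed.

Lemma invG_sym p i j : U p -> invmx (G p) i j = invmx (G p) j i.
Proof. by move=> Up; rewrite -{2}(pG Up).1 invmx_tr mxE. Qed.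

Lemma Ck_gv k h l : C k.+1 h -> C k (gv h l).
Proof.
move=> hh; apply: Ck_sum => // i _; apply: CkM => //; first exact: Ck_ginv.
exact: Ck_pd hh.
Qed.

Lemma pd_sum (f h : 'I_n -> 'rV[R]_n -> R) k p : U p ->
  (forall l, C 1 (f l)) -> (forall l, C 1 (h l)) ->
  pd k (fun q => \sum_l f l q * h l q) p =
  \sum_l (pd k (f l) p * h l p + f l p * pd k (h l) p).
Proof.
move=> Up hf hh; apply: pd_val; elim: (index_enum _) => [|l r IH].
  rewrite big_nil (_ : (fun y => _) = cst 0); first exact: is_derive_cst.
  by apply/funext => y; rewrite big_nil.
rewrite big_cons (_ : (fun y => _) = (fun y => f l y * h l y + \sum_(l <- r) f l y * h l y)).
  exact: (is_deriveDp (is_deriveMp (Ck_pdP k (hf l) Up) (Ck_pdP k (hh l) Up)) IH).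
by apply/funext => y; rewrite big_cons.
Qed.

Lemma pd_comm k l u p : U p -> C 2 u -> pd k (pd l u) p = pd l (pd k u) p.
Proof. by move=> Up hu; rewrite !pdE; exact: (clairaut_Ck l k oU Up hu). Qed.

Lemma hess_formula h u p : U p -> C 2 h -> C 2 u ->
  hess h u p = \sum_i \sum_j HT h p i j * (pd i u p * pd j u p).
Proof.
move=> Up hh hu.
have h1 l : C 1 (gv h l) by exact: Ck_gv.
have u1 l : C 1 (gv u l) by exact: Ck_gv.
have d1 l : C 1 (pd l u) by exact: Ck_pd.
have i1 i j : C 1 (fun q => invmx (G q) i j) by exact: Ck_ginv.
have gE f k q : gam G f k q = \sum_l pd l f q * gv k l q by exact: gamE.
have eA k : pd k (gam G h u) p =
    \sum_l (pd k (pd l u) p * gv h l p + pd l u p * pd k (gv h l) p).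
  rewrite (pd_eq k (g := fun q => \sum_l pd l u q * gv h l q) oU Up).
    exact: pd_sum.
  by move=> q /set_mem Uq; rewrite gamC.
have eB l : pd l (gam G u u) p = \sum_i (pd l (pd i u) p * gv u i p + pd i u p *
    \sum_j (pd l (fun q => invmx (G q) i j) p * pd j u p + invmx (G p) i j * pd l (pd j u) p)).
  rewrite (pd_eq l (g := fun q => \sum_l pd l u q * gv u l q) oU Up); last first.
    by move=> q /set_mem Uq; rewrite gE.
  rewrite pd_sum//; apply: eq_bigr => i _; congr (_ + _ * _).
  by rewrite /gv pd_sum.
rewrite /hess (gamC _ _ Up) gE [gam G h _ p](gamC _ _ Up) [X in _ - _ * X]gE.
under eq_bigr do rewrite eA.
under [X in _ - _ * X]eq_bigr do rewrite eB.
apply: hess_sums; [|by move=> i j; exact: pd_comm|by []].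
by move=> i j; exact: invG_sym.
Qed.

(** Differentiating [vol^2 det (G^-1) = 1] by Jacobi's formula expresses the derivative of the
    density through that of the inverse metric, which is how it occurs in the trace of [HT]. *)
Lemma lap_trace h p : U p -> C 2 h -> laplace_beltrami G h p = \tr (G p *m (\matrix_(i, j) HT h p i j)).
Proof.
move=> Up hh; have v0 := vol_gt0 pG Up; have uG := posdef_unit (pG Up).
have h1 l : C 1 (gv h l) by exact: Ck_gv.
have cv : C 1 (vol_density G) by exact: Ck_vol.
pose D l i j := pd l (fun q => invmx (G q) i j) p.
have dv l : pd l (vol_density G) p = - (2^-1 * vol_density G p * \sum_i \sum_j G p i j * D l i j).
  have hd := is_derive_det (A := fun q => invmx (G q)) (dA := \matrix_(i, j) D l i j)
    (x := p) (v := e_ l).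
  have {}hd : is_derive p (e_ l) (fun q => \det (invmx (G q)))
     (\det (invmx (G p)) * \sum_i \sum_j G p i j * D l i j).
    apply: (is_derive_eq (hd _)).
      by move=> i j; rewrite mxE; exact: (Ck_pdP l (Ck_ginv oU sG pG 1 i j) Up).
    rewrite mulr_sumr exchange_big; apply: eq_bigr => j _; rewrite mulr_sumr; apply: eq_bigr => i _.
    rewrite cofactor_invmx ?unitmx_inv// invmxK mxE /D.
    rewrite (pd_eq l (g := fun q => invmx (G q) j i) oU Up); first by ring.
    by move=> q /set_mem Uq; exact: invG_sym.
  have hv := Ck_pdP l cv Up.
  have h3 := is_deriveMp (is_deriveMp hv hv) hd.
  have e q : U q -> vol_density G q * vol_density G q * \det (invmx (G q)) = 1.
    move=> Uq; rewrite -expr2 sqr_sqrtr ?ltW ?posdef_det//; last exact: pG.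
    by rewrite det_inv mulfV// gt_eqF// posdef_det//; exact: pG.
  have d0 : pd l (fun q => vol_density G q * vol_density G q * \det (invmx (G q))) p = 0.
    rewrite (pd_eq l (g := fun=> 1) oU Up) ?pd_cst// => q /set_mem; exact: e.
  move: d0; rewrite (pd_val h3) det_inv.
  have -> : (\det (G p))^-1 = (vol_density G p * vol_density G p)^-1.
    by rewrite -expr2 sqr_sqrtr// ltW// posdef_det//; exact: pG.
  move: (\sum_i _) (pd _ _ _) v0; move: (vol_density G p) => v S d v0 /eqP.
  have vn : v != 0 by rewrite gt_eqF.
  rewrite (_ : _ + _ = v^-1 * (2 * d + v * S)); last by field.
  rewrite mulf_eq0 invr_eq0 (negbTE vn) /= => /eqP hS.
  by rewrite (_ : d = (2 * d + v * S) / 2 - v * S / 2); [rewrite hS; field|field].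
have hfl k : pd k (flux G h k) p = vol_density G p * pd k (gv h k) p + pd k (vol_density G) p * gv h k p.
  apply: etrans (pd_val (is_deriveMp (Ck_pdP k cv Up) (Ck_pdP k (h1 k) Up))) _.
  exact: addrC.
rewrite lapE (sum_split2 hfl) sum_mulr mulrDr mulKf ?gt_eqF//.
transitivity (\sum_k pd k (gv h k) p - 2^-1 * \sum_k gv h k p * \sum_i \sum_j G p i j * D k i j).
  congr (_ + _); rewrite !mulr_sumr -sumrN; apply: eq_bigr => k _.
  rewrite dv; move: (\sum_i _) (gv h k p) => S g; by field; rewrite gt_eqF.
transitivity (\sum_i \sum_j G p i j * HT h p i j); last first.
  rewrite /mxtrace exchange_big; apply: eq_bigr => j _; rewrite mxE; apply: eq_bigr => i _.
  rewrite mxE; congr (_ * _); by rewrite -{1}(pG Up).1 mxE.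
rewrite /HT; under [RHS]eq_bigr do under eq_bigr do rewrite mulrBr.
under [RHS]eq_bigr do rewrite big_split /= sumrN.
rewrite big_split /= sumrN; congr (_ - _).
  rewrite exchange_big; apply: eq_bigr => j _.
  transitivity (\sum_k (G p *m invmx (G p)) j k * pd k (gv h j) p).
    rewrite mulmxV// (bigD1 j)//= big1 ?addr0; last first.
      by move=> k kj; rewrite mxE eq_sym (negbTE kj) mul0r.
    by rewrite mxE eqxx mul1r.
  transitivity (\sum_k \sum_i G p j i * invmx (G p) i k * pd k (gv h j) p).
    by apply: eq_bigr => k _; rewrite mxE mulr_suml.
  rewrite exchange_big; apply: eq_bigr => i _; rewrite mulr_sumr; apply: eq_bigr => k _.
  by rewrite mulrA; congr (_ * _ * _); rewrite -{1}(pG Up).1 mxE.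
rewrite mulr_sumr; under eq_bigr do rewrite !mulr_sumr.
rewrite exchange_big; apply: eq_bigr => i _.
under eq_bigr do rewrite !mulr_sumr.
rewrite exchange_big; apply: eq_bigr => j _; rewrite !mulr_sumr; apply: eq_bigr => k _.
by rewrite /D; ring.
Qed.

Lemma Ck_HT h i j k : C k.+2 h -> C k (fun p => HT h p i j).
Proof.
move=> hh; apply: CkB => //.
  apply: Ck_sum => // l _; apply: CkM => //; first exact: Ck_ginv.
  exact: Ck_pd (Ck_gv _ hh).
apply: CkM => //; first exact: Ck_cst.
apply: Ck_sum => // l _; apply: CkM => //; first by apply: Ck_gv; apply: CkS.
exact: Ck_pd (Ck_ginv oU sG pG k.+1 i j).
Qed.

Lemma gdot_coord (A : 'M[R]_n) (xi : 'rV[R]_n) i : posdef A ->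
  xi 0 i ^+ 2 <= gdot A xi xi * A i i.
Proof.
move=> pA; have uA := posdef_unit pA; have := gdot_cs xi (row i A) pA.
have e (v : 'rV[R]_n) : gdot A v (row i A) = v 0 i.
  have e : invmx A *m (row i A)^T = (delta_mx i 0 : 'cV[R]_n).
    by rewrite tr_row pA.1 colE mulmxA mulVmx// mul1mx.
  by rewrite /gdot -mulmxA e -colE mxE.
by rewrite !e mxE.
Qed.

(** By [gdot_coord] the square of a partial derivative of [u] is at most a diagonal entry of [G]
    times the gradient form. *)
Lemma hess_bound h u p : U p -> C 2 h -> C 2 u ->
  `|hess h u p| <= (\sum_i \sum_j `|HT h p i j| * (G p i i + G p j j)) * gam G u u p.
Proof.
move=> Up hh hu; rewrite hess_formula//.
apply: le_trans (ler_norm_sum _ _ _) _; rewrite mulr_suml; apply: ler_sum => i _.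
apply: le_trans (ler_norm_sum _ _ _) _; rewrite mulr_suml; apply: ler_sum => j _.
rewrite normrM -mulrA ler_wpM2l// normrM.
have hi := gdot_coord (grad u p) i (pG Up); have hj := gdot_coord (grad u p) j (pG Up).
rewrite !mxE -/(gam G u u p) in hi hj.
rewrite mulrDl [G p i i * _]mulrC [G p j j * _]mulrC.
exact: norm_mul_le hi hj.
Qed.

Lemma gam_eq f g h p : U p -> {in U, f =1 g} -> gam G h f p = gam G h g p.
Proof.
move=> Up fg; rewrite /gam; congr gdot; apply/rowP => k; rewrite !mxE.
exact: (pd_eq k oU Up fg).
Qed.

End HessChart.

Lemma is_derive_affine {R : realType} {V : normedModType R} (f : V -> R) v (c : R) z :
  (forall z t, f (z + t *: v) = f z + t * c) -> is_derive z v f c.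
Proof.
move=> h; rewrite -[z]addr0 -(scale0r v); apply/is_derive_lineP.
rewrite (_ : (fun t => _) = (fun t => f z + t * c)); last by apply/funext => t; exact: h.
have h1 : is_derive (0 : R) (1 : R) (fun t : R => t * c) (1 * c + 0 * 0).
  exact: is_deriveMp (is_derive_id _ _) (is_derive_cst _ _ _).
apply: (is_derive_eq (is_deriveDp (is_derive_cst (f z) _ _) h1)).
by ring.
Qed.

Lemma Ck_coord {R : realType} n k (U : set 'rV[R]_n) l :
  Ck (fun j => delta_mx 0 j) k U (fun q => q 0 l).
Proof.
have cl (q : 'rV[R]_n) : {for q, continuous (fun q : 'rV[R]_n => q 0 l)}.
  exact: coord_continuous.
have hd j (q : 'rV[R]_n) : is_derive q (delta_mx 0 j) (fun q : 'rV[R]_n => q 0 l) ((l == j)%:R : R).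
  by apply: is_derive_affine => z t; rewrite !mxE eqxx.
case: k => [|k]; first by split.
split => // j; split=> [x Ux|]; first by have [] := hd j x.
rewrite (_ : 'D_(delta_mx 0 j) _ = cst ((l == j)%:R : R)); first exact: Ck_cst.
by apply/funext => q; have [_ ->] := hd j q.
Qed.

(** * The Hessian and the Laplacian in arbitrary coordinates *)

Section Local.
Context {R : realType} {n : nat} (M : riemannian_manifold R n)
  (mu : {measure set (borel M) -> \bar R}) (hmu : riemannian_measure mu).
Notation e_ := (fun j => delta_mx 0 j).
Notation ix := (index (charts M)).
Implicit Types (f h u : M -> R) (x : M) (i : ix).

Lemma sm_param i f (k : nat) : sm f -> Ck e_ k (img i) (f \o param i).
Proof. by move=> sf; have := sf i k; rewrite cimgT. Qed.

Lemma plateau_sqd i p (r : R) : 0 < r -> cball p r `<=` img i ->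
  exists chi : M -> R, [/\ sm chi, supp_in (param i @` cball p r) chi,
    forall x, 0 <= chi x <= 1 &
    forall x, dom i x -> sqd i p x <= r ^+ 2 / 2 -> chi x = 1].
Proof.
move=> r0 pr; pose a t := smoothstep (2 - 2 / r ^+ 2 * t).
have r20 : 0 < r ^+ 2 by rewrite exprn_gt0.
have ha k : Ck1 k setT a.
  apply: (@Ck_comp1 R R unit (fun=> 1) k setT setT (fun t => 2 - 2 / r ^+ 2 * t) smoothstep) => //.
  - exact: openT.
  - apply: CkB; [exact: openT|exact: Ck_cst|].
    by apply: CkM; [exact: openT|exact: Ck_cst|apply: Ck1_id; exact: openT].
  - by apply: Ck1_smoothstep; exact: openT.
have a0 t : r ^+ 2 <= t -> a t = 0.
  move=> h; rewrite /a smoothstep0// subr_le0 mulrAC ler_pdivlMr// ler_pM2l//.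
have [sf s0] := radial_ext r0 pr ha a0.
exists (ext (dom i) (fun x => a (sqd i p x))); split => //.
- move=> x; rewrite /ext; case: pselect => dx /=; first exact: smoothstep_itv.
  by rewrite lexx ler01.
- move=> x dx h; rewrite extE// /a smoothstep1// lerBrDl -lerBrDr.
  rewrite (_ : 2 - 1 = 1); last by ring.
  by rewrite mulrAC ler_pdivrMr// mul1r mulrC -ler_pdivlMr.
Qed.

Lemma plateau_exists O x : open O -> O x -> exists (K : set M) (chi : M -> R),
  [/\ compact K, K `<=` O, sm chi, supp_in K chi &
   (forall y, 0 <= chi y <= 1) /\ exists U, [/\ open U, U x & forall y, U y -> chi y = 1]].
Proof.
move=> oO Ox; pose i := cidx x; have di : dom i x := cidxP x.
have oD := dom_open (chartM i).
have Up : cimg i O (chart i x) by apply: cimg_chart.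
have [r r0 hr] := cball_in (cimg_open oO) Up.
have hri : cball (chart i x) r `<=` img i by move=> q /hr/cimgP[].
have [cK Kd] := param_compact (@cball_compact _ _ (chart i x) r) hri.
have [chi [s0 s1 s2 s3]] := plateau_sqd r0 hri.
exists (param i @` cball (chart i x) r), chi; split => //.
  by move=> _ [q /hr/cimgP[iq Oq] <-].
split => //; exists (dom i `&` [set y | sqd i (chart i x) y < r ^+ 2 / 2]); split.
- rewrite openE => y [dy hy]; apply: filterI; first exact: open_nbhs_nbhs.
  apply: (@smO_continuous _ _ _ _ _ y oD dy (sqd_smooth i (chart i x)) [set t : R | t < r ^+ 2 / 2]).
  by apply: nbhs_of_open => //; exact: open_lt.
- split => //=; rewrite /sqd big1 ?divr_gt0 ?exprn_gt0// => l _.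
  by rewrite subrr expr0n.
- by move=> y [dy /ltW hy]; exact: s3.
Qed.

(** A linear function of the coordinates times a plateau equal to 1 near [x]. *)
Lemma covector_exists i x (xi : 'rV[R]_n) : dom i x ->
  exists2 u, sm u & grad (u \o param i) (chart i x) = xi.
Proof.
move=> di; have oD := dom_open (chartM i).
have [K [chi [cK Kd sc c0 [_ [U [oU Ux c1]]]]]] := plateau_exists oD di.
pose L y := \sum_l xi 0 l * chart i y 0 l.
have sL : smO (dom i) L.
  apply: smO_sum => // l _; apply: smOM => //; first exact: smO_cst.
  exact: chart_coord_smO.
have [su _] : smO setT (ext (dom i) (fun y => chi y * L y)) /\
    supp_in K (ext (dom i) (fun y => chi y * L y)).
  apply: ext_smooth => //; first by move=> y _ /c0 ->; rewrite mul0r.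
  by apply: smOM => //; apply: smO_sub sc.
exists (ext (dom i) (fun y => chi y * L y)) => //.
apply/rowP => k; rewrite mxE.
rewrite (pd_eq k (U := cimg i U) (g := fun q => \sum_l xi 0 l * q 0 l)).
- apply: pd_val; apply: is_derive_affine => z t.
  rewrite (_ : xi 0 k = \sum_l xi 0 l * (l == k)%:R); last first.
    rewrite (bigD1 k)//= eqxx mulr1 big1 ?addr0// => l /negbTE ->.
    by rewrite mulr0.
  rewrite mulr_sumr -big_split; apply: eq_bigr => l _; rewrite !mxE eqxx /=.
  by ring.
- exact: cimg_open.
- exact: cimg_chart.
- move=> q /set_mem/cimgP[iq Uq] /=; have [e d] := paramK iq.
  by rewrite extE// c1// mul1r /L e.
Qed.

Lemma param_gam i : forall f h, sm f -> sm h -> forall q, img i q ->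
  Gam f h (param i q) = gam (metric i) (f \o param i) (h \o param i) q.
Proof.
by move=> f h sf sh q iq; have [e d] := paramK iq; rewrite (GamE' sf sh d) /Gam_in e.
Qed.

Section Coord.
Variables (V : set 'rV[R]_n) (Phi : 'rV[R]_n -> M) (Gt : 'rV[R]_n -> 'M[R]_n).
Hypotheses (oV : open V) (hG : forall f h, sm f -> sm h -> forall q, V q ->
  Gam f h (Phi q) = gam Gt (f \o Phi) (h \o Phi) q).

(** [Phi] need not come from a chart of the atlas, as with polar coordinates on the end: it is
    enough that [Gam] is read through [Phi] with some matrix [Gt]. *)
Lemma Hs_coord h u q : V q -> sm h -> sm u ->
  Hs h u (Phi q) = hess Gt (h \o Phi) (u \o Phi) q.
Proof.
move=> Vq sh su; have s1 : sm (Gam h u) by exact: sm_Gam.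
have s2 : sm (Gam u u) by exact: sm_Gam.
rewrite /Hs /hess !hG//; congr (_ - _ * _).
  by apply: (@gam_eq _ _ V Gt oV _ _ _ _ Vq) => p /set_mem Vp /=; rewrite hG.
by apply: (@gam_eq _ _ V Gt oV _ _ _ _ Vq) => p /set_mem Vp /=; rewrite hG.
Qed.

End Coord.

Section LapCoord.
Variables (V : set 'rV[R]_n) (Phi : 'rV[R]_n -> M) (Gt : 'rV[R]_n -> 'M[R]_n).
Hypotheses (oV : open V) (hG : forall f h, sm f -> sm h -> forall q, V q ->
  Gam f h (Phi q) = gam Gt (f \o Phi) (h \o Phi) q).
Hypotheses (sGt : forall k (i j : 'I_n), Ck e_ k V (fun p => Gt p i j))
  (pGt : forall p, V p -> posdef (Gt p)).

(** [Hs h u] is intrinsic, so both coordinate Hessians define the same quadratic form, every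
    covector being a differential by [covector_exists]; by [quad_trace] the traces agree. No second
    derivative of the change of variables appears. *)
Lemma Lap_coord h q i (J : 'M[R]_n) : V q -> sm h -> Ck e_ 2 V (h \o Phi) ->
  (forall u, sm u -> Ck e_ 2 V (u \o Phi)) -> dom i (Phi q) ->
  (forall u, sm u -> grad (u \o Phi) q = grad (u \o param i) (chart i (Phi q)) *m J^T) ->
  Gt q = J *m metric i (chart i (Phi q)) *m J^T ->
  Lap h (Phi q) = \tr (Gt q *m \matrix_(i, j) HT Gt (h \o Phi) q i j).
Proof.
move=> Vq sh ch cu dx hJ eG; set x := Phi q in dx hJ eG *.
set p := chart i x in hJ eG *; have ip : img i p by exists x.
have ex : param i p = x by exact: (chartK (chartM i)).
have sG k a b : Ck e_ k (img i) (fun p => metric i p a b) by exact: metric_Coo.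
have pG p' : img i p' -> posdef (metric i p') by exact: metric_posdef.
have oI := img_open (chartM i).
pose T := \matrix_(a, b) HT (metric i) (h \o param i) p a b.
pose T' := \matrix_(a, b) HT Gt (h \o Phi) q a b.
have form (A : 'M[R]_n) (v : 'rV[R]_n) :
    (v *m A *m v^T) 0 0 = \sum_a \sum_b A a b * (v 0 a * v 0 b).
  rewrite mxE exchange_big; apply: eq_bigr => b _; rewrite !mxE mulr_suml.
  by apply: eq_bigr => a _; rewrite mulrAC mulrC mulrCA mulrA.
have key (xi : 'rV[R]_n) : (xi *m (T - J^T *m T' *m J) *m xi^T) 0 0 = 0.
  have [u su eu] := covector_exists xi dx.
  have e1 : Hs h u x = (xi *m T *m xi^T) 0 0.
    rewrite -[in LHS]ex (Hs_coord oI (@param_gam i) ip sh su).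
    rewrite (hess_formula oI sG pG ip (sm_param i 2 sh) (sm_param i 2 su)) form.
    apply: eq_bigr => a _; apply: eq_bigr => b _.
    by rewrite [T a b]mxE -eu; congr (_ * (_ * _)); rewrite mxE.
  have e2 : Hs h u x = (xi *m J^T *m T' *m (xi *m J^T)^T) 0 0.
    rewrite (Hs_coord oV hG Vq sh su) (hess_formula oV sGt pGt Vq ch (cu _ su)) form.
    apply: eq_bigr => a _; apply: eq_bigr => b _.
    by rewrite [T' a b]mxE -eu -(hJ _ su); congr (_ * (_ * _)); rewrite [in RHS]mxE.
  rewrite mulmxBr mulmxBl mx11D -e1 e2 trmx_mul trmxK !mulmxA.
  by rewrite [X in _ + X]mxE subrr.
have Gs : (metric i p)^T = metric i p := (pG _ ip).1.
have := quad_trace Gs key; rewrite mulmxBr raddfB /= => /eqP; rewrite subr_eq0 => /eqP e.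
rewrite (LapE hmu sh dx) /Lap_in -/p (lap_trace oI sG pG ip (sm_param i 2 sh)) -/T e -/T' eG.
by rewrite !mulmxA mxtrace_mulC !mulmxA.
Qed.

End LapCoord.

(** The local constant of [hess_bound] is continuous in the point; [compact_ind] makes it uniform on
    [K]. *)
Lemma Hs_bound h (K : set M) : sm h -> compact K ->
  exists2 C : R, 0 <= C & forall x u, K x -> sm u -> `|Hs h u x| <= C * Gam u u x.
Proof.
move=> sh cK.
apply: (compact_ind (P := fun A => exists2 C : R, 0 <= C & forall x u, A x -> sm u ->
  `|Hs h u x| <= C * Gam u u x)) cK _ _ _ _.
- by exists 0.
- move=> A B [C C0 hC] [D D0 hD]; exists (C + D); first by rewrite addr_ge0.
  move=> x u [Ax|Bx] su; [apply: le_trans (hC x u Ax su) _|apply: le_trans (hD x u Bx su) _];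
  by rewrite ler_wpM2r ?Gam_ge0// ?lerDl ?lerDr.
- by move=> A B AB [C C0 hC]; exists C => // x u /AB Bx; exact: hC.
move=> x Kx; pose i := cidx x; have dx : dom i x := cidxP x.
have sG k a b : Ck e_ k (img i) (fun p => metric i p a b) by exact: metric_Coo.
have pG p' : img i p' -> posdef (metric i p') by exact: metric_posdef.
have oI := img_open (chartM i); have ip : img i (chart i x) by exists x.
pose B p := \sum_a \sum_b `|HT (metric i) (h \o param i) p a b| *
  (metric i p a a + metric i p b b).
have cB : {for chart i x, continuous B}.
  suff h0 : Ck e_ 0 (img i) B by exact: (Ck_cont h0 ip).
  apply: Ck_sum => // a _; apply: Ck_sum => // b _; apply: CkM => //; last first.
    by apply: CkD => //; exact: sG.
  split => // q iq; apply: (cvg_norm (F := nbhs q)).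
  exact: (Ck_cont (Ck_HT oI sG pG a b (sm_param i 2 sh)) iq).
have B0 p : img i p -> 0 <= B p.
  move=> ip'; apply: sumr_ge0 => a _; apply: sumr_ge0 => b _; rewrite mulr_ge0//.
  have d c : 0 <= metric i p c c.
    have [/eqP z|/(pG p ip').2] := eqVneq (delta_mx 0 c : 'rV[R]_n) 0.
      by have := congr1 (fun v : 'rV[R]_n => v 0 c) (eqP z); rewrite !mxE !eqxx => /eqP; rewrite oner_eq0.
    by rewrite -rowE trmx_delta -colE !mxE => /ltW.
  by rewrite addr_ge0.
exists (dom i `&` chart i @^-1` [set p | B p < B (chart i x) + 1]).
  apply: filterI; first by apply: nbhs_of_open => //; exact: (dom_open (chartM i)).
  apply: (chart_continuous (chartM i) dx); apply: (cB [set t : R | t < B (chart i x) + 1]).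
  by apply: open_nbhs_nbhs; split; [exact: open_lt|rewrite /= ltrDl].
exists (B (chart i x) + 1); first by rewrite addr_ge0// B0.
move=> y u [dy /= hy] su; have iy : img i (chart i y) by exists y.
have ey : param i (chart i y) = y by exact: (chartK (chartM i)).
rewrite -ey (Hs_coord oI (@param_gam i) iy sh su) (param_gam su su iy).
apply: le_trans (hess_bound oI sG pG iy (sm_param i 2 sh) (sm_param i 2 su)) _.
by rewrite ler_wpM2r ?(ltW hy)//; apply: gdot_ge0; exact: pG.
Qed.

End Local.

(** * Quadratic forms and tensor norms *)

Section FormBounds.
Context {R : realType}.

Lemma formE n (A : 'M[R]_n) (v : 'rV[R]_n) :
  (v *m A *m v^T) 0 0 = \sum_a \sum_b A a b * (v 0 a * v 0 b).
Proof.
rewrite mxE exchange_big; apply: eq_bigr => b _; rewrite !mxE mulr_suml.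
by apply: eq_bigr => a _; ring.
Qed.

Lemma entry_form n (z : 'rV[R]_n) (S : 'M[R]_n) (C : R) : (forall i j, `|S i j| <= C) ->
  `|(z *m S *m z^T) 0 0| <= n%:R * C * (z *m z^T) 0 0.
Proof.
move=> hS; rewrite formE.
apply: (@le_trans _ _ (\sum_a \sum_b (C / 2 * (z 0 a ^+ 2 + z 0 b ^+ 2)))).
  apply: le_trans (ler_norm_sum _ _ _) _; apply: ler_sum => a _.
  apply: le_trans (ler_norm_sum _ _ _) _; apply: ler_sum => b _.
  rewrite normrM -mulrA; apply: ler_pM => //.
  rewrite ler_norml; have h1 := sqr_ge0 (z 0 a - z 0 b); have h2 := sqr_ge0 (z 0 a + z 0 b).
  rewrite sqrrB in h1; rewrite sqrrD in h2.
  by apply/andP; split; lra.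
rewrite sqnormE; apply: le_of_eq.
transitivity (\sum_a (C / 2 * (n%:R * z 0 a ^+ 2 + \sum_b z 0 b ^+ 2))).
  apply: eq_bigr => a _; rewrite -mulr_sumr big_split /= sumr_const card_ord.
  by rewrite mulr_natl.
rewrite -mulr_sumr big_split /= -mulr_sumr sumr_const card_ord -[_ *+ n]mulr_natl.
by move: (\sum_i _) => s; field.
Qed.

(** In an orthonormal frame for [h], given by the Cholesky factor, [tensor_norm] is the Frobenius
    norm and bounds every entry. *)
Lemma tensor_form n (h S : 'M[R]_n) (v : 'rV[R]_n) (C : R) : posdef h -> tensor_norm h S <= C ->
  `|(v *m S *m v^T) 0 0| <= n%:R * C * (v *m h *m v^T) 0 0.
Proof.
move=> ph hC; have [L [uL hL]] := cholesky ph.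
pose Sh := invmx L *m S *m (invmx L)^T.
have eS : S = L *m Sh *m L^T.
  rewrite /Sh !mulmxA mulmxV// mul1mx -mulmxA -trmx_mul mulmxV//.
  by rewrite trmx1 mulmx1.
have C0 : 0 <= C := le_trans (sqrtr_ge0 _) hC.
have tE : tensor_dot h S S = \sum_i \sum_j Sh i j ^+ 2.
  transitivity (\tr (Sh *m Sh^T)); last first.
    by apply: eq_bigr => i _; rewrite mxE; apply: eq_bigr => j _; rewrite [_^T _ _]mxE expr2.
  rewrite /tensor_dot hL invmx_mul ?unitmx_tr// invmx_tr /Sh !trmx_mul trmxK.
  by rewrite !mulmxA [RHS]mxtrace_mulC !mulmxA.
have hSh i j : `|Sh i j| <= C.
  rewrite -(@ler_pXn2r _ 2) ?nnegrE// real_normK ?num_real//.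
  apply: (@le_trans _ _ (tensor_dot h S S)).
    rewrite tE (bigD1 i)//= (bigD1 j)//= -addrA lerDl addr_ge0// sumr_ge0// => *.
      by rewrite sqr_ge0.
    by apply: sumr_ge0 => *; rewrite sqr_ge0.
  rewrite -(sqr_sqrtr (a := tensor_dot h S S)); last first.
    by rewrite tE; apply: sumr_ge0 => k _; apply: sumr_ge0 => l _; rewrite sqr_ge0.
  by rewrite ler_pXn2r ?nnegrE ?sqrtr_ge0.
have := entry_form (v *m L) hSh.
by rewrite [in X in _ <= X](trmx_mul v L) hL eS trmx_mul !mulmxA.
Qed.

(** The trace is the sum of the values of the form on the rows of [invmx L], which are unit vectors
    for [K]. *)
Lemma form_trace n (K S : 'M[R]_n) (d : R) : posdef K ->
  (forall v : 'rV[R]_n, `|(v *m S *m v^T) 0 0| <= d * (v *m K *m v^T) 0 0) ->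
  `|\tr (S *m invmx K)| <= n%:R * d.
Proof.
move=> pK hS; have [L [uL hL]] := cholesky pK.
have -> : \tr (S *m invmx K) = \sum_(i < n) (row i (invmx L) *m S *m (row i (invmx L))^T) 0 0.
  rewrite hL invmx_mul ?unitmx_tr// invmx_tr mulmxA mxtrace_mulC mulmxA.
  apply: eq_bigr => i _; rewrite -row_mul mxE [RHS]mxE; apply: eq_bigr => j _.
  by rewrite [row i _ 0 j]mxE; congr (_ * _); rewrite !mxE.
apply: le_trans (ler_norm_sum _ _ _) _; rewrite mulr_natl -[n in X in _ <= X]card_ord -sumr_const.
apply: ler_sum => i _; apply: le_trans (hS _) _.
rewrite (_ : (_ *m K *m _) 0 0 = 1) ?mulr1// hL mulmxA -row_mul mulVmx//.
rewrite row1 -mulmxA -trmx_mul -row_mul mulVmx// row1 trmx_delta -colE !mxE.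
by rewrite !eqxx.
Qed.

Lemma posdef_perturb n (h S : 'M[R]_n) : posdef h -> (h + S)^T = h + S ->
  (forall v : 'rV[R]_n, `|(v *m S *m v^T) 0 0| <= 2^-1 * (v *m h *m v^T) 0 0) ->
  posdef (h + S) /\
  forall v : 'rV[R]_n, (v *m h *m v^T) 0 0 <= 2 * (v *m (h + S) *m v^T) 0 0.
Proof.
move=> ph hs hS.
have e (v : 'rV[R]_n) : (v *m (h + S) *m v^T) 0 0 = (v *m h *m v^T) 0 0 + (v *m S *m v^T) 0 0.
  by rewrite mulmxDr mulmxDl mx11D.
split; last first.
  by move=> v; rewrite e; have := hS v; rewrite ler_norml => /andP[h1 _]; lra.
split => // v v0; rewrite e; have := ph.2 v v0.
by have := hS v; rewrite ler_norml => /andP[h1 _]; lra.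
Qed.

End FormBounds.

(** * The metric on the conic end *)

Section EndGeometry.
Context {R : realType} {m : nat} {sigma : R} (s0 : 0 < sigma) (M : riemannian_manifold R m.+1)
  (X : asymptotically_conic sigma M) (w : M -> R) (hw : is_weight X w)
  (mu : {measure set (borel M) -> \bar R}) (hmu : riemannian_measure mu).
Notation N := (conic_boundary X).
Notation cmap := (@conic_map _ _ _ _ X).
Notation cerr := (@conic_error _ _ _ _ X).
Notation R0 := (conic_radius X).
Notation e_ := (fun j => delta_mx 0 j).
Implicit Types (a : index (charts N)) (q : 'rV[R]_(1 + m)).

Definition rr q : R := q 0 (lshift m 0).
Definition yy q : 'rV[R]_m := rsubmx q.
(** Polar coordinates with a chart of the boundary: a coordinate system on the end that need not
    belong to the atlas of [M]. *)
Definition Phi a q : M := cmap (rr q, param a (yy q)).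
Definition Vend a : set 'rV[R]_(1 + m) := [set q | R0 < rr q /\ img a (yy q)].
(** The metric of the end is [dr^2 + r^2 Ktan]. *)
Definition Ktan a q : 'M[R]_m :=
  metric a (yy q) + rr q `^ (- (2 * sigma)) *: cerr (rr q) a (yy q).
Definition Gend a q : 'M[R]_(1 + m) := block_mx 1%:M 0 0 (rr q ^+ 2 *: Ktan a q).

Lemma R0_gt0 : 0 < R0.
Proof. exact: lt_trans ltr01 (conic_radius_gt1 X). Qed.

Lemma rowE_ q : row_mx (const_mx (rr q) : 'rV[R]_1) (yy q) = q.
Proof. exact: (rcons_rowK q). Qed.

Lemma rr_row (r : R) (y : 'rV[R]_m) : rr (row_mx (const_mx r) y) = r.
Proof. by rewrite /rr row_mxEl mxE. Qed.

Lemma yy_row (r : R) (y : 'rV[R]_m) : yy (row_mx (const_mx r) y) = y.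
Proof. by rewrite /yy row_mxKr. Qed.

Lemma Phi_cyl a q : Phi a q = (cmap \o param (a : index (cyl_atlas (charts N)))) q.
Proof. by rewrite /Phi /= /rr mxE. Qed.

Lemma yy_continuous : continuous yy.
Proof.
move=> q; apply: rV_continuous => l.
rewrite (_ : (fun y => _) = (fun y : 'rV[R]_(1 + m) => y 0 (rshift 1 l))).
  exact: coord_continuous.
by apply/funext => p; rewrite mxE.
Qed.

Lemma rr_continuous : continuous rr.
Proof. by move=> q; exact: coord_continuous. Qed.

Lemma Vend_open a : open (Vend a).
Proof.
rewrite (_ : Vend a = rr @^-1` [set t | R0 < t] `&` yy @^-1` img a)//; apply: openI.
  by apply: open_comp => [q _|]; [exact: rr_continuous|exact: open_gt].
apply: open_comp => [q _|]; first exact: yy_continuous.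
exact: (img_open (chartM a)).
Qed.

Lemma Phi_continuous a q : Vend a q -> {for q, continuous (Phi a)}.
Proof.
move=> [rq iq].
have c1 : (fun p => (rr p, param a (yy p))) @ q --> (rr q, param a (yy q)).
  apply: (@cvg_pair _ _ _ (nbhs q) (nbhs (rr q)) (nbhs (param a (yy q))) _ _ _ rr (fun p => param a (yy p))).
    exact: rr_continuous.
  apply: (@continuous_comp _ _ _ yy (param a)); first exact: yy_continuous.
  exact: (param_continuous (chartM a) iq).
exact: (@continuous_comp _ _ _ (fun p => (rr p, param a (yy p))) (cmap) q c1
  ((conic_map_smooth X).1 (_, _) rq)).
Qed.

Implicit Types (i : index (charts M)).
Definition Vdom a (i : index (charts M)) := Vend a `&` [set q | dom i (Phi a q)].

Lemma Vdom_open a i : open (Vdom a i).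
Proof.
rewrite openE => q [Vq dq]; apply: filterI; first by apply: nbhs_of_open => //; exact: Vend_open.
apply: (Phi_continuous Vq); apply: nbhs_of_open => //; exact: (dom_open (chartM i)).
Qed.

Lemma Phi_chart_Coo a i l : Coo e_ (Vdom a i) (fun q => chart i (Phi a q) 0 l).
Proof.
have h := @proj2 _ _ (conic_map_smooth X) (a : index (cyl_atlas (charts N))) i.
apply: (@smooth_on_coord _ _ _ _ _ (fun q => chart i (Phi a q)) 0 l (@Vdom_open a i)).
move=> s q [[rq iq] dq].
have e : (fun q => chart i (Phi a q)) = chart i \o cmap \o
    param (a : index (cyl_atlas (charts N))).
  by apply/funext => p /=; rewrite Phi_cyl.
rewrite e; apply: h; exists (rr q, param a (yy q)).
  split; last exact: dq.
  by split => //=; exact: (paramK iq).2.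
by rewrite /= (paramK iq).1 rowE_.
Qed.

Lemma Gend_pullback a i q : Vdom a i q ->
  Gend a q = 'J (fun q => chart i (Phi a q)) q *m metric i (chart i (Phi a q)) *m
     ('J (fun q => chart i (Phi a q)) q)^T.
Proof.
move=> [[rq iq] dq]; have := conic_metric rq iq dq; rewrite rowE_ => h.
rewrite /Gend /Ktan -h /pullback.
have e : (fun q => chart i (Phi a q)) = chart i \o cmap \o
    param (a : index (cyl_atlas (charts N))).
  by apply/funext => p /=; rewrite Phi_cyl.
by rewrite -e.
Qed.

Lemma w_Phi a q : Vend a q -> w (Phi a q) = rr q.
Proof.
move=> [rq iq]; have [_ h _] := hw; have [h1 h2] := @conic_mapP _ _ _ _ X (rr q, param a (yy q)) rq.
by rewrite (h _ h1) h2.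
Qed.

Lemma end_param x : ~ conic_core X x -> exists a q, [/\ Vend a q, Phi a q = x & rr q = w x].
Proof.
move=> nc; have [_ h _] := hw; have [h1 h2] := conic_polarP nc.
pose a := cidx (conic_polar X x).2; have da := cidxP (conic_polar X x).2.
exists a, (row_mx (const_mx (conic_polar X x).1) (chart a (conic_polar X x).2)).
rewrite /Vend /Phi /= rr_row yy_row (chartK (chartM a))//; split; last by rewrite h.
  by split => //; exists (conic_polar X x).2.
by rewrite -[RHS]h2; congr cmap; case: (conic_polar X x).
Qed.

Lemma grad_Phi a i (u : M -> R) q : sm u -> Vdom a i q ->
  grad (u \o Phi a) q = grad (u \o param i) (chart i (Phi a q)) *m
    ('J (fun q => chart i (Phi a q)) q)^T.
Proof.
move=> su Vq; have oV := @Vdom_open a i.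
rewrite -(grad_pullback (U := Vdom a i) (W := img i) oV Vq (img_open (chartM i))).
- apply/rowP => k; rewrite !mxE; apply: (pd_eq k oV Vq) => p /set_mem[_ dp] /=.
  by rewrite (chartK (chartM i)).
- by exists (Phi a q) => //; exact: Vq.2.
- by move=> l; exact: Phi_chart_Coo.
- exact: sm_param.
Qed.

Lemma sm_Phi a (u : M -> R) k : sm u -> Ck e_ k (Vend a) (u \o Phi a).
Proof.
move=> su; apply: Ck_local => q Vq; pose i := cidx (Phi a q).
exists (Vdom a i); first by split => //; exact: cidxP.
apply: (Ck_eq (f := fun q => (u \o param i) (chart i (Phi a q)))).
- exact: Vdom_open.
- by move=> p /set_mem[_ dp] /=; rewrite (chartK (chartM i)).
apply: (@Ck_comp _ _ _ _ _ _ (Vdom a i) (img i)).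
- exact: Vdom_open.
- exact: (img_open (chartM i)).
- by move=> p [_ dp]; exists (Phi a p).
- by move=> l; exact: Phi_chart_Coo.
- exact: sm_param.
Qed.

Lemma Gam_Phi a (f h : M -> R) q : sm f -> sm h -> Vend a q -> Gend a q \in unitmx ->
  Gam f h (Phi a q) = gam (Gend a) (f \o Phi a) (h \o Phi a) q.
Proof.
move=> sf sh Vq uG; set i := cidx (Phi a q).
have Vi : Vdom a i q by split => //; exact: cidxP.
rewrite /gam (grad_Phi sf Vi) (grad_Phi sh Vi) (Gend_pullback Vi) gdot_transfer//.
by rewrite -(Gend_pullback Vi).
Qed.

(** Joint smoothness in [(r, y)] is read off the smooth extension in the variable [s = 1 / r]. *)
Lemma error_Coo a (i j : 'I_m) : Coo e_ (Vend a) (fun q => cerr (rr q) a (yy q) i j).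
Proof.
move=> k; have [W [F [oW hW sF hF]]] := conic_error_smooth a.
pose T q : 'rV[R]_(1 + m) := row_mx (const_mx (rr q)^-1) (yy q).
have Rp := R0_gt0.
have rp q : Vend a q -> 0 < rr q by move=> [h _]; exact: lt_trans h.
apply: (Ck_eq (f := fun q => F (T q) i j)).
- exact: Vend_open.
- move=> q /set_mem Vq; have [rq iq] := Vq.
  rewrite hF ?invrK// invr_gt0 rp//= ltf_pV2// posrE rp//.
apply: (@Ck_comp _ _ _ _ _ k (Vend a) W T (fun z => F z i j)).
- exact: Vend_open.
- exact: oW.
- move=> q Vq; have [rq iq] := Vq; apply: hW => //.
  by rewrite invr_ge0 (ltW (rp q Vq))/= lef_pV2 ?posrE ?rp// ltW.
- move=> l; case: (split_ordP l) => l' ->.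
    rewrite (_ : (fun q => _) = (fun q => (rr q)^-1)); last first.
      by apply/funext => q; rewrite /T row_mxEl mxE.
    apply: (@Ck_comp1 _ _ _ _ k (Vend a) [set t | t != 0] rr (fun t => t^-1)).
    + exact: Vend_open.
    + by move=> q Vq /=; rewrite gt_eqF// rp.
    + exact: Ck_coord.
    + exact: Ck1_inv.
  rewrite (_ : (fun q => _) = (fun q : 'rV[R]_(1 + m) => q 0 (rshift 1 l'))); last first.
    by apply/funext => q; rewrite /T row_mxEr mxE.
  exact: Ck_coord.
- exact: (@smooth_on_coord _ _ _ _ _ F i j oW sF).
Qed.

Definition err_r a q : 'M[R]_m := derive1 (fun t => cerr t a (yy q)) (rr q).

Lemma err_pd a (i j : 'I_m) q : Vend a q ->
  pd (lshift m 0) (fun q => cerr (rr q) a (yy q) i j) q = err_r a q i j.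
Proof.
move=> Vq; have hd := Ck_pdP (lshift m 0) (error_Coo a i j 1%N) Vq.
set e0 : 'rV[R]_(1 + m) := delta_mx 0 (lshift m 0) in hd.
have hline k l : is_derive (rr q) (1 : R) (fun t => cerr t a (yy q) k l)
    (pd (lshift m 0) (fun q => cerr (rr q) a (yy q) k l) q).
  have hkl := Ck_pdP (lshift m 0) (error_Coo a k l 1%N) Vq.
  have e : q = (q - rr q *: e0) + rr q *: e0 by rewrite subrK.
  rewrite [in X in is_derive X _ _ _]e in hkl.
  move/is_derive_lineP : hkl; congr is_derive; apply/funext => t.
  congr (cerr _ _ _ _ _); first by rewrite /rr !mxE !eqxx /=; ring.
  by apply/rowP => z; rewrite !mxE eq_rlshift andbF /=; ring.
have dM : derivable (fun t => cerr t a (yy q)) (rr q) 1.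
  by apply/derivable_mxP => k l; have [] := hline k l.
rewrite /err_r derive1E derive_mx// mxE; have [_ ->] := hline i j.
by [].
Qed.

Definition Ktan' a q : 'M[R]_m :=
  (- (2 * sigma) * rr q `^ (- (2 * sigma) - 1)) *: cerr (rr q) a (yy q) +
  rr q `^ (- (2 * sigma)) *: err_r a q.

Lemma rr_gt0 a q : Vend a q -> 0 < rr q.
Proof. by move=> [h _]; exact: lt_trans R0_gt0 h. Qed.

Lemma pd_rr k q : pd k rr q = (k == lshift m 0)%:R.
Proof.
by apply: pd_val; apply: is_derive_affine => z t; rewrite /rr !mxE eqxx eq_sym.
Qed.

Lemma metric_yy_Coo a (i j : 'I_m) : Coo e_ (Vend a) (fun q => metric a (yy q) i j).
Proof.
move=> k; apply: (@Ck_comp _ _ _ _ _ k (Vend a) (img a) yy (fun y => metric a y i j)).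
- exact: Vend_open.
- exact: (img_open (chartM a)).
- by move=> q [].
- move=> l; rewrite (_ : (fun q => _) = (fun q : 'rV[R]_(1 + m) => q 0 (rshift 1 l))).
    exact: Ck_coord.
  by apply/funext => q; rewrite mxE.
- exact: metric_Coo.
Qed.

Lemma metric_yy_pd a (i j : 'I_m) q : pd (lshift m 0) (fun q => metric a (yy q) i j) q = 0.
Proof.
apply: pd_val; apply: is_derive_affine => z t; rewrite mulr0 addr0; congr (metric a _ i j).
by apply/rowP => l; rewrite !mxE eq_rlshift andbF /= mulr0 addr0.
Qed.

Lemma rr_powR_Coo a p k : Ck e_ k (Vend a) (fun q => rr q `^ p).
Proof.
apply: (@Ck_comp1 _ _ _ _ k (Vend a) [set t | 0 < t] rr (fun t => t `^ p)).
- exact: Vend_open.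
- exact: rr_gt0.
- exact: Ck_coord.
- exact: Ck1_powR.
Qed.

Lemma Ktan_Coo a (i j : 'I_m) : Coo e_ (Vend a) (fun q => Ktan a q i j).
Proof.
move=> k; have oV := @Vend_open a.
apply: (Ck_eq (f := fun q => metric a (yy q) i j + rr q `^ (- (2 * sigma)) * cerr (rr q) a (yy q) i j)) => //.
  by move=> q _; rewrite !mxE.
apply: CkD => //; first exact: metric_yy_Coo.
by apply: CkM => //; [exact: rr_powR_Coo|exact: error_Coo].
Qed.

Lemma Gend_Coo a k (i j : 'I_(1 + m)) : Ck e_ k (Vend a) (fun q => Gend a q i j).
Proof.
have oV := @Vend_open a.
case: (split_ordP i) => i' ->; case: (split_ordP j) => j' ->.
- by apply: (Ck_eq (f := fun=> (1%:M : 'M[R]_1) i' j')) => //; [move=> q _; rewrite block_mxEul|exact: Ck_cst].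
- by apply: (Ck_eq (f := fun=> 0)) => //; [move=> q _; rewrite block_mxEur mxE|exact: Ck_cst].
- by apply: (Ck_eq (f := fun=> 0)) => //; [move=> q _; rewrite block_mxEdl mxE|exact: Ck_cst].
- apply: (Ck_eq (f := fun q => (rr q * rr q) * Ktan a q i' j')) => //.
    by move=> q _; rewrite block_mxEdr [RHS]mxE expr2.
  by do 2?apply: CkM => //; [exact: Ck_coord|exact: Ck_coord|exact: Ktan_Coo].
Qed.

Definition Gend' a q : 'M[R]_(1 + m) :=
  block_mx 0 0 0 ((2 * rr q) *: Ktan a q + rr q ^+ 2 *: Ktan' a q).

Lemma Gend_pd a q (i j : 'I_(1 + m)) : Vend a q ->
  pd (lshift m 0) (fun q => Gend a q i j) q = Gend' a q i j.
Proof.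
move=> Vq; have oV := @Vend_open a.
case: (split_ordP i) => i' ->; case: (split_ordP j) => j' ->.
- rewrite (pd_eq _ (g := fun=> (1%:M : 'M[R]_1) i' j') oV Vq); last by move=> p _; rewrite block_mxEul.
  by rewrite pd_cst block_mxEul mxE.
- rewrite (pd_eq _ (g := fun=> 0) oV Vq); last by move=> p _; rewrite block_mxEur mxE.
  by rewrite pd_cst block_mxEur mxE.
- rewrite (pd_eq _ (g := fun=> 0) oV Vq); last by move=> p _; rewrite block_mxEdl mxE.
  by rewrite pd_cst block_mxEdl mxE.
rewrite (pd_eq _ (g := fun q => (rr q * rr q) * (metric a (yy q) i' j' +
    rr q `^ (- (2 * sigma)) * cerr (rr q) a (yy q) i' j')) oV Vq); last first.
  by move=> p _; rewrite block_mxEdr !mxE expr2.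
have d1 : is_derive q (delta_mx 0 (lshift m 0)) rr 1.
  have := Ck_pdP (lshift m 0) (Ck_coord (n := 1 + m) (R := R) 1 (Vend a) (lshift m 0)) Vq.
  by rewrite pd_rr eqxx.
have d2 := Ck_pdP (lshift m 0) (metric_yy_Coo a i' j' 1%N) Vq.
have d3 := Ck_pdP (lshift m 0) (error_Coo a i' j' 1%N) Vq.
have d4 := is_derive_comp1 d1 (is_derive1_powR (- (2 * sigma)) (rr_gt0 Vq)).
rewrite metric_yy_pd in d2; rewrite (err_pd i' j' Vq) in d3.
rewrite (pd_val (is_deriveMp (is_deriveMp d1 d1) (is_deriveDp d2 (is_deriveMp d4 d3)))).
rewrite block_mxEdr !mxE; by ring.
Qed.

(** Beyond [R1] the error is at most half of the boundary metric, so [Ktan] is positive definite and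
    comparable with it. In its radial derivative the power [r^(-1-2 sigma)] comes once from
    differentiating [r^(-2 sigma)] and once from the decay of the derivative of the error. *)
Lemma end_bounds : exists R1 C : R, [/\ R0 < R1, 0 <= C &
  forall a q, Vend a q -> R1 < rr q -> [/\ posdef (Ktan a q), posdef (Gend a q) &
    forall v : 'rV[R]_m, `|(v *m Ktan' a q *m v^T) 0 0| <=
      C * rr q `^ (- 1 - 2 * sigma) * (v *m Ktan a q *m v^T) 0 0]].
Proof.
have [C0 hC0] := conic_error_bound X; pose C := `|C0|.
have Cp : 0 <= C := normr_ge0 _.
have sp : 0 < 2 * sigma by rewrite mulr_gt0.
have hC a q : Vend a q -> tensor_norm (metric a (yy q)) (cerr (rr q) a (yy q)) <= C /\
    tensor_norm (metric a (yy q)) (err_r a q) <= C / rr q.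
  move=> Vq; have [rq iq] := Vq; have rp := rr_gt0 Vq; have := hC0 a _ _ rq iq.
  rewrite -/(err_r a q) => h; have hh := le_trans h (ler_norm C0).
  have n1 := sqrtr_ge0 (tensor_dot (metric a (yy q)) (cerr (rr q) a (yy q)) (cerr (rr q) a (yy q))).
  have n2 : 0 <= tensor_norm (metric a (yy q)) (err_r a q) := sqrtr_ge0 _.
  have n3 : 0 <= cov_deriv_norm (metric a) (cerr (rr q) a) (yy q) := sqrtr_ge0 _.
  have n2' := mulr_ge0 (ltW rp) n2; rewrite -/(tensor_norm _ _) in n1.
  split; first by rewrite /C; move: n1 n2' n3 hh; lra.
  by rewrite ler_pdivlMr// mulrC /C; move: n1 n2' n3 hh; lra.
pose D := m%:R * C; have Dp : 0 <= D by rewrite mulr_ge0.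
(* Chosen so that [r^(2 sigma) >= 2 D + 1] beyond [R1], which gives [r^(-2 sigma) D <= 1/2]. *)
pose R1 := Num.max (R0 + 1) ((2 * D + 1) `^ (2 * sigma)^-1).
have R1p : 0 < R1 by rewrite lt_max addr_gt0 ?R0_gt0.
exists R1, (2 * (2 * sigma * D + D)); split.
- by rewrite lt_max ltrDl ltr01.
- by rewrite mulr_ge0// addr_ge0// mulr_ge0// ltW.
move=> a q Vq R1q; have [rq iq] := Vq; have rp := rr_gt0 Vq.
have [c1 c2] := hC a q Vq; have ph := metric_posdef iq.
pose h := metric a (yy q); pose r := rr q.
have small : r `^ (- (2 * sigma)) * D <= 2^-1.
  have h1 : 2 * D + 1 <= r `^ (2 * sigma).
    have R1r : (2 * D + 1) `^ (2 * sigma)^-1 <= r.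
      by apply: le_trans (ltW R1q); rewrite le_max lexx orbT.
    have := @ge0_ler_powR R (2 * sigma) (ltW sp) _ _ _ _ R1r.
    rewrite !nnegrE powR_ge0 (ltW rp) -powRrM mulVf ?gt_eqF// powRr1; last by rewrite addr_ge0// mulr_ge0.
    exact.
  rewrite powRN mulrC ler_pdivrMr ?powR_gt0//.
  by move: h1; move: (r `^ _) => z; lra.
have pp (p : R) : 0 <= r `^ p by exact: powR_ge0.
have f1 (v : 'rV[R]_m) := tensor_form v ph c1.
have f2 (v : 'rV[R]_m) := tensor_form v ph c2.
have hv0 (v : 'rV[R]_m) : 0 <= (v *m h *m v^T) 0 0.
  by have [->|/(ph.2)/ltW//] := eqVneq v 0; rewrite !mul0mx mxE.
(* The symmetry of the perturbed metric is inherited from the metric of [M] through the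
   pull-back. *)
have Gs : (Gend a q)^T = Gend a q.
  have Vi : Vdom a (cidx (Phi a q)) q by split => //; exact: cidxP.
  rewrite (Gend_pullback Vi) !trmx_mul trmxK mulmxA; congr (_ *m _ *m _).
  by apply: (metric_posdef _).1; exists (Phi a q) => //; exact: cidxP.
have Ks : (Ktan a q)^T = Ktan a q.
  move: Gs; rewrite /Gend tr_block_mx => /eq_block_mx[_ _ _].
  rewrite linearZ /= => /(congr1 (fun A => (rr q ^+ 2)^-1 *: A)).
  by rewrite !scalerA mulVf ?scale1r// gt_eqF// exprn_gt0.
have [pK pK2] : posdef (Ktan a q) /\ forall v : 'rV[R]_m,
    (v *m h *m v^T) 0 0 <= 2 * (v *m Ktan a q *m v^T) 0 0.
  apply: posdef_perturb => // v.
  rewrite -scalemxAr -scalemxAl mx11Z normrM ger0_norm ?powR_ge0//.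
  apply: le_trans (ler_wpM2l (pp _) (f1 v)) _.
  by rewrite mulrA ler_wpM2r.
split => //.
  split => // v v0; rewrite -[v](@hsubmxK _ 1 1 m) /Gend.
  set v1 := lsubmx _; set v2 := rsubmx _.
  rewrite (mul_row_block v1 v2) !mulmx0 addr0 add0r mulmx1 (tr_row_mx v1 v2).
  rewrite (mul_row_col v1) mx11D -scalemxAr -scalemxAl mx11Z.
  have [z2|nz2] := eqVneq v2 0.
    have -> : (v2 *m Ktan a q *m v2^T) 0 0 = 0 by rewrite z2 !mul0mx mxE.
    rewrite mulr0 addr0 lt_neqAle sqnorm_ge0 andbT eq_sym.
    apply: contraNneq v0 => /sqnorm_eq0 z1.
    by rewrite -[v](@hsubmxK _ 1 1 m) -/v1 -/v2 z1 z2 row_mx0.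
  by rewrite ltr_wpDl ?sqnorm_ge0// mulr_gt0 ?exprn_gt0//; exact: pK.2.
move=> v; rewrite /Ktan' mulmxDr mulmxDl mx11D -!scalemxAr -!scalemxAl !mx11Z.
apply: le_trans (ler_normD _ _) _; rewrite !normrM normrN.
rewrite [`|2 * sigma|]gtr0_norm// ![`|_ `^ _|]ger0_norm ?powR_ge0//.
have e1 : r `^ (- (2 * sigma) - 1) = r `^ (- 1 - 2 * sigma) by congr powR; ring.
have e2 : r `^ (- (2 * sigma)) / r = r `^ (- 1 - 2 * sigma).
  rewrite -e1 powRD; last by rewrite (gt_eqF rp) implybT.
  by rewrite [r `^ (- 1)]powRN powRr1 ?ltW.
rewrite -/r e1; have pz := pp (- 1 - 2 * sigma).
have g1 : 2 * sigma * r `^ (- 1 - 2 * sigma) * `|(v *m cerr r a (yy q) *m v^T) 0 0| <=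
   2 * sigma * D * (r `^ (- 1 - 2 * sigma) * (v *m h *m v^T) 0 0).
  apply: le_trans (ler_wpM2l (mulr_ge0 (ltW sp) pz) (f1 v)) _.
  by apply: le_of_eq; rewrite /D -/h; ring.
have g2 : r `^ (- (2 * sigma)) * `|(v *m err_r a q *m v^T) 0 0| <=
   D * (r `^ (- 1 - 2 * sigma) * (v *m h *m v^T) 0 0).
  apply: le_trans (ler_wpM2l (pp _) (f2 v)) _; rewrite -e2; apply: le_of_eq.
  by rewrite /D -/h -/r; ring.
apply: le_trans (lerD g1 g2) _; rewrite -mulrDl.
have g3 := ler_wpM2l pz (pK2 v).
have Dq : 0 <= 2 * sigma * D + D by rewrite addr_ge0// mulr_ge0// ltW.
apply: le_trans (ler_wpM2l Dq g3) _.
by apply: le_of_eq; ring.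
Qed.

End EndGeometry.

(** * Gradient, Hessian and Laplacian of the radial weight *)

Section EndGeometry2.
Context {R : realType} {m : nat} {sigma : R} (s0 : 0 < sigma) (M : riemannian_manifold R m.+1)
  (X : asymptotically_conic sigma M) (w : M -> R) (hw : is_weight X w)
  (mu : {measure set (borel M) -> \bar R}) (hmu : riemannian_measure mu).
Notation N := (conic_boundary X).
Notation R0 := (conic_radius X).
Notation e_ := (fun j => delta_mx 0 j).
Notation l0 := (lshift m 0 : 'I_(1 + m)).
Implicit Types (a : index (charts N)) (q : 'rV[R]_(1 + m)).

Lemma sm_w : sm w.
Proof. by apply/smO_smooth_fun; have [] := hw. Qed.

Section Fixed.
Variables (R1 : R) (a : index (charts N)).
Hypotheses (pK : forall q, Vend a q -> R1 < rr q -> posdef (Ktan a q))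
  (pG : forall q, Vend a q -> R1 < rr q -> posdef (Gend a q)).
Let V1 := Vend a `&` [set q | R1 < rr q].
Let G := Gend a.
Let wP : 'rV[R]_(1 + m) -> R := w \o Phi a.
Let B q := invmx (rr q ^+ 2 *: Ktan a q).

Lemma V1_open : open V1.
Proof.
apply: openI; first exact: Vend_open.
rewrite (_ : [set q | R1 < rr q] = rr @^-1` [set t : R | R1 < t])//.
by apply: open_comp => [q _|]; [exact: rr_continuous|exact: open_gt].
Qed.

Let oV := V1_open.
Let pGV q : V1 q -> posdef (G q). Proof. by move=> [h1 h2]; exact: pG. Qed.
Let sGV k (i j : 'I_(1 + m)) : Ck e_ k V1 (fun p => G p i j).
Proof. by apply: Ck_subset (Gend_Coo a k i j) => q []. Qed.
Let hGV : forall f h : M -> R, sm f -> sm h -> forall q, V1 q ->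
  Gam f h (Phi a q) = gam G (f \o Phi a) (h \o Phi a) q.
Proof.
by move=> f h sf sh q Vq; apply: Gam_Phi => //; [exact: Vq.1|apply: posdef_unit; exact: pGV].
Qed.

Lemma invGend q : V1 q -> invmx (G q) = block_mx 1%:M 0 0 (B q).
Proof.
by move=> Vq; rewrite /G /Gend invmx_block_diag ?invmx1//; exact: posdef_unit (pGV Vq).
Qed.

Lemma wPE : {in V1, wP =1 rr}.
Proof. by move=> q /set_mem[Vq _]; exact: w_Phi. Qed.

Lemma pd_wP k q : V1 q -> pd k wP q = (k == l0)%:R.
Proof. by move=> Vq; rewrite (pd_eq k oV Vq wPE) pd_rr. Qed.

Lemma gv_wP l q : V1 q -> gv G wP l q = (l == l0)%:R.
Proof.
move=> Vq; rewrite /gv (bigD1 l0)//= big1 ?addr0; last first.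
  by move=> k /negbTE kl; rewrite pd_wP// kl mulr0.
rewrite pd_wP// eqxx mulr1 invGend//.
case: (split_ordP l) => l' ->.
  by rewrite block_mxEul mxE (ord1 l') !eqxx.
by rewrite block_mxEdl mxE eq_rlshift.
Qed.

Lemma pd_inv q : V1 q -> \matrix_(i, j) pd l0 (fun q => invmx (G q) i j) q =
  - (invmx (G q) *m Gend' a q *m invmx (G q)).
Proof.
move=> Vq; have uG := posdef_unit (pGV Vq); set D := \matrix_(i, j) _.
have h : Gend' a q *m invmx (G q) + G q *m D = 0.
  apply/matrixP => i j.
  have := pd_sum (U := V1) l0 Vq (fun l => sGV 1 i l) (fun l => Ck_ginv oV sGV pGV 1 l j).
  rewrite (pd_eq l0 (g := fun=> (i == j)%:R) oV Vq); last first.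
    move=> p /set_mem Vp; transitivity ((G p *m invmx (G p)) i j); first by rewrite mxE.
    by rewrite mulmxV ?mxE//; exact: posdef_unit (pGV Vp).
  rewrite pd_cst big_split /= => h; rewrite !mxE [RHS]h; congr (_ + _).
    by apply: eq_bigr => l _; rewrite -(Gend_pd i l Vq.1).
  by apply: eq_bigr => l _; rewrite [D _ _]mxE.
have -> : D = invmx (G q) *m (G q *m D) by rewrite mulmxA mulVmx// mul1mx.
have -> : G q *m D = - (Gend' a q *m invmx (G q)).
  by apply/eqP; rewrite -addr_eq0 addrC h.
by rewrite mulmxN mulmxA.
Qed.

(** The raised gradient of [w] is the constant field d/dr, so only the derivative of the inverse
    metric contributes. *)
Lemma HT_wP q : V1 q -> \matrix_(i, j) HT G wP q i j =
  2^-1 *: (invmx (G q) *m Gend' a q *m invmx (G q)).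
Proof.
move=> Vq; have := pd_inv Vq => /(congr1 (fun A => - 2^-1 *: A)).
rewrite scalerN -scaleNr opprK => <-; apply/matrixP => i j; rewrite !mxE /HT.
rewrite big1 ?sub0r; last first.
  move=> k _; rewrite (pd_eq k (g := fun=> (j == l0)%:R) oV Vq) ?pd_cst ?mulr0//.
  by move=> p /set_mem; exact: gv_wP.
rewrite (bigD1 l0)//= big1 ?addr0; last first.
  by move=> k /negbTE kl; rewrite gv_wP// kl mul0r.
by rewrite gv_wP// eqxx mul1r mulNr.
Qed.

Lemma Ck_wP k : Ck e_ k V1 wP.
Proof. by apply: Ck_subset (sm_Phi a k sm_w) => q []. Qed.

(** Half the radial derivative of [r^2 Ktan] is [r Ktan + r^2 Ktan' / 2]. The first term makes the
    Hessian of [w] equal to [1 / r] times the tangential metric, with trace [m / r]; the second is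
    the error measured by [d]. *)
Lemma V1_geometry (d : R) q : V1 q ->
  (forall v : 'rV[R]_m, `|(v *m Ktan' a q *m v^T) 0 0| <= d * (v *m Ktan a q *m v^T) 0 0) ->
  let x := Phi a q in
  [/\ Gam w w x = 1,
    forall u, sm u -> `|Hs w u x - (rr q)^-1 * (Gam u u x - Gam w u x ^+ 2)| <=
       d * (Gam u u x - Gam w u x ^+ 2) &
    `|Lap w x - m%:R / rr q| <= m%:R * d].
Proof.
move=> Vq hd x; have rp : 0 < rr q by exact: rr_gt0 Vq.1.
have uG := posdef_unit (pGV Vq).
have uA : rr q ^+ 2 *: Ktan a q \in unitmx.
  by have := uG; rewrite /G /Gend block_diag_mx_unit => /andP[].
have gw : grad wP q = row_mx 1%:M 0.
  apply/rowP => k; rewrite mxE pd_wP//; case: (split_ordP k) => k' ->.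
    by rewrite row_mxEl mxE (ord1 k') !eqxx.
  by rewrite row_mxEr mxE eq_rlshift.
have wG : row_mx 1%:M 0 *m invmx (G q) = row_mx (1%:M : 'M[R]_1) 0.
  by rewrite invGend// (mul_row_block 1%:M 0) !mulmx0 mul0mx mulmx1 !addr0.
have Bs : (B q)^T = B q.
  rewrite /B -invmx_tr linearZ /=; congr (invmx (_ *: _)); exact: (pK Vq.1 Vq.2).1.
split.
- rewrite (hGV sm_w sm_w Vq) /gam -/wP gw /gdot wG (tr_row_mx 1%:M) (mul_row_col 1%:M).
  by rewrite mul0mx addr0 mul1mx !mxE eqxx.
- move=> u su; rewrite /x (Hs_coord oV hGV Vq sm_w su) !hGV//; last exact: sm_w.
  have cu k : Ck e_ k V1 (u \o Phi a) by apply: Ck_subset (sm_Phi a k su) => p [].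
  rewrite (hess_formula oV sGV pGV Vq (Ck_wP 2) (cu 2%N)) -/wP.
  pose xi : 'rV[R]_(1 + m) := grad (u \o Phi a) q.
  have -> : \sum_i \sum_j HT G wP q i j * (pd i (u \o Phi a) q * pd j (u \o Phi a) q) =
     2^-1 * (xi *m (invmx (G q) *m Gend' a q *m invmx (G q)) *m xi^T) 0 0.
    rewrite -mx11Z scalemxAl scalemxAr -(HT_wP Vq) formE.
    by apply: eq_bigr => i _; apply: eq_bigr => j _; rewrite mxE [xi 0 i]mxE [xi 0 j]mxE.
  (* Radial and tangential parts of the covector; [S] below is the tangential square
     [Gam u u - Gam w u ^+ 2]. *)
  pose z : 'M[R]_1 := lsubmx xi; pose eta : 'rV[R]_m := rsubmx xi.
  have exi : xi = row_mx z eta by rewrite hsubmxK.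
  have xG : xi *m invmx (G q) = row_mx z (eta *m B q).
    by rewrite invGend// exi (mul_row_block z eta) !mulmx0 mulmx1 addr0 add0r.
  have Gx : invmx (G q) *m xi^T = (row_mx z (eta *m B q))^T.
    have := congr1 trmx xG; rewrite trmx_mul -invmx_tr; rewrite (pGV Vq).1 => <-.
    by [].
  have gwu : gam G wP (u \o Phi a) q = z 0 0.
    rewrite /gam gw /gdot wG -/xi exi (tr_row_mx z) (mul_row_col 1%:M) mul0mx addr0 mul1mx.
    by rewrite mxE.
  pose S := (eta *m B q *m eta^T) 0 0.
  have guu : gam G (u \o Phi a) (u \o Phi a) q = z 0 0 ^+ 2 + S.
    rewrite /gam /gdot -/xi xG exi (tr_row_mx z) (mul_row_col z) mx11D -/S; congr (_ + _).
    by rewrite mxE big_ord1 [_^T _ _]mxE expr2.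
  rewrite guu gwu [_ + S]addrC addrK.
  pose v := eta *m B q.
  have vT : v^T = B q *m eta^T by rewrite /v trmx_mul Bs.
  have vK : rr q ^+ 2 * (v *m Ktan a q *m v^T) 0 0 = S.
    by rewrite -mx11Z scalemxAl scalemxAr vT mulmxA -/S /v -(mulmxA eta) mulVmx// mulmx1.
  have -> : (xi *m (invmx (G q) *m Gend' a q *m invmx (G q)) *m xi^T) 0 0 =
     2 * rr q * (v *m Ktan a q *m v^T) 0 0 + rr q ^+ 2 * (v *m Ktan' a q *m v^T) 0 0.
    rewrite !mulmxA xG -mulmxA Gx /Gend' (mul_row_block z) !mulmx0 !addr0 add0r.
    rewrite (tr_row_mx z) (mul_row_col 0) mul0mx add0r -/v mulmxDr mulmxDl mx11D.
    by rewrite -!scalemxAr -!scalemxAl !mx11Z.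
  have -> : 2^-1 * (2 * rr q * (v *m Ktan a q *m v^T) 0 0 + rr q ^+ 2 * (v *m Ktan' a q *m v^T) 0 0)
     - (rr q)^-1 * S = 2^-1 * rr q ^+ 2 * (v *m Ktan' a q *m v^T) 0 0.
    rewrite -vK; move: (_ 0 0) (_ 0 0) => s t; by field; rewrite gt_eqF.
  rewrite normrM ger0_norm; last by rewrite mulr_ge0// ?sqr_ge0.
  apply: (@le_trans _ _ (2^-1 * rr q ^+ 2 * (d * (v *m Ktan a q *m v^T) 0 0))).
    by apply: ler_wpM2l (hd v); rewrite mulr_ge0 ?sqr_ge0 ?invr_ge0.
  have S0 : 0 <= d * S.
    rewrite -vK mulrCA mulr_ge0 ?sqr_ge0//.
    exact: le_trans (normr_ge0 _) (hd v).
  have -> : 2^-1 * rr q ^+ 2 * (d * (v *m Ktan a q *m v^T) 0 0) = 2^-1 * (d * S).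
    by rewrite -vK; ring.
  by lra.
- have dx : dom (cidx x) x := cidxP x.
  have Vi : Vdom a (cidx x) q by split => //; exact: Vq.1.
  have hJ u (su : sm u) := grad_Phi su Vi.
  rewrite /x (Lap_coord hmu oV hGV sGV pGV Vq sm_w (Ck_wP 2) _ dx hJ (Gend_pullback Vi)); last first.
    by move=> u su; apply: Ck_subset (sm_Phi a 2 su) => p [].
  rewrite -/wP -/G (HT_wP Vq) -scalemxAr mxtraceZ !mulmxA mulmxV// mul1mx.
  rewrite invGend// /Gend' (@mulmx_block _ 1 m 1 m 1 m) !mul0mx !mulmx0 !add0r (@mxtrace_block _ 1 m) mxtrace0 add0r.
  have -> : B q = (rr q ^- 2) *: invmx (Ktan a q) by rewrite /B invmxZ.
  rewrite mulmxDl -!scalemxAl -!scalemxAr mulmxV; last exact: posdef_unit (pK Vq.1 Vq.2).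
  rewrite mxtraceD !mxtraceZ mxtrace1.
  have -> : 2^-1 * (2 * rr q * (rr q ^- 2 * m%:R) + rr q ^+ 2 * (rr q ^- 2 *
      \tr (Ktan' a q *m invmx (Ktan a q)))) - m%:R / rr q =
      2^-1 * \tr (Ktan' a q *m invmx (Ktan a q)).
    by move: (\tr _) => t; field; rewrite gt_eqF.
  have := form_trace (pK Vq.1 Vq.2) hd; rewrite normrM ger0_norm//.
  by move: `|_| (normr_ge0 (\tr (Ktan' a q *m invmx (Ktan a q)))) => t t0; lra.
Qed.

End Fixed.

Lemma end_geometry : exists R1 C : R, [/\ R0 < R1, 0 <= C &
  forall x, ~ conic_core X x -> R1 < w x -> [/\ Gam w w x = 1,
    forall u, sm u -> `|Hs w u x - (w x)^-1 * (Gam u u x - Gam w u x ^+ 2)| <=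
       C * w x `^ (- 1 - 2 * sigma) * (Gam u u x - Gam w u x ^+ 2) &
    `|Lap w x - m%:R / w x| <= C * w x `^ (- 1 - 2 * sigma)]].
Proof.
have [R1 [C [hR hC hb]]] := end_bounds s0 X.
(* One constant for the Hessian, which needs [C], and for the Laplacian, which needs [m C]. *)
exists R1, ((m%:R + 1) * C); split => //; first by rewrite mulr_ge0// addr_ge0.
move=> x nc wx; have [a [q [Vq ex eq]]] := end_param hw nc.
have rq : R1 < rr q by rewrite eq.
have pK p : Vend a p -> R1 < rr p -> posdef (Ktan a p) by move=> h1 h2; have [] := hb a p h1 h2.
have pG p : Vend a p -> R1 < rr p -> posdef (Gend a p) by move=> h1 h2; have [] := hb a p h1 h2.
have [_ _ hd] := hb a q Vq rq.
have [g1 g2 g3] := V1_geometry pK pG (conj Vq rq) hd.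
rewrite ex eq in g1 g2 g3; have pw := powR_ge0 (w x) (- 1 - 2 * sigma).
split => //.
  move=> u su; apply: le_trans (g2 u su) _; apply: ler_wpM2r.
    by have := Gam_cs w u x; rewrite g1 mul1r subr_ge0.
  by rewrite ler_wpM2r// mulrDl mul1r lerDr mulr_ge0.
apply: le_trans g3 _; rewrite mulrA ler_wpM2r// ler_wpM2r//.
by rewrite lerDl.
Qed.

End EndGeometry2.

(** * Carleman estimates and unique continuation *)

Lemma sqrM_ge0 {R : realDomainType} (x : R) : 0 <= x * x.
Proof. by rewrite -expr2 sqr_ge0. Qed.

Ltac pos := repeat first [assumption | done | exact: sqr_ge0 | exact: sqrM_ge0 | exact: normr_ge0
  | exact: expR_gt0 | exact: expR_ge0 | exact: powR_ge0 | (apply: ltW; assumption)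
  | apply: divr_gt0 | apply: mulr_gt0 | apply: addr_gt0 | apply: exprn_gt0
  | apply: divr_ge0 | apply: mulr_ge0 | apply: addr_ge0 | apply: exprn_ge0
  | rewrite invr_gt0 | rewrite invr_ge0 ].

Lemma der_expR {R : realType} (t : R) : der expR t = expR t.
Proof. by apply: der_val; exact: is_derive_expR. Qed.

Lemma young {R : realType} (s a b : R) : 0 < s -> - (a * b) <= (4 * s)^-1 * a ^+ 2 + s * b ^+ 2.
Proof.
move=> s0; have := mulr_ge0 (ltW s0) (sqr_ge0 ((2 * s)^-1 * a + b)).
rewrite (_ : s * ((2 * s)^-1 * a + b) ^+ 2 = (4 * s)^-1 * a ^+ 2 + a * b + s * b ^+ 2); last first.
  by field; rewrite gt_eqF.
by move: (_ * a ^+ 2) (s * _) => x y; lra.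
Qed.

Ltac sm_ := repeat lazymatch goal with
  | |- sm (Gam _ _) => apply: sm_Gam
  | |- sm (fun x => Gam _ _ x) => apply: sm_Gam
  | |- sm (Lap _) => match goal with H : riemannian_measure _ |- _ => apply: (sm_Lap H) end
  | |- sm (fun x => Lap _ x) => match goal with H : riemannian_measure _ |- _ => apply: (sm_Lap H) end
  | |- sm (fun x => - _) => apply: smN
  | |- sm (fun x => _ + _) => apply: smD
  | |- sm (fun x => _ * _) => apply: smM
  | |- sm (fun x => _ ^+ _) => apply: smX
  | |- sm (fun _ => ?c) => exact: sm_cst
  | |- sm _ => assumption
  end.

Section Carleman0.
Context {R : realType} {n : nat} (M : riemannian_manifold R n)
  (mu : {measure set (borel M) -> \bar R}) (hmu : riemannian_measure mu).
Implicit Types (f h g u v z phi : M -> R) (x : M) (K : set M).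
Notation II := (II mu).

Lemma supp_Gam K f h : closed K -> supp_in K f -> supp_in K (Gam f h).
Proof. by move=> cK f0 x nK; exact: Gam_in_out cK f0 (cidxP x) nK. Qed.

Lemma supp_Gamr K f h : closed K -> supp_in K f -> supp_in K (Gam h f).
Proof. by move=> cK f0 x nK; rewrite GamC; exact: supp_Gam nK. Qed.

Lemma supp_Lap K f : closed K -> supp_in K f -> supp_in K (Lap f).
Proof.
move=> cK f0 x nK; rewrite /Lap /Lap_in; set i := cidx x; set p := chart i x.
have oU : open (cimg i (~` K)) by apply: cimg_open; exact: closed_openC.
have Up : cimg i (~` K) p by apply: cimg_chart => //; exact: cidxP.
have z l : {in cimg i (~` K), flux (metric i) (f \o param i) l =1 cst 0}.
  move=> q /set_mem qU; rewrite /flux big1 ?mulr0// => k _.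
  rewrite (pd_eq k (g := fun=> 0) oU qU) ?pd_cst ?mulr0//.
  by move=> q' /set_mem/cimgP[_ nK'] /=; exact: f0.
rewrite lapE big1 ?mulr0// => k _.
by rewrite (pd_eq k (g := fun=> 0) oU Up (z k)) pd_cst.
Qed.

Lemma supp_Hs K h u : closed K -> supp_in K u -> supp_in K (Hs h u).
Proof.
move=> cK u0 x nK; rewrite /Hs (supp_Gam _ cK u0 nK) (supp_Gamr h cK (supp_Gam u cK u0) nK).
by rewrite mulr0 subrr.
Qed.

Opaque Gam Lap.

Lemma csX f k : cs f -> cs (fun x => f x ^+ k.+1).
Proof. by move=> [K cK f0]; exists K => // x /f0 ->; rewrite expr0n. Qed.

Lemma cs_Lap f : cs f -> cs (Lap f).
Proof. by move=> [K cK f0]; exists K => //; apply: supp_Lap => //; exact: compact_closedM. Qed.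

Lemma cont_bound f K : continuous f -> compact K ->
  exists2 B : R, 0 < B & forall x, K x -> `|f x| <= B.
Proof.
move=> cf cK; have [D [_ hD]] : bounded_set (f @` K).
  apply: compact_bounded; apply: continuous_compact => //; exact: continuous_subspaceT.
exists (`|D| + 1); first by rewrite ltr_wpDl.
by move=> x Kx; apply: (hD (`|D| + 1)); [rewrite (le_lt_trans (ler_norm _))// ltrDl|exists x].
Qed.

Lemma sm_exp f : sm f -> sm (fun x => expR (f x)).
Proof. by move=> sf; apply: (sm_comp1 (J := setT)) => // k; apply: Ck1_expR; exact: openT. Qed.

Lemma Gam_exp f h x : sm f -> Gam (fun x => expR (f x)) h x = expR (f x) * Gam f h x.
Proof.
move=> sf; rewrite (Gam_comp1 (J := setT) (a := expR))// ?der_expR// => k.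
by apply: Ck1_expR; exact: openT.
Qed.

Lemma Lap_exp f x : sm f -> Lap (fun x => expR (f x)) x = expR (f x) * (Lap f x + Gam f f x).
Proof.
move=> sf; rewrite (Lap_comp1 (J := setT) (a := expR))//; last 2 first.
- exact: openT.
- by move=> k; apply: Ck1_expR; exact: openT.
have -> : der expR = @expR R by apply/funext => t; exact: der_expR.
by rewrite der_expR mulrDr.
Qed.

(** Conjugation of the Laplacian by [exp phi]: for [u = exp phi * z] the multiplier identity for
    [P0] turns into a statement on [Lap z]. *)
Lemma conj_lap phi z x : sm phi -> sm z -> let u y := expR (phi y) * z y in
  Lap u x - 2 * Gam phi u x + (Gam phi phi x - Lap phi x) * u x = expR (phi x) * Lap z x.
Proof.
move=> sp sz u; have sE := sm_exp sp.
have -> : Gam phi u x = expR (phi x) * Gam phi z x + z x * (expR (phi x) * Gam phi phi x).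
  by rewrite GamC /u GamMl// Gam_exp// [Gam z phi x]GamC.
rewrite /u LapM// Lap_exp// Gam_exp//.
by move: (Lap z x) (Lap phi x) (Gam phi z x) (Gam phi phi x) (expR _) => *; ring.
Qed.

Lemma bcs_ind (A : set M) f : measurable (A : set (borel M)) -> bcs f ->
  bcs (fun x => \1_A x * f x).
Proof.
move=> mA; apply: bcsM; first exact: measurable_indic.
by exists 1 => x; rewrite indicE; case: (_ \in _); rewrite ?normr1 ?normr0 ?ler01.
Qed.

End Carleman0.

Ltac cs_ := lazymatch goal with
  | |- cs (Gam _ _) => first [apply: cs_Gam; cs_ | apply: cs_Gamr; cs_]
  | |- cs (fun x => Gam _ _ x) => first [apply: cs_Gam; cs_ | apply: cs_Gamr; cs_]
  | |- cs (Lap _) => apply: cs_Lap; cs_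
  | |- cs (fun x => Lap _ x) => apply: cs_Lap; cs_
  | |- cs (fun x => - _) => apply: csN; cs_
  | |- cs (fun x => _ + _) => apply: csD; cs_
  | |- cs (fun x => _ * _) => first [apply: csM; cs_ | apply: csMr; cs_]
  | |- cs (fun x => _ ^+ _) => apply: csX; cs_
  | |- cs _ => assumption
  end.

(** * Caccioppoli inequality and the interior Carleman estimate *)

Section Carleman.
Context {R : realType} {n : nat} (M : riemannian_manifold R n)
  (mu : {measure set (borel M) -> \bar R}) (hmu : riemannian_measure mu).
Implicit Types (f h g u v z phi : M -> R) (x : M) (K : set M).
Notation II := (II mu).

(** Green's identity with the test function [z^2 v]; the cross term is controlled by the
    Cauchy-Schwarz inequality for [Gam]. *)
Lemma caccioppoli z v : sm z -> cs z -> sm v ->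
  II (fun x => z x * z x * Gam v v x) <=
  II (fun x => z x * z x * (v x * v x + Lap v x * Lap v x) + 4 * (Gam z z x * (v x * v x))).
Proof.
move=> sz cz sv; have sL : sm (Lap v) by sm_.
have s1 : sm (fun x => z x * z x * v x) by sm_.
have c1 : cs (fun x => z x * z x * v x) by cs_.
have g0 := green hmu s1 c1 sv.
have b1 : bcs (fun x => z x * z x * Gam v v x) by apply: bcs_sm; [sm_|cs_].
have b2 : bcs (fun x => z x * z x * (v x * v x + Lap v x * Lap v x) + 4 * (Gam z z x * (v x * v x))).
  by apply: bcs_sm; [sm_|cs_].
have b3 : bcs (fun x => z x * z x * v x * Lap v x + Gam (fun x => z x * z x * v x) v x).
  by apply: bcs_sm; [sm_|cs_].
have e0 := IID hmu (bcsB b2 b1) (bcsZ 2 b3).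
rewrite (IIB hmu b2 b1) (IIZ hmu 2 b3) g0 mulr0 addr0 in e0.
rewrite -subr_ge0 -e0; apply: II_ge0 => x.
have szz : sm (fun x => z x * z x) by sm_.
rewrite (GamMl _ _ szz sv) (GamMl _ _ sz sz).
have cs := Gam_cs z v x; have gv := Gam_ge0 v x; have gz := Gam_ge0 z x.
move: (Gam v v x) (Gam z z x) (Gam z v x) (Lap v x) (v x) (z x) cs gv gz => V Z B l a c cs V0 Z0.
(* Times [V], this is a square plus a multiple of the Gram determinant [Z V - B^2]; for [V = 0] also
   [B = 0]. *)
have key : 0 <= c ^+ 2 * V + 4 * (c * a * B) + 4 * (Z * a ^+ 2).
  have [V00|Vp] := eqVneq V 0.
    move: cs; rewrite V00 mulr0 => B2.
    have /eqP : B ^+ 2 = 0 by apply/eqP; rewrite eq_le B2 sqr_ge0.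
    rewrite sqrf_eq0 => /eqP ->; rewrite !mulr0 !add0r.
    by rewrite mulr_ge0// mulr_ge0// sqr_ge0.
  have {V0}Vp : 0 < V by rewrite lt_neqAle eq_sym Vp.
  rewrite -(pmulr_rge0 _ Vp).
  rewrite (_ : V * _ = (c * V + 2 * a * B) ^+ 2 + 4 * a ^+ 2 * (Z * V - B ^+ 2)); last by ring.
  by rewrite addr_ge0 ?sqr_ge0// mulr_ge0 ?subr_ge0// mulr_ge0// sqr_ge0.
have := addr_ge0 (sqr_ge0 (c * (a + l))) key; congr (_ <= _).
by ring.
Qed.

Section Interior.
Variables (K : set M) (rho : M -> R) (c0 : R).
Hypotheses (cK : compact K) (srho : sm rho) (c0p : 0 < c0)
  (hrho : forall x, K x -> c0 <= Gam rho rho x).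

(** The usual convexification: exponentiating adds the square of the differential of [rho], with one
    more power of [gm] than the Hessian of [rho] carries. *)
Lemma Hs_exp (gm : R) u x : sm u -> let psi y := expR (gm * rho y) in
  Hs psi u x = gm * psi x * Hs rho u x + gm ^+ 2 * psi x * Gam rho u x ^+ 2.
Proof.
move=> su psi; have sgr : sm (fun y => gm * rho y) by sm_.
have spsi : sm psi by exact: sm_exp.
have e v : (fun y => Gam psi v y) = (fun y => (gm * psi y) * Gam rho v y).
  by apply/funext => y; rewrite Gam_exp// GamZl// mulrCA mulrA.
have sgp : sm (fun y => gm * psi y) by sm_.
have sgu : sm (Gam rho u) by sm_.
have h1 := congr1 (fun f => f x) (e (Gam u u)).
rewrite /Hs h1 [Gam u (Gam psi u) x]GamC (_ : Gam psi u = fun y => (gm * psi y) * Gam rho u y); last exact: (e u).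
rewrite GamMl// GamZl// (congr1 (fun f => f x) (e u)) [Gam (Gam rho u) u x]GamC.
by ring.
Qed.

(** The multiplier identity with [h = psi = exp (gm rho)], [b = 1] and [q = Lap psi / 2 + k]. The
    shift [k] outweighs a possibly negative Hessian of [rho] in the gradient terms; it costs [k G]
    at order [tau^2], which the convexity of [psi] pays back for large [gm]. *)
Lemma int_carleman : exists (gm C tau0 : R), [/\ 0 < gm, 0 <= C, 0 < tau0 &
  forall tau u phi, phi = (fun y => tau * expR (gm * rho y)) ->
  tau0 <= tau -> sm u -> supp_in K u ->
  tau ^+ 2 * II (fun x => u x * u x) <=
  C * II (fun x => (Lap u x - 2 * Gam phi u x + (Gam phi phi x - Lap phi x) * u x) ^+ 2)].
Proof.
have [Cr Cr0 hCr] := Hs_bound srho cK; pose C1 := Cr + 1.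
have C1p : 0 < C1 by rewrite ltr_wpDl.
(* Gives [gm g - 3 C1 >= 1] as soon as [g >= c0]: one [C1] pays for the Hessian of [rho], two for
   [k]. *)
pose gm := (3 * C1 + 1) / c0.
have gmp : 0 < gm by rewrite divr_gt0// addr_gt0// mulr_gt0.
pose psi y := expR (gm * rho y).
have spsi : sm psi by apply: sm_exp; sm_.
have psip x : 0 < psi x by exact: expR_gt0.
pose G := Gam psi psi; have sG : sm G by exact: sm_Gam.
pose k y := 2 * C1 * gm * psi y.
have sk : sm k by rewrite /k; apply: smM => //; exact: sm_cst.
have sL : sm (Lap psi) by sm_.
pose q y := 2^-1 * Lap psi y + k y; have sq : sm q by rewrite /q; sm_.
have sLq : sm (Lap q) by sm_.
pose b1 y := - Gam q psi y - q y * Lap psi y - 2^-1 * Gam psi (Lap psi) y + k y * Lap psi y.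
have sb1 : sm b1 by rewrite /b1; sm_.
pose b0 y := - (2^-1 * Lap q y); have sb0 : sm b0 by rewrite /b0; sm_.
have [B1 B1p hB1] := cont_bound (sm_cont sb1) cK.
have [B0 B0p hB0] := cont_bound (sm_cont sb0) cK.
have [Br Brp hBr] := cont_bound (sm_cont srho) cK.
have [BG BGp hBG] := cont_bound (sm_cont sG) cK.
have [Bq Bqp hBq] := cont_bound (sm_cont sq) cK.
pose pm := expR (- (gm * Br)); have pmp : 0 < pm by exact: expR_gt0.
have pmK x : K x -> pm <= psi x.
  move=> /hBr; rewrite ler_norml => /andP[h _]; rewrite ler_expR -mulrN ler_wpM2l//.
  exact: ltW.
(* The lower bound, proved in [main], for the coefficient of [tau^2 u^2]. *)
pose delta := gm ^+ 3 * pm ^+ 3 * c0.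
have dp : 0 < delta by apply: mulr_gt0 => //; apply: mulr_gt0; exact: exprn_gt0.
have gmc : gm * c0 = 3 * C1 + 1 by rewrite /gm mulfVK// gt_eqF.
have Gpsi v x : sm v -> Gam psi v x = gm * psi x * Gam rho v x.
  move=> sv; rewrite Gam_exp; last by sm_.
  by rewrite GamZl// /psi; ring.
have GE x : G x = gm ^+ 2 * psi x ^+ 2 * Gam rho rho x.
  by rewrite /G Gpsi// GamC Gpsi//; ring.
have main x : K x -> delta <= 2^-1 * Gam psi G x - k x * G x.
  move=> Kx; have e : 2^-1 * Gam psi G x = Hs psi psi x.
    by rewrite /Hs -/G; move: (Gam _ _ _) => t; field.
  have hg := hrho Kx; have g0 := lt_le_trans c0p hg.
  have hH := hCr x psi Kx spsi; rewrite ler_norml in hH; have {hH} /andP[hH _] := hH.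
  rewrite e (Hs_exp gm x spsi) -/(psi x) [Gam rho psi x]GamC Gpsi//.
  rewrite -/(G x) GE in hH *; rewrite /k /delta; set g := Gam rho rho x in hg g0 hH *.
  set P := psi x in hH *; have P0 : 0 < P by exact: psip.
  have hP := pmK x Kx; rewrite -/P in hP.
  apply: (@le_trans _ _ (gm ^+ 3 * P ^+ 3 * (g * (gm * g - 3 * C1)))).
    have h3 : 1 <= gm * g - 3 * C1.
      by rewrite lerBrDl -gmc ler_wpM2l// ltW.
    have h4 : c0 <= g * (gm * g - 3 * C1).
      by apply: le_trans hg _; rewrite ler_peMr// ltW.
    have h5 : gm ^+ 3 * pm ^+ 3 <= gm ^+ 3 * P ^+ 3.
      rewrite ler_wpM2l ?exprn_ge0 ?(ltW gmp)// lerXn2r ?nnegrE ?(ltW pmp) ?(ltW P0)//.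
    by apply: ler_pM => //; [apply: mulr_ge0; apply: exprn_ge0; exact: ltW|exact: ltW].
  have h6 : - (Cr * (gm ^+ 2 * P ^+ 2 * g)) * (gm * P) <= Hs rho psi x * (gm * P).
    by rewrite ler_wpM2r// mulr_ge0// ltW.
  have h7 : 0 <= gm ^+ 3 * P ^+ 3 * g by pos.
  move: h6; move: (Hs rho psi x) => H h6; rewrite /C1.
  rewrite -subr_ge0; apply: (@le_trans _ _ ((H * (gm * P) + Cr * (gm ^+ 2 * P ^+ 2 * g) * (gm * P)) + gm ^+ 3 * P ^+ 3 * g)).
    by rewrite addr_ge0// -lerBlDr sub0r -mulNr.
  by apply: le_of_eq; ring.
pose kap := C1 * gm * pm; have kapp : 0 < kap by rewrite /kap; pos.
pose A1 := 2 * BG + 2 * Bq ^+ 2.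
have A1p : 0 < A1 by rewrite addr_gt0// mulr_gt0// exprn_gt0.
(* The parameter of Young's inequality: the square of the multiplier then consumes at most the
   gradient term [kap] and half of the mass term. *)
pose s := Num.min kap (delta / 4) / A1.
have sp : 0 < s by rewrite divr_gt0// lt_min kapp divr_gt0.
have sA : s * A1 = Num.min kap (delta / 4) by rewrite /s mulfVK// gt_eqF.
have sA1 : s * A1 <= kap by rewrite sA ge_min lexx.
have sA2 : s * A1 <= delta / 4 by rewrite sA ge_min lexx orbT.
(* From here on the coefficients of order [tau] and 1 cost at most half of [delta tau^2]. *)
pose tau0 := 1 + 2 * (B1 + B0) / delta.
have BBp : 0 <= 2 * (B1 + B0) / delta by pos.
exists gm, ((s * delta)^-1), tau0; split => //.
- by rewrite invr_ge0 mulr_ge0 ?ltW.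
- by rewrite ltr_wpDr.
move=> tau u phi0 ephi htau su u0.
pose phi y := tau * psi y; rewrite {phi0}ephi -/phi.
have tau1 : 1 <= tau by apply: le_trans htau; rewrite lerDl.
have tp : 0 < tau by apply: lt_le_trans tau1.
have cKc := compact_closedM cK.
have cu : cs u by exists K.
have sphi : sm phi by rewrite /phi; sm_.
pose c y := Gam phi phi y - Lap phi y; have sc : sm c by rewrite /c; sm_.
have s1 : sm ((fun=> 1) : M -> R) by exact: sm_cst.
have mult := multiplier hmu spsi s1 sq sphi sc su cu.
pose Pu := P0 phi c u; pose Mu' := Mu psi (fun=> 1) q u; pose Q := Qform psi (fun=> 1) q phi c u.
have sPu : sm Pu by rewrite /Pu /P0; sm_.
have cPu : cs Pu by rewrite /Pu /P0; cs_.
have sMu : sm Mu' by rewrite /Mu' /Mu; sm_.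
have cMu : cs Mu' by rewrite /Mu' /Mu; cs_.
have sBp : sm (Bpot psi (fun=> 1) q phi c) by rewrite /Bpot; sm_.
have sQ : sm Q by rewrite /Q /Qform /Hs; sm_.
have cQ : cs Q by rewrite /Q /Qform /Hs; cs_.
have bu : bcs (fun x => u x * u x) by apply: bcs_sm; [sm_|cs_].
have bQ := bcs_sm sQ cQ.
have bM : bcs (fun x => s * Mu' x ^+ 2).
  by apply: bcs_sm; [sm_|cs_].
have bP : bcs (fun x => Pu x ^+ 2) by apply: bcs_sm; [sm_|cs_].
have bPM : bcs (fun x => - (Pu x * Mu' x)) by apply: bcs_sm; [sm_|cs_].
have phiE v x : sm v -> Gam phi v x = tau * Gam psi v x by move=> sv; exact: GamZl.
have LphiE x : Lap phi x = tau * Lap psi x by exact: LapZ.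
have cE : c = (fun y => tau ^+ 2 * G y - tau * Lap psi y).
  apply/funext => y; rewrite /c LphiE phiE// GamC phiE// -/(G y); by ring.
have BE x : Bpot psi (fun=> 1) q phi c x =
    tau ^+ 2 * (2^-1 * Gam psi G x - k x * G x) + tau * b1 x + b0 x.
  rewrite /Bpot Gam_cstl [Gam q phi x]GamC phiE// [Gam psi q x]GamC LphiE.
  have -> : Gam psi c x = tau ^+ 2 * Gam psi G x - tau * Gam psi (Lap psi) x.
    rewrite GamC cE GamDl; [|by sm_|by sm_].
    by rewrite GamNl ?GamZl 1?[Gam G psi x]GamC 1?[Gam (Lap psi) psi x]GamC//; sm_.
  rewrite (congr1 (fun f => f x) cE) /b1 /b0 /q.
  move: (Lap (fun y => _) x) (Gam (fun y => _) _ x) (Gam psi G x) (Gam psi (Lap psi) x) (G x) (Lap psi x) (k x).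
  by move=> *; field.
have QM x : delta / 4 * tau ^+ 2 * (u x * u x) <= Q x - s * Mu' x ^+ 2.
  have [Kx|nK] := pselect (K x); last first.
    rewrite /Q /Qform /Mu' /Mu (supp_Hs psi cKc u0 nK) !(supp_Gamr _ cKc u0 nK) u0//.
    by rewrite expr0n /= !mulr0 ?mul0r ?mulr0 !addr0 expr0n /= mulr0 subrr.
  have hH := hCr x u Kx su; rewrite ler_norml in hH; have {hH} /andP[hH _] := hH.
  have gu := Gam_ge0 u x; have hP := pmK x Kx; have P0 := psip x.
  have B2 : delta / 2 * tau ^+ 2 <= Bpot psi (fun=> 1) q phi c x.
    rewrite BE; have h1 := main x Kx.
    have := hB1 x Kx; have := hB0 x Kx; rewrite !ler_norml => /andP[h2 _] /andP[h3 _].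
    have h4 : delta * tau ^+ 2 <= tau ^+ 2 * (2^-1 * Gam psi G x - k x * G x).
      by rewrite mulrC ler_wpM2l// sqr_ge0.
    have h5 : - (tau * B1) <= tau * b1 x by rewrite -mulrN ler_wpM2l// ltW.
    have h6 : - (tau * B0) <= b0 x.
      by apply: le_trans h2; rewrite lerN2 ler_peMl// ltW.
    have h7 : tau * (B1 + B0) <= delta / 2 * tau ^+ 2.
      have h8 : 2 * (B1 + B0) / delta <= tau by apply: le_trans htau; rewrite lerDr.
      rewrite ler_pdivrMr// in h8; rewrite -subr_ge0.
      rewrite (_ : _ - _ = tau / 2 * (tau * delta - 2 * (B1 + B0))); last by field.
      by apply: mulr_ge0; [pos|rewrite subr_ge0].
    rewrite mulrDr in h7.
    have e2 : delta * tau ^+ 2 = delta / 2 * tau ^+ 2 + delta / 2 * tau ^+ 2 by field.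
    by move: h4 h5 h6 h7; rewrite e2; lra.
  have MM : Mu' x ^+ 2 <= A1 * (Gam u u x + u x * u x).
    have := hBG x Kx; rewrite ger0_norm; last exact: Gam_ge0.
    move=> hG; have hq : q x ^+ 2 <= Bq ^+ 2.
      by rewrite -(real_normK (num_real (q x))) lerXn2r ?nnegrE ?(ltW Bqp)//; exact: hBq.
    have cs := Gam_cs psi u x; rewrite -/(G x) in cs.
    have e1 : G x * Gam u u x <= BG * Gam u u x by rewrite ler_wpM2r.
    have e2 : q x ^+ 2 * (u x * u x) <= Bq ^+ 2 * (u x * u x).
      by rewrite ler_wpM2r// -expr2 sqr_ge0.
    have e3 : 0 <= BG * (u x * u x) by pos.
    have e4 : 0 <= Bq ^+ 2 * Gam u u x by rewrite mulr_ge0// sqr_ge0.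
    have e5 : (Gam psi u x + q x * u x) ^+ 2 <= 2 * Gam psi u x ^+ 2 + 2 * (q x ^+ 2 * (u x * u x)).
      rewrite -subr_ge0 (_ : _ - _ = (Gam psi u x - q x * u x) ^+ 2) ?sqr_ge0//.
      by ring.
    rewrite /Mu' /Mu mul1r /A1; apply: le_trans e5 _.
    rewrite (_ : (2 * BG + 2 * Bq ^+ 2) * _ = 2 * (BG * Gam u u x) + 2 * (BG * (u x * u x))
      + 2 * (Bq ^+ 2 * Gam u u x) + 2 * (Bq ^+ 2 * (u x * u x))); last by ring.
    by move: e1 e2 e3 e4 cs; lra.
  have uu0 : 0 <= u x * u x by pos.
  have sM : s * Mu' x ^+ 2 <= kap * Gam u u x + delta / 4 * (u x * u x).
    apply: le_trans (ler_wpM2l (ltW sp) MM) _; rewrite [s * _]mulrA mulrDr.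
    by apply: lerD; rewrite ler_wpM2r.
  have QL : kap * Gam u u x + delta / 2 * tau ^+ 2 * (u x * u x) <= Q x.
    rewrite /Q /Qform !Gam_cstl mul0r addr0 !mul1r (Hs_exp gm x su) -/(psi x).
    rewrite phiE// [q x - _](_ : _ = k x); last by rewrite /q; ring.
    have h8 := ler_wpM2r uu0 B2; rewrite -expr2 in h8 *.
    have h9 : - (Cr * Gam u u x) * (gm * psi x) <= Hs rho u x * (gm * psi x).
      by rewrite ler_wpM2r// mulr_ge0// ltW.
    have h10 : 0 <= gm ^+ 2 * psi x * Gam rho u x ^+ 2 by pos.
    have h11 : 0 <= 2 * (tau * Gam psi u x * Gam psi u x).
      by rewrite mulr_ge0// -mulrA mulr_ge0 ?(ltW tp)// -expr2 sqr_ge0.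
    have h12 : kap * Gam u u x <= C1 * gm * psi x * Gam u u x.
      by rewrite ler_wpM2r// ler_wpM2l// mulr_ge0 ?ltW.
    have h13 : 0 <= gm * psi x * Gam u u x by pos.
    rewrite /k; move: h8 h9 h10 h11 h12 h13; rewrite /C1.
    move: (Bpot _ _ _ _ _ x * _) (gm ^+ 2 * _ * _) (2 * (tau * _ * _)) (delta / 2 * _ * _) => t1 t2 t3 t4.
    move: (kap * _) => t5 h8 h9 h10 h11 h12 h13.
    have -> : 2 * (Cr + 1) * gm * psi x * Gam u u x = 2 * (Cr * Gam u u x * (gm * psi x)) + 2 * (gm * psi x * Gam u u x) by ring.
    have e5 : (Cr + 1) * gm * psi x * Gam u u x = Cr * Gam u u x * (gm * psi x) + gm * psi x * Gam u u x by ring.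
    rewrite e5 in h12; rewrite mulNr in h9; rewrite [gm * psi x * Hs rho u x]mulrC.
    move: (Cr * _ * _) (gm * psi x * Gam u u x) (Hs rho u x * _) h9 h12 h13 => t6 t7 t8 *.
    by lra.
  have h14 : delta / 4 * (u x * u x) <= delta / 4 * tau ^+ 2 * (u x * u x).
    rewrite [delta / 4 * tau ^+ 2]mulrC -[leRHS]mulrA; apply: ler_peMl; first by pos.
    exact: exprn_ege1.
  have e6 : delta / 2 * tau ^+ 2 * (u x * u x) = 2 * (delta / 4 * tau ^+ 2 * (u x * u x)) by field.
  by move: QL sM h14; rewrite e6; lra.
have I1 : delta / 4 * tau ^+ 2 * II (fun x => u x * u x) <= (4 * s)^-1 * II (fun x => Pu x ^+ 2).
  rewrite -(IIZ hmu _ bu) -(IIZ hmu _ bP).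
  apply: (@le_trans _ _ (II (fun x => Q x - s * Mu' x ^+ 2))).
    by apply: II_le => //; [exact: bcsZ|exact: bcsB].
  rewrite (IIB hmu bQ bM) -mult -(IIB hmu bPM bM).
  apply: II_le => //; [exact: bcsB|exact: bcsZ|] => x.
  by rewrite lerBlDr; exact: young.
have e7 : tau ^+ 2 * II (fun x => u x * u x) = 4 / delta * (delta / 4 * tau ^+ 2 * II (fun x => u x * u x)).
  by move: (II _) => t; field; rewrite gt_eqF.
rewrite e7; have d4 : 0 <= 4 / delta by rewrite divr_ge0// ltW.
apply: le_trans (ler_wpM2l d4 I1) _; apply: le_of_eq.
by rewrite /Pu /P0; move: (II _) => t; field; rewrite !gt_eqF.
Qed.

End Interior.

End Carleman.

Ltac bcs_ := lazymatch goal with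
  | |- bcs (fun x => _ + _) => apply: bcsD; bcs_
  | |- bcs (fun x => - _) => apply: bcsN; bcs_
  | |- bcs (fun x => indic _ x * _) => apply: bcs_ind; [try assumption|bcs_]
  | |- bcs (fun x => _ * _) => first [ apply: bcsZ; bcs_ | apply: bcs_sm; [by sm_|by cs_]
      | apply: bcs_contM; [apply: sm_cont; by sm_|bcs_] ]
  | |- bcs _ => first [assumption | apply: bcs_sm; [by sm_|by cs_]] end.

Lemma gam_locally_cst {R : realType} {n : nat} (M : riemannian_manifold R n)
    (f : M -> R) (c : R) (O : set M) : open O -> (forall x, O x -> f x = c) ->
  forall x h, O x -> Gam f h x = 0 /\ Lap f x = 0.
Proof.
move=> oO fc x h Ox.
have oU : open (cimg (cidx x) O) by exact: cimg_open.
have Up : cimg (cidx x) O (chart (cidx x) x) by apply: cimg_chart => //; exact: cidxP.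
have fz k : {in cimg (cidx x) O, pd k (f \o param (cidx x)) =1 cst 0}.
  move=> q /set_mem qU; rewrite (pd_eq k (g := fun=> c) oU qU) ?pd_cst//.
  by move=> q' /set_mem/cimgP[_ Oq] /=; exact: fc.
rewrite /Gam /Lap /Gam_in /Lap_in; split.
  rewrite gamE big1// => k _; rewrite fz ?mul0r//; exact: mem_set.
rewrite lapE big1 ?mulr0// => k _.
rewrite (pd_eq k (g := fun=> 0) oU Up) ?pd_cst// => q Uq; rewrite /flux big1 ?mulr0// => l _.
by rewrite fz// mulr0.
Qed.

Opaque Gam Lap.

(** * Smooth cut-off functions of one variable *)

Section Steps.
Context {R : realType}.

Definition up (a b t : R) := smoothstep ((t - a) / (b - a)).
Definition down (a b t : R) := smoothstep ((b - t) / (b - a)).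

Lemma up0 a b t : a < b -> t <= a -> up a b t = 0.
Proof. by move=> ab h; rewrite /up smoothstep0// pmulr_lle0 ?invr_gt0 ?subr_gt0// subr_le0. Qed.
Lemma up1 a b t : a < b -> b <= t -> up a b t = 1.
Proof. by move=> ab h; rewrite /up smoothstep1// ler_pdivlMr ?subr_gt0// mul1r lerB. Qed.
Lemma down0 a b t : a < b -> b <= t -> down a b t = 0.
Proof. by move=> ab h; rewrite /down smoothstep0// pmulr_lle0 ?invr_gt0 ?subr_gt0// subr_le0. Qed.
Lemma down1 a b t : a < b -> t <= a -> down a b t = 1.
Proof. by move=> ab h; rewrite /down smoothstep1// ler_pdivlMr ?subr_gt0// mul1r lerB. Qed.
Lemma up_itv a b t : 0 <= up a b t <= 1. Proof. exact: smoothstep_itv. Qed.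
Lemma down_itv a b t : 0 <= down a b t <= 1. Proof. exact: smoothstep_itv. Qed.

Lemma Ck1_affine k (a b : R) : Ck1 k setT (fun t => (t - a) * b).
Proof.
apply: CkM; [exact: openT| |exact: Ck_cst].
by apply: CkB; [exact: openT|apply: Ck1_id; exact: openT|exact: Ck_cst].
Qed.

Lemma Ck1_up k a b : Ck1 k setT (up a b).
Proof.
apply: (@Ck_comp1 R R unit (fun=> 1) k setT setT (fun t => (t - a) / (b - a)) smoothstep) => //.
- exact: openT.
- exact: Ck1_affine.
- by apply: Ck1_smoothstep; exact: openT.
Qed.

Lemma Ck1_down k a b : Ck1 k setT (down a b).
Proof.
apply: (@Ck_comp1 R R unit (fun=> 1) k setT setT (fun t => (b - t) / (b - a)) smoothstep) => //.
- exact: openT.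
- apply: (Ck_eq openT (f := fun t => (t - b) * (- (b - a)^-1))); last exact: Ck1_affine.
  by move=> t _; rewrite mulrN -mulNr opprB.
- by apply: Ck1_smoothstep; exact: openT.
Qed.

Lemma Ck1_M k (f g : R -> R) : Ck1 k setT f -> Ck1 k setT g -> Ck1 k setT (fun t => f t * g t).
Proof. by apply: CkM; exact: openT. Qed.

End Steps.

(** * Differential inequalities and localized mass *)

Section Propagation.
Context {R : realType} {n : nat} (M : riemannian_manifold R n)
  (mu : {measure set (borel M) -> \bar R}) (hmu : riemannian_measure mu).
Implicit Types (f h g u v z phi : M -> R) (x : M) (K A B : set M).
Notation II := (II mu).

Definition JJ A g : R := II (fun x => \1_A x * g x).

Definition e2 v1 v2 x : R := v1 x * v1 x + v2 x * v2 x.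

(** A differential inequality is all that unique continuation uses; the potential and the spectral
    parameter survive only through [L]. *)
Record sol (L : R) v1 v2 f : Prop := Sol {
  sol1 : sm v1 ; sol2 : sm v2 ; solc1 : cs v1 ; solc2 : cs v2 ;
  solf : bcs f ; solf0 : forall x, 0 <= f x ;
  solE : forall x, Lap v1 x ^+ 2 + Lap v2 x ^+ 2 <= L * e2 v1 v2 x + f x }.

Lemma e2_ge0 v1 v2 x : 0 <= e2 v1 v2 x.
Proof. by rewrite /e2; pos. Qed.

Lemma bcs_e2 v1 v2 : sm v1 -> sm v2 -> cs v1 -> cs v2 -> bcs (e2 v1 v2).
Proof. by move=> s1 s2 c1 c2; rewrite /e2; bcs_. Qed.

Lemma indic01 A x : 0 <= (\1_A x : R) <= 1.
Proof. by rewrite indicE; case: (_ \in _); rewrite ?lexx ler01. Qed.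

Lemma JJ_mono A B g : measurable (A : set (borel M)) -> measurable (B : set (borel M)) ->
  bcs g -> (forall x, 0 <= g x) -> A `<=` B -> JJ A g <= JJ B g.
Proof.
move=> mA mB bg g0 AB; apply: II_le => //; try exact: bcs_ind.
move=> x; apply: ler_wpM2r => //; rewrite !indicE.
have [Ax|nA] := pselect (A x); first by rewrite !mem_set//; exact: AB.
by rewrite memNset//; case: (_ \in _).
Qed.

Lemma JJ_ge0 A g : (forall x, 0 <= g x) -> 0 <= JJ A g.
Proof. by move=> g0; apply: II_ge0 => x; rewrite mulr_ge0//; have /andP[] := indic01 A x. Qed.

Lemma JJU A B g : measurable (A : set (borel M)) -> measurable (B : set (borel M)) ->
  bcs g -> (forall x, 0 <= g x) -> JJ (A `|` B) g <= JJ A g + JJ B g.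
Proof.
move=> mA mB bg g0; rewrite -(IID hmu); try exact: bcs_ind.
apply: II_le => //; first by apply: bcs_ind => //; exact: measurableU.
  by apply: bcsD; exact: bcs_ind.
move=> x; rewrite -mulrDl; apply: ler_wpM2r => //.
have /andP[a0 _] := indic01 A x; have /andP[b0 _] := indic01 B x.
rewrite [\1_(_ `|` _) _]indicE; have [[Ax|Bx]|nU] := pselect ((A `|` B) x).
- by rewrite mem_set ?[\1_A x]indicE ?(mem_set Ax) ?lerDl//; left.
- by rewrite mem_set ?[\1_B x]indicE ?(mem_set Bx) ?lerDr//; right.
- by rewrite memNset// addr_ge0.
Qed.

Lemma II_lin4 (a b c d : R) g1 g2 g3 g4 : bcs g1 -> bcs g2 -> bcs g3 -> bcs g4 ->
  II (fun x => a * g1 x + b * g2 x + c * g3 x + d * g4 x) =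
  a * II g1 + b * II g2 + c * II g3 + d * II g4.
Proof.
move=> h1 h2 h3 h4; rewrite -!(IIZ hmu)//.
have b1 := bcsZ a h1; have b2 := bcsZ b h2; have b3 := bcsZ c h3; have b4 := bcsZ d h4.
by rewrite (IID hmu (bcsD (bcsD b1 b2) b3) b4) (IID hmu (bcsD b1 b2) b3) (IID hmu b1 b2).
Qed.

Lemma bcs_lin4 (a b c d : R) g1 g2 g3 g4 : bcs g1 -> bcs g2 -> bcs g3 -> bcs g4 ->
  bcs (fun x => a * g1 x + b * g2 x + c * g3 x + d * g4 x).
Proof. by move=> *; bcs_. Qed.

Lemma compact_min g K : continuous g -> compact K -> (forall x, K x -> 0 < g x) ->
  exists2 c : R, 0 < c & forall x, K x -> c <= g x.
Proof.
move=> cg cK g0.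
apply: (compact_ind (P := fun A => exists2 c : R, 0 < c & forall x, A x -> c <= g x)) cK _ _ _ _.
- by exists 1.
- move=> A B [c c0 hc] [d d0 hd]; exists (Num.min c d); first by rewrite lt_min c0.
  by move=> x [/hc|/hd] h; rewrite ge_min h ?orbT.
- by move=> A B AB [c c0 hc]; exists c => // x /AB/hc.
- move=> x Kx; exists [set y | g x / 2 < g y].
    apply: (cg x [set t : R | g x / 2 < t]); apply: open_nbhs_nbhs; split; first exact: open_gt.
    by rewrite /= ltr_pdivrMr// ltr_pMr ?g0// ltr1n.
  by exists (g x / 2) => [|y /ltW//]; rewrite divr_gt0// g0.
Qed.

Lemma cacc_sol (L Dz : R) v1 v2 f z (Z : set M) : 0 <= L -> 0 <= Dz -> sol L v1 v2 f ->
  measurable (Z : set (borel M)) -> sm z -> cs z -> supp_in Z z -> supp_in Z (Gam z z) ->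
  (forall x, z x ^+ 2 <= 1) -> (forall x, Gam z z x <= Dz) ->
  II (fun x => z x * z x * (3 * e2 v1 v2 x + 12 * (Gam v1 v1 x + Gam v2 v2 x))) <=
  (15 + 12 * L + 48 * Dz) * (JJ Z (e2 v1 v2) + II f).
Proof.
move=> L0 D0 [s1 s2 c1 c2 bf f0 hE] mZ sz cz z0 G0 z1 GD.
have bE := bcs_e2 s1 s2 c1 c2; have E0 := e2_ge0 v1 v2.
have sE : sm (e2 v1 v2) by rewrite /e2; sm_.
have cE : cs (e2 v1 v2) by rewrite /e2; cs_.
have q1 := caccioppoli hmu sz cz s1; have q2 := caccioppoli hmu sz cz s2.
set G1 := (fun x => z x * z x * Gam v1 v1 x) in q1; set G2 := (fun x => z x * z x * Gam v2 v2 x) in q2.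
set H1 := (fun x => z x * z x * (v1 x * v1 x + _) + _) in q1.
set H2 := (fun x => z x * z x * (v2 x * v2 x + _) + _) in q2.
have bG1 : bcs G1 by rewrite /G1; bcs_.
have bG2 : bcs G2 by rewrite /G2; bcs_.
have bH1 : bcs H1 by rewrite /H1; bcs_.
have bH2 : bcs H2 by rewrite /H2; bcs_.
have b0 : bcs (fun x => z x * z x * e2 v1 v2 x) by bcs_.
apply: (@le_trans _ _ (II (fun x => 3 * (z x * z x * e2 v1 v2 x) + 12 * G1 x + 12 * G2 x + 0 * f x))).
  apply: II_le => //; [by bcs_|exact: bcs_lin4|] => x; rewrite /G1 /G2; apply: le_of_eq.
  by ring.
rewrite II_lin4//.
apply: (@le_trans _ _ (II (fun x => 3 * (z x * z x * e2 v1 v2 x) + 12 * H1 x + 12 * H2 x + 0 * f x))).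
  by rewrite II_lin4//; lra.
have bJ : bcs (fun x => \1_Z x * e2 v1 v2 x) by exact: bcs_ind.
apply: (@le_trans _ _ (II (fun x => (15 + 12 * L + 48 * Dz) * (\1_Z x * e2 v1 v2 x) + 12 * f x + 0 * f x + 0 * f x))).
  apply: II_le => //; [exact: bcs_lin4|exact: bcs_lin4|] => x.
  have zz : z x * z x <= 1 by rewrite -expr2.
  have zz0 := sqrM_ge0 (z x); have Ex := E0 x; have hx := hE x; have fx := f0 x.
  have G0' : ~ Z x -> Gam z z x = 0 by exact: G0.
  have z0' : ~ Z x -> z x = 0 by exact: z0.
  have gx := GD x; have g0 := Gam_ge0 z x.
  rewrite !mul0r !addr0 /H1 /H2 indicE; move: (Gam z z x) (Lap v1 x) (Lap v2 x) gx g0 G0' hx zz zz0 z0' Ex fx.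
  rewrite /e2; move: (z x) (v1 x) (v2 x) (f x) => c a b fx G l1 l2 gx g0 G0' hx zz zz0 z0' Ex f0x.
  have [Zx|nZ] := pselect (Z x); last first.
    by rewrite z0'// G0'// memNset// !(mul0r, mulr0, addr0, add0r) mulr_ge0.
  rewrite mem_set// mul1r; set S := l1 ^+ 2 + l2 ^+ 2 in hx.
  have S0 : 0 <= S by rewrite /S; pos.
  rewrite (_ : _ + _ = c * c * (15 * (a * a + b * b) + 12 * S) + 48 * (G * (a * a + b * b))); last first.
    by rewrite /S; ring.
  have k1 : c * c * (15 * (a * a + b * b) + 12 * S) <= 15 * (a * a + b * b) + 12 * S.
    by apply: ler_piMl => //; pos.
  have k2 : G * (a * a + b * b) <= Dz * (a * a + b * b) by exact: ler_wpM2r.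
  by move: k1 k2 hx; lra.
rewrite II_lin4// !mul0r !addr0 mulrDr lerD2l; apply: ler_wpM2r; first exact: II_ge0.
by move: L0 D0; lra.
Qed.

End Propagation.

(** * Coordinate annuli and radial functions *)

Section Annulus.
Context {R : realType} {n : nat} (M : riemannian_manifold R n)
  (i : index (charts M)) (p : 'rV[R]_n) (r : R).
Hypotheses (r0 : 0 < r) (pr : cball p r `<=` img i).
Notation e_ := (fun j => delta_mx 0 j).

Let sq (q : 'rV[R]_n) : R := \sum_l (q 0 l - p 0 l) ^+ 2.

(** [a] and [t] bound the squared Euclidean distance; the intersection with [cball] keeps the set
    inside the chart. *)
Definition ann (a t : R) : set M := param i @` [set q | cball p r q /\ a <= sq q <= t].

Lemma sq_continuous : continuous sq.
Proof.
move=> q; suff h : Ck e_ 0 setT sq by exact: (Ck_cont h I).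
apply: Ck_sum => [|l _]; first exact: openT.
have h : Ck e_ 0 setT (fun q : 'rV[R]_n => q 0 l - p 0 l).
  by apply: CkB; [exact: openT|exact: Ck_coord|exact: Ck_cst].
apply: (Ck_eq openT (f := fun q : 'rV[R]_n => (q 0 l - p 0 l) * (q 0 l - p 0 l))).
  by move=> q' _; rewrite expr2.
by apply: CkM => //; exact: openT.
Qed.

Lemma ann_compact a t : compact (ann a t).
Proof.
apply: (param_compact (A := [set q | cball p r q /\ a <= sq q <= t]) _ _).1; last first.
  by move=> q [/pr].
rewrite (_ : [set q | _] = cball p r `&` sq @^-1` [set s | a <= s <= t])//.
apply: compact_closedI; first exact: cball_compact.
apply: closed_comp => [q _|]; first exact: sq_continuous.
rewrite (_ : [set s | _] = `[a, t]%classic); first exact: interval_closed.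
by apply/funext => s /=; rewrite in_itv.
Qed.

Lemma annP a t x : t <= r ^+ 2 -> ann a t x <-> dom i x /\ a <= sqd i p x <= t.
Proof.
move=> tr; split=> [[q [/pr iq hq] <-]|[dx hs]].
  by have [e d] := paramK iq; rewrite /sqd e.
exists (chart i x); last by rewrite (chartK (chartM i)).
split => //; apply: (sqd_norm (ltW r0)); have /andP[_ h] := hs.
exact: le_trans h tr.
Qed.

Definition rad (a : R -> R) : M -> R := ext (dom i) (fun x => a (sqd i p x)).

Lemma radE a x : dom i x -> rad a x = a (sqd i p x). Proof. exact: extE. Qed.

Lemma rad_supp a : (forall k, Ck1 k setT a) -> (forall t, r ^+ 2 <= t -> a t = 0) ->
  sm (rad a) /\ supp_in (ann 0 (r ^+ 2)) (rad a).
Proof.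
move=> ha a0; have [h1 _] := radial_ext r0 pr ha a0; split => // x nx.
have [dx|ndx] := pselect (dom i x); last by rewrite /rad ext_out.
rewrite radE//; apply: a0; rewrite leNgt; apply/negP => /ltW hs; apply: nx.
by apply/annP => //; split => //; rewrite hs andbT sumr_ge0// => l _; rewrite sqr_ge0.
Qed.

Lemma sqd_open (P : set R) : open P -> open (dom i `&` [set x | P (sqd i p x)]).
Proof.
move=> oP; rewrite openE => x [dx Px]; have oD := dom_open (chartM i).
apply: filterI; first exact: open_nbhs_nbhs.
by apply: (smO_continuous oD dx (sqd_smooth i p)); exact: open_nbhs_nbhs.
Qed.

(** The coordinate gradient of [- |q - p|^2] is [2 (p - q)], which vanishes at the centre only. *)
Lemma gam_radial (a : R -> R) (b : R) x : (forall t, t < b -> a t = - t) ->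
  dom i x -> 0 < sqd i p x < b -> sm (rad a) -> 0 < Gam (rad a) (rad a) x.
Proof.
move=> ha dx /andP[s0 sb] sa; have ix : img i (chart i x) by exists x.
have oU : open (cimg i (dom i `&` [set y | sqd i p y < b])).
  by apply: cimg_open; apply: (sqd_open (P := [set t | t < b])); exact: open_lt.
have Ux : cimg i (dom i `&` [set y | sqd i p y < b]) (chart i x) by apply: cimg_chart.
rewrite lt_neqAle Gam_ge0 andbT eq_sym; apply/eqP => g0.
have := param_gam sa sa ix; rewrite (chartK (chartM i))// g0 => /esym/(gdot_eq0 (metric_posdef ix)) gr.
have pdk k : pd k (rad a \o param i) (chart i x) = 2 * (p 0 k - chart i x 0 k).
  rewrite (pd_eq k (g := fun q => \sum_l (q 0 l - p 0 l) * (p 0 l - q 0 l)) oU Ux); last first.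
    move=> q /set_mem/cimgP[iq [_ /= hq]]; have [e d] := paramK iq.
    rewrite radE// ha// /sqd e -sumrN; apply: eq_bigr => l _; by ring.
  have o := @openT 'rV[R]_n.
  have c1 l : Ck e_ 1 setT (fun q : 'rV[R]_n => q 0 l - p 0 l).
    by apply: CkB => //; [exact: Ck_coord|exact: Ck_cst].
  have c2 l : Ck e_ 1 setT (fun q : 'rV[R]_n => p 0 l - q 0 l).
    by apply: CkB => //; [exact: Ck_cst|exact: Ck_coord].
  rewrite (pd_sum k I c1 c2).
  have d1 l : pd k (fun q : 'rV[R]_n => q 0 l - p 0 l) (chart i x) = (l == k)%:R.
    by apply: pd_val; apply: is_derive_affine => z t; rewrite !mxE eqxx /=; ring.
  have d2 l : pd k (fun q : 'rV[R]_n => p 0 l - q 0 l) (chart i x) = - (l == k)%:R.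
    by apply: pd_val; apply: is_derive_affine => z t; rewrite !mxE eqxx /=; ring.
  rewrite (bigD1 k)//= big1 ?addr0; first by rewrite d1 d2 eqxx mulr1n; ring.
  by move=> l lk; rewrite d1 d2 (negbTE lk) mulr0n oppr0 mul0r mulr0 addr0.
have : sqd i p x = 0.
  apply: big1 => l _; have := congr1 (fun v : 'rV[R]_n => v 0 l) gr.
  rewrite !mxE pdk => /eqP; rewrite mulf_eq0 pnatr_eq0 /= subr_eq0 => /eqP ->.
  by rewrite subrr expr0n.
by move=> h; rewrite h ltxx in s0.
Qed.

End Annulus.

Lemma sq3 {R : realDomainType} (a b c : R) : (a + b + c) ^+ 2 <= 3 * (a ^+ 2 + b ^+ 2 + c ^+ 2).
Proof.
rewrite -subr_ge0 (_ : _ - _ = (a - b) ^+ 2 + (a - c) ^+ 2 + (b - c) ^+ 2); last by ring.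
by rewrite !addr_ge0 ?sqr_ge0.
Qed.

(** * Propagation from a small ball to a larger one *)

Section LocalProp.
Context {R : realType} {n : nat} (M : riemannian_manifold R n)
  (mu : {measure set (borel M) -> \bar R}) (hmu : riemannian_measure mu).
Implicit Types (f h g u v z phi : M -> R) (x : M) (K A B : set M).
Notation II := (II mu).
Notation JJ := (JJ mu).

(* The commutator of the Laplacian with a cut-off, weighted by [E]. *)
Lemma cutoff_pointwise (L D W E c l G fx v1 v2 l1 l2 w1 w2 V1 V2 a1 : R) :
  0 <= L -> 0 <= E -> c ^+ 2 <= 1 -> E ^+ 2 <= a1 -> 0 <= fx ->
  l1 ^+ 2 + l2 ^+ 2 <= L * (v1 * v1 + v2 * v2) + fx ->
  w1 ^+ 2 <= G * V1 -> w2 ^+ 2 <= G * V2 -> 0 <= V1 -> 0 <= V2 ->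
  E ^+ 2 * l ^+ 2 <= D * W -> E ^+ 2 * G <= D * W ->
  (E * (c * l1 + v1 * l + 2 * w1)) ^+ 2 + (E * (c * l2 + v2 * l + 2 * w2)) ^+ 2 <=
  3 * L * (E * (c * v1) * (E * (c * v1)) + E * (c * v2) * (E * (c * v2))) + 3 * a1 * fx +
  D * (W * (3 * (v1 * v1 + v2 * v2) + 12 * (V1 + V2))).
Proof.
move=> L0 E0 c1 Ea f0 hl h1 h2 V10 V20 hE hG.
have EE : 0 <= E ^+ 2 by pos.
apply: (@le_trans _ _ (E ^+ 2 * (3 * c ^+ 2 * (l1 ^+ 2 + l2 ^+ 2)) + E ^+ 2 * l ^+ 2 * (3 * (v1 * v1 + v2 * v2))
   + E ^+ 2 * (12 * (w1 ^+ 2 + w2 ^+ 2)))).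
  have := ler_wpM2l EE (sq3 (c * l1) (v1 * l) (2 * w1)).
  have := ler_wpM2l EE (sq3 (c * l2) (v2 * l) (2 * w2)) => q2 q1.
  rewrite !exprMn; apply: le_trans (lerD q1 q2) _.
  by apply: le_of_eq; ring.
have k1 : E ^+ 2 * (3 * c ^+ 2 * (l1 ^+ 2 + l2 ^+ 2)) <=
   3 * L * (E ^+ 2 * c ^+ 2 * (v1 * v1 + v2 * v2)) + 3 * a1 * fx.
  have Ec : 0 <= 3 * (E ^+ 2 * c ^+ 2) by pos.
  have := ler_wpM2l Ec hl.
  have Ec2 : E ^+ 2 * c ^+ 2 <= a1.
    by apply: le_trans Ea; rewrite ler_piMr.
  have := ler_wpM2r f0 Ec2.
  move=> q1 q2; apply: (@le_trans _ _ (3 * (E ^+ 2 * c ^+ 2) * (l1 ^+ 2 + l2 ^+ 2))).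
    by apply: le_of_eq; ring.
  apply: le_trans q2 _; rewrite mulrDr; apply: lerD.
    by apply: le_of_eq; ring.
  by rewrite -!(mulrA 3) ler_pM2l.
have vv : 0 <= 3 * (v1 * v1 + v2 * v2) by pos.
have k2 := ler_wpM2r vv hE.
have k3 : E ^+ 2 * (12 * (w1 ^+ 2 + w2 ^+ 2)) <= D * W * (12 * (V1 + V2)).
  have V0 : 0 <= 12 * (V1 + V2) by pos.
  apply: le_trans (ler_wpM2r V0 hG); rewrite -[leRHS]mulrA; apply: ler_wpM2l => //.
  by rewrite mulrCA ler_pM2l// mulrDr lerD.
apply: le_trans (lerD (lerD k1 k2) k3) _.
by apply: le_of_eq; ring.
Qed.

Section Chart.
Variables (i : index (charts M)) (p : 'rV[R]_n) (r T d0 : R).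
Hypotheses (r0 : 0 < r) (pr : cball p r `<=` img i) (d0p : 0 < d0) (d0T : d0 < T) (Tr : T < r ^+ 2).
Notation S := (fun x => sqd i p x).
Notation ann := (ann i p r).
Notation rad := (rad i p).

(** The Carleman weight decreases with the distance to [p]. The commutator with the cut-off lives on
    an inner shell, inside the small ball, and on an outer shell, where the weight does not exceed
    its minimum on the region to be estimated ([a3 <= aT]). The small factor [eta] comes from the
    [tau^2] on the left of the Carleman estimate. *)
Lemma local_prop (L eta : R) : 0 <= L -> 0 < eta -> exists2 C : R, 0 <= C &
  forall v1 v2 f, sol L v1 v2 f -> JJ (ann 0 T) (e2 v1 v2) <=
    eta * JJ (ann 0 (r ^+ 2)) (e2 v1 v2) + C * (JJ (ann 0 d0) (e2 v1 v2) + II f).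
Proof.
move=> L0 etap; have Trr := Tr; set rr := r ^+ 2 in Trr *.
(* Squared radii [t1 < t2 < d0 < T < t3 < t4 < t5 < r^2]: the cut-off rises on [[t1, t2]] and falls
   on [[t3, t4]], and [rho] is minus the squared distance up to [t5]. *)
pose t1 := d0 / 3; pose t2 := 2 * d0 / 3; pose t3 := (2 * T + rr) / 3.
pose t4 := (T + 2 * rr) / 3; pose t5 := (T + 5 * rr) / 6.
have [[ot1 ot2 ot3 ot4] [ot5 ot6 ot7 ot8]] : [/\ 0 < t1, t1 < t2, t2 < d0 & T < t3] /\
    [/\ t3 < t4, t4 < t5, t5 < rr & t2 < t3].
  by rewrite /t1 /t2 /t3 /t4 /t5; move: d0p d0T Trr; split; split; lra.
have t4r : t4 < rr by exact: lt_trans ot7.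
have cm a t : measurable (ann a t : set (borel M)).
  by apply: compact_borel; exact: ann_compact.
have sP a t x : t <= rr -> ann a t x <-> dom i x /\ a <= S x <= t by exact: annP.
have S0 x : 0 <= S x by apply: sumr_ge0 => l _; exact: sqr_ge0.
pose chi := rad (fun t => up t1 t2 t * down t3 t4 t).
pose zin := rad (down t2 d0).
pose zout := rad (fun t => up T t3 t * down t4 rr t).
pose rho := rad (fun t => - t * down t5 rr t).
have [schi _] : sm chi /\ supp_in (ann 0 rr) chi.
  apply: rad_supp => // [k|t ht]; first by apply: Ck1_M; [exact: Ck1_up|exact: Ck1_down].
  by rewrite [down _ _ _]down0 ?mulr0// (le_trans (ltW t4r)).
have [szin zin0] : sm zin /\ supp_in (ann 0 rr) zin.
  apply: rad_supp => // [k|t ht]; first exact: Ck1_down.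
  by rewrite down0// (le_trans _ ht)// ltW// (lt_trans d0T).
have [szout zout0] : sm zout /\ supp_in (ann 0 rr) zout.
  apply: rad_supp => // [k|t ht]; first by apply: Ck1_M; [exact: Ck1_up|exact: Ck1_down].
  by rewrite [down _ _ _]down0 ?mulr0.
have [srho _] : sm rho /\ supp_in (ann 0 rr) rho.
  apply: rad_supp => // [k|t ht].
    apply: Ck1_M; last exact: Ck1_down.
    rewrite (_ : -%R = (fun t : R => (t - 0) * -1)); first exact: Ck1_affine.
    by apply/funext => t; rewrite subr0 mulrN1.
  by rewrite down0 ?mulr0.
have czin : cs zin by exists (ann 0 rr) => //; exact: ann_compact.
have czout : cs zout by exists (ann 0 rr) => //; exact: ann_compact.
have chi0 : supp_in (ann t1 t4) chi.
  move=> x nx; have [dx|ndx] := pselect (dom i x); last by rewrite /chi /rad ext_out.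
  rewrite /chi radE//; have [h|h] := lerP (S x) t1; first by rewrite up0// mul0r.
  rewrite [down _ _ _]down0 ?mulr0// leNgt; apply/negP => h'; apply: nx.
  by apply/sP; [exact: ltW|split => //; rewrite !ltW].
have KAc := @ann_compact R n M i p r pr t1 t4.
have cchi : cs chi by exists (ann t1 t4).
have zin00 : supp_in (ann 0 d0) zin.
  move=> x nx; have [dx|ndx] := pselect (dom i x); last by rewrite /zin /rad ext_out.
  rewrite /zin radE// down0// leNgt; apply/negP => h'; apply: nx.
  by apply/sP; [exact: ltW (lt_trans d0T Trr)|split => //; rewrite S0 ltW].
have [c0 c0p hc0] : exists2 c : R, 0 < c & forall x, ann t1 t4 x -> c <= Gam rho rho x.
  apply: compact_min => //; first by apply: sm_cont; sm_.
  move=> x /(sP _ _ _ (ltW t4r))[dx /andP[h1 h2]]; apply: (gam_radial (b := t5)) => //.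
  - by move=> t ht; rewrite down1 ?mulr1// ltW.
  - by rewrite (lt_le_trans ot1 h1) (le_lt_trans h2 ot6).
have [gm [Cc [tau0 [gmp Cc0 tau0p hC]]]] := int_carleman hmu KAc srho c0p hc0.
have sG : sm (Gam chi chi) by sm_.
have sLc : sm (fun x => Lap chi x ^+ 2) by sm_.
have [D1 hD1] := bcs_bound (bcs_sm sG (cs_Gam chi cchi)).
have bL2 : bcs (fun x => Lap chi x ^+ 2) by apply: bcs_sm; [sm_|cs_].
have [D2 hD2] := bcs_bound bL2.
pose D := `|D1| + `|D2|; have D0 : 0 <= D by rewrite /D; pos.
have GD x : Gam chi chi x <= D.
  apply: le_trans (ler_norm _) _; apply: le_trans (hD1 x) _.
  by apply: le_trans (ler_norm _) _; rewrite lerDl.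
have LD x : Lap chi x ^+ 2 <= D.
  apply: le_trans (ler_norm _) _; apply: le_trans (hD2 x) _.
  by apply: le_trans (ler_norm _) _; rewrite lerDr.
have [F1 hF1] := bcs_bound (bcs_sm (sm_Gam szin szin) (cs_Gam zin czin)).
have [F2 hF2] := bcs_bound (bcs_sm (sm_Gam szout szout) (cs_Gam zout czout)).
pose Dz := `|F1| + `|F2|; have Dz0 : 0 <= Dz by rewrite /Dz; pos.
have zinD x : Gam zin zin x <= Dz.
  apply: le_trans (ler_norm _) _; apply: le_trans (hF1 x) _.
  by apply: le_trans (ler_norm _) _; rewrite lerDl.
have zoutD x : Gam zout zout x <= Dz.
  apply: le_trans (ler_norm _) _; apply: le_trans (hF2 x) _.
  by apply: le_trans (ler_norm _) _; rewrite lerDr.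
have sq1 (t : R) : 0 <= t <= 1 -> t ^+ 2 <= 1 by move=> /andP[a b]; exact: exprn_ile1.
have ud (a b c d t : R) : 0 <= up a b t * down c d t <= 1.
  have /andP[u0 u1] := up_itv a b t; have /andP[w0 w1] := down_itv c d t.
  by rewrite mulr_ge0//= mulr_ile1.
have rad01 (a : R -> R) : (forall t, 0 <= a t <= 1) -> forall x, rad a x ^+ 2 <= 1.
  move=> ha x; have [dx|ndx] := pselect (dom i x); last by rewrite /rad ext_out// expr0n.
  by rewrite radE//; exact: sq1.
have chi1 : forall x, chi x ^+ 2 <= 1 by apply: rad01 => t; exact: ud.
have zin1 : forall x, zin x ^+ 2 <= 1 by apply: rad01 => t; exact: down_itv.
have zout1 : forall x, zout x ^+ 2 <= 1 by apply: rad01 => t; exact: ud.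
have rho0 x : rho x <= 0.
  have [dx|ndx] := pselect (dom i x); last by rewrite /rho /rad ext_out.
  rewrite /rho radE// mulNr oppr_le0 mulr_ge0//.
  by have /andP[] := down_itv t5 rr (S x).
have flat_ x : ~ (dom i x /\ (t1 <= S x <= t2 \/ t3 <= S x <= t4)) ->
    Gam chi chi x = 0 /\ Lap chi x = 0.
  move=> nx; have [dx|ndx] := pselect (dom i x); last first.
    apply: (@gam_locally_cst _ _ _ chi 0 (~` ann t1 t4)) => //.
      by apply: closed_openC; exact: compact_closedM.
    by move=> /(sP _ _ _ (ltW t4r))[].
  have [h1|h1] := ltP (S x) t1.
    apply: (@gam_locally_cst _ _ _ chi 0 (dom i `&` [set y | S y < t1])) => //.
      by apply: (@sqd_open _ _ _ i p [set t | t < t1]); exact: open_lt.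
    by move=> y [dy /= hy]; rewrite /chi radE// up0 ?mul0r// ltW.
  have [h2|h2] := leP (S x) t2; first by case: nx; split => //; left; rewrite h1.
  have [h3|h3] := ltP (S x) t3.
    apply: (@gam_locally_cst _ _ _ chi 1 (dom i `&` [set y | t2 < S y < t3])) => //; last first.
    - by split => //=; rewrite h2.
    - by move=> y [dy /= /andP[hy hy']]; rewrite /chi radE// up1 ?(ltW hy)// down1 ?(ltW hy')// mulr1.
    apply: (@sqd_open _ _ _ i p [set t | t2 < t < t3]).
    rewrite (_ : [set t | _] = `]t2, t3[%classic); first exact: interval_open.
    by apply/funext => s /=; rewrite in_itv.
  have [h4|h4] := leP (S x) t4; first by case: nx; split => //; right; rewrite h3.
  apply: (@gam_locally_cst _ _ _ chi 0 (dom i `&` [set y | t4 < S y])) => //.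
    by apply: (@sqd_open _ _ _ i p [set t | t4 < t]); exact: open_gt.
  by move=> y [dy /= hy]; rewrite /chi radE// [down _ _ _]down0 ?mulr0// ltW.
pose Cz := 15 + 12 * L + 48 * Dz; have Cz0 : 0 <= Cz by rewrite /Cz; pos.
(* The summands provide, in this order, [1 <= tau], the range of the Carleman estimate, the
   absorption of the term in [L], and the factor [eta] for the outer mass; [tau <= tau^2] turns them
   into bounds on [tau^2]. *)
pose tau := 1 + tau0 + 6 * Cc * L + 2 * Cc * D * Cz / eta.
have [q1 [q2 q3]] : 0 <= 6 * Cc * L /\ 0 <= 2 * Cc * D * Cz / eta /\ 0 <= tau0.
  by split; [pos|split; [pos|exact: ltW]].
have tau1 : 1 <= tau by rewrite /tau; clear -q1 q2 q3; lra.
have tp : 0 < tau by apply: lt_le_trans tau1.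
have tt : tau <= tau ^+ 2 by rewrite expr2 ler_peMl// ltW.
pose psi3 := expR (- (gm * t3)); pose psiT := expR (- (gm * T)).
have psi3T : psi3 <= psiT by rewrite ler_expR lerN2 ler_pM2l// ltW.
pose a1 := expR (2 * tau); pose a3 := expR (2 * tau * psi3); pose aT := expR (2 * tau * psiT).
have aTp : 0 < aT by exact: expR_gt0.
have a3T : a3 <= aT by rewrite ler_expR ler_pM2l// mulr_gt0.
pose C1 := 2 * Cc / tau ^+ 2 / aT * (3 * a1 + D * a1 * Cz + D * a3 * Cz).
have tau2p : 0 < tau ^+ 2 by rewrite exprn_gt0.
have C10 : 0 <= C1.
  by rewrite /C1; apply: mulr_ge0; [pos|rewrite !addr_ge0//; rewrite ?mulr_ge0 ?expR_ge0].
exists (1 + C1); first by rewrite addr_ge0.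
move=> v1 v2 f hs; have [s1 s2 c1 c2 bf f0 hE] := hs.
have bE := bcs_e2 s1 s2 c1 c2; have E0 := e2_ge0 v1 v2.
pose psi x := expR (gm * rho x); pose phi x := tau * psi x.
have sphi : sm phi by rewrite /phi; apply: smM; [exact: sm_cst|apply: sm_exp; sm_].
have sEx : sm (fun x => expR (phi x)) by exact: sm_exp.
pose u1 x := expR (phi x) * (chi x * v1 x); pose u2 x := expR (phi x) * (chi x * v2 x).
have su1 : sm u1 by rewrite /u1; sm_.
have su2 : sm u2 by rewrite /u2; sm_.
have u10 : supp_in (ann t1 t4) u1 by move=> x /chi0 h; rewrite /u1 h mul0r mulr0.
have u20 : supp_in (ann t1 t4) u2 by move=> x /chi0 h; rewrite /u2 h mul0r mulr0.
have htau : tau0 <= tau by rewrite /tau; clear -q1 q2 q3; lra.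
have h1 := hC tau u1 phi erefl htau su1 u10; have h2 := hC tau u2 phi erefl htau su2 u20.
have P1 v : sm v -> (fun x => (Lap (fun x => expR (phi x) * (chi x * v x)) x - 2 * Gam phi (fun x => expR (phi x) * (chi x * v x)) x +
    (Gam phi phi x - Lap phi x) * (expR (phi x) * (chi x * v x))) ^+ 2) =
    (fun x => (expR (phi x) * (chi x * Lap v x + v x * Lap chi x + 2 * Gam chi v x)) ^+ 2).
  move=> sv; apply/funext => x; have sz : sm (fun x => chi x * v x) by sm_.
  by rewrite (conj_lap x sphi sz) LapM.
rewrite (P1 v1 s1) in h1; rewrite (P1 v2 s2) in h2.
set w1 := (fun x => (_ * (chi x * Lap v1 x + _ + _)) ^+ 2) in h1.
set w2 := (fun x => (_ * (chi x * Lap v2 x + _ + _)) ^+ 2) in h2.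
pose g0 x := u1 x * u1 x + u2 x * u2 x.
pose gin x := zin x * zin x * (3 * e2 v1 v2 x + 12 * (Gam v1 v1 x + Gam v2 v2 x)).
pose gout x := zout x * zout x * (3 * e2 v1 v2 x + 12 * (Gam v1 v1 x + Gam v2 v2 x)).
have sE : sm (e2 v1 v2) by rewrite /e2; sm_.
have cE : cs (e2 v1 v2) by rewrite /e2; cs_.
have cu1 : cs u1 by exists (ann t1 t4).
have cu2 : cs u2 by exists (ann t1 t4).
have bu1 : bcs (fun x => u1 x * u1 x) by bcs_.
have bu2 : bcs (fun x => u2 x * u2 x) by bcs_.
have bg0 : bcs g0 by exact: bcsD.
have bgin : bcs gin by rewrite /gin; bcs_.
have bgout : bcs gout by rewrite /gout; bcs_.
have bw1 : bcs w1 by rewrite /w1; bcs_.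
have bw2 : bcs w2 by rewrite /w2; bcs_.
have wE x : w1 x + w2 x <= 3 * L * g0 x + 3 * a1 * f x + D * a1 * gin x + D * a3 * gout x.
  have Ea : expR (phi x) ^+ 2 <= a1.
    rewrite -expRM_natl /a1 ler_expR /phi mulrA ler_piMr//; first by rewrite mulr_ge0// ltW.
    by rewrite /psi -expR0 ler_expR pmulr_rle0.
  have Wp : D * (a1 * zin x ^+ 2 + a3 * zout x ^+ 2) =
     D * (a1 * zin x ^+ 2 + a3 * zout x ^+ 2) by [].
  have key t : 0 <= t -> t <= D -> (~ (dom i x /\ (t1 <= S x <= t2 \/ t3 <= S x <= t4)) -> t = 0) ->
      expR (phi x) ^+ 2 * t <= D * (a1 * zin x ^+ 2 + a3 * zout x ^+ 2).
    move=> t0' tD tz; have [[dx [/andP[h3 h4]|/andP[h3 h4]]]|nx] := pselect (dom i x /\ (t1 <= S x <= t2 \/ t3 <= S x <= t4)).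
    - have -> : zin x = 1 by rewrite /zin radE// down1.
      rewrite expr1n mulr1 mulrC; apply: ler_pM => //.
      by apply: le_trans Ea _; rewrite lerDl mulr_ge0 ?expR_ge0 ?sqr_ge0.
    - have -> : zout x = 1 by rewrite /zout radE// up1 ?down1 ?mulr1.
      rewrite expr1n mulr1 mulrC; apply: ler_pM => //.
      apply: (@le_trans _ _ a3); last by rewrite lerDr mulr_ge0 ?expR_ge0 ?sqr_ge0.
      rewrite -expRM_natl /a3 ler_expR /phi mulrA ler_pM2l ?mulr_gt0// ler_expR.
      rewrite /rho radE// down1 ?mulr1; first by rewrite mulrN lerN2 ler_pM2l.
        exact: ot7.
      exact: le_trans h4 (ltW ot6).
    - by rewrite tz// mulr0 mulr_ge0// addr_ge0// mulr_ge0 ?expR_ge0 ?sqr_ge0.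
  have kl : expR (phi x) ^+ 2 * Lap chi x ^+ 2 <= D * (a1 * zin x ^+ 2 + a3 * zout x ^+ 2).
    by apply: key; [exact: sqr_ge0|exact: LD|move=> hx; rewrite (flat_ x hx).2 expr0n].
  have kg : expR (phi x) ^+ 2 * Gam chi chi x <= D * (a1 * zin x ^+ 2 + a3 * zout x ^+ 2).
    by apply: key => //; [exact: Gam_ge0|move=> h; rewrite (flat_ x h).1].
  have := cutoff_pointwise L0 (expR_ge0 (phi x)) (chi1 x) Ea (f0 x) (hE x)
    (Gam_cs chi v1 x) (Gam_cs chi v2 x) (Gam_ge0 v1 x) (Gam_ge0 v2 x) kl kg.
  move=> hh; apply: le_trans hh _; rewrite /g0 /u1 /u2 /gin /gout /e2.
  move: (expR _) (chi x) (zin x) (zout x) (v1 x) (v2 x) (Gam v1 v1 x) (Gam v2 v2 x) (f x) => *.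
  by apply: le_of_eq; ring.
have IW : II w1 + II w2 <= 3 * L * II g0 + 3 * a1 * II f + D * a1 * II gin + D * a3 * II gout.
  rewrite -(IID hmu bw1 bw2) -(II_lin4 hmu _ _ _ _ bg0 bf bgin bgout).
  by apply: II_le => //; [exact: bcsD|exact: bcs_lin4].
set Jd := JJ (ann 0 d0) (e2 v1 v2); set Jr := JJ (ann 0 rr) (e2 v1 v2); set JT := JJ (ann 0 T) (e2 v1 v2).
have clo a t : closed (ann a t) by apply: compact_closedM; exact: ann_compact.
have Iin : II gin <= Cz * (Jd + II f).
  apply: (cacc_sol hmu L0 Dz0 hs (cm 0 d0) szin czin zin00 _ zin1 zinD).
  by apply: supp_Gam => //; exact: clo.
have Iout : II gout <= Cz * (Jr + II f).
  apply: (cacc_sol hmu L0 Dz0 hs (cm 0 rr) szout czout zout0 _ zout1 zoutD).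
  by apply: supp_Gam => //; exact: clo.
have If0 : 0 <= II f by exact: II_ge0.
have Jd0 : 0 <= Jd by exact: JJ_ge0.
have Jr0 : 0 <= Jr by exact: JJ_ge0.
have g00 : 0 <= II g0 by apply: II_ge0 => x; rewrite /g0; pos.
have main : tau ^+ 2 * II g0 <= Cc * (3 * L * II g0 + 3 * a1 * II f + D * a1 * (Cz * (Jd + II f)) + D * a3 * (Cz * (Jr + II f))).
  have g0E : II g0 = II (fun x => u1 x * u1 x) + II (fun x => u2 x * u2 x) := IID hmu bu1 bu2.
  rewrite {1}g0E mulrDr; apply: le_trans (lerD h1 h2) _; rewrite -mulrDr.
  apply: ler_wpM2l => //; apply: le_trans IW _; apply: lerD; first apply: lerD => //.
    by apply: ler_wpM2l => //; rewrite mulr_ge0 ?expR_ge0.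
  by apply: ler_wpM2l => //; rewrite mulr_ge0 ?expR_ge0.
have absorb : Cc * (3 * L * II g0) <= tau ^+ 2 / 2 * II g0.
  rewrite !mulrA; apply: ler_wpM2r => //.
  have : 6 * Cc * L <= tau by rewrite /tau; clear -q1 q2 q3; lra.
  by clear -tt; lra.
have low : aT * JJ (ann t2 T) (e2 v1 v2) <= II g0.
  rewrite -(IIZ hmu); last exact: bcs_ind.
  apply: II_le => //; first by apply: bcsZ; exact: bcs_ind.
  move=> x; have [hx|nx] := pselect (ann t2 T x); last first.
    by rewrite indicE memNset// mul0r mulr0 /g0; pos.
  have [dx /andP[h3 h4]] := (sP _ _ _ (ltW Trr)).1 hx.
  rewrite indicE mem_set// mul1r /g0 /u1 /u2.
  have -> : chi x = 1 by rewrite /chi radE// up1// down1 ?mulr1// (le_trans h4)// ltW.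
  rewrite !mul1r (_ : _ + _ = expR (phi x) ^+ 2 * e2 v1 v2 x); last by rewrite /e2; ring.
  apply: ler_wpM2r => //; rewrite -expRM_natl /aT ler_expR /phi mulrA ler_pM2l ?mulr_gt0// ler_expR.
  rewrite /rho radE// down1 ?mulr1//; first by rewrite mulrN lerN2 ler_pM2l.
  by apply: le_trans h4 _; apply: ltW; exact: lt_trans (lt_trans ot4 ot5) ot6.
have JTs : JT <= Jd + JJ (ann t2 T) (e2 v1 v2).
  apply: le_trans (JJU hmu (cm 0 d0) (cm t2 T) bE E0); apply: JJ_mono => //; first exact: measurableU.
  move=> x /(sP _ _ _ (ltW Trr))[dx /andP[h3 h4]]; have [h5|h5] := leP (S x) d0.
    by left; apply/sP; [exact: ltW (lt_trans d0T Trr)|split => //; rewrite h3].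
  by right; apply/sP; [exact: ltW|split => //; rewrite h4 andbT ltW// (lt_trans ot3)].
apply: le_trans JTs _.
have mid : JJ (ann t2 T) (e2 v1 v2) <= 2 * Cc / tau ^+ 2 / aT * (3 * a1 * II f + D * a1 * (Cz * (Jd + II f)) + D * a3 * (Cz * (Jr + II f))).
  have : aT * JJ (ann t2 T) (e2 v1 v2) <= 2 * Cc / tau ^+ 2 * (3 * a1 * II f + D * a1 * (Cz * (Jd + II f)) + D * a3 * (Cz * (Jr + II f))).
    apply: le_trans low _.
    have : tau ^+ 2 / 2 * II g0 <= Cc * (3 * a1 * II f + D * a1 * (Cz * (Jd + II f)) + D * a3 * (Cz * (Jr + II f))).
      by clear -main absorb; move: main absorb; rewrite -!addrA mulrDr; lra.
    move: (_ + _ + _) => Q hq; rewrite (_ : 2 * Cc / tau ^+ 2 * Q = (Cc * Q) * (2 / tau ^+ 2)); last by ring.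
    rewrite -ler_pdivrMr ?divr_gt0//; apply: le_trans hq; apply: le_of_eq.
    by field; rewrite gt_eqF.
  move: (_ + _ + _) => Q; rewrite -ler_pdivlMl// => h; apply: le_trans h _.
  by apply: le_of_eq; ring.
have coef : 2 * Cc / tau ^+ 2 / aT * (D * a3 * Cz) <= eta.
  apply: (@le_trans _ _ (2 * Cc * D * Cz / tau ^+ 2)).
    rewrite (_ : _ * (_ * _ * _) = 2 * Cc * D * Cz / tau ^+ 2 * (a3 / aT)); last by ring.
    by apply: ler_piMr; [pos|rewrite ler_pdivrMr// mul1r].
  rewrite ler_pdivrMr//; have : 2 * Cc * D * Cz / eta <= tau by rewrite /tau; clear -q1 q2 q3; lra.
  rewrite ler_pdivrMr// => h; apply: le_trans h _; rewrite mulrC.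
  by apply: ler_wpM2l => //; exact: ltW.
have k0 : 0 <= 2 * Cc / tau ^+ 2 / aT by pos.
have a10 : 0 <= a1 by exact: expR_ge0.
have a30 : 0 <= a3 by exact: expR_ge0.
apply: (@le_trans _ _ (Jd + (2 * Cc / tau ^+ 2 / aT * (D * a3 * Cz) * Jr + C1 * (Jd + II f)))).
  rewrite lerD2l; apply: le_trans mid _; rewrite /C1.
  move: k0; set kk := 2 * Cc / tau ^+ 2 / aT => k0.
  rewrite [leRHS](_ : _ = kk * (D * a3 * Cz * Jr + (3 * a1 + D * a1 * Cz + D * a3 * Cz) * (Jd + II f))); last by ring.
  apply: ler_wpM2l => //.
  have : 0 <= 3 * a1 * Jd + D * a3 * Cz * Jd by pos.
  move=> h; rewrite -subr_ge0; apply: le_trans h _.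
  by apply: le_of_eq; ring.
have := ler_wpM2r Jr0 coef; rewrite [(1 + C1) * _]mulrDl mul1r.
by move: (C1 * _) (_ * Jr) => t s; clear -If0; lra.
Qed.

End Chart.

End LocalProp.

(** * Chaining along the connected manifold *)

Section Chain.
Context {R : realType} {n : nat} (M : riemannian_manifold R n)
  (mu : {measure set (borel M) -> \bar R}) (hmu : riemannian_measure mu).
Implicit Types (f h g u v z phi : M -> R) (x : M) (K A B : set M).
Notation II := (II mu).
Notation JJ := (JJ mu).

(** Mass on [B] is controlled by mass on [A] up to an arbitrarily small multiple of the mass on a
    compact set. [K] is quantified before [L] and [eta], so it does not grow when [eta] has to be
    shrunk in order to compose estimates. *)
Definition ctrl A B := exists2 K : set M, compact K &
  forall L eta : R, 0 <= L -> 0 < eta -> exists2 C : R, 0 <= C &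
  forall v1 v2 f, sol L v1 v2 f ->
  JJ B (e2 v1 v2) <= eta * JJ K (e2 v1 v2) + C * (JJ A (e2 v1 v2) + II f).

Variable A0 : set M.
Hypothesis oA : open A0.

Let mA : measurable (A0 : set (borel M)). Proof. exact: open_borel. Qed.

Let bE L v1 v2 f : sol L v1 v2 f -> bcs (e2 v1 v2).
Proof. by move=> [s1 s2 c1 c2 _ _ _]; exact: bcs_e2. Qed.

Lemma ctrl_mono A B B' : measurable (B : set (borel M)) -> measurable (B' : set (borel M)) ->
  B' `<=` B -> ctrl A B -> ctrl A B'.
Proof.
move=> mB mB' BB [K cK h]; exists K => // L eta L0 e0; have [C C0 hC] := h L eta L0 e0.
exists C => // v1 v2 f hs; apply: le_trans (hC _ _ _ hs).
by apply: JJ_mono => //; [exact: bE hs|exact: e2_ge0].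
Qed.

Lemma ctrl_self : ctrl A0 A0.
Proof.
exists set0; first exact: compact0.
move=> L eta L0 e0; exists 1 => // v1 v2 f [_ _ _ _ _ f0 _].
rewrite mul1r; have h1 : 0 <= II f by exact: II_ge0.
have h2 : 0 <= JJ set0 (e2 v1 v2) by apply: JJ_ge0; exact: e2_ge0.
have := mulr_ge0 (ltW e0) h2; lra.
Qed.

Lemma JJ_compact_mono L v1 v2 f K K' : sol L v1 v2 f -> compact K -> compact K' -> K `<=` K' ->
  JJ K (e2 v1 v2) <= JJ K' (e2 v1 v2).
Proof.
move=> hs cK cK' h; apply: JJ_mono => //; try exact: compact_borel.
  exact: bE hs.
exact: e2_ge0.
Qed.

Lemma ctrlU A B1 B2 : measurable (B1 : set (borel M)) -> measurable (B2 : set (borel M)) ->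
  ctrl A B1 -> ctrl A B2 -> ctrl A (B1 `|` B2).
Proof.
move=> m1 m2 [K1 cK1 h1] [K2 cK2 h2]; exists (K1 `|` K2); first exact: compactU.
move=> L eta L0 e0; have e2p : 0 < eta / 2 by rewrite divr_gt0.
have [C1 C10 hC1] := h1 L (eta / 2) L0 e2p; have [C2 C20 hC2] := h2 L (eta / 2) L0 e2p.
exists (C1 + C2); first by rewrite addr_ge0.
move=> v1 v2 f hs; apply: le_trans (JJU hmu m1 m2 (bE hs) (e2_ge0 v1 v2)) _.
apply: le_trans (lerD (hC1 _ _ _ hs) (hC2 _ _ _ hs)) _.
have k1 := ler_wpM2l (ltW e2p) (JJ_compact_mono hs cK1 (compactU cK1 cK2) (@subsetUl _ K1 K2)).
have k2 := ler_wpM2l (ltW e2p) (JJ_compact_mono hs cK2 (compactU cK1 cK2) (@subsetUr _ K1 K2)).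
rewrite (_ : eta * JJ (K1 `|` K2) _ = eta / 2 * JJ (K1 `|` K2) (e2 v1 v2) + eta / 2 * JJ (K1 `|` K2) (e2 v1 v2)); last by field.
by rewrite [(C1 + C2) * _]mulrDl; move: k1 k2; clear; lra.
Qed.

Let S := [set x | exists U : set M, [/\ open U, U x & ctrl A0 U]].

Let openS : open S.
Proof.
rewrite openE => x [U [oU Ux cU]]; apply: (@filterS _ _ _ U); last exact: open_nbhs_nbhs.
by move=> y Uy; exists U.
Qed.

(** Some point [y] of the set lies close to [x] in a chart. [local_prop] centred at [y], started
    from a small ball inside a controlled neighbourhood of [y], reaches a ball that contains [x]. *)
Let closedS : closed S.
Proof.
move=> x clx; pose i := cidx x; have dx : dom i x := cidxP x.
have oD := dom_open (chartM i); have oI := img_open (chartM i).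
have ix : img i (chart i x) by exists x.
have [r2 r20 hr2] := cball_in oI ix.
(* Half the radius, so that the ball of radius [r] about any point at distance at most [r] from [x]
   stays in the chart. *)
pose r := r2 / 2; have r0 : 0 < r by rewrite divr_gt0.
pose T := r ^+ 2 / 2; have T0 : 0 < T by rewrite divr_gt0// exprn_gt0.
have Tr : T < r ^+ 2 by rewrite /T ltr_pdivrMr// ltr_pMr ?exprn_gt0// ltr1n.
have oN : open (dom i `&` [set y | sqd i (chart i x) y < T]).
  by apply: (@sqd_open _ _ _ i (chart i x) [set t | t < T]); exact: open_lt.
have [|y [[U [oU Uy cU]] [dy /= hy]]] := clx (dom i `&` [set y | sqd i (chart i x) y < T]).
  apply: nbhs_of_open => //; split => //=.
  by rewrite /sqd big1// => l _; rewrite subrr expr0n.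
pose p := chart i y.
have pr : cball p r `<=` img i.
  move=> q hq; apply: hr2; rewrite /cball /=.
  have : cball (chart i x) r p by apply: (sqd_norm (ltW r0)); apply: ltW; exact: lt_trans Tr.
  rewrite /cball /= => h; rewrite -(subrK p q) -addrA; apply: le_trans (ler_normD _ _) _.
  by rewrite [r2]splitr lerD.
have Up : cimg i U p by apply: cimg_chart.
have [dl dl0 hdl] := cball_in (cimg_open oU) Up.
pose d0 := Num.min (dl ^+ 2) (T / 2).
have d0p : 0 < d0 by rewrite lt_min exprn_gt0//= divr_gt0.
have d0T : d0 < T by rewrite gt_min [T / 2 < T]ltr_pdivrMr// ltr_pMr// ltr1n orbT.
have annU : ann i p r 0 d0 `<=` U.
  move=> z /(@annP _ _ _ i p r r0 pr _ _ _ (ltW (lt_trans d0T Tr)))[dz /andP[_ hz]].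
  have : cball p dl (chart i z).
    by apply: (sqd_norm (ltW dl0)); apply: le_trans hz _; rewrite ge_min lexx.
  by move=> /hdl/cimgP[_]; rewrite (chartK (chartM i)).
exists (dom i `&` [set z | sqd i p z < T]); split.
- by apply: (@sqd_open _ _ _ i p [set t | t < T]); exact: open_lt.
- split => //=; rewrite (_ : sqd i p x = sqd i (chart i x) y)//.
  by apply: eq_bigr => l _; rewrite -sqrrN opprB.
have [K cK hK] := cU.
have ca a t := @ann_compact _ _ _ i p r pr a t.
exists (ann i p r 0 (r ^+ 2) `|` K); first exact: compactU.
move=> L eta L0 e0; have e2p : 0 < eta / 2 by rewrite divr_gt0.
have [C C0 hC] := local_prop hmu r0 pr d0p d0T Tr L0 e2p.
(* Small enough to survive multiplication by the constant [C] of the local estimate. *)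
pose eta' := eta / 2 / (C + 1); have C1 : 0 < C + 1 by rewrite ltr_wpDl.
have e'p : 0 < eta' by rewrite divr_gt0.
have [D D0 hD] := hK L eta' L0 e'p.
exists (C * (D + 1)); first by rewrite mulr_ge0// addr_ge0.
move=> v1 v2 f hs; have b := bE hs; have E0 := e2_ge0 v1 v2.
set E := e2 v1 v2 in b E0 *.
have q1 : JJ (dom i `&` [set z | sqd i p z < T]) E <= JJ (ann i p r 0 T) E.
  apply: JJ_mono => //.
  - by apply: open_borel; apply: (@sqd_open _ _ _ i p [set t | t < T]); exact: open_lt.
  - by apply: compact_borel; exact: ca.
  - move=> z [dz /= hz]; apply/(@annP _ _ _ i p r r0 pr _ _ _ (ltW Tr)); split => //.
    by rewrite (ltW hz) andbT sumr_ge0// => l _; rewrite sqr_ge0.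
apply: le_trans q1 _; apply: le_trans (hC _ _ _ hs) _; rewrite -/E.
have q2 : JJ (ann i p r 0 d0) E <= JJ U E.
  by apply: JJ_mono => //; [apply: compact_borel; exact: ca|exact: open_borel].
have q3 := hD _ _ _ hs; rewrite -/E in q3.
have cU' := compactU (ca 0 (r ^+ 2)) cK.
have q4 := JJ_compact_mono hs (ca 0 (r ^+ 2)) cU' (@subsetUl _ _ K).
have q5 := JJ_compact_mono hs cK cU' (@subsetUr _ (ann i p r 0 (r ^+ 2)) K).
rewrite -/E in q4 q5.
set JU := JJ (_ `|` _) E in q4 q5 *.
have JU0 : 0 <= JU by exact: JJ_ge0.
have If0 : 0 <= II f by apply: II_ge0; exact: solf0 hs.
have JA0 : 0 <= JJ A0 E by exact: JJ_ge0.
have q6 : C * JJ (ann i p r 0 d0) E <= C * (eta' * JU + D * (JJ A0 E + II f)).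
  apply: ler_wpM2l => //; apply: le_trans q2 _; apply: le_trans q3 _.
  by rewrite lerD2r; apply: ler_wpM2l => //; exact: ltW.
have q7 : C * eta' * JU <= eta / 2 * JU.
  apply: ler_wpM2r => //; rewrite (_ : eta / 2 = (C + 1) * eta').
    by apply: ler_wpM2r; [exact: ltW|rewrite lerDl].
  by rewrite /eta' mulrCA mulfV ?mulr1// gt_eqF.
have q8 := ler_wpM2l (ltW e2p) q4.
have q9 : 0 <= C * JJ A0 E by exact: mulr_ge0.
rewrite (_ : eta * JU = eta / 2 * JU + eta / 2 * JU); last by field.
rewrite (_ : C * (D + 1) * _ = C * (D * (JJ A0 E + II f)) + C * JJ A0 E + C * II f); last by ring.
rewrite mulrDr mulrA in q6; rewrite mulrDr; move: q6 q7 q8 q9.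
move: (C * JJ (ann _ _ _ _ _) E) (C * II f) (C * JJ A0 E) (C * (D * _)) (C * eta' * JU) (eta / 2 * JU) => *.
lra.
Qed.

(** The controlled points form a nonempty set that is open and closed. *)
Lemma chain : connected [set: M] -> A0 !=set0 -> forall x, exists U : set M,
  [/\ open U, U x & ctrl A0 U].
Proof.
move=> cM [a Aa] x; have : S = setT.
  apply: cM.
  - by exists a, A0; split => //; exact: ctrl_self.
  - by exists S; [exact: openS|rewrite setTI].
  - by exists S; [exact: closedS|rewrite setTI].
by move=> e; have : S x by rewrite e.
Qed.

Lemma chain_compact K : connected [set: M] -> A0 !=set0 -> compact K -> ctrl A0 K.
Proof.
move=> cM nA cK; have [B [mB KB cB]] : exists B, [/\ measurable (B : set (borel M)), K `<=` B & ctrl A0 B].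
  apply: (compact_ind (P := fun A => exists B, [/\ measurable (B : set (borel M)), A `<=` B & ctrl A0 B])) cK _ _ _ _.
  - exists set0; split => //.
    by apply: (ctrl_mono mA _ (@sub0set _ A0) ctrl_self).
  - move=> A B [A' [m1 s1 c1]] [B' [m2 s2 c2]]; exists (A' `|` B'); split.
    + exact: measurableU.
    + exact: setUSS.
    + exact: ctrlU.
  - by move=> A B AB [B' [m s c]]; exists B'; split => //; exact: subset_trans s.
  - move=> x Kx; have [U [oU Ux cU]] := chain cM nA x; exists U; first exact: open_nbhs_nbhs.
    by exists U; split => //; exact: open_borel.
by apply: ctrl_mono KB cB => //; exact: compact_borel.
Qed.

End Chain.

(** * The Carleman weight at infinity *)

Section SmoothDer.
Context {R : realType}.
Implicit Types f g : R -> R.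

(** The derivative is carried along as an explicit function on the half-line, so that long
    computations with weights are chained without evaluating [der]. *)
Definition smoothder f f' := (forall k, Ck1 k [set t : R | 0 < t] f) /\
  forall t : R, 0 < t -> is_derive t (1 : R) f (f' t).

Lemma smoothder_eq f f' g : smoothder f f' -> (forall t : R, 0 < t -> f' t = g t) -> smoothder f g.
Proof. by move=> [h1 h2] e; split => // t t0; rewrite -e//; exact: h2. Qed.

Lemma smoothder_cst (c : R) : smoothder (fun=> c) (fun=> 0).
Proof. by split => [k|t t0]; [exact: Ck_cst|exact: is_derive_cst]. Qed.

Lemma smoothderD f f' g g' : smoothder f f' -> smoothder g g' ->
  smoothder (fun t => f t + g t) (fun t => f' t + g' t).
Proof.
move=> [h1 h2] [k1 k2]; split => [k|t t0]; first by apply: CkD; [exact: (@open_pos R)|exact: h1|exact: k1].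
by apply: is_deriveD; [exact: h2|exact: k2].
Qed.

Lemma smoothderM f f' g g' : smoothder f f' -> smoothder g g' ->
  smoothder (fun t => f t * g t) (fun t => f' t * g t + f t * g' t).
Proof.
move=> [h1 h2] [k1 k2]; split => [k|t t0]; first by apply: CkM; [exact: (@open_pos R)|exact: h1|exact: k1].
have := @is_deriveM _ _ f g t 1 (f' t) (g' t) (h2 t t0) (k2 t t0).
by move=> h; apply: is_derive_eq; rewrite addrC /GRing.scale /= [g t * _]mulrC.
Qed.

Lemma smoothderX f f' k : smoothder f f' ->
  smoothder (fun t => f t ^+ k.+1) (fun t => k.+1%:R * (f t ^+ k * f' t)).
Proof.
move=> hf; elim: k => [|k IH]; first by apply: smoothder_eq hf _ => t _; rewrite expr0 !mul1r.
have h := smoothderM hf IH.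
rewrite (_ : (fun t => f t ^+ k.+2) = (fun t => f t * f t ^+ k.+1)); last first.
  by apply/funext => t; rewrite exprS.
apply: smoothder_eq h _ => t _; rewrite [k.+2%:R]mulrSr exprS; ring.
Qed.

Lemma smoothderV f f' : (forall t : R, 0 < t -> 0 < f t) -> smoothder f f' ->
  smoothder (fun t => (f t)^-1) (fun t => - (f t ^- 2 * f' t)).
Proof.
move=> f0 [h1 h2]; split => [k|t t0].
  apply: (@Ck_comp1 R R unit (fun=> 1) k [set t | 0 < t] [set t | t != 0] f (fun t => t^-1)).
  - exact: (@open_pos R).
  - by move=> t ht; rewrite /= gt_eqF//; exact: f0.
  - exact: h1.
  - exact: Ck1_inv.
have ft := lt0r_neq0 (f0 _ t0); have [d1 d2] := h2 t t0.
apply: DeriveDef; first exact: derivableV.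
by rewrite deriveV// d2 /GRing.scale /= mulNr.
Qed.

Lemma smoothder_powR (p : R) : smoothder (fun t => t `^ p) (fun t => p * (t `^ p / t)).
Proof.
split => [k|t t0]; first exact: Ck1_powR.
apply: is_derive_eq (is_derive1_powR p t0) _; congr (_ * _).
by rewrite powRB ?powRr1 ?ltW// (gt_eqF t0) implybT.
Qed.

Lemma smoothder_inv : smoothder (fun t => t^-1) (fun t => - t ^- 2).
Proof.
have h : smoothder id (fun=> 1 : R).
  by split => [k|t t0]; [apply: Ck1_id; exact: (@open_pos R)|exact: is_derive_id].
by apply: smoothder_eq (smoothderV _ h) _ => // t _; rewrite mulr1.
Qed.

End SmoothDer.

Section Composition.
Context {R : realType} {n : nat} (M : riemannian_manifold R n).
Implicit Types (h : M -> R) (x : M).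
Variable w : M -> R.
Hypotheses (sw : sm w) (w0 : forall x, 0 < w x).

Lemma smoothder_sm f f' : smoothder f f' -> sm (fun x => f (w x)).
Proof. by move=> [h _]; exact: (sm_comp1 (J := [set t | 0 < t])). Qed.

Lemma smoothder_Gam f f' h x : smoothder f f' ->
  Gam (fun y => f (w y)) h x = f' (w x) * Gam w h x.
Proof.
move=> [h1 h2]; rewrite (Gam_comp1 (J := [set t | 0 < t]))//.
by rewrite (der_val (h2 _ (w0 x))).
Qed.

Lemma smoothder_Lap f f' f'' x : smoothder f f' -> smoothder f' f'' ->
  Lap (fun y => f (w y)) x = f' (w x) * Lap w x + f'' (w x) * Gam w w x.
Proof.
move=> [h1 h2] [k1 k2]; rewrite (Lap_comp1 _ (@open_pos R) w0 h1 sw).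
rewrite (der_val (h2 _ (w0 x))); congr (_ + _ * _).
apply: der_val; apply: near_eq_is_derive (k2 _ (w0 x)).
near=> t; rewrite (der_val (h2 t _))//; near: t; apply: nbhs_of_open => //; exact: (@open_pos R).
Unshelve. all: by end_near. Qed.

End Composition.

Section Weights.
Context {R : realType}.
Variables (k m : nat) (ell tau lam : R).
Hypotheses (k0 : (0 < k)%N) (ell0 : 0 < ell).
Notation kap := ((4 * k)%:R^-1 : R).
Notation N := (4 * k)%N.

(** For [ell = 0] one has [wP = 1], the phase is [tau (4/3) r^(3/4)] and the multiplier [wa] is [r].
    A positive [ell] replaces [S = r^kap] by [Y = S / (1 + ell S)], which is bounded by [1 / ell];
    as [S^(4k) = r], [wa] is [Y^(4k)] and the phase is [tau (4/3) Y^(3k)]. Derivatives bring in only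
    the factors [P], [1 - P] and [1 / r]. *)
Definition wS (r : R) := r `^ kap.
Definition wP (r : R) := (1 + ell * wS r)^-1.
Definition wY (r : R) := wS r * wP r.
Definition wa (r : R) := r * wP r ^+ N.
Definition wa1 (r : R) := wP r ^+ N * wP r.
Definition wphi (r : R) := tau * (4 / 3) * wY r ^+ (3 * k).
Definition wphi1 (r : R) := tau * (wY r ^+ (3 * k) * (wP r * r^-1)).
(** The ratio [r phi'' / phi'], equal to -1/4 when [ell = 0]. *)
Definition wT (r : R) := 3 / 4 * wP r - kap * (1 - wP r) - 1.
Definition wphi2 (r : R) := wphi1 r * (r^-1 * wT r).

Lemma wP_def r : wP r = (1 + ell * wS r)^-1. Proof. by []. Qed.
Lemma wphi_def r : wphi r = tau * (4 / 3) * wY r ^+ (3 * k). Proof. by []. Qed.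
(** [m / 2] times [wa / r], the usual companion of order zero of the radial multiplier. *)
Definition wq (r : R) := m%:R / 2 * wP r ^+ N.
Definition wq1 (r : R) := - (m%:R / 2) * (wP r ^+ N * ((1 - wP r) * r^-1)).
Definition wq2 (r : R) := - (m%:R / 2) * (wP r ^+ N * (1 - wP r) * r^-1 * r^-1 * (- (1 - wP r) + kap * wP r - 1)).
Definition wE (r : R) := - wT r - m%:R.
(** [lambda + phi'^2 - Lap phi], with [Lap w] replaced by its model value [m / r]; see [wc_conj]. *)
Definition wc (r : R) := lam + wphi1 r ^+ 2 + wphi1 r * (r^-1 * wE r).
Definition wc1 (r : R) := 2 * wphi1 r * wphi2 r + (wphi2 r * r^-1 - wphi1 r * r^-1 * r^-1) * wE r
  + wphi1 r * r^-1 * ((kap + 3 / 4) * kap * wP r * (1 - wP r) * r^-1).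

Lemma wS_gt0 r : 0 < r -> 0 < wS r. Proof. exact: powR_gt0. Qed.

Lemma wden_gt0 r : 0 < r -> 0 < 1 + ell * wS r.
Proof. by move=> r0; rewrite addr_gt0// mulr_gt0// wS_gt0. Qed.

Lemma wP_gt0 r : 0 < r -> 0 < wP r. Proof. by move=> r0; rewrite invr_gt0 wden_gt0. Qed.

Lemma wP_le1 r : 0 < r -> wP r <= 1.
Proof. by move=> r0; rewrite invf_le1 ?wden_gt0// lerDl mulr_ge0// ltW// wS_gt0. Qed.

Lemma w1P r : 0 < r -> 1 - wP r = ell * wS r * wP r.
Proof. by move=> r0; rewrite /wP; field; rewrite gt_eqF// wden_gt0. Qed.

Let Nk : kap * N%:R = 1 :> R.
Proof. by rewrite mulVf// pnatr_eq0 muln_eq0 -lt0n. Qed.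

Lemma wS_der : smoothder wS (fun r => kap * (wS r / r)).
Proof. exact: smoothder_powR. Qed.

Lemma wP_der : smoothder wP (fun r => - kap * (wP r * ((1 - wP r) * r^-1))).
Proof.
have h := smoothderD (smoothder_cst 1) (smoothderM (smoothder_cst ell) wS_der).
apply: smoothder_eq (smoothderV wden_gt0 h) _ => r r0; rewrite (w1P r0) /wP.
have := wden_gt0 r0; move: (1 + _) => D D0; by move: (N%:R^-1) => K; field; rewrite (gt_eqF r0) (gt_eqF D0).
Qed.

Lemma wPN_der : smoothder (fun r => wP r ^+ N) (fun r => - (wP r ^+ N * ((1 - wP r) * r^-1))).
Proof.
have NS : N = N.-1.+1 by rewrite prednK// muln_gt0.
rewrite [in fun r => wP r ^+ N]NS; apply: smoothder_eq (smoothderX _ wP_der) _ => r r0.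
rewrite -NS; have -> : wP r ^+ N = wP r * wP r ^+ N.-1 by rewrite -exprS -NS.
move: Nk; move: ((N%:R : R)^-1) (N%:R : R) => K N' h; rewrite -[RHS]mul1r -h; ring.
Qed.

Lemma wa_der : smoothder wa wa1.
Proof.
have h : smoothder id (fun=> 1 : R).
  by split => [j|t t0]; [apply: Ck1_id; exact: (@open_pos R)|exact: is_derive_id].
by apply: smoothder_eq (smoothderM h wPN_der) _ => r r0; rewrite /wa1; field; rewrite gt_eqF.
Qed.

Lemma wY_der : smoothder wY (fun r => kap * (wY r * (wP r * r^-1))).
Proof.
by apply: smoothder_eq (smoothderM wS_der wP_der) _ => r r0; rewrite /wY; ring.
Qed.

Lemma wYX_der : smoothder (fun r => wY r ^+ (3 * k)) (fun r => 3 / 4 * (wY r ^+ (3 * k) * (wP r * r^-1))).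
Proof.
have NS : (3 * k = (3 * k).-1.+1)%N by rewrite prednK// muln_gt0.
rewrite [in fun r => wY r ^+ (3 * k)]NS; apply: smoothder_eq (smoothderX _ wY_der) _ => r r0.
rewrite -NS; have -> : wY r ^+ (3 * k) = wY r * wY r ^+ (3 * k).-1 by rewrite -exprS -NS.
have -> : (3 / 4 : R) = (3 * k)%:R * kap.
  by rewrite !natrM; field; rewrite ?pnatr_eq0 -?lt0n// andbT.
by ring.
Qed.

Lemma wphi_der : smoothder wphi wphi1.
Proof.
apply: smoothder_eq (smoothderM (smoothder_cst _) wYX_der) _ => r r0.
by rewrite /wphi1; field; rewrite gt_eqF.
Qed.

Lemma wphi1_der : smoothder wphi1 wphi2.
Proof.
have h := smoothderM (smoothder_cst tau) (smoothderM wYX_der (smoothderM wP_der smoothder_inv)).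
apply: smoothder_eq h _ => r r0; rewrite /wphi2 /wphi1 /wT.
move: (N%:R^-1) (wY r ^+ _) (wP r) => K y p; field; exact: lt0r_neq0.
Qed.

Lemma wq_der : smoothder wq wq1.
Proof. by apply: smoothder_eq (smoothderM (smoothder_cst _) wPN_der) _ => r r0; rewrite /wq1; ring. Qed.

Lemma w1P_der : smoothder (fun r => 1 - wP r) (fun r => kap * (wP r * ((1 - wP r) * r^-1))).
Proof.
have h := smoothderD (smoothder_cst 1) (smoothderM (smoothder_cst (-1)) wP_der).
rewrite (_ : (fun r => 1 - wP r) = (fun r => 1 + -1 * wP r)); last by apply/funext => r; ring.
by apply: smoothder_eq h _ => r _; ring.
Qed.

Lemma wq1_der : smoothder wq1 wq2.
Proof.
have h := smoothderM (smoothder_cst (- (m%:R / 2))) (smoothderM wPN_der (smoothderM w1P_der smoothder_inv)).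
apply: smoothder_eq h _ => r r0; rewrite /wq2; move: (N%:R^-1) (wP r) (wP r ^+ _) => K p y; field; exact: lt0r_neq0.
Qed.

Lemma wE_der : smoothder wE (fun r => (kap + 3 / 4) * kap * wP r * (1 - wP r) * r^-1).
Proof.
have h := smoothderD (smoothderM (smoothder_cst (- (kap + 3 / 4))) wP_der) (smoothder_cst (kap + 1 - m%:R)).
rewrite (_ : wE = (fun r => - (kap + 3 / 4) * wP r + (kap + 1 - m%:R))); last first.
  by apply/funext => r; rewrite /wE /wT; ring.
by apply: smoothder_eq h _ => r r0; ring.
Qed.

Lemma wc_der : smoothder wc wc1.
Proof.
have h := smoothderD (smoothderD (smoothder_cst lam) (smoothderX 1 wphi1_der))
  (smoothderM wphi1_der (smoothderM smoothder_inv wE_der)).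
by apply: smoothder_eq h _ => r r0; rewrite /wc1; move: (N%:R^-1) (wphi1 r) (wphi2 r) (wP r) (wE r) => K y z p e; field; exact: lt0r_neq0.
Qed.

Lemma wc_conj r : 0 < r -> wc r = lam + (wphi1 r ^+ 2 - (wphi1 r * (m%:R * r^-1) + wphi2 r)).
Proof. by move=> r0; rewrite /wc /wphi2 /wE; ring. Qed.

End Weights.

(** * Positivity of the zeroth-order coefficient at infinity *)

Section Algebra.
Context {R : realType}.
Implicit Types r P kap mm lam f e b : R.

(** Here [e] is the deviation of [Lap w] from [m / r], and [z = r e]. Up to [z], the coefficient of
    [f ^+ 2] is [P / 4 - (1 + kap) (1 - P)]: its negative part, present where [ell] acts, is
    dominated by [lam P] through the hypothesis on [f ^+ 2 * (1 - P)]. [X] and [Y] collect the terms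
    of order [1 / r] and [1 / r^2], absorbed through the last two hypotheses, which hold for large
    [r]. *)
Lemma Bpot_alg r P kap mm lam f e b : let T := 3 / 4 * P - kap * (1 - P) - 1 in
  let E := - T - mm in let f2 := f * (r^-1 * T) in
  let q := mm / 2 * b in let q1 := - (mm / 2) * (b * ((1 - P) * r^-1)) in
  let q2 := - (mm / 2) * (b * (1 - P) * r^-1 * r^-1 * (- (1 - P) + kap * P - 1)) in
  let c := lam + f ^+ 2 + f * (r^-1 * E) in
  let c1 := 2 * f * f2 + (f2 * r^-1 - f * r^-1 * r^-1) * E
    + f * r^-1 * ((kap + 3 / 4) * kap * P * (1 - P) * r^-1) in
  let C := mm ^+ 2 + 10 * mm + 10 in
  0 < r -> 0 < P -> P <= 1 -> 0 < kap -> kap <= 1 / 4 -> 0 <= mm -> 0 <= f -> 0 < lam -> 0 < b ->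
  8 * `|r * e| <= P -> 32 * (f ^+ 2 * (1 - P)) <= lam * P ->
  64 * C ^+ 2 <= lam * (r * P) ^+ 2 -> 16 * C <= lam * (r ^+ 2 * P) ->
  (b * P * (f ^+ 2 / 8 + lam / 4) <=
  - (2^-1 * (q1 * (mm * r^-1 + e) + q2)) - q1 * f - q * (f * (mm * r^-1 + e) + f2)
  + 2^-1 * (r * b * c1) + 2^-1 * (c * (r * b * (mm * r^-1 + e) + b * P)) - c * q)%R.
Proof.
move=> T E f2 q q1 q2 c c1 C r0 P0 P1 K0 K1 m0 f0 l0 b0 he hf h1 h2.
pose z := r * e; rewrite -/z in he.
pose X := mm / 2 * (1 - P - mm - z - T) + 2^-1 * E * (T - 1 + z + P) + 2^-1 * (kap + 3 / 4) * kap * P * (1 - P).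
pose Y := mm / 4 * (1 - P) * (mm + z) + mm / 4 * (1 - P) * (- (1 - P) + kap * P - 1).
have rn : r != 0 by rewrite gt_eqF.
rewrite [leRHS](_ : _ = b * (f ^+ 2 * (T + P / 2 + z / 2) + lam * (P / 2 + z / 2) + f / r * X + Y / r ^+ 2)); last first.
  by rewrite /X /Y /c1 /c /q2 /q1 /q /f2 /E /T /z; field.
rewrite -mulrA; apply: ler_wpM2l; first exact: ltW.
clear c1 c q2 q1 q f2; clearbody z.
have [z1 z2] : - (P / 8) <= z /\ z <= P / 8.
  by apply/andP; rewrite -ler_norml; lra.
have KP0 : 0 <= kap * (1 - P) by rewrite mulr_ge0 ?subr_ge0// ltW.
have KP1 : kap * (1 - P) <= 1 / 4.
  by apply: le_trans K1; apply: ler_piMr; [exact: ltW|lra].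
have [T1 T2] : - 2 <= T /\ T <= 0 by rewrite /T; split; lra.
have [E1 E2] : - mm <= E /\ E <= 2 - mm by rewrite /E; split; lra.
have k3 : - (lam * P / 16) + f ^+ 2 * (P / 4) <= f ^+ 2 * (T + P / 2).
  have : f ^+ 2 * (1 - P) * kap <= f ^+ 2 * (1 - P) * (1 / 4).
    by apply: ler_wpM2l => //; rewrite mulr_ge0 ?sqr_ge0//; lra.
  have : 0 <= f ^+ 2 * (1 - P) by rewrite mulr_ge0 ?sqr_ge0//; lra.
  rewrite (_ : f ^+ 2 * (T + P / 2) = f ^+ 2 * (P / 4) - f ^+ 2 * (1 - P) - f ^+ 2 * (1 - P) * kap); last first.
    by rewrite /T; field.
  by move: (f ^+ 2 * (1 - P)) (lam * P) (f ^+ 2 * (P / 4)) (_ * kap) hf => *; lra.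
clearbody E T.
have kP : 0 <= kap * P <= 1.
  apply/andP; split; first exact: mulr_ge0 (ltW K0) (ltW P0).
  by apply: mulr_ile1; [exact: ltW|exact: ltW|(clear -P0 P1 z1 z2 T1 T2 E1 E2 m0 K0 K1; lra)|].
have bound (a t A B : R) : 0 <= a -> a <= A -> `|t| <= B -> `|a * t| <= A * B.
  by move=> a0 aA tB; rewrite normrM ger0_norm// ler_pM.
have XC : `|X| <= C.
  have B1 : `|mm / 2 * (1 - P - mm - z - T)| <= mm / 2 * (mm + 4).
    by apply: bound => //; [rewrite divr_ge0|rewrite ler_norml; apply/andP; split; (clear -P0 P1 z1 z2 T1 T2 E1 E2 m0 K0 K1; lra)].
  have B2 : `|2^-1 * E * (T - 1 + z + P)| <= (mm + 2) / 2 * 5.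
    rewrite normrM; apply: ler_pM => //; last by rewrite ler_norml; apply/andP; split; (clear -P0 P1 z1 z2 T1 T2 E1 E2 m0 K0 K1; lra).
    by rewrite ler_norml; apply/andP; split; (clear -P0 P1 z1 z2 T1 T2 E1 E2 m0 K0 K1; lra).
  have B3 : `|2^-1 * (kap + 3 / 4) * kap * P * (1 - P)| <= 1.
    rewrite (_ : _ * _ = (2^-1 * (kap + 3 / 4)) * ((kap * P) * (1 - P))); last by ring.
    rewrite -[leRHS]mulr1; apply: bound; [(clear -P0 P1 z1 z2 T1 T2 E1 E2 m0 K0 K1; lra)|(clear -P0 P1 z1 z2 T1 T2 E1 E2 m0 K0 K1; lra)|].
    have P10 : 0 <= 1 - P by (clear -P0 P1 z1 z2 T1 T2 E1 E2 m0 K0 K1; lra).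
    have P11 : 1 - P <= 1 by (clear -P0 P1 z1 z2 T1 T2 E1 E2 m0 K0 K1; lra).
    have /andP[kp0 kp1] := kP; rewrite ger0_norm; last exact: mulr_ge0.
    exact: mulr_ile1.
  apply: le_trans (ler_normD _ _) _; apply: le_trans (lerD (ler_normD _ _) (lexx _)) _.
  apply: le_trans (lerD (lerD B1 B2) B3) _; rewrite /C -subr_ge0.
  rewrite (_ : _ - _ = mm ^+ 2 / 2 + mm * (11 / 2) + 4); last by field.
  by clear -m0; rewrite !addr_ge0 ?mulr_ge0 ?sqr_ge0.
have YC : `|Y| <= C.
  have B0 : 0 <= mm / 4 * (1 - P) by apply: mulr_ge0; (clear -P0 P1 z1 z2 T1 T2 E1 E2 m0 K0 K1; lra).
  have B00 : mm / 4 * (1 - P) <= mm / 4 by apply: ler_piMr; (clear -P0 P1 z1 z2 T1 T2 E1 E2 m0 K0 K1; lra).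
  have B1 : `|mm / 4 * (1 - P) * (mm + z)| <= mm / 4 * (mm + 1).
    by apply: bound => //; rewrite ler_norml; apply/andP; split; (clear -P0 P1 z1 z2 T1 T2 E1 E2 m0 K0 K1; lra).
  have B2 : `|mm / 4 * (1 - P) * (- (1 - P) + kap * P - 1)| <= mm / 4 * 2.
    by apply: bound => //; rewrite ler_norml; case/andP: kP => kp0 kp1; apply/andP; split; (clear -kp0 kp1 P0 P1 z1 z2 T1 T2 E1 E2 m0 K0 K1; lra).
  apply: le_trans (ler_normD _ _) _; apply: le_trans (lerD B1 B2) _; rewrite /C -subr_ge0.
  rewrite (_ : _ - _ = mm ^+ 2 * (3 / 4) + mm * (37 / 4) + 10); last by field.
  by clear -m0; rewrite !addr_ge0 ?mulr_ge0 ?sqr_ge0.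
have C0 : 0 <= C by apply: le_trans XC.
have r2 : 0 < r ^+ 2 by exact: exprn_gt0.
have k1 : - (f ^+ 2 * P / 16 + lam * P / 16) <= f / r * X.
  have : `|f / r * X| <= f / r * C.
    by apply: bound => //; apply: divr_ge0 => //; exact: ltW.
  rewrite ler_norml => /andP[h _]; apply: le_trans h; rewrite lerN2.
  apply: (@le_trans _ _ (f ^+ 2 * P / 16 + 4 * C ^+ 2 / (r ^+ 2 * P))).
    have hs : 0 <= (f / 4 - 2 * C / (r * P)) ^+ 2 * P by rewrite mulr_ge0 ?sqr_ge0// ltW.
    rewrite -subr_ge0; apply: le_trans hs _; apply: le_of_eq.
    by field; rewrite rn gt_eqF.
  rewrite lerD2l ler_pdivrMr ?mulr_gt0//; apply: (@le_trans _ _ (lam * (r * P) ^+ 2 / 16)); first by clear -h1; lra.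
  by apply: le_of_eq; field.
have k2 : - (lam * P / 16) <= Y / r ^+ 2.
  rewrite ler_pdivlMr//; have : - C <= Y by move: YC; rewrite ler_norml => /andP[].
  by move=> h; apply: le_trans h; rewrite (_ : _ * _ = - (lam * (r ^+ 2 * P) / 16)); [clear -h2; lra|field].
have k4 : - (f ^+ 2 * (P / 16)) <= f ^+ 2 * (z / 2).
  by rewrite -mulrN ler_wpM2l ?sqr_ge0//; clear -z1; lra.
have k5 : - (lam * (P / 16)) <= lam * (z / 2).
  by rewrite -mulrN; apply: ler_wpM2l; [exact: ltW|clear -z1; lra].
have e1 : f ^+ 2 * (T + P / 2 + z / 2) = f ^+ 2 * (T + P / 2) + f ^+ 2 * (z / 2) by ring.
have e2 : lam * (P / 2 + z / 2) = 8 * (lam * P / 16) + lam * (z / 2) by field.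
have e3 : P * (f ^+ 2 / 8 + lam / 4) = 2 * (f ^+ 2 * P / 16) + 4 * (lam * P / 16) by field.
have e4 : f ^+ 2 * (P / 4) = 4 * (f ^+ 2 * P / 16) by field.
have e5 : f ^+ 2 * (P / 16) = f ^+ 2 * P / 16 by ring.
have e6 : lam * (P / 16) = lam * P / 16 by ring.
rewrite e1 e2 e3; rewrite e4 in k3; rewrite e5 in k4; rewrite e6 in k5.
move: k1 k2 k3 k4 k5; clear.
move: (f ^+ 2 * P / 16) (lam * P / 16) (f / r * X) (Y / r ^+ 2) (f ^+ 2 * (T + P / 2)) (f ^+ 2 * (z / 2)) (lam * (z / 2)).
by move=> *; lra.
Qed.

Lemma powR_decay (d C delta : R) : 0 < d -> 0 <= C -> 0 < delta ->
  exists2 R2 : R, 1 <= R2 & forall r, R2 <= r -> C * r `^ (- d) <= delta.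
Proof.
move=> d0 C0 dl0; pose Q := (C / delta + 1) `^ d^-1.
have CQ : 0 <= C / delta by rewrite divr_ge0// ltW.
exists (1 + Q) => [|r hr]; first by rewrite lerDl powR_ge0.
have Q0 : 0 < Q by rewrite powR_gt0// ltr_wpDl.
have r0 : 0 < r by apply: lt_le_trans hr; rewrite addr_gt0.
have Qr : Q <= r by apply: le_trans hr; rewrite lerDr.
rewrite powRN ler_pdivrMr ?powR_gt0//.
have : Q `^ d <= r `^ d by apply: ge0_ler_powR => //; rewrite ?nnegrE ltW.
rewrite /Q -powRrM mulVf ?gt_eqF// powRr1 ?addr_ge0// => h.
by rewrite mulrC -ler_pdivrMr//; apply: le_trans h; rewrite lerDl.
Qed.

End Algebra.

(** * Bounds on the weights *)

Section WeightBounds.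
Context {R : realType}.
Variables (k : nat) (ell tau : R).
Hypotheses (k0 : (0 < k)%N) (ell0 : 0 < ell) (ell1 : ell <= 1) (tau0 : 0 < tau).
Notation N := (4 * k)%N.
Notation wS := (wS k). Notation wP := (wP k ell). Notation wY := (wY k ell).

Lemma wS_pow (r : R) : 0 < r -> wS r ^+ N = r.
Proof.
move=> r0; rewrite /wS -powR_mulrn ?powR_ge0// -powRrM mulVf ?powRr1 ?ltW//.
by rewrite pnatr_eq0 muln_eq0 -lt0n k0.
Qed.

Lemma wS_ge1 (r : R) : 1 <= r -> 1 <= wS r.
Proof.
move=> r1; have r0 : 0 < r by apply: lt_le_trans r1.
rewrite leNgt; apply/negP => h.
have : wS r ^+ N < 1 by rewrite exprn_ilt1 ?ltW ?wS_gt0// -lt0n muln_gt0.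
by rewrite wS_pow// ltNge r1.
Qed.

Lemma wS2_le (r : R) : 1 <= r -> wS r ^+ 2 <= r.
Proof.
move=> r1; have r0 : 0 < r by apply: lt_le_trans r1.
rewrite -[leRHS](wS_pow r0); apply: ler_weXn2l; first exact: wS_ge1.
by rewrite (leq_trans (n := 4))// leq_pmulr.
Qed.

(** As [ell <= 1], [P] loses at most a factor comparable with [S = r^kap], a power that the
    short-range decay can afford. *)
Lemma wP_lower (r : R) : 1 <= r -> (2 * wS r)^-1 <= wP r.
Proof.
move=> r1; have s1 := wS_ge1 r1; have r0 : 0 < r by apply: lt_le_trans r1.
have s0 : 0 < wS r by exact: wS_gt0.
rewrite lef_pV2 ?posrE ?wden_gt0 ?mulr_gt0//.
have : ell * wS r <= 1 * wS r by rewrite ler_wpM2r// ltW.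
by lra.
Qed.

Lemma wY_gt0 (r : R) : 0 < r -> 0 < wY r.
Proof. by move=> r0; rewrite mulr_gt0 ?wS_gt0 ?wP_gt0. Qed.

Lemma wY_le (r : R) : 0 < r -> wY r <= ell^-1.
Proof.
move=> r0; rewrite /wY wP_def ler_pdivrMr ?wden_gt0// mulrDr mulr1 mulKf ?gt_eqF//.
by rewrite lerDr invr_ge0 ltW.
Qed.

Let wz (r : R) := wY r ^+ (3 * k) * (wP r * r^-1).

(** [Y <= S] and [P <= 1] bound [phi' / tau] by [S^(3k) / r = S^(-k)], which is at most [1 / S]
    because [k >= 1]. *)
Let wz_le (r : R) : 1 <= r -> wz r * wS r <= 1.
Proof.
move=> r1; have s1 := wS_ge1 r1; have r0 : 0 < r by apply: lt_le_trans r1.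
have s0 := wS_gt0 k r0; have p0 := wP_gt0 k ell0 r0; have p1 := wP_le1 k ell0 r0.
have hY : wY r ^+ (3 * k) <= wS r ^+ (3 * k).
  apply: lerXn2r; rewrite ?nnegrE; [exact: ltW (wY_gt0 r0)|exact: ltW|].
  by apply: ler_piMr p1; exact: ltW.
rewrite /wz -mulrA -mulrA [r^-1 * _]mulrC.
apply: (@le_trans _ _ (wS r ^+ (3 * k) * (1 * (wS r / r)))).
  have sr : 0 <= wS r / r by apply: divr_ge0; exact: ltW.
  apply: ler_pM => //; [by apply: exprn_ge0; exact: ltW (wY_gt0 r0)|exact: mulr_ge0 (ltW p0) sr|].
  exact: ler_wpM2r.
rewrite mul1r mulrA ler_pdivrMr// mul1r -[leRHS](wS_pow r0) -exprSr.
by apply: ler_weXn2l => //; move: k0; rewrite !mulSn; case: (k) => // j _; rewrite addSn ltnS leq_addl.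
Qed.

Let wz_gt0 (r : R) : 0 < r -> 0 < wz r.
Proof. move=> r0; have p0 := wP_gt0 k ell0 r0; have y0 := wY_gt0 r0.
by apply: mulr_gt0; [exact: exprn_gt0|apply: mulr_gt0; [exact: p0|by rewrite invr_gt0]]. Qed.

Lemma wphi1_gt0 (r : R) : 0 < r -> 0 < wphi1 k ell tau r.
Proof. by move=> r0; rewrite mulr_gt0// wz_gt0. Qed.

Lemma wphi1_le (r : R) : 1 <= r -> wphi1 k ell tau r <= tau.
Proof.
move=> r1; have r0 : 0 < r by apply: lt_le_trans r1.
apply: ler_piMr; first exact: ltW.
apply: le_trans (wz_le r1); apply: ler_peMr; [exact: ltW (wz_gt0 r0)|exact: wS_ge1].
Qed.

(** One has [1 - P = ell S P], and the factor [S] is absorbed by [phi' S <= tau]. The defect of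
    convexity is thus at most [tau^2 ell P], which is what couples [ell] to [tau]. *)
Lemma wphi1_sq (r : R) : 1 <= r -> wphi1 k ell tau r ^+ 2 * (1 - wP r) <= tau ^+ 2 * ell * wP r.
Proof.
move=> r1; have r0 : 0 < r by apply: lt_le_trans r1.
have p0 := wP_gt0 k ell0 r0; have z0 := wz_gt0 r0; have s1 := wS_ge1 r1.
rewrite w1P// /wphi1 -/(wz r) (_ : _ * _ = tau ^+ 2 * ell * wP r * (wz r * (wz r * wS r))); last by ring.
apply: ler_piMr; first by rewrite !mulr_ge0 ?sqr_ge0 ?ltW.
apply: mulr_ile1; [exact: ltW|by rewrite mulr_ge0 ?ltW// (lt_le_trans _ s1)| |exact: wz_le].
apply: le_trans (wz_le r1); apply: ler_peMr => //; exact: ltW.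
Qed.

Lemma rP_lower (r : R) : 1 <= r -> r / 4 <= (r * wP r) ^+ 2.
Proof.
move=> r1; have r0 : 0 < r by apply: lt_le_trans r1.
have s0 := wS_gt0 k r0; have p0 := wP_gt0 k ell0 r0; have hP := wP_lower r1.
have i0 : 0 < (2 * wS r)^-1 by rewrite invr_gt0 mulr_gt0.
have : r ^+ 2 * ((2 * wS r)^-1) ^+ 2 <= r ^+ 2 * wP r ^+ 2.
  apply: ler_wpM2l; first exact: sqr_ge0.
  by apply: lerXn2r; rewrite ?nnegrE; [exact: ltW|exact: ltW|].
rewrite exprMn => h; apply: le_trans h.
have hs := wS2_le r1; have hs0 : 0 < wS r ^+ 2 by exact: exprn_gt0.
rewrite (_ : _ ^+ 2 * _ = (r ^+ 2 / 4) / wS r ^+ 2); last by field; rewrite gt_eqF.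
rewrite ler_pdivlMr//; have := ler_wpM2l (ltW r0) hs; rewrite expr2; lra.
Qed.

Lemma wphi1_lower (r : R) : 1 <= r -> tau * ((2^-1) ^+ (3 * k) * (2 * r ^+ 2)^-1) <= wphi1 k ell tau r.
Proof.
move=> r1; have r0 : 0 < r by apply: lt_le_trans r1.
have s0 := wS_gt0 k r0; have s1 := wS_ge1 r1; have hP := wP_lower r1.
apply: ler_wpM2l; first exact: ltW.
apply: ler_pM.
- by apply: exprn_ge0; rewrite invr_ge0.
- by rewrite invr_ge0 mulr_ge0 ?sqr_ge0.
- apply: lerXn2r; rewrite ?nnegrE ?invr_ge0//; first exact: ltW (wY_gt0 r0).
  apply: le_trans (ler_wpM2l (ltW s0) hP).
  by apply: le_of_eq; field; rewrite gt_eqF.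
rewrite ler_pdivlMr//; apply: le_trans hP.
rewrite (_ : _ * r = (2 * r)^-1); last by field; rewrite gt_eqF.
rewrite lef_pV2 ?posrE ?mulr_gt0// ler_pM2l//.
by apply: le_trans (wS2_le r1); rewrite expr2 ler_peMr// ltW.
Qed.

End WeightBounds.

(** Here [D] is the radial derivative of [u], [G] the square of its tangential gradient, [H] the
    Hessian form of [w], and [y / r] the perturbation of order zero. The Hessian supplies [7/8 G],
    of which the multiplier terms spend at most [9/16 G]; a quarter of [P D^2] and half of [lam / 4]
    remain. *)
Lemma Qform_alg {R : realType} (b P r f z y mm lam D G H u delta B : R) :
  0 < b -> 0 < P -> P <= 1 -> 1 <= r -> 0 <= f -> 0 < lam -> 0 <= mm -> 0 <= G -> 0 <= delta ->
  delta * (1 + mm) <= 1 / 8 -> delta * (1 + mm) <= lam / 8 ->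
  `|z| <= delta * P -> `|y| <= delta * P * (1 + f) ->
  7 / 8 * r^-1 * G <= H -> b * P * (f ^+ 2 / 8 + lam / 4) <= B ->
  b * P * (1 / 4 * D ^+ 2 + lam / 8 * u ^+ 2) <=
  r * b * H + b * P * D * D + (- (b / 2 * (z + P))) * (G + D ^+ 2)
   + 2 * (r * b * (f * D * D)) + B * u ^+ 2 + y * r^-1 * u * (r * b * D + mm / 2 * b * u).
Proof.
move=> b0 P0 P1 r1 f0 l0 m0 G0 d0 d1 d2 hz hy hH hB.
have r0 : 0 < r by apply: lt_le_trans r1.
have u0 : 0 <= u ^+ 2 by exact: sqr_ge0.
have D0 : 0 <= D ^+ 2 by exact: sqr_ge0.
have dd : delta <= 1 / 8.
  by apply: le_trans d1; apply: ler_peMr => //; clear -m0; lra.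
have dP : delta * P <= P / 8 by rewrite mulrC; have := ler_wpM2l (ltW P0) dd; clear; lra.
have h1 : b * (7 / 8 * G) <= r * b * H.
  have := ler_wpM2l (mulr_ge0 (ltW r0) (ltW b0)) hH.
  by rewrite (_ : r * b * (7 / 8 * r^-1 * G) = b * (7 / 8 * G)); [|field; rewrite gt_eqF].
have h2 : b * (- (9 / 16 * G) - (P / 2 + delta * P / 2) * D ^+ 2) <= (- (b / 2 * (z + P))) * (G + D ^+ 2).
  rewrite (_ : - _ * _ = b * (- ((z + P) / 2 * (G + D ^+ 2)))); last by field.
  apply: ler_wpM2l; first exact: ltW.
  have z2 : z <= delta * P by apply: le_trans (ler_norm _) hz.
  have k1 : (z + P) * G <= (9 / 8) * G by apply: ler_wpM2r => //; clear -z2 dP P1; lra.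
  have k2 : (z + P) * D ^+ 2 <= (P + delta * P) * D ^+ 2 by apply: ler_wpM2r => //; clear -z2; lra.
  rewrite (_ : (z + P) / 2 * (G + D ^+ 2) = ((z + P) * G + (z + P) * D ^+ 2) / 2); last by field.
  rewrite (_ : (P / 2 + _) * D ^+ 2 = (P + delta * P) * D ^+ 2 / 2); last by field.
  by move: k1 k2; clear; move: ((z + P) * G) (_ * D ^+ 2) (_ * D ^+ 2) => *; lra.
have h3 : 0 <= 2 * (r * b * (f * D * D)).
  rewrite -[f * D * D]mulrA -expr2; have := ltW r0; have := ltW b0; clear -f0 D0 => h g.
  by pos.
have h4 := ler_wpM2r u0 hB.
have h5 : - (b * P * (delta / 2 * D ^+ 2 + delta * (1 + mm) * (1 + f ^+ 2) * u ^+ 2)) <=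
    y * r^-1 * u * (r * b * D + mm / 2 * b * u).
  rewrite (_ : y * _ * _ * _ = b * (y * (u * D + mm / 2 * u ^+ 2 / r))); last by field; rewrite gt_eqF.
  rewrite -mulrA -mulrN; apply: ler_wpM2l; first exact: ltW.
  set t := u * D + _; have ht : `|t| <= `|u| * `|D| + mm / 2 * u ^+ 2.
    apply: le_trans (ler_normD _ _) _; rewrite normrM lerD2l ger0_norm.
      by rewrite ler_pdivrMr//; apply: ler_peMr => //; rewrite mulr_ge0// divr_ge0.
    by rewrite divr_ge0 ?(ltW r0)// mulr_ge0// divr_ge0.
  have : `|y * t| <= delta * P * (1 + f) * (`|u| * `|D| + mm / 2 * u ^+ 2).
    by rewrite normrM ler_pM.
  rewrite ler_norml => /andP[h _]; apply: le_trans h; rewrite lerN2.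
  rewrite (_ : delta * P * _ * _ = P * (delta * ((1 + f) * (`|u| * `|D|) + (1 + f) / 2 * (mm * u ^+ 2)))); last by field.
  apply: ler_wpM2l; first exact: ltW.
  rewrite [leRHS](_ : _ = delta * (2^-1 * D ^+ 2 + (1 + mm) * (1 + f ^+ 2) * u ^+ 2)); last by ring.
  apply: ler_wpM2l => //.
  have s1 : (1 + f) * (`|u| * `|D|) <= 2^-1 * D ^+ 2 + (1 + f ^+ 2) * u ^+ 2.
    rewrite -(real_normK (num_real D)) -(real_normK (num_real u)); move: `|u| `|D| => U V.
    rewrite -subr_ge0 (_ : _ - _ = 2^-1 * (V - (1 + f) * U) ^+ 2 + 2^-1 * ((1 - f) * U) ^+ 2); last by field.
    by rewrite addr_ge0// mulr_ge0// sqr_ge0.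
  have s2 : (1 + f) / 2 <= 1 + f ^+ 2.
    rewrite -subr_ge0 (_ : _ - _ = (f - 1 / 4) ^+ 2 + 7 / 16); last by field.
    by rewrite addr_ge0 ?sqr_ge0.
  have s3 := ler_wpM2r (mulr_ge0 m0 u0) s2.
  rewrite (_ : (1 + mm) * _ * _ = (1 + f ^+ 2) * u ^+ 2 + (1 + f ^+ 2) * (mm * u ^+ 2)); last by ring.
  by rewrite addrA lerD.
have h6 : delta * (1 + mm) * (1 + f ^+ 2) * u ^+ 2 <= (f ^+ 2 / 8 + lam / 8) * u ^+ 2.
  apply: ler_wpM2r => //; rewrite mulrDr mulr1 addrC; apply: lerD => //.
  by rewrite mulrC; have := ler_wpM2l (sqr_ge0 f) d1; clear; lra.
have bP : 0 <= b * P by rewrite mulr_ge0// ltW.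
have h7 := ler_wpM2l bP h6.
have h8 : b * P * (delta * D ^+ 2) <= b * P * (1 / 4 * D ^+ 2).
  by apply: ler_wpM2l => //; apply: ler_wpM2r => //; clear -dd; lra.
have h9 : 0 <= b * G by rewrite mulr_ge0// ltW.
rewrite -(mulrA (b * P) D D) -expr2.
rewrite mulrDr in h5.
have e1 : b * (- (9 / 16 * G) - (P / 2 + delta * P / 2) * D ^+ 2) = - (9 / 16 * (b * G)) - 2 * (b * P * (1 / 4 * D ^+ 2)) - 2^-1 * (b * P * (delta * D ^+ 2)) by field.
have e2 : b * P * (delta / 2 * D ^+ 2) = 2^-1 * (b * P * (delta * D ^+ 2)) by field.
have e3 : b * P * D ^+ 2 = 4 * (b * P * (1 / 4 * D ^+ 2)) by field.
have e4 : b * P * (1 / 4 * D ^+ 2 + lam / 8 * u ^+ 2) = b * P * (1 / 4 * D ^+ 2) + b * P * (lam / 8) * u ^+ 2 by ring.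
have e5 : b * (7 / 8 * G) = 7 / 8 * (b * G) by ring.
have e6 : b * P * (f ^+ 2 / 8 + lam / 4) * u ^+ 2 = b * P * ((f ^+ 2 / 8 + lam / 8) * u ^+ 2) + b * P * (lam / 8) * u ^+ 2 by field.
rewrite e1 in h2; rewrite e2 in h5; rewrite e5 in h1; rewrite e6 in h4; rewrite e4 e3.
move: h1 h2 h3 h4 h5 h7 h8 h9; clear.
move: (r * b * H) (2 * (r * b * _)) (B * _) (y / r * u * _) (b * G) (b * P * (1 / 4 * D ^+ 2)) (b * P * (delta * D ^+ 2)) (- _ * (G + _)) (b * P * (lam / 8) * _) (b * P * (delta * (1 + mm) * _ * _)) (b * P * (_ * u ^+ 2)).
by move=> *; lra.
Qed.

Lemma young_X {R : realType} (b P r mm lam D u X : R) : 0 < b -> 0 < P -> 0 < lam ->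
  - (X * (r * b * D + mm / 2 * b * u)) <=
  b * P * (1 / 8 * D ^+ 2 + lam / 16 * u ^+ 2) + b * ((2 * r ^+ 2 + mm ^+ 2 / lam) / P) * X ^+ 2.
Proof.
move=> b0 P0 l0.
have h1 : 0 <= b * P / 8 * (D + 4 * r * X / P) ^+ 2 by rewrite mulr_ge0 ?sqr_ge0// divr_ge0// mulr_ge0 ?ltW.
have h2 : 0 <= b * P * lam / 16 * (u + 4 * mm * X / (P * lam)) ^+ 2.
  by rewrite mulr_ge0 ?sqr_ge0// divr_ge0// !mulr_ge0 ?ltW.
rewrite -subr_ge0; apply: le_trans (addr_ge0 h1 h2) _.
by apply: le_of_eq; field; rewrite !gt_eqF.
Qed.

Lemma ext_sum_alg {R : realType} (b P r mm lam eps E D1 D2 u1 u2 Z X1 X2 g1 g2 Q1 Q2 M1 M2 S1 S2 : R) :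
  0 < b -> 0 < P -> 0 < lam -> 0 < eps ->
  M1 = r * b * D1 + mm / 2 * b * u1 -> M2 = r * b * D2 + mm / 2 * b * u2 ->
  b * P * (1 / 4 * D1 ^+ 2 + lam / 8 * u1 ^+ 2) <= Q1 + Z * u1 * M1 ->
  b * P * (1 / 4 * D2 ^+ 2 + lam / 8 * u2 ^+ 2) <= Q2 + Z * u2 * M2 ->
  S1 = Z * u1 + X1 + (eps * u2 - E * g1) -> S2 = Z * u2 + X2 + (- (eps * u1) - E * g2) ->
  b * P * (lam / 16 * (u1 ^+ 2 + u2 ^+ 2)) <=
  (Q1 + S1 * M1) + (Q2 + S2 * M2) + eps * (2^-1 * (u1 ^+ 2 + u2 ^+ 2) + (M1 ^+ 2 + M2 ^+ 2))
  + eps^-1 * (E ^+ 2 * (g1 ^+ 2 + g2 ^+ 2))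
  + b * ((2 * r ^+ 2 + mm ^+ 2 / lam) / P) * (X1 ^+ 2 + X2 ^+ 2).
Proof.
move=> b0 P0 l0 e0 m1 m2 h1 h2 s1 s2.
have y1 := young_X r mm D1 u1 X1 b0 P0 l0; have y2 := young_X r mm D2 u2 X2 b0 P0 l0.
rewrite -m1 in y1; rewrite -m2 in y2.
have eps0 := ltW e0.
have k1 := mulr_ge0 eps0 (sqr_ge0 (u2 + M1)); have k2 := mulr_ge0 eps0 (sqr_ge0 (u1 - M2)).
have ie : 0 <= eps^-1 by rewrite invr_ge0.
have k3 := mulr_ge0 ie (sqr_ge0 (eps * M1 - E * g1)); have k4 := mulr_ge0 ie (sqr_ge0 (eps * M2 - E * g2)).
have k5 : 0 <= eps^-1 * (E ^+ 2 * (g1 ^+ 2 + g2 ^+ 2)).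
  by rewrite mulr_ge0// mulr_ge0 ?sqr_ge0// addr_ge0 ?sqr_ge0.
have d1 : 0 <= b * P * (1 / 8 * D1 ^+ 2) by clear -b0 P0; pos.
have d2 : 0 <= b * P * (1 / 8 * D2 ^+ 2) by clear -b0 P0; pos.
have e3 (M g : R) : eps^-1 * (eps * M - E * g) ^+ 2 = eps * M ^+ 2 - 2 * (E * g * M) + eps^-1 * (E ^+ 2 * g ^+ 2).
  by field; rewrite gt_eqF.
rewrite e3 in k3; rewrite e3 in k4; rewrite {e3}s1 {}s2.
rewrite -subr_ge0; set T := (X in 0 <= X).
(* The difference of the two sides as a sum of terms that are nonnegative by the facts just
   collected. *)
have -> : T = (Q1 + Z * u1 * M1 - b * P * (1 / 4 * D1 ^+ 2 + lam / 8 * u1 ^+ 2)) +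
  (Q2 + Z * u2 * M2 - b * P * (1 / 4 * D2 ^+ 2 + lam / 8 * u2 ^+ 2)) +
  (X1 * M1 + (b * P * (1 / 8 * D1 ^+ 2 + lam / 16 * u1 ^+ 2) + b * ((2 * r ^+ 2 + mm ^+ 2 / lam) / P) * X1 ^+ 2)) +
  (X2 * M2 + (b * P * (1 / 8 * D2 ^+ 2 + lam / 16 * u2 ^+ 2) + b * ((2 * r ^+ 2 + mm ^+ 2 / lam) / P) * X2 ^+ 2)) +
  (b * P * (1 / 8 * D1 ^+ 2)) + (b * P * (1 / 8 * D2 ^+ 2)) +
  2^-1 * (eps * (u2 + M1) ^+ 2) + 2^-1 * (eps * (u1 - M2) ^+ 2) +
  2^-1 * (eps * M1 ^+ 2 - 2 * (E * g1 * M1) + eps^-1 * (E ^+ 2 * g1 ^+ 2)) +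
  2^-1 * (eps * M2 ^+ 2 - 2 * (E * g2 * M2) + eps^-1 * (E ^+ 2 * g2 ^+ 2)) +
  2^-1 * (eps^-1 * (E ^+ 2 * (g1 ^+ 2 + g2 ^+ 2))).
  by rewrite /T; field; rewrite !gt_eqF.
rewrite -subr_ge0 in h1; rewrite -subr_ge0 in h2.
rewrite -subr_ge0 opprK [_ + X1 * M1]addrC in y1; rewrite -subr_ge0 opprK [_ + X2 * M2]addrC in y2.
by do 10 (apply: addr_ge0; last by [|rewrite mulr_ge0]).
Qed.

(** * Growth of the phase and size of the multiplier *)

Section WeightGrowth.
Context {R : realType}.
Variables (k : nat) (ell tau : R).
Hypotheses (k0 : (0 < k)%N) (ell0 : 0 < ell) (ell1 : ell <= 1) (tau0 : 0 < tau).
Notation wphi := (wphi k ell tau).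

Lemma wphi_MVT (r1 r2 : R) : 0 < r1 -> r1 < r2 -> exists c : R,
  [/\ r1 < c, c < r2 & wphi r2 - wphi r1 = wphi1 k ell tau c * (r2 - r1)].
Proof.
move=> r10 r12; have [h1 h2] := wphi_der tau k0 ell0.
have hd (c : R) : r1 <= c -> is_derive c (1 : R) wphi (wphi1 k ell tau c).
  by move=> hc; apply: h2; exact: lt_le_trans hc.
have [||c] := MVT r12 (f := wphi) (df := wphi1 k ell tau).
- by move=> c; rewrite in_itv => /andP[hc _]; apply: hd; exact: ltW.
- apply: derivable_within_continuous => c; rewrite in_itv => /andP[hc _].
  by have [] := hd _ hc.
by rewrite in_itv => /andP[c1 c2] e; exists c.
Qed.

Lemma wphi_mono (r1 r2 : R) : 0 < r1 -> r1 <= r2 -> wphi r1 <= wphi r2.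
Proof.
move=> r10; rewrite le_eqVlt => /orP[/eqP -> //|r12].
have [c [c1 _ e]] := wphi_MVT r10 r12; rewrite -subr_ge0 e mulr_ge0 ?subr_ge0 ?ltW//.
by apply: wphi1_gt0 => //; exact: lt_trans c1.
Qed.

(** The bound does not involve [ell], which will depend on [tau]; it is the source of the factor
    exp(-c tau). *)
Lemma wphi_growth (r : R) : 1 <= r ->
  tau * ((2^-1) ^+ (3 * k) * (2 * (r + 1) ^+ 2)^-1) <= wphi (r + 1) - wphi r.
Proof.
move=> r1; have r0 : 0 < r by apply: lt_le_trans r1.
have [c [c1 c2 ->]] := wphi_MVT r0 (ltr_pwDr ltr01 (lexx r)).
rewrite (_ : r + 1 - r = 1) ?mulr1; last by ring.
have c11 : 1 <= c by apply: le_trans (ltW c1).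
apply: le_trans (wphi1_lower k0 ell0 ell1 tau0 c11); apply: ler_wpM2l; first exact: ltW.
apply: ler_wpM2l; first by rewrite exprn_ge0// invr_ge0.
have c0 : 0 < c by apply: lt_trans c1.
rewrite lef_pV2 ?posrE ?mulr_gt0 ?exprn_gt0 ?addr_gt0// ler_pM2l//.
by apply: lerXn2r; rewrite ?nnegrE ?ltW// addr_gt0.
Qed.

Lemma wphi_ge0 (r : R) : 0 < r -> 0 <= wphi r.
Proof.
move=> r0; have y0 := ltW (wY_gt0 k ell0 r0); have t0 := ltW tau0.
by rewrite wphi_def mulr_ge0 ?exprn_ge0// mulr_ge0 ?divr_ge0.
Qed.

Lemma wphi_le (r : R) : 0 < r -> wphi r <= tau * (4 / 3) * ell^-1 ^+ (3 * k).
Proof.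
move=> r0; have y0 := wY_gt0 k ell0 r0; rewrite !wphi_def; apply: ler_wpM2l.
  by rewrite mulr_ge0 ?divr_ge0 ?ltW.
by apply: lerXn2r; rewrite ?nnegrE ?invr_ge0 ?(ltW y0) ?(ltW ell0)//; exact: (wY_le k ell0 r0).
Qed.

Lemma wa_le (r : R) : 0 < r -> wa k ell r <= ell^-1 ^+ (4 * k).
Proof.
move=> r0; have y0 := wY_gt0 k ell0 r0; rewrite /wa -{1}(wS_pow k0 r0) -exprMn -/(wY k ell r).
by apply: lerXn2r; rewrite ?nnegrE ?invr_ge0 ?(ltW y0) ?(ltW ell0)//; exact: (wY_le k ell0 r0).
Qed.

Lemma wq_itv (m : nat) (r : R) : 0 < r -> 0 <= wq k m ell r <= m%:R / 2.
Proof.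
move=> r0; have p0 := ltW (wP_gt0 k ell0 r0); have p1 := wP_le1 k ell0 r0.
rewrite /wq mulr_ge0 ?exprn_ge0 ?divr_ge0//=.
by apply: ler_piMr; [rewrite divr_ge0|exact: exprn_ile1].
Qed.

Lemma wP_lower_bound (r : R) : 1 <= r -> (2 * r)^-1 <= wP k ell r.
Proof.
move=> r1; have r0 : 0 < r by apply: lt_le_trans r1.
apply: le_trans (wP_lower k0 ell0 ell1 r1); have s1 := wS_ge1 k0 r1.
have s0 := wS_gt0 k r0; rewrite lef_pV2 ?posrE ?mulr_gt0// ler_pM2l//.
by apply: le_trans (wS2_le k0 r1); rewrite expr2 ler_peMr// ltW.
Qed.

End WeightGrowth.

Section Supports.
Context {R : realType} {n : nat} (M : riemannian_manifold R n).
Implicit Types (f h u : M -> R) (K : set M).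

Lemma P0_out K phi c u x : closed K -> supp_in K u -> ~ K x -> P0 phi c u x = 0.
Proof.
by move=> cK u0 nx; rewrite /P0 (supp_Lap cK u0 nx) (supp_Gamr phi cK u0 nx) u0// !mulr0 subr0 addr0.
Qed.

Lemma Qform_out K h b q phi c u x : closed K -> supp_in K u -> ~ K x -> Qform h b q phi c u x = 0.
Proof.
move=> cK u0 nx; rewrite /Qform (supp_Hs h cK u0 nx) !(supp_Gamr _ cK u0 nx) u0//.
by rewrite expr0n !(mulr0, mul0r, addr0).
Qed.

Lemma sm_cs_bound f : sm f -> cs f -> exists2 D : R, 0 <= D & forall x, `|f x| <= D.
Proof.
move=> sf cf; have [D hD] := bcs_bound (bcs_sm sf cf); exists `|D| => // x.
exact: le_trans (hD x) (ler_norm _).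
Qed.

End Supports.

(** Real and imaginary parts of [(- Lap + V - lam - i eps) v = f + g] with [v = v1 + i v2]. In the
    estimates [f] is a localized source and [g] a global error, weighted differently. *)
Record hsol {R : realType} {n : nat} {M : riemannian_manifold R n} (V : M -> R) (lam eps : R)
  (v1 v2 f1 f2 g1 g2 : M -> R) : Prop := Hsol {
  hsol_sm1 : sm v1 ; hsol_sm2 : sm v2 ; hsol_cs1 : cs v1 ; hsol_cs2 : cs v2 ;
  hsol_f1 : bcs f1 ; hsol_f2 : bcs f2 ; hsol_g1 : bcs g1 ; hsol_g2 : bcs g2 ;
  hsol_eq1 : forall x, Lap v1 x + lam * v1 x = V x * v1 x + eps * v2 x - f1 x - g1 x ;
  hsol_eq2 : forall x, Lap v2 x + lam * v2 x = V x * v2 x - eps * v1 x - f2 x - g2 x }.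

(** Division by [c0 e3]: since [e3 >= 1] the unweighted terms do not grow, and [e' <= ex e3] carries
    the exponential gain. *)
Lemma ext_final {R : realType} (c0 e3 e' ex K2 K3 k3 q Cz C1 C2 J JK a F G g W : R) :
  0 < c0 -> 1 <= e3 -> e' <= ex * e3 -> ex <= 1 -> 0 <= e' -> 0 <= K2 -> 0 <= K3 -> 0 <= k3 -> 0 <= C1 ->
  C1 = q * Cz / c0 -> C2 = (K2 + K3 + k3) / c0 + C1 * 6 -> 0 <= q -> 0 <= JK -> 0 <= F -> 0 <= G ->
  0 <= a -> G <= g -> W <= Cz * (JK + 6 * (F + G)) ->
  c0 * e3 * J <= K2 * a + K3 * g + q * e' * W + k3 * F ->
  J <= C1 * ex * JK + C2 * (F + a + g).
Proof.
move=> c00 e1 ee ex1 e0 K20 K30 k30 C10 hC1 hC2 q0 JK0 F0 G0 a0 Gg hW h.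
have e30 : 0 < e3 by apply: lt_le_trans e1.
have g0 : 0 <= g by apply: le_trans Gg.
rewrite -(ler_pM2l (mulr_gt0 c00 e30)); apply: le_trans h _.
have cC1 : c0 * C1 = q * Cz by rewrite hC1; field; rewrite gt_eqF.
have h1 : q * e' * W <= c0 * C1 * (e' * JK) + c0 * C1 * 6 * (e' * (F + g)).
  apply: le_trans (_ : q * e' * (Cz * (JK + 6 * (F + G))) <= _); first by rewrite ler_wpM2l ?mulr_ge0.
  rewrite (_ : q * e' * _ = q * Cz * (e' * JK) + q * Cz * 6 * (e' * (F + G))); last by ring.
  rewrite -cC1 lerD2l; apply: ler_wpM2l; first by rewrite mulr_ge0// mulr_ge0// ltW.
  by apply: ler_wpM2l => //; rewrite lerD2l.
have cC0 : 0 <= c0 * C1 by rewrite mulr_ge0// ltW.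
have h2 : e' * JK <= ex * e3 * JK by exact: ler_wpM2r.
have h3 : e' * (F + g) <= e3 * (F + g).
  by apply: ler_wpM2r; [exact: addr_ge0|apply: le_trans ee _; rewrite ler_piMl// ltW].
have h2' := ler_wpM2l cC0 h2.
have cC6 : 0 <= c0 * C1 * 6 by exact: mulr_ge0.
have h3' := ler_wpM2l cC6 h3.
have step t : 0 <= t -> t <= e3 * t by move=> t0; rewrite ler_peMl.
have h4 := step _ (mulr_ge0 K20 a0); have h5 := step _ (mulr_ge0 K30 g0); have h6 := step _ (mulr_ge0 k30 F0).
apply: le_trans (lerD (lerD (lerD h4 h5) (le_trans h1 (lerD h2' h3'))) h6) _.
rewrite hC2 -subr_ge0; set T := (X in 0 <= X).
have -> : T = e3 * (K2 * (F + g) + K3 * (F + a) + k3 * (a + g)) + c0 * C1 * 6 * (e3 * a).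
  by rewrite /T; field; rewrite gt_eqF.
have e3' := ltW e30; by pos.
Qed.

Section HsolSol.
Context {R : realType} {n : nat} (M : riemannian_manifold R n).
Implicit Types (f g v : M -> R).

Lemma bcsMM f g : bcs f -> bcs g -> bcs (fun x => f x * g x).
Proof. by move=> [mf bf _] hg; exact: bcsM. Qed.

Lemma bcs_e2_meas f g : bcs f -> bcs g -> bcs (e2 f g).
Proof. by move=> hf hg; apply: bcsD; exact: bcsMM. Qed.

(** The three groups of terms, potential and energy, coupling, and sources, are squared by [sq3],
    whence the factor 3. *)
Lemma hsol_sol V CV lam lam2 eps v1 v2 f1 f2 g1 g2 : (forall x, `|V x| <= CV) ->
  0 < lam -> lam <= lam2 -> 0 < eps -> eps <= 1 -> hsol V lam eps v1 v2 f1 f2 g1 g2 ->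
  sol (3 * ((lam2 + CV) ^+ 2 + 1)) v1 v2 (fun x => 6 * (e2 f1 f2 x + e2 g1 g2 x)).
Proof.
move=> hV l0 l2 e0 e1 [s1 s2 c1 c2 bf1 bf2 bg1 bg2 E1 E2]; split => //.
- by apply: bcsZ; apply: bcsD; exact: bcs_e2_meas.
- by move=> x; rewrite mulr_ge0// addr_ge0// e2_ge0.
move=> x; have C0 : 0 <= CV by apply: le_trans (hV x).
have Vl : (V x - lam) ^+ 2 <= (lam2 + CV) ^+ 2.
  have := hV x; rewrite ler_norml => /andP[h1 h2].
  rewrite -subr_ge0 (_ : _ - _ = (lam2 + CV - (V x - lam)) * (lam2 + CV + (V x - lam))); last by ring.
  by apply: mulr_ge0; move: (V x) h1 h2 => t h1 h2; lra.
have ee : eps ^+ 2 <= 1 by rewrite exprn_ile1// ltW.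
have key (l v v' f g e : R) : l + lam * v = V x * v + e * v' - f - g -> e ^+ 2 <= 1 ->
    l ^+ 2 <= 3 * ((lam2 + CV) ^+ 2 * (v * v) + v' * v' + 2 * (f * f + g * g)).
  move=> h he; have -> : l = (V x - lam) * v + e * v' + - (f + g).
    by rewrite -[l](addrK (lam * v)) h; ring.
  apply: le_trans (sq3 _ _ _) _; apply: ler_wpM2l => //; apply: lerD.
    by apply: lerD; rewrite exprMn -expr2; [apply: ler_wpM2r; rewrite ?sqr_ge0|apply: ler_piMl; rewrite ?sqr_ge0].
  rewrite -subr_ge0 (_ : _ - _ = (f - g) ^+ 2); first exact: sqr_ge0.
  by ring.
have k1 := key _ _ _ _ _ _ (E1 x) ee.
have E2' : Lap v2 x + lam * v2 x = V x * v2 x + - eps * v1 x - f2 x - g2 x by rewrite E2 mulNr.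
have ee' : (- eps) ^+ 2 <= 1 by rewrite sqrrN.
have k2 := key _ _ _ _ _ _ E2' ee'.
apply: le_trans (lerD k1 k2) _; apply: le_of_eq; rewrite /e2.
by move: (lam2 + CV) => *; ring.
Qed.

End HsolSol.

(** * The Carleman estimate on the end *)

Section Exterior.
Context {R : realType} {m : nat} (M : riemannian_manifold R m.+1)
  (mu : {measure set (borel M) -> \bar R}) (hmu : riemannian_measure mu).
Implicit Types (f g h u v z : M -> R) (x : M).
Notation II := (II mu).
Notation JJ := (JJ mu).
Variables (w V : M -> R) (k : nat) (A delta lam1 : R).
Hypotheses (sw : sm w) (w0 : forall x, 0 < w x) (k0 : (0 < k)%N) (A1 : 1 <= A) (lam10 : 0 < lam1)
  (dl0 : 0 <= delta) (dl1 : delta * (1 + m%:R) <= 1 / 8) (dl2 : delta * (1 + m%:R) <= lam1 / 8)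
  (geoG : forall x, A < w x -> Gam w w x = 1)
  (geoH : forall x u, A < w x -> sm u -> 7 / 8 * (w x)^-1 * (Gam u u x - Gam w u x ^+ 2) <= Hs w u x)
  (geoL : forall x, A < w x -> `|w x * (Lap w x - m%:R / w x)| <= delta * (2 * wS k (w x))^-1)
  (geoV : forall x, A < w x -> `|w x * V x| <= delta * (2 * wS k (w x))^-1)
  (bigA : 256 * (m%:R ^+ 2 + 10 * m%:R + 10) ^+ 2 <= lam1 * A)
  (bigA' : 64 * (m%:R ^+ 2 + 10 * m%:R + 10) <= lam1 * A).

Section Tau.
Variables (ell tau lam : R).
Hypotheses (ell0 : 0 < ell) (ell1 : ell <= 1) (tau0 : 0 < tau) (hlam : lam1 <= lam)
  (hell : 32 * (tau ^+ 2 * ell) <= lam1).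
Notation P := (fun x => wP k ell (w x)).
Notation b := (fun x => wP k ell (w x) ^+ (4 * k)).
Notation phi1 := (fun x => wphi1 k ell tau (w x)).

Definition Wa x := wa k ell (w x).
Definition Wphi x := wphi k ell tau (w x).
Definition Wq x := wq k m ell (w x).
Definition Wc x := wc k m ell tau lam (w x).

Let lam0 : 0 < lam. Proof. exact: lt_le_trans hlam. Qed.

(** Feeds the geometry of the end into [Bpot_alg] and [Qform_alg]. The last summand holds [V] and
    the deviation of [Lap w] from [m / w], the perturbation that the positive terms absorb here. *)
Lemma ext_pointwise u x : sm u -> A < w x ->
  b x * P x * (1 / 4 * Gam w u x ^+ 2 + lam / 8 * u x ^+ 2) <=
  Qform w Wa Wq Wphi Wc u x +
  (V x + phi1 x * (Lap w x - m%:R / w x)) * u x * Mu w Wa Wq u x.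
Proof.
move=> su Ax; have r1 : 1 <= w x by apply: le_trans A1 (ltW Ax).
have P0 := wP_gt0 k ell0 (w0 x); have P1 := wP_le1 k ell0 (w0 x).
have f0 := wphi1_gt0 k ell0 tau0 (w0 x).
have b0 : 0 < b x by exact: exprn_gt0.
have PL := wP_lower k0 ell0 ell1 r1.
set e := Lap w x - m%:R / w x.
have hz : `|w x * e| <= delta * P x.
  by apply: le_trans (geoL Ax) _; exact: ler_wpM2l.
have hV : `|w x * V x| <= delta * P x.
  by apply: le_trans (geoV Ax) _; exact: ler_wpM2l.
have hy : `|w x * V x + phi1 x * (w x * e)| <= delta * P x * (1 + phi1 x).
  apply: le_trans (ler_normD _ _) _; rewrite [delta * _ * (1 + _)]mulrDr mulr1; apply: lerD => //.
  by rewrite normrM ger0_norm ?(ltW f0)// mulrC ler_wpM2r// ltW.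
have G0 : 0 <= Gam u u x - Gam w u x ^+ 2.
  by rewrite subr_ge0; apply: le_trans (Gam_cs w u x) _; rewrite geoG// mul1r.
have d8 : 8 * delta <= 1.
  by move: dl1; have := ler_wpM2l dl0 (ler0n R m); rewrite mulrDr; lra.
have hB : b x * P x * (phi1 x ^+ 2 / 8 + lam / 4) <= Bpot w Wa Wq Wphi Wc x.
  have lw : Lap w x = m%:R * (w x)^-1 + e by rewrite /e; ring.
  rewrite /Bpot (smoothder_Lap sw w0 x (wq_der m k0 ell0) (wq1_der m k0 ell0)).
  rewrite (smoothder_Lap sw w0 x (wphi_der tau k0 ell0) (wphi1_der tau k0 ell0)).
  rewrite (smoothder_Gam sw w0 _ x (wq_der m k0 ell0)) [Gam w Wphi x]GamC.
  rewrite (smoothder_Gam sw w0 _ x (wphi_der tau k0 ell0)) [Gam w Wc x]GamC.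
  rewrite (smoothder_Gam sw w0 _ x (wc_der m tau lam k0 ell0)).
  rewrite (smoothder_Gam sw w0 _ x (wa_der k0 ell0)) geoG// !mulr1 lw.
  apply: (Bpot_alg (kap := (4 * k)%:R^-1)) => //.
  - by rewrite invr_gt0 ltr0n muln_gt0.
  - by rewrite div1r lef_pV2 ?posrE ?ltr0n ?muln_gt0// ler_nat leq_pmulr.
  - exact: ltW.
  - apply: le_trans (_ : 8 * (delta * P x) <= _); first by rewrite ler_pM2l.
    by rewrite mulrA; apply: ler_piMl => //; exact: ltW.
  - have := wphi1_sq k0 ell0 tau0 r1; rewrite -(ler_pM2l (x := 32))// => h.
    apply: le_trans h _; rewrite mulrA; apply: ler_wpM2r; [exact: ltW|exact: le_trans hlam].
  - have := ler_wpM2l (ltW lam0) (rP_lower k0 ell0 ell1 r1).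
    have : lam1 * A <= lam * w x by apply: ler_pM => //; [exact: ltW|exact: le_trans A1|exact: ltW].
    by move: bigA; lra.
  - have h1 := rP_lower k0 ell0 ell1 r1.
    have : lam1 * A <= lam * w x by apply: ler_pM => //; [exact: ltW|exact: le_trans A1|exact: ltW].
    have : lam * (w x / 4) <= lam * (w x ^+ 2 * P x).
      apply: ler_wpM2l; first exact: ltW.
      apply: le_trans h1 _; rewrite exprMn; apply: ler_wpM2l; first exact: sqr_ge0.
      by rewrite expr2; apply: ler_piMl => //; exact: ltW.
    by move: bigA'; lra.
have dl2' : delta * (1 + m%:R) <= lam / 8 by apply: le_trans dl2 _; rewrite ler_pM2r.
have := Qform_alg (Gam w u x) (u x) b0 P0 P1 r1 (ltW f0) lam0 (ler0n R m) G0 dl0 dl1 dl2' hz hy (geoH Ax su) hB.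
congr (_ <= _); rewrite /Qform /Mu (smoothder_Gam sw w0 _ x (wa_der k0 ell0)).
rewrite (smoothder_Gam sw w0 _ x (wa_der k0 ell0)) (smoothder_Gam sw w0 _ x (wphi_der tau k0 ell0)) geoG//.
have lw : Lap w x = m%:R * (w x)^-1 + e by rewrite /e; ring.
rewrite [in RHS]lw /Wa /Wq /wa /wq /wa1; move: (Bpot _ _ _ _ _ x) (Hs w u x) (wphi1 _ _ _ _) (wP k ell (w x)) => B H f p.
move: (p ^+ (4 * k)) (Gam w u x) (Gam u u x) (w0 x) (u x) (V x); move: (w x) => r c D G r0 U VV.
by field; rewrite gt_eqF.
Qed.

End Tau.

Opaque Gam Lap.
Opaque wphi wphi1 wphi2 wc wc1 wq wq1 wq2 wa wa1 wP wS wY.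

Section P0.
Variables (ell tau lam : R).
Hypotheses (ell0 : 0 < ell).
Notation phi1 := (fun x => wphi1 k ell tau (w x)).
Notation Wphi := (Wphi ell tau). Notation Wc := (Wc ell tau lam).

(** [Wc] is built on the model Laplacian [m / w]; the last term corrects for the difference. *)
Lemma ext_P0 chi v x : sm chi -> sm v -> A < w x ->
  P0 Wphi Wc (fun y => expR (Wphi y) * (chi y * v y)) x =
  expR (Wphi x) * (chi x * (Lap v x + lam * v x) + (v x * Lap chi x + 2 * Gam chi v x)) +
  phi1 x * (Lap w x - m%:R / w x) * (expR (Wphi x) * (chi x * v x)).
Proof.
move=> sc sv Ax; have sz : sm (fun y => chi y * v y) by sm_.
have sp : sm Wphi := smoothder_sm sw w0 (wphi_der tau k0 ell0).
have := conj_lap x sp sz; rewrite LapM// => h.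
have hc : Wc x = lam + (Gam Wphi Wphi x - Lap Wphi x) + phi1 x * (Lap w x - m%:R / w x).
  have -> : Gam Wphi Wphi x = phi1 x * (phi1 x * Gam w w x).
    by rewrite (smoothder_Gam sw w0 Wphi x (wphi_der tau k0 ell0)) GamC (smoothder_Gam sw w0 w x (wphi_der tau k0 ell0)).
  rewrite (smoothder_Lap sw w0 x (wphi_der tau k0 ell0) (wphi1_der tau k0 ell0)) geoG//.
  rewrite /Wc (wc_conj k m ell tau lam (w0 x)).
  by move: (wphi1 k ell tau (w x)) (wphi2 k ell tau (w x)) (Lap w x) => f f2 l; ring.
have key (L G c E z l a d g t : R) : L - 2 * G + c * (E * (z * a)) = E * (z * l + a * d + 2 * g) ->
    L - 2 * G + (lam + c + t) * (E * (z * a)) = E * (z * (l + lam * a) + (a * d + 2 * g)) + t * (E * (z * a)).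
  move=> e; rewrite (_ : _ + _ = L - 2 * G + c * (E * (z * a)) + (lam + t) * (E * (z * a))); last by ring.
  by rewrite e; ring.
by rewrite /P0 hc; exact: key h.
Qed.

End P0.

Section Cutoff.
Variables (Dc : R).
Let chi x := up (A + 1) (A + 2) (w x).
Let zout x := up A (A + 1) (w x) * down (A + 2) (A + 3) (w x).
Let cA : A < A + 1. Proof. by rewrite ltrDl. Qed.
Let cA12 : A + 1 < A + 2. Proof. by rewrite ltrD2l ltr1n. Qed.
Let cA23 : A + 2 < A + 3. Proof. by rewrite ltrD2l ltr_nat. Qed.

Lemma sm_up a c : sm (fun x => up a c (w x)).
Proof. by apply: (sm_comp1 (J := setT)) => // j; exact: Ck1_up. Qed.
Lemma sm_down a c : sm (fun x => down a c (w x)).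
Proof. by apply: (sm_comp1 (J := setT)) => // j; exact: Ck1_down. Qed.

Let schi : sm chi. Proof. exact: sm_up. Qed.
Let szout : sm zout. Proof. by apply: smM; [exact: sm_up|exact: sm_down]. Qed.

Lemma w_open (O : set R) : open O -> open [set x | O (w x)].
Proof. by move=> oO; apply: open_comp => // x _; exact: sm_cont. Qed.

Lemma chi_flat x h : ~ (A + 1 <= w x <= A + 2) -> Gam chi h x = 0 /\ Lap chi x = 0.
Proof.
move=> nx; have [h1|h1] := ltP (w x) (A + 1).
  apply: (@gam_locally_cst _ _ _ chi 0 [set y | w y < A + 1]) => //.
    by apply: (@w_open [set t | t < A + 1]); exact: open_lt.
  by move=> y /= hy; rewrite /chi up0// ltW.
apply: (@gam_locally_cst _ _ _ chi 1 [set y | A + 2 < w y]) => //.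
- by apply: (@w_open [set t | A + 2 < t]); exact: open_gt.
- by move=> y /= hy; rewrite /chi up1// ltW.
- by rewrite /= ltNge; apply/negP => h2; apply: nx; rewrite h1.
Qed.

Hypothesis (hDc : forall x, Gam chi chi x <= Dc /\ Lap chi x ^+ 2 <= Dc).

Variables (ell tau lam eps rho : R).
Hypotheses (ell0 : 0 < ell) (ell1 : ell <= 1) (tau0 : 0 < tau) (hlam : lam1 <= lam)
  (hell : 32 * (tau ^+ 2 * ell) <= lam1) (eps0 : 0 < eps) (hrho : A + 2 <= rho).
Notation P := (fun x => wP k ell (w x)).
Notation b := (fun x => wP k ell (w x) ^+ (4 * k)).
Notation phi1 := (fun x => wphi1 k ell tau (w x)).
Notation Wphi := (Wphi ell tau). Notation Wc := (Wc ell tau lam).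
Notation Wa := (Wa ell). Notation Wq := (Wq ell).

(** A bound for exp(2 phi) on all of [M], finite because the phase is bounded. It depends on [tau],
    and so does [extK2], whereas [extKK] does not. *)
Definition extK3 := expR (tau * (4 / 3) * ell^-1 ^+ (3 * k)) ^+ 2.
Definition extK2 := (1 + m%:R ^+ 2) * extK3 + 6 * (ell^-1 ^+ (4 * k)) ^+ 2 * extK3 * (1 + Dc + tau ^+ 2).
Definition extKK := (2 * rho ^+ 2 + m%:R ^+ 2 / lam1) * (2 * rho).
Definition extW v1 v2 x := zout x * zout x * (3 * e2 v1 v2 x + 12 * (Gam v1 v1 x + Gam v2 v2 x)).
Definition extu v x := expR (Wphi x) * (chi x * v x).
Definition extS v x := Qform w Wa Wq Wphi Wc (extu v) x + P0 Wphi Wc (extu v) x * Mu w Wa Wq (extu v) x.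

Let lam0 : 0 < lam. Proof. exact: lt_le_trans hlam. Qed.
Let Dc0 : 0 <= Dc. Proof. by apply: le_trans (hDc point).2; exact: sqr_ge0. Qed.
Let chi01 x : 0 <= chi x <= 1. Proof. exact: up_itv. Qed.

Let E2 x : (expR (Wphi x) * chi x) ^+ 2 <= extK3.
Proof.
have /andP[c0 c1] := chi01 x; rewrite /extK3; apply: lerXn2r.
- by rewrite nnegrE mulr_ge0 ?expR_ge0.
- by rewrite nnegrE expR_ge0.
apply: (@le_trans _ _ (expR (Wphi x))); first by rewrite ler_piMr ?expR_ge0.
by rewrite ler_expR; exact: (wphi_le k ell0 tau0 (w0 x)).
Qed.

Let e2K3 x : expR (Wphi x) ^+ 2 <= extK3.
Proof.
by rewrite /extK3; apply: lerXn2r; rewrite ?nnegrE ?expR_ge0// ler_expR; exact: (wphi_le k ell0 tau0 (w0 x)).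
Qed.

(** Boundedness of the phase and of [wa] is used here: the multiplier is controlled by mass and
    gradient alone, with a constant that appears only in front of [eps]. *)
Let Mbound v x : sm v -> A < w x ->
  2^-1 * extu v x ^+ 2 + Mu w Wa Wq (extu v) x ^+ 2 <= extK2 * (v x ^+ 2 + Gam v v x).
Proof.
move=> sv Ax; have r1 : 1 <= w x by apply: le_trans A1 (ltW Ax).
have sE : sm (fun y => expR (Wphi y)) by apply: sm_exp; exact: (smoothder_sm sw w0 (wphi_der tau k0 ell0)).
have sz : sm (fun y => chi y * v y) by exact: smM.
have hD : Gam w (extu v) x = expR (Wphi x) * chi x * Gam w v x + expR (Wphi x) * (v x * Gam w chi x)
    + phi1 x * (expR (Wphi x) * chi x * v x).
  rewrite GamC (GamMl _ _ sE sz) (GamMl _ _ schi sv) Gam_exp; last exact: (smoothder_sm sw w0 (wphi_der tau k0 ell0)).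
  rewrite (smoothder_Gam sw w0 w x (wphi_der tau k0 ell0)) geoG// [Gam v w x]GamC [Gam chi w x]GamC.
  by move: (Gam w v x) (Gam w chi x) (phi1 x) (expR _) (chi x) => *; ring.
have gv := Gam_ge0 v x.
have hv : Gam w v x ^+ 2 <= Gam v v x by apply: le_trans (Gam_cs w v x) _; rewrite geoG// mul1r.
have hc : Gam w chi x ^+ 2 <= Dc by apply: le_trans (Gam_cs w chi x) _; rewrite geoG// mul1r (hDc x).1.
have K30 : 0 <= extK3 by exact: sqr_ge0.
have vv : 0 <= v x ^+ 2 by exact: sqr_ge0.
have D2 : Gam w (extu v) x ^+ 2 <= 3 * extK3 * (Gam v v x + (Dc + tau ^+ 2) * v x ^+ 2).
  rewrite hD; apply: le_trans (sq3 _ _ _) _; rewrite -[3 * extK3 * _]mulrA; apply: ler_wpM2l => //.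
  have t1 : (expR (Wphi x) * chi x * Gam w v x) ^+ 2 <= extK3 * Gam v v x.
    by rewrite exprMn; apply: ler_pM; [exact: sqr_ge0|exact: sqr_ge0|exact: E2|exact: hv].
  have t2 : (expR (Wphi x) * (v x * Gam w chi x)) ^+ 2 <= extK3 * (Dc * v x ^+ 2).
    rewrite exprMn; apply: ler_pM; [exact: sqr_ge0|exact: sqr_ge0|exact: e2K3|].
    by rewrite exprMn mulrC ler_wpM2r.
  have t3 : (phi1 x * (expR (Wphi x) * chi x * v x)) ^+ 2 <= extK3 * (tau ^+ 2 * v x ^+ 2).
    rewrite exprMn [(_ * v x) ^+ 2]exprMn mulrCA; apply: ler_pM.
    - exact: sqr_ge0.
    - by rewrite mulr_ge0 ?sqr_ge0.
    - exact: E2.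
    apply: ler_wpM2r => //; apply: lerXn2r; rewrite ?nnegrE ?(ltW tau0)//.
      exact: ltW (wphi1_gt0 k ell0 tau0 (w0 x)).
    exact: (wphi1_le k0 ell0 tau0 r1).
  by rewrite (_ : extK3 * _ = extK3 * Gam v v x + extK3 * (Dc * v x ^+ 2) + extK3 * (tau ^+ 2 * v x ^+ 2)); [rewrite !lerD|ring].
have u2 : extu v x ^+ 2 <= extK3 * v x ^+ 2.
  by rewrite /extu mulrA exprMn ler_wpM2r.
have a0 : 0 <= Wa x.
  by apply: mulr_ge0; [exact: ltW|apply: exprn_ge0; exact: ltW (wP_gt0 k ell0 (w0 x))].
have a1 : Wa x ^+ 2 <= (ell^-1 ^+ (4 * k)) ^+ 2.
  by apply: lerXn2r; rewrite ?nnegrE ?exprn_ge0 ?invr_ge0 ?(ltW ell0)//; exact: (wa_le k0 ell0 (w0 x)).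
have q1 : Wq x ^+ 2 <= (m%:R / 2) ^+ 2.
  have /andP[h1 h2] := wq_itv k ell0 m (w0 x).
  by apply: lerXn2r; rewrite ?nnegrE ?divr_ge0.
have M2 : Mu w Wa Wq (extu v) x ^+ 2 <= 2 * (Wa x ^+ 2 * Gam w (extu v) x ^+ 2) + 2 * (Wq x ^+ 2 * extu v x ^+ 2).
  rewrite /Mu; move: (Wa x) (Wq x) (Gam w _ x) (extu v x) => a q D u.
  rewrite -subr_ge0 (_ : _ - _ = (a * D - q * u) ^+ 2); first exact: sqr_ge0.
  by ring.
have n1 := ler_pM (sqr_ge0 _) (sqr_ge0 _) a1 D2.
have n2 := ler_pM (sqr_ge0 _) (sqr_ge0 _) q1 u2.
apply: le_trans (lerD (ler_wpM2l _ u2) (le_trans M2 (lerD (ler_wpM2l _ n1) (ler_wpM2l _ n2)))) _ => //.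
rewrite /extK2; move: K30 vv gv (sqr_ge0 (ell^-1 ^+ (4 * k))) Dc0 (sqr_ge0 tau) (sqr_ge0 (m%:R : R)).
move: extK3 (v x ^+ 2) (Gam v v x) ((ell^-1 ^+ (4 * k)) ^+ 2) (tau ^+ 2) => K3 V2 G L T2 K0 V0 G0 L0 d0 T0 m0.
rewrite -subr_ge0 (_ : _ - _ = K3 * V2 / 2 + m%:R ^+ 2 * (K3 * V2) / 2 + (1 + m%:R ^+ 2) * (K3 * G)
   + 6 * L * K3 * (V2 + (Dc + T2) * G)); last by field.
have KV : 0 <= K3 * V2 by exact: mulr_ge0.
have KG : 0 <= K3 * G by exact: mulr_ge0.
have mKV : 0 <= m%:R ^+ 2 * (K3 * V2) by exact: mulr_ge0.
have z1 : 0 <= 1 + m%:R ^+ 2 :> R by exact: addr_ge0.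
have z2 : 0 <= 6 * L * K3 by rewrite mulr_ge0// mulr_ge0.
have z3 : 0 <= V2 + (Dc + T2) * G by rewrite addr_ge0// mulr_ge0// addr_ge0.
by rewrite !addr_ge0 ?divr_ge0// mulr_ge0.
Qed.

(** The pointwise form of the estimate; the terms [extS] integrate to 0. The commutator lives on
    [w <= A + 2], where the increasing phase is at most its value at [A + 2], and the source on
    [w <= rho], where [extKK] bounds its coefficient. *)
Lemma ext_master v1 v2 f1 f2 g1 g2 x : hsol V lam eps v1 v2 f1 f2 g1 g2 ->
  (forall x, rho < w x -> f1 x = 0 /\ f2 x = 0) ->
  b x * P x * (lam1 / 16 * ((expR (Wphi x) * chi x) ^+ 2 * e2 v1 v2 x)) <=
  extS v1 x + extS v2 x + eps * extK2 * (e2 v1 v2 x + (Gam v1 v1 x + Gam v2 v2 x))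
  + eps^-1 * extK3 * e2 g1 g2 x + 2 * extKK * expR (wphi k ell tau (A + 2)) ^+ 2 * Dc * extW v1 v2 x
  + 2 * extKK * extK3 * e2 f1 f2 x.
Proof.
move=> [sv1 sv2 _ _ _ _ _ _ eq1 eq2] hf.
have K30 : 0 <= extK3 by exact: sqr_ge0.
have rho0 : 0 < rho by apply: lt_le_trans hrho; rewrite addr_gt0// (lt_le_trans _ A1).
have lr : 0 <= m%:R ^+ 2 / lam1 by rewrite divr_ge0 ?sqr_ge0 ?ltW.
have KK0 : 0 <= extKK.
  apply: mulr_ge0; last by rewrite mulr_ge0// ltW.
  by apply: addr_ge0 => //; rewrite mulr_ge0 ?sqr_ge0.
have K20 : 0 <= extK2.
  have := sqr_ge0 (ell^-1 ^+ (4 * k)); have := sqr_ge0 (m%:R : R); have := sqr_ge0 tau.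
  move=> h1 h2 h3; rewrite /extK2; apply: addr_ge0; first by apply: mulr_ge0 => //; exact: addr_ge0.
  apply: mulr_ge0; last by rewrite !addr_ge0.
  by rewrite mulr_ge0// mulr_ge0.
have W0 : 0 <= extW v1 v2 x.
  have := Gam_ge0 v1 x; have := Gam_ge0 v2 x; have := e2_ge0 v1 v2 x => h1 h2 h3.
  by apply: mulr_ge0; [exact: sqrM_ge0|rewrite addr_ge0// mulr_ge0// addr_ge0].
have eg := e2_ge0 g1 g2 x; have ef := e2_ge0 f1 f2 x; have ev := e2_ge0 v1 v2 x.
have G1 := Gam_ge0 v1 x; have G2 := Gam_ge0 v2 x.
have ie : 0 <= eps^-1 by rewrite invr_ge0 ltW.
have T1 : 0 <= eps * extK2 * (e2 v1 v2 x + (Gam v1 v1 x + Gam v2 v2 x)).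
  apply: mulr_ge0; first by apply: mulr_ge0 => //; exact: ltW.
  by apply: addr_ge0 => //; exact: addr_ge0.
have T2 : 0 <= eps^-1 * extK3 * e2 g1 g2 x by rewrite !mulr_ge0.
have T3 : 0 <= 2 * extKK * expR (wphi k ell tau (A + 2)) ^+ 2 * Dc * extW v1 v2 x.
  by rewrite mulr_ge0// mulr_ge0// mulr_ge0 ?sqr_ge0// mulr_ge0.
have T4 : 0 <= 2 * extKK * extK3 * e2 f1 f2 x by rewrite mulr_ge0// mulr_ge0// mulr_ge0.
have [Ax|xA] := ltP A (w x); last first.
  have cK : closed [set y | A + 1 <= w y].
    rewrite (_ : [set y | _] = w @^-1` [set t | A + 1 <= t])//.
    by apply: closed_comp => [y _|]; [exact: (sm_cont sw)|exact: closed_ge].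
  have nK : ~ [set y | A + 1 <= w y] x by apply/negP; rewrite -ltNge; exact: le_lt_trans cA.
  have u0 v : supp_in [set y | A + 1 <= w y] (extu v).
    by move=> y /negP; rewrite -ltNge => /ltW h; rewrite /extu /chi up0// mul0r mulr0.
  have S0 v : extS v x = 0.
    by rewrite /extS (Qform_out w Wa Wq Wphi Wc cK (u0 v) nK) (P0_out Wphi Wc cK (u0 v) nK) mul0r addr0.
  rewrite !S0 add0r add0r /chi up0 ?(le_trans xA) ?(ltW cA)// mulr0 expr0n mul0r !mulr0.
  by rewrite !addr_ge0.
have r1 : 1 <= w x by apply: le_trans A1 (ltW Ax).
have P0' := wP_gt0 k ell0 (w0 x); have P1 := wP_le1 k ell0 (w0 x).
have b0 : 0 < b x by exact: exprn_gt0.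
have b1 : b x <= 1 by apply: exprn_ile1 => //; exact: ltW.
pose X v f := expR (Wphi x) * (v x * Lap chi x + 2 * Gam chi v x - chi x * f x).
pose Z := V x + phi1 x * (Lap w x - m%:R / w x).
have sE : sm (fun y => expR (Wphi y)) by apply: sm_exp; exact: (smoothder_sm sw w0 (wphi_der tau k0 ell0)).
have su v : sm v -> sm (extu v) by move=> sv; apply: smM => //; exact: smM.
have p1 := ext_pointwise ell0 ell1 tau0 hlam hell (su v1 sv1) Ax.
have p2 := ext_pointwise ell0 ell1 tau0 hlam hell (su v2 sv2) Ax.
have m1 v : Mu w Wa Wq (extu v) x = w x * b x * Gam w (extu v) x + m%:R / 2 * b x * extu v x by [].
have key (l E c v v' VV d g' t f g e : R) : l = VV * v + e * v' - f - g ->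
    E * (c * l + (v * d + 2 * g')) + t * (E * (c * v)) =
    (VV + t) * (E * (c * v)) + E * (v * d + 2 * g' - c * f) + (e * (E * (c * v')) - E * c * g).
  by move=> ->; ring.
have s1 : P0 Wphi Wc (extu v1) x = Z * extu v1 x + X v1 f1 + (eps * extu v2 x - expR (Wphi x) * chi x * g1 x).
  exact: etrans (ext_P0 tau lam ell0 schi sv1 Ax) (key _ _ _ _ _ _ _ _ _ _ _ _ (eq1 x)).
have eq2' : Lap v2 x + lam * v2 x = V x * v2 x + - eps * v1 x - f2 x - g2 x by rewrite eq2 mulNr.
have s2 : P0 Wphi Wc (extu v2) x = Z * extu v2 x + X v2 f2 + (- (eps * extu v1 x) - expR (Wphi x) * chi x * g2 x).
  rewrite -mulNr; exact: etrans (ext_P0 tau lam ell0 schi sv2 Ax) (key _ _ _ _ _ _ _ _ _ _ _ _ eq2').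
have main := ext_sum_alg b0 P0' lam0 eps0 (m1 v1) (m1 v2) p1 p2 s1 s2.
have Xb : b x * ((2 * w x ^+ 2 + m%:R ^+ 2 / lam) / P x) * (X v1 f1 ^+ 2 + X v2 f2 ^+ 2) <=
    2 * extKK * expR (wphi k ell tau (A + 2)) ^+ 2 * Dc * extW v1 v2 x + 2 * extKK * extK3 * e2 f1 f2 x.
  have [xr|rx] := leP (w x) rho; last first.
    have [h1 h2] := hf x rx.
    have fl h : Gam chi h x = 0 /\ Lap chi x = 0.
      by apply: chi_flat => /andP[_ h3]; have := le_lt_trans hrho rx; rewrite ltNge h3.
    have [z1 z1'] := fl v1; have [z2 _] := fl v2; rewrite /X h1 h2 z1 z2 z1' !mulr0 addr0 subr0 mulr0 expr0n addr0 mulr0.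
    exact: addr_ge0.
  have cf : 0 <= b x * ((2 * w x ^+ 2 + m%:R ^+ 2 / lam) / P x) <= extKK.
    have l1 : m%:R ^+ 2 / lam <= m%:R ^+ 2 / lam1.
      by apply: ler_wpM2l; [exact: sqr_ge0|rewrite lef_pV2].
    have l0 : 0 <= m%:R ^+ 2 / lam by rewrite divr_ge0 ?sqr_ge0 ?ltW.
    have w2 : 0 <= w x ^+ 2 by exact: sqr_ge0.
    apply/andP; split; first by rewrite mulr_ge0 ?(ltW b0)// divr_ge0 ?(ltW P0')// addr_ge0// mulr_ge0.
    rewrite -[leRHS]mul1r; apply: ler_pM => //; first exact: ltW.
      by rewrite divr_ge0 ?(ltW P0')// addr_ge0// mulr_ge0.
    apply: ler_pM.
    - by rewrite addr_ge0// mulr_ge0.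
    - by rewrite invr_ge0 ltW.
    - apply: lerD l1; rewrite ler_pM2l//; apply: lerXn2r => //; first exact: ltW (w0 x).
      exact: ltW.
    have h3 := wP_lower_bound k0 ell0 ell1 r1.
    have wx0 := w0 x; apply: (@le_trans _ _ (2 * w x)); last by rewrite ler_pM2l.
    by rewrite -[leRHS]invrK lef_pV2// ?posrE// invr_gt0 mulr_gt0.
  have /andP[cf0 cf1] := cf.
  have X2 v f : X v f ^+ 2 <= 2 * (expR (Wphi x) ^+ 2 * (v x * Lap chi x + 2 * Gam chi v x) ^+ 2) + 2 * (extK3 * f x ^+ 2).
    have := ler_wpM2r (sqr_ge0 (f x)) (E2 x); rewrite /X exprMn.
    move: (expR (Wphi x)) (_ + 2 * _) (chi x) (f x) => E C c F h.
    apply: le_trans (_ : 2 * (E ^+ 2 * C ^+ 2) + 2 * ((E * c) ^+ 2 * F ^+ 2) <= _); last by rewrite lerD2l ler_pM2l// exprMn.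
    rewrite -subr_ge0 (_ : _ - _ = (E * (C + c * F)) ^+ 2); first exact: sqr_ge0.
    by ring.
  have CW : expR (Wphi x) ^+ 2 * ((v1 x * Lap chi x + 2 * Gam chi v1 x) ^+ 2 + (v2 x * Lap chi x + 2 * Gam chi v2 x) ^+ 2) <=
      expR (wphi k ell tau (A + 2)) ^+ 2 * (Dc * extW v1 v2 x).
    have [hx|nx] := boolP (A + 1 <= w x <= A + 2); last first.
      have fl h : Gam chi h x = 0 /\ Lap chi x = 0 by apply: chi_flat; exact/negP.
      have [z1 z1'] := fl v1; have [z2 _] := fl v2.
      apply: (@le_trans _ _ 0); last by rewrite mulr_ge0 ?sqr_ge0// mulr_ge0.
      by rewrite z1 z2 z1' !mulr0 addr0 expr0n addr0 mulr0.
    have /andP[x1 x2] := hx.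
    apply: ler_pM; [exact: sqr_ge0|by rewrite addr_ge0 ?sqr_ge0| |].
      apply: lerXn2r; [exact: expR_ge0|exact: expR_ge0|]; rewrite ler_expR.
      exact: (wphi_mono k0 ell0 tau0 (w0 x) x2).
    have zo : zout x = 1 by rewrite /zout up1// down1// mulr1.
    have comm v : (v x * Lap chi x + 2 * Gam chi v x) ^+ 2 <= Dc * (2 * (v x * v x) + 8 * Gam v v x).
      have [d1 d2] := hDc x; have vv := sqrM_ge0 (v x).
      have g1' : Gam chi v x ^+ 2 <= Dc * Gam v v x.
        by apply: le_trans (Gam_cs chi v x) _; apply: ler_wpM2r => //; exact: Gam_ge0.
      have l1' := ler_wpM2l vv d2.
      apply: (@le_trans _ _ (2 * (v x * v x * Lap chi x ^+ 2) + 8 * Gam chi v x ^+ 2)).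
        rewrite -subr_ge0 (_ : _ - _ = (v x * Lap chi x - 2 * Gam chi v x) ^+ 2); first exact: sqr_ge0.
        by move: (Lap chi x) (Gam chi v x) => *; ring.
      rewrite mulrDr !(mulrCA Dc); apply: lerD; last by rewrite ler_pM2l.
      by rewrite ler_pM2l// [v x * (Dc * _)]mulrCA [Dc * _]mulrC.
    apply: le_trans (lerD (comm v1) (comm v2)) _; rewrite -mulrDr; apply: ler_wpM2l => //.
    rewrite /extW zo !mul1r /e2; have a1 := sqrM_ge0 (v1 x); have a2 := sqrM_ge0 (v2 x).
    by rewrite -subr_ge0 (_ : _ - _ = v1 x * v1 x + v2 x * v2 x + 4 * (Gam v1 v1 x + Gam v2 v2 x)); [rewrite !addr_ge0// mulr_ge0// addr_ge0|ring].
  apply: le_trans (ler_wpM2l cf0 (lerD (X2 v1 f1) (X2 v2 f2))) _.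
  have ef' : f1 x ^+ 2 + f2 x ^+ 2 = e2 f1 f2 x by rewrite /e2 !expr2.
  have ge0' : 0 <= 2 * (expR (wphi k ell tau (A + 2)) ^+ 2 * (Dc * extW v1 v2 x)) + 2 * (extK3 * e2 f1 f2 x).
    by rewrite addr_ge0// mulr_ge0// mulr_ge0 ?sqr_ge0// mulr_ge0.
  apply: (@le_trans _ _ (b x * ((2 * w x ^+ 2 + m%:R ^+ 2 / lam) / P x) * (2 * (expR (wphi k ell tau (A + 2)) ^+ 2 * (Dc * extW v1 v2 x)) + 2 * (extK3 * e2 f1 f2 x)))).
    apply: ler_wpM2l => //; rewrite -ef' addrACA -mulrDr -mulrDr -mulrDr.
    by apply: lerD; rewrite ler_pM2l// mulrDr.
  apply: le_trans (ler_wpM2r ge0' cf1) _; apply: le_of_eq.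
  by move: (expR _ ^+ 2) (extW v1 v2 x) extK3 extKK => *; ring.
have MM := lerD (Mbound sv1 Ax) (Mbound sv2 Ax).
have EM : eps * (2^-1 * (extu v1 x ^+ 2 + extu v2 x ^+ 2) + (Mu w Wa Wq (extu v1) x ^+ 2 + Mu w Wa Wq (extu v2) x ^+ 2)) <=
    eps * extK2 * (e2 v1 v2 x + (Gam v1 v1 x + Gam v2 v2 x)).
  rewrite -[leRHS]mulrA; apply: ler_wpM2l; first exact: ltW.
  apply: le_trans (_ : extK2 * (v1 x ^+ 2 + Gam v1 v1 x) + extK2 * (v2 x ^+ 2 + Gam v2 v2 x) <= _).
    by apply: le_trans MM; rewrite mulrDr addrACA.
  by rewrite -mulrDr /e2 -!expr2 addrACA.
have EG : eps^-1 * ((expR (Wphi x) * chi x) ^+ 2 * (g1 x ^+ 2 + g2 x ^+ 2)) <= eps^-1 * extK3 * e2 g1 g2 x.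
  rewrite -[leRHS]mulrA; apply: ler_wpM2l => //; rewrite /e2 -!expr2; apply: ler_wpM2r; last exact: E2.
  by rewrite addr_ge0 ?sqr_ge0.
have L1 : b x * P x * (lam1 / 16 * ((expR (Wphi x) * chi x) ^+ 2 * e2 v1 v2 x)) <=
    b x * P x * (lam / 16 * (extu v1 x ^+ 2 + extu v2 x ^+ 2)).
  apply: ler_wpM2l; first by rewrite mulr_ge0 ?ltW.
  rewrite (_ : extu v1 x ^+ 2 + _ = (expR (Wphi x) * chi x) ^+ 2 * e2 v1 v2 x).
    apply: ler_wpM2r; first by rewrite mulr_ge0 ?sqr_ge0.
    by apply: ler_wpM2r; rewrite ?invr_ge0.
  by rewrite /extu /e2; move: (expR _) (chi x) => *; ring.
apply: le_trans L1 (le_trans main _); rewrite -[leRHS]addrA.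
apply: lerD; last exact: Xb.
apply: lerD; last exact: EG.
by apply: lerD; last exact: EM.
Qed.

End Cutoff.

Variables (CV lam2 : R).
Hypotheses (hK : forall rho, compact [set x | w x <= rho]) (hV : forall x, `|V x| <= CV).

Lemma cutoff_const : exists Dc, forall x,
  [/\ Gam (fun x => up (A + 1) (A + 2) (w x)) (fun x => up (A + 1) (A + 2) (w x)) x <= Dc,
      Lap (fun x => up (A + 1) (A + 2) (w x)) x ^+ 2 <= Dc &
      Gam (fun x => up A (A + 1) (w x) * down (A + 2) (A + 3) (w x)) (fun x => up A (A + 1) (w x) * down (A + 2) (A + 3) (w x)) x <= Dc].
Proof.
set chi := (fun x => up (A + 1) _ _); set z := (fun x => _ * _).
have sc : sm chi by exact: sm_up.
have sz : sm z by apply: smM; [exact: sm_up|exact: sm_down].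
have [D1 D10 h1] : exists2 D : R, 0 <= D & forall x, `|Gam chi chi x| <= D.
  apply: sm_cs_bound; first by sm_.
  exists [set x | w x <= A + 2]; first exact: hK.
  by move=> x /= nx; apply: (chi_flat chi _).1 => /andP[].
have [D2 D20 h2] : exists2 D : R, 0 <= D & forall x, `|Lap chi x ^+ 2| <= D.
  apply: sm_cs_bound; first by sm_.
  exists [set x | w x <= A + 2]; first exact: hK.
  by move=> x /= nx; rewrite (chi_flat chi _).2 ?expr0n// => /andP[].
have [D3 D30 h3] : exists2 D : R, 0 <= D & forall x, `|Gam z z x| <= D.
  apply: sm_cs_bound; first by sm_.
  apply: cs_Gam; exists [set x | w x <= A + 3]; first exact: hK.
  by move=> x /= /negP; rewrite -ltNge => /ltW h; rewrite /z [down _ _ _]down0 ?mulr0// ltrD2l ltr_nat.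
exists (D1 + D2 + D3) => x; split.
- by apply: le_trans (ler_norm _) (le_trans (h1 x) _); rewrite -addrA lerDl addr_ge0.
- by apply: le_trans (ler_norm _) (le_trans (h2 x) _); rewrite addrAC lerDr addr_ge0.
- by apply: le_trans (ler_norm _) (le_trans (h3 x) _); rewrite lerDr addr_ge0.
Qed.

(** [C1] is quantified before [tau] and [C2] after it: the factor exp(-c tau) has to beat [C1],
    while the constant in front of sources and errors may grow with [tau]. *)
Lemma ext_carleman : exists2 cc : R, 0 < cc & forall rho rho' : R, A + 2 <= rho -> A + 3 <= rho' ->
  exists2 C1 : R, 0 <= C1 & forall tau : R, 0 < tau -> exists2 C2 : R, 0 <= C2 &
  forall (lam eps : R) v1 v2 f1 f2 g1 g2, lam1 <= lam -> lam <= lam2 -> 0 < eps -> eps <= 1 ->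
  hsol V lam eps v1 v2 f1 f2 g1 g2 ->
  (forall x, rho < w x -> f1 x = 0 /\ f2 x = 0) ->
  JJ [set x | A + 3 <= w x <= rho'] (e2 v1 v2) <=
  C1 * expR (- (cc * tau)) * JJ [set x | w x <= A + 3] (e2 v1 v2) +
  C2 * (II (e2 f1 f2) + eps * II (fun x => e2 v1 v2 x + (Gam v1 v1 x + Gam v2 v2 x)) + eps^-1 * II (e2 g1 g2)).
Proof.
have [Dc hD] := cutoff_const.
have hDc x : Gam (fun x => up (A + 1) (A + 2) (w x)) (fun x => up (A + 1) (A + 2) (w x)) x <= Dc /\
  Lap (fun x => up (A + 1) (A + 2) (w x)) x ^+ 2 <= Dc by have [] := hD x.
have Dc0 : 0 <= Dc by apply: le_trans (hDc point).2; exact: sqr_ge0.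
have A20 : 1 <= A + 2 by apply: le_trans A1 _; rewrite lerDl.
have A0 : 0 < A by apply: lt_le_trans A1.
(* Twice the rate of [wphi_growth] on [[A + 2, A + 3]], because the weight enters squared. *)
pose cc : R := 2 * ((2^-1) ^+ (3 * k) * (2 * (A + 2 + 1) ^+ 2)^-1).
exists cc => [|rho rho' hrho hrho'].
  by rewrite /cc mulr_gt0// mulr_gt0 ?exprn_gt0 ?invr_gt0// mulr_gt0// exprn_gt0// !addr_gt0.
have rho0 : 0 < rho' by apply: lt_le_trans hrho'; rewrite addr_gt0.
have rho1 : 1 <= rho' by apply: le_trans hrho'; apply: le_trans A1 _; rewrite lerDl.
(* Lower bound for the coefficient of the mass on [w <= rho'], from [wP >= 1 / (2 r)]; it involves
   neither [tau] nor [ell]. *)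
pose c0 : R := (2 * rho')^-1 ^+ (4 * k) * (2 * rho')^-1 * (lam1 / 16).
have i0 : 0 < (2 * rho')^-1 by rewrite invr_gt0 mulr_gt0.
have c00 : 0 < c0 by apply: mulr_gt0; [apply: mulr_gt0 => //; exact: exprn_gt0|rewrite divr_gt0].
pose L := 3 * ((lam2 + CV) ^+ 2 + 1).
have L0 : 0 <= L by rewrite mulr_ge0// addr_ge0 ?sqr_ge0.
pose Cz := 15 + 12 * L + 48 * Dc; have Cz0 : 0 <= Cz by rewrite /Cz; pos.
have KK0 : 0 <= extKK rho.
  have r0 : 0 <= rho by apply: le_trans hrho; rewrite addr_ge0// ltW.
  by rewrite /extKK mulr_ge0 ?mulr_ge0// addr_ge0 ?mulr_ge0 ?sqr_ge0 ?invr_ge0 ?(ltW lam10).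
(* Fixed before [tau]: no factor involves the phase. *)
pose C1 := 2 * extKK rho * Dc * Cz / c0.
have C10 : 0 <= C1 by rewrite divr_ge0 ?(ltW c00)// mulr_ge0// mulr_ge0// mulr_ge0.
exists C1 => // tau tau0.
(* The largest [ell <= 1] compatible with [hell]. *)
pose ell := Num.min 1 (lam1 / (32 * tau ^+ 2)).
have t2 : 0 < 32 * tau ^+ 2 by rewrite mulr_gt0// exprn_gt0.
have ell0 : 0 < ell by rewrite lt_min ltr01 divr_gt0.
have ell1 : ell <= 1 by rewrite ge_min lexx.
have hell : 32 * (tau ^+ 2 * ell) <= lam1.
  have : ell <= lam1 / (32 * tau ^+ 2) by rewrite ge_min lexx orbT.
  by rewrite ler_pdivlMr// => h; apply: le_trans h; rewrite mulrA mulrC.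
clearbody ell.
have K30 : 0 <= extK3 ell tau by exact: sqr_ge0.
have K20 : 0 <= extK2 Dc ell tau.
  rewrite /extK2; apply: addr_ge0; first by apply: mulr_ge0 => //; rewrite addr_ge0 ?sqr_ge0.
  by apply: mulr_ge0; [rewrite mulr_ge0// mulr_ge0 ?sqr_ge0|rewrite !addr_ge0 ?sqr_ge0].
pose C2 := (extK2 Dc ell tau + extK3 ell tau + 2 * extKK rho * extK3 ell tau) / c0 + C1 * 6.
have C20 : 0 <= C2.
  by rewrite /C2; pos.
exists C2 => // lam eps v1 v2 f1 f2 g1 g2 hlam hlam2 eps0 eps1 hs hf.
have lam0 : 0 < lam by apply: lt_le_trans hlam.
have [sv1 sv2 cv1 cv2 bf1 bf2 bg1 bg2 _ _] := hs.
have hsl := hsol_sol hV lam0 hlam2 eps0 eps1 hs.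
pose e3 := expR (wphi k ell tau (A + 3)) ^+ 2; pose e2' := expR (wphi k ell tau (A + 2)) ^+ 2.
have e30 : 0 < e3 by rewrite exprn_gt0// expR_gt0.
have e31 : 1 <= e3.
  rewrite /e3 exprn_ege1// -expR0 ler_expR; apply: (wphi_ge0 k ell0 tau0).
  by rewrite addr_gt0.
have e20 : 0 <= e2' by exact: sqr_ge0.
have e23 : e2' <= expR (- (cc * tau)) * e3.
  rewrite [leLHS](esym (expRM_natl _ _)) (_ : e3 = expR (2%:R * wphi k ell tau (A + 3))); last exact: esym (expRM_natl _ _).
  rewrite -expRD ler_expR.
  have := wphi_growth k0 ell0 ell1 tau0 A20; rewrite (_ : A + 2 + 1 = A + 3); last by ring.
  move: (wphi _ _ _ _) (wphi _ _ _ _) => p q; rewrite /cc (_ : A + 2 + 1 = A + 3); last by ring.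
  by move: (_ * (2 * _)^-1) => t; lra.
set Z := [set x | A + 3 <= w x <= rho'].
have mw (B : set R) : measurable B -> measurable ((fun x => B (w x)) : set (borel M)).
  by move=> mB; rewrite -[X in measurable X]setTI; apply: (sm_meas sw).
have mZ : measurable (Z : set (borel M)).
  rewrite (_ : Z = [set x | `[A + 3, rho']%classic (w x)]); first by apply: mw; exact: measurable_itv.
  by apply/funext => x; rewrite /= in_itv.
pose z x := up A (A + 1) (w x) * down (A + 2) (A + 3) (w x).
have sz : sm z by apply: smM; [exact: sm_up|exact: sm_down].
have z0 : supp_in [set x | w x <= A + 3] z.
  by move=> x /= /negP; rewrite -ltNge => /ltW h; rewrite /z [down _ _ _]down0 ?mulr0// ltrD2l ltr_nat.
have cz : cs z by exists [set x | w x <= A + 3]; first exact: hK.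
have clK : closed [set x | w x <= A + 3] by apply: compact_closedM; exact: hK.
have z1 x : z x ^+ 2 <= 1.
  have /andP[u0 u1] := up_itv A (A + 1) (w x); have /andP[d0 d1] := down_itv (A + 2) (A + 3) (w x).
  by apply: exprn_ile1; [exact: mulr_ge0|exact: mulr_ile1].
have mZ3 : measurable ([set x | w x <= A + 3] : set (borel M)) by apply: compact_borel; exact: hK.
have cacc := cacc_sol hmu L0 Dc0 hsl mZ3 sz cz z0 (supp_Gam z clK z0) z1 (fun x => let: And3 _ _ h := hD x in h).
rewrite -/Cz in cacc.
have bE : bcs (e2 v1 v2) by exact: bcs_e2.
have bF : bcs (e2 f1 f2) by exact: bcs_e2_meas.
have bG : bcs (e2 g1 g2) by exact: bcs_e2_meas.
pose H x := e2 v1 v2 x + (Gam v1 v1 x + Gam v2 v2 x).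
have bH : bcs H by apply: bcsD => //; apply: bcs_sm; [sm_|cs_].
pose W x := z x * z x * (3 * e2 v1 v2 x + 12 * (Gam v1 v1 x + Gam v2 v2 x)).
have sE : sm (e2 v1 v2) by rewrite /e2; sm_.
have cE : cs (e2 v1 v2) by rewrite /e2; cs_.
have bW : bcs W by rewrite /W; apply: bcs_sm; [sm_|cs_].
have swf := smoothder_sm sw w0.
have spp := swf _ _ (wphi_der tau k0 ell0); have sa := swf _ _ (wa_der k0 ell0).
have sq := swf _ _ (wq_der m k0 ell0); have sc := swf _ _ (wc_der m tau lam k0 ell0).
pose U v x := expR (Wphi ell tau x) * (up (A + 1) (A + 2) (w x) * v x).
have sU v : sm v -> sm (U v).
  by move=> sv; apply: smM; [exact: sm_exp|apply: smM => //; exact: sm_up].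
have cU v : cs v -> cs (U v) by move=> [K cK v0]; exists K => // x /v0 h; rewrite /U h !mulr0.
pose S v x := Qform w (Wa ell) (Wq ell) (Wphi ell tau) (Wc ell tau lam) (U v) x +
  P0 (Wphi ell tau) (Wc ell tau lam) (U v) x * Mu w (Wa ell) (Wq ell) (U v) x.
have SI v : sm v -> cs v -> bcs (S v) /\ II (S v) = 0.
  move=> sv cv; have su := sU v sv; have cu := cU v cv.
  have mult := multiplier hmu sw sa sq spp sc su cu.
  have bQ : bcs (Qform w (Wa ell) (Wq ell) (Wphi ell tau) (Wc ell tau lam) (U v)).
    by apply: bcs_sm; rewrite /Qform /Bpot /Hs; [sm_|cs_].
  have bP : bcs (fun x => P0 (Wphi ell tau) (Wc ell tau lam) (U v) x * Mu w (Wa ell) (Wq ell) (U v) x).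
    by apply: bcs_sm; rewrite /P0 /Mu; [sm_|cs_].
  split; first exact: bcsD.
  by rewrite /S (IID hmu bQ bP) -mult (IIN hmu bP) addNr.
have [bS1 I1] := SI v1 sv1 cv1; have [bS2 I2] := SI v2 sv2 cv2.
have pt x : c0 * e3 * (\1_Z x * e2 v1 v2 x) <= S v1 x + S v2 x + (eps * extK2 Dc ell tau * H x
   + eps^-1 * extK3 ell tau * e2 g1 g2 x + 2 * extKK rho * e2' * Dc * W x
   + 2 * extKK rho * extK3 ell tau * e2 f1 f2 x).
  have := ext_master hDc ell0 ell1 tau0 hlam hell eps0 hrho x hs hf.
  have reas (a b c d e f : R) : a + b + c + d + e + f = a + b + (c + d + e + f) by ring.
  move=> h; apply: (le_trans _ (le_trans h _)); last by apply: le_of_eq; exact: reas.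
  have ev := e2_ge0 v1 v2 x.
  have p0 := wP_gt0 k ell0 (w0 x).
  have l16 : 0 <= lam1 / 16 by apply: divr_ge0 => //; exact: ltW.
  rewrite indicE; have [hx|nx] := pselect (Z x); last first.
    rewrite memNset// mul0r mulr0; apply: mulr_ge0; first by rewrite mulr_ge0 ?exprn_ge0 ?ltW.
    by apply: mulr_ge0; [exact: l16|exact: mulr_ge0 (sqr_ge0 _) ev].
  have /andP[x1 x2] := hx; rewrite mem_set// mul1r.
  have r1 : 1 <= w x by apply: le_trans x1; apply: le_trans A1 _; rewrite lerDl.
  have pl : (2 * rho')^-1 <= wP k ell (w x).
    apply: le_trans (wP_lower_bound k0 ell0 ell1 r1).
    by rewrite lef_pV2 ?posrE ?mulr_gt0// ler_pM2l.
  have c0E (t u : R) : c0 * t * u = (2 * rho')^-1 ^+ (4 * k) * (2 * rho')^-1 * (lam1 / 16 * (t * u)).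
    by rewrite /c0; ring.
  rewrite c0E; apply: ler_pM.
  - by apply: mulr_ge0; [apply: exprn_ge0; exact: ltW|exact: ltW].
  - apply: mulr_ge0; [exact: l16|exact: mulr_ge0 (ltW e30) ev].
  - apply: ler_pM => //; [by apply: exprn_ge0; exact: ltW|exact: ltW|].
    by apply: lerXn2r => //; exact: ltW.
  apply: ler_wpM2l; first exact: l16.
  apply: ler_wpM2r => //.
  have -> : up (A + 1) (A + 2) (w x) = 1.
    have A12 : A + 1 < A + 2 by rewrite ltrD2l (ltr_nat R 1 2).
    by rewrite up1//; apply: le_trans x1; rewrite lerD2l (ler_nat R 2 3).
  rewrite mulr1; apply: lerXn2r; [exact: expR_ge0|exact: expR_ge0|].
  by rewrite ler_expR; apply: (wphi_mono k0 ell0 tau0) x1; rewrite addr_gt0.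
have bJ : bcs (fun x => \1_Z x * e2 v1 v2 x) by exact: bcs_ind.
have b4 := bcs_lin4 (eps * extK2 Dc ell tau) (eps^-1 * extK3 ell tau) (2 * extKK rho * e2' * Dc)
  (2 * extKK rho * extK3 ell tau) bH bG bW bF.
have Ipt := II_le hmu (bcsZ (c0 * e3) bJ) (bcsD (bcsD bS1 bS2) b4) pt.
rewrite (IIZ hmu _ bJ) (IID hmu (bcsD bS1 bS2) b4) (IID hmu bS1 bS2) I1 I2 addr0 add0r (II_lin4 hmu _ _ _ _ bH bG bW bF) in Ipt.
have I6 : II (fun x => 6 * (e2 f1 f2 x + e2 g1 g2 x)) = 6 * (II (e2 f1 f2) + II (e2 g1 g2)).
  by rewrite (IIZ hmu _ (bcsD bF bG)) (IID hmu bF bG).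
rewrite I6 -/(W) in cacc.
have IF0 : 0 <= II (e2 f1 f2) by apply: II_ge0 => x; exact: e2_ge0.
have IG0 : 0 <= II (e2 g1 g2) by apply: II_ge0 => x; exact: e2_ge0.
have IH0 : 0 <= II H by apply: II_ge0 => x; rewrite addr_ge0 ?e2_ge0// addr_ge0 ?Gam_ge0.
have JK0 : 0 <= JJ [set x | w x <= A + 3] (e2 v1 v2) by apply: JJ_ge0; exact: e2_ge0.
have ex1 : expR (- (cc * tau)) <= 1.
  rewrite -expR0 ler_expR oppr_le0 mulr_ge0 ?(ltW tau0)// /cc.
  have h9 : 0 <= A + 2 + 1 by rewrite !addr_ge0// ltW.
  by pos.
have ieps : II (e2 g1 g2) <= eps^-1 * II (e2 g1 g2) by rewrite ler_peMl// invf_ge1.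
apply: (ext_final c00 e31 e23 ex1 _ _ _ _ C10 erefl erefl _ JK0 IF0 IG0 _ ieps cacc) => //; last first.
- apply: le_trans Ipt _; apply: le_of_eq; rewrite -/W -/H.
  move: (II H) (II W) (II (e2 g1 g2)) (II (e2 f1 f2)) (extK2 Dc ell tau) (extK3 ell tau) (extKK rho) => *.
  by ring.
- by apply: mulr_ge0 => //; exact: ltW.
- by apply: mulr_ge0 => //; exact: mulr_ge0.
- by apply: mulr_ge0 => //; exact: mulr_ge0.
Qed.

End Exterior.

(** * The local energy estimate *)

(** [a] is the mass inside and [b] the mass outside: substituting the second inequality into the
    first leaves a multiple of [a] below 1 on the right, thanks to the smallness of [q]. *)
Lemma absorb_main {R : realType} (a b F H G q C0 C1 C2 : R) :
  0 <= C0 -> 0 <= F -> 0 <= H -> 0 <= G -> 0 <= C2 -> 0 <= q ->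
  a <= 1 / 4 * (a + b) + C0 * (b + 6 * (F + G)) -> b <= q * a + C2 * (F + H + G) ->
  (1 + 4 * C0) * q <= 1 / 2 -> C1 = 4 * (12 * C0 + (1 + 4 * C0) * C2) ->
  a <= C1 * (F + H + G).
Proof.
move=> C00 F0 H0 G0 C20 q0 h1 h2 hq ->.
have c : 0 <= 1 + 4 * C0 by rewrite addr_ge0// mulr_ge0.
have k1 := ler_wpM2l c h2.
have [a0|a0] := leP a 0.
  apply: le_trans a0 _; apply: mulr_ge0; last by rewrite !addr_ge0.
  by rewrite mulr_ge0// addr_ge0 ?mulr_ge0.
have k2 := ler_wpM2r (ltW a0) hq.
have e1 : (1 + 4 * C0) * (q * a + C2 * (F + H + G)) = (1 + 4 * C0) * q * a + (1 + 4 * C0) * C2 * (F + H + G) by ring.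
rewrite e1 in k1.
have e2 : (1 + 4 * C0) * b = b + 4 * (C0 * b) by ring.
rewrite e2 in k1.
have e3 : 4 * (12 * C0 + (1 + 4 * C0) * C2) * (F + H + G) = 48 * (C0 * F) + 48 * (C0 * H) + 48 * (C0 * G) + 4 * ((1 + 4 * C0) * C2 * (F + H + G)) by ring.
rewrite e3.
have e4 : C0 * (b + 6 * (F + G)) = C0 * b + 6 * (C0 * F) + 6 * (C0 * G) by ring.
rewrite e4 in h1.
have f1 : 0 <= C0 * F by exact: mulr_ge0.
have f2 : 0 <= C0 * H by exact: mulr_ge0.
have f3 : 0 <= C0 * G by exact: mulr_ge0.
have f4 : 0 <= (1 + 4 * C0) * C2 * (F + H + G) by pos.
by clear -h1 k1 k2 f1 f2 f3 f4; lra.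
Qed.

Lemma quasimode_arith {R : realType} (P Q E F eps L D : R) : 0 < eps -> eps <= 1 -> 0 <= E -> 0 <= F ->
  P <= L * E + Q -> Q <= 2 * eps ^+ 2 * E + 2 * F -> L + 4 <= D -> 4 <= D ->
  eps * P + eps^-1 * Q <= D * (eps * E + eps^-1 * F).
Proof.
move=> e0 e1 E0 F0 hP hQ hL h4; have i0 : 0 < eps^-1 by rewrite invr_gt0.
have i1 : 1 <= eps^-1 by rewrite invf_ge1.
have ie : eps^-1 * eps = 1 by rewrite mulVf// gt_eqF.
move: (eps^-1) i0 i1 ie => i i0 i1 ie.
have a1 : eps * P <= eps * (L * E + Q) by rewrite ler_wpM2l// ltW.
have a2 : (eps + i) * Q <= (eps + i) * (2 * eps ^+ 2 * E + 2 * F) by rewrite ler_wpM2l//; lra.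
have a3 : eps ^+ 2 <= 1 by rewrite expr_le1// ltW.
have eE : 0 <= eps * E by rewrite mulr_ge0// ltW.
have iF : 0 <= i * F by rewrite mulr_ge0// ltW.
have b1 : eps * eps ^+ 2 * E <= eps * E by rewrite [eps * _]mulrC -mulrA ler_piMl.
have b2 : eps * F <= i * F by rewrite ler_wpM2r//; lra.
have b3 : i * eps ^+ 2 * E = eps * E by rewrite expr2 mulrA ie mul1r.
have b4 : (L + 4) * (eps * E) <= D * (eps * E) by rewrite ler_wpM2r.
have b5 : 4 * (i * F) <= D * (i * F) by rewrite ler_wpM2r.
have e1' : eps * (L * E + Q) = L * (eps * E) + eps * Q by ring.
have e2' : (eps + i) * Q = eps * Q + i * Q by ring.
have e3' : (eps + i) * (2 * eps ^+ 2 * E + 2 * F) =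
  2 * (eps * eps ^+ 2 * E) + 2 * (i * eps ^+ 2 * E) + (2 * (eps * F) + 2 * (i * F)) by ring.
have e4' : (L + 4) * (eps * E) = L * (eps * E) + 4 * (eps * E) by ring.
rewrite mulrDr; rewrite e1' in a1; rewrite e2' e3' in a2; rewrite e4' in b4.
move: a1 a2 b1 b2 b3 b4 b5; clear.
by move: (eps * P) (eps * Q) (i * Q) (eps * F) (i * F) (eps * eps ^+ 2 * E) (i * eps ^+ 2 * E) (L * (eps * E)) (D * (eps * E)) (D * (i * F)) (eps * E) => *; lra.
Qed.

Section Main.
Context {R : realType} {n : nat} (M : riemannian_manifold R n)
  (mu : {measure set (borel M) -> \bar R}) (hmu : riemannian_measure mu).
Implicit Types (f g h u v z : M -> R) (x : M) (K : set M).
Notation II := (II mu).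
Notation JJ := (JJ mu).

Section Identities.
Variables (V : M -> R) (CV lam lam2 eps : R) (v1 v2 f1 f2 g1 g2 : M -> R).
Hypotheses (hV : forall x, `|V x| <= CV) (l0 : 0 < lam) (hl : lam <= lam2)
  (hs : hsol V lam eps v1 v2 f1 f2 g1 g2).

Let sv1 := hsol_sm1 hs. Let sv2 := hsol_sm2 hs.
Let cv1 := hsol_cs1 hs. Let cv2 := hsol_cs2 hs.
Let bF : bcs (e2 f1 f2). Proof. by apply: bcs_e2_meas; [exact: hsol_f1 hs|exact: hsol_f2 hs]. Qed.
Let bG : bcs (e2 g1 g2). Proof. by apply: bcs_e2_meas; [exact: hsol_g1 hs|exact: hsol_g2 hs]. Qed.
Let bE : bcs (e2 v1 v2). Proof. exact: bcs_e2. Qed.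

(** Green's identity for each of [v1] and [v2]; in the sum the coupling terms in [eps] cancel. *)
Lemma energy : II (fun x => e2 v1 v2 x + (Gam v1 v1 x + Gam v2 v2 x)) <=
  (lam2 + CV + 2) * II (e2 v1 v2) + (II (e2 f1 f2) + II (e2 g1 g2)).
Proof.
have gr v : sm v -> cs v -> bcs (fun x => v x * Lap v x + Gam v v x) /\ II (fun x => v x * Lap v x + Gam v v x) = 0.
  move=> sv cv; split; last exact: green.
  by apply: bcs_sm; [sm_|cs_].
have [b1 i1] := gr v1 sv1 cv1; have [b2 i2] := gr v2 sv2 cv2.
have bH : bcs (fun x => e2 v1 v2 x + (Gam v1 v1 x + Gam v2 v2 x)).
  by apply: bcsD => //; apply: bcs_sm; [sm_|cs_].
have bR : bcs (fun x => (v1 x * Lap v1 x + Gam v1 v1 x) + (v2 x * Lap v2 x + Gam v2 v2 x) +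
   ((lam2 + CV + 2) * e2 v1 v2 x + (e2 f1 f2 x + e2 g1 g2 x))).
  by apply: bcsD; [exact: bcsD|apply: bcsD; [exact: bcsZ|exact: bcsD]].
have : II (fun x => e2 v1 v2 x + (Gam v1 v1 x + Gam v2 v2 x)) <=
    II (fun x => (v1 x * Lap v1 x + Gam v1 v1 x) + (v2 x * Lap v2 x + Gam v2 v2 x) +
   ((lam2 + CV + 2) * e2 v1 v2 x + (e2 f1 f2 x + e2 g1 g2 x))).
  apply: II_le => // x; have E1 := hsol_eq1 hs x; have E2 := hsol_eq2 hs x.
  have e1 : Lap v1 x = V x * v1 x + eps * v2 x - f1 x - g1 x - lam * v1 x by rewrite -E1 addrK.
  have e2' : Lap v2 x = V x * v2 x - eps * v1 x - f2 x - g2 x - lam * v2 x by rewrite -E2 addrK.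
  rewrite e1 e2' /e2; have := hV x; rewrite ler_norml => /andP[h1 h2].
  move: (Gam v1 v1 x) (Gam v2 v2 x) (v1 x) (v2 x) (f1 x) (f2 x) (g1 x) (g2 x) => G1 G2 a b c d e f.
  rewrite -subr_ge0; set T := (X in 0 <= X).
  have -> : T = ((V x + CV) + (lam2 - lam)) * (a ^+ 2 + b ^+ 2) + 2^-1 * ((a - c) ^+ 2 + (b - d) ^+ 2 + (a - e) ^+ 2 + (b - f) ^+ 2)
    + 2^-1 * (c ^+ 2 + d ^+ 2 + e ^+ 2 + f ^+ 2) by rewrite /T; field.
  have h3 : 0 <= V x + CV by rewrite -lerBlDr sub0r.
  have h4 : 0 <= lam2 - lam by rewrite subr_ge0.
  by pos.
rewrite (IID hmu (bcsD b1 b2)) ?(IID hmu b1 b2) ?i1 ?i2 ?addr0 ?add0r; last first.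
  by apply: bcsD; [exact: bcsZ|exact: bcsD].
by rewrite (IID hmu (bcsZ _ bE) (bcsD bF bG)) (IIZ hmu _ bE) (IID hmu bF bG).
Qed.

End Identities.

Variables (w V : M -> R) (CV lam1 lam2 A : R).
Hypotheses (cw : continuous w) (hK : forall rho, compact [set x | w x <= rho])
  (hV : forall x, `|V x| <= CV) (l10 : 0 < lam1) (cM : connected [set: M])
  (nA : exists x, A + 3 < w x /\ w x < A + 4).
Hypothesis ext_est : exists2 cc : R, 0 < cc & forall rho rho' : R, A + 2 <= rho -> A + 3 <= rho' ->
  exists2 C1 : R, 0 <= C1 & forall tau : R, 0 < tau -> exists2 C2 : R, 0 <= C2 &
  forall (lam eps : R) v1 v2 f1 f2 g1 g2, lam1 <= lam -> lam <= lam2 -> 0 < eps -> eps <= 1 ->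
  hsol V lam eps v1 v2 f1 f2 g1 g2 ->
  (forall x, rho < w x -> f1 x = 0 /\ f2 x = 0) ->
  JJ [set x | A + 3 <= w x <= rho'] (e2 v1 v2) <=
  C1 * expR (- (cc * tau)) * JJ [set x | w x <= A + 3] (e2 v1 v2) +
  C2 * (II (e2 f1 f2) + eps * II (fun x => e2 v1 v2 x + (Gam v1 v1 x + Gam v2 v2 x)) + eps^-1 * II (e2 g1 g2)).

(** The chain bounds the mass on [w <= rho] by the mass on the shell [A0], which lies in the
    exterior region, plus a quarter of the mass on a compact [K']; [rho'] is chosen so that [K'] is
    covered by the interior and exterior regions together. *)
Lemma local_energy_bound (rho : R) : A + 3 <= rho -> exists2 C : R, 0 <= C &
  forall (lam eps : R) v1 v2 f1 f2 g1 g2, lam1 <= lam -> lam <= lam2 -> 0 < eps -> eps <= 1 ->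
  hsol V lam eps v1 v2 f1 f2 g1 g2 -> (forall x, rho < w x -> f1 x = 0 /\ f2 x = 0) ->
  JJ [set x | w x <= rho] (e2 v1 v2) <=
  C * (II (e2 f1 f2) + eps * II (fun x => e2 v1 v2 x + (Gam v1 v1 x + Gam v2 v2 x)) + eps^-1 * II (e2 g1 g2)).
Proof.
move=> hrho; pose A0 := [set x | A + 3 < w x < A + 4].
have oA : open A0.
  rewrite (_ : A0 = w @^-1` `]A + 3, A + 4[%classic).
    by apply: open_comp => [x _|]; [exact: cw|exact: interval_open].
  by apply/funext => x; rewrite /A0 /= in_itv.
have nA0 : A0 !=set0 by have [x [h1 h2]] := nA; exists x; rewrite /A0 /= h1 h2.
have [K' cK' hKK] := chain_compact hmu oA cM nA0 (@hK rho).
have [B B0 hB] := cont_bound cw cK'.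
pose rho' := Num.max B (Num.max rho (A + 4)).
have r1 : B <= rho' by rewrite le_max lexx.
have r2 : rho <= rho' by rewrite !le_max lexx orbT.
have r3 : A + 4 <= rho' by rewrite !le_max lexx !orbT.
have r4 : A + 3 <= rho' by apply: le_trans r3; rewrite lerD2l (ler_nat R 3 4).
pose L := 3 * ((lam2 + CV) ^+ 2 + 1).
have L0 : 0 <= L by rewrite mulr_ge0// addr_ge0 ?sqr_ge0.
have [C0 C00 hC0] := hKK L (1 / 4) L0 (divr_gt0 ltr01 (ltr0n R 4)).
have [cc cc0 hext] := ext_est.
have hrho2 : A + 2 <= rho by apply: le_trans hrho; rewrite lerD2l (ler_nat R 2 3).
have [C1 C10 hC1] := hext rho rho' hrho2 r4.
(* [expR x >= 1 + x] at [x = Q + 1] makes the product at most 1/2. This is legitimate since [C0] and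
   [C1] were fixed before [tau]. *)
have [tau tau0 htau] : exists2 tau : R, 0 < tau & (1 + 4 * C0) * (C1 * expR (- (cc * tau))) <= 1 / 2.
  pose Q := 2 * ((1 + 4 * C0) * C1).
  have Q0 : 0 <= Q by rewrite mulr_ge0// mulr_ge0// addr_ge0 ?mulr_ge0.
  exists ((Q + 1) / cc); first by rewrite divr_gt0// ltr_wpDl.
  rewrite mulrC [cc * _]mulrC divfK ?gt_eqF//.
  have := expR_ge1Dx (Q + 1); rewrite expRN => hQ.
  have eQ : 0 < expR (Q + 1) by exact: expR_gt0.
  rewrite (_ : _ * (1 + 4 * C0) = (Q / 2) / expR (Q + 1)); last by rewrite /Q; field; rewrite gt_eqF.
  rewrite ler_pdivrMr//; move: hQ Q0; lra.
have [C2 C20 hC2] := hC1 tau tau0.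
exists (4 * (12 * C0 + (1 + 4 * C0) * C2)).
  by rewrite mulr_ge0// addr_ge0 ?mulr_ge0 ?addr_ge0 ?mulr_ge0.
move=> lam eps v1 v2 f1 f2 g1 g2 h1 h2 e0 e1 hs hf.
have l0 : 0 < lam by exact: lt_le_trans h1.
have hsl := hsol_sol hV l0 h2 e0 e1 hs.
have bF : bcs (e2 f1 f2) by apply: bcs_e2_meas; [exact: hsol_f1 hs|exact: hsol_f2 hs].
have bG : bcs (e2 g1 g2) by apply: bcs_e2_meas; [exact: hsol_g1 hs|exact: hsol_g2 hs].
have bE : bcs (e2 v1 v2) by apply: bcs_e2; [exact: hsol_sm1 hs|exact: hsol_sm2 hs|exact: hsol_cs1 hs|exact: hsol_cs2 hs].
have E0 := e2_ge0 v1 v2.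
have IF0 : 0 <= II (e2 f1 f2) by apply: II_ge0 => x; exact: e2_ge0.
have IG0 : 0 <= II (e2 g1 g2) by apply: II_ge0 => x; exact: e2_ge0.
have IH0 : 0 <= II (fun x => e2 v1 v2 x + (Gam v1 v1 x + Gam v2 v2 x)).
  by apply: II_ge0 => x; rewrite addr_ge0 ?e2_ge0// addr_ge0 ?Gam_ge0.
have Gie : II (e2 g1 g2) <= eps^-1 * II (e2 g1 g2) by rewrite ler_peMl// invf_ge1.
have c1 := hC0 _ _ _ hsl; have c2 := hC2 _ _ _ _ _ _ _ _ h1 h2 e0 e1 hs hf.
rewrite (IIZ hmu _ (bcsD bF bG)) (IID hmu bF bG) in c1.
have mZ : measurable ([set x | A + 3 <= w x <= rho'] : set (borel M)).
  rewrite (_ : [set x | _] = [set x | A + 3 <= w x] `&` [set x | w x <= rho']).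
    apply: measurableI; last by apply: compact_borel; exact: hK.
    apply: closed_borel; rewrite (_ : [set y | _] = w @^-1` [set t | A + 3 <= t])//.
    by apply: closed_comp => [y _|]; [exact: cw|exact: closed_ge].
  by apply/seteqP; split => x /= => [/andP[]|[-> ->]].
have mK r : measurable ([set x | w x <= r] : set (borel M)) by apply: compact_borel; exact: hK.
have j1 : JJ K' (e2 v1 v2) <= JJ [set x | w x <= rho] (e2 v1 v2) + JJ [set x | A + 3 <= w x <= rho'] (e2 v1 v2).
  apply: le_trans (JJU hmu (mK rho) mZ bE E0); apply: JJ_mono => //; first exact: compact_borel.
    exact: measurableU.
  move=> x /hB hx; have wx : w x <= rho' by apply: le_trans (ler_norm _) (le_trans hx r1).
  by have [h|h] := leP (w x) rho; [left|right; rewrite /= wx andbT (le_trans hrho)// ltW].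
have j2 : JJ A0 (e2 v1 v2) <= JJ [set x | A + 3 <= w x <= rho'] (e2 v1 v2).
  apply: JJ_mono => //; first exact: open_borel.
  by move=> x /= /andP[/ltW -> /ltW h /=]; exact: le_trans r3.
have j3 : JJ [set x | w x <= A + 3] (e2 v1 v2) <= JJ [set x | w x <= rho] (e2 v1 v2).
  by apply: JJ_mono => // x /= h; exact: le_trans hrho.
have q0 : 0 <= C1 * expR (- (cc * tau)) by rewrite mulr_ge0 ?expR_ge0.
have ie0 : 0 <= eps^-1 * II (e2 g1 g2) by rewrite mulr_ge0 ?invr_ge0 ?(ltW e0).
apply: (absorb_main C00 IF0 (mulr_ge0 (ltW e0) IH0) ie0 C20 q0 _ _ htau erefl (b := JJ [set x | A + 3 <= w x <= rho'] (e2 v1 v2))).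
  apply: le_trans c1 _; apply: lerD; first by apply: ler_wpM2l.
  apply: ler_wpM2l => //; apply: lerD => //; rewrite ler_pM2l// lerD2l//.
apply: le_trans c2 _; rewrite lerD2r; exact: ler_wpM2l.
Qed.

(** The coupling [eps] is introduced artificially: [(H - lam) v = G] is the same as
    [(H - lam - i eps) v = G - i eps v], whose right-hand side counts as global error. The gradient
    mass is removed by [energy]. *)
Lemma quasimode_estimate (rho : R) : exists2 C : R, 0 <= C &
  forall (lam eps : R) v1 v2 G1 G2, lam1 <= lam -> lam <= lam2 -> 0 < eps -> eps <= 1 ->
  hsol V lam 0 v1 v2 (fun=> 0) (fun=> 0) G1 G2 ->
  JJ [set x | w x <= rho] (e2 v1 v2) <= C * (eps * II (e2 v1 v2) + eps^-1 * II (e2 G1 G2)).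
Proof.
pose rh := Num.max rho (A + 3).
have rh1 : rho <= rh by rewrite le_max lexx.
have [|C C0 hC] := @local_energy_bound rh; first by rewrite le_max lexx orbT.
pose D := `|lam2| + `|CV| + 6; have D6 : 6 <= D by rewrite lerDr addr_ge0.
have D0 : 0 <= D by apply: le_trans D6.
exists (C * D); first exact: mulr_ge0.
move=> lam eps v1 v2 G1 G2 h1 h2 e0 e1 hs0.
have bG1 := hsol_g1 hs0; have bG2 := hsol_g2 hs0; have b00 := hsol_f1 hs0.
have bv1 := bcs_sm (hsol_sm1 hs0) (hsol_cs1 hs0); have bv2 := bcs_sm (hsol_sm2 hs0) (hsol_cs2 hs0).
pose g1 x := eps * v2 x + G1 x; pose g2 x := - eps * v1 x + G2 x.
have bg1 : bcs g1 by apply: bcsD => //; exact: bcsZ.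
have bg2 : bcs g2 by apply: bcsD => //; exact: bcsZ.
have hs : hsol V lam eps v1 v2 (fun=> 0) (fun=> 0) g1 g2.
  case: hs0 => s1 s2 c1 c2 _ _ _ _ q1 q2.
  by apply: (Hsol s1 s2 c1 c2 b00 b00 bg1 bg2) => x; [rewrite q1|rewrite q2]; rewrite /g1 /g2; ring.
have loc := hC _ _ _ _ _ _ _ _ h1 h2 e0 e1 hs (fun x _ => conj erefl erefl).
have en := energy hV h2 hs.
have bE : bcs (e2 v1 v2) by exact: bcs_e2_meas.
have bG : bcs (e2 G1 G2) by exact: bcs_e2_meas.
have mK r : measurable ([set x | w x <= r] : set (borel M)) by apply: compact_borel; exact: hK.
have mono : JJ [set x | w x <= rho] (e2 v1 v2) <= JJ [set x | w x <= rh] (e2 v1 v2).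
  apply: JJ_mono => //; first by move=> x; exact: e2_ge0.
  by move=> x /= h; exact: le_trans rh1.
apply: le_trans mono _; apply: le_trans loc _; rewrite -mulrA; apply: ler_wpM2l => //.
have z0 : II (e2 (fun _ : M => 0) (fun=> 0)) = 0.
  rewrite (_ : e2 _ _ = fun x => 0 * e2 v1 v2 x) ?(IIZ hmu _ bE) ?mul0r//.
  by apply/funext => x; rewrite /e2 !mul0r addr0.
have gG : II (e2 g1 g2) <= 2 * eps ^+ 2 * II (e2 v1 v2) + 2 * II (e2 G1 G2).
  rewrite -(IIZ hmu _ bE) -(IIZ hmu _ bG) -(IID hmu (bcsZ _ bE) (bcsZ _ bG)).
  apply: II_le => //; [exact: bcs_e2_meas|by apply: bcsD; exact: bcsZ|move=> x].
  rewrite -subr_ge0 /e2 /g1 /g2; set T := (X in 0 <= X).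
  rewrite (_ : T = (eps * v2 x - G1 x) ^+ 2 + (- eps * v1 x - G2 x) ^+ 2); last by rewrite /T; ring.
  by rewrite addr_ge0 ?sqr_ge0.
have IG0 : 0 <= II (e2 G1 G2) by apply: II_ge0 => x; exact: e2_ge0.
have IE0 : 0 <= II (e2 v1 v2) by apply: II_ge0 => x; exact: e2_ge0.
rewrite z0 add0r; rewrite z0 add0r in en.
apply: (quasimode_arith e0 e1 IE0 IG0 en gG).
  by rewrite /D; have := ler_norm lam2; have := ler_norm CV; lra.
by apply: le_trans D6; rewrite ler_nat.
Qed.

End Main.

(** * The estimate on an asymptotically conic manifold *)

Section ConicEstimate.
Context {R : realType} {m : nat} {sigma : R} (s0 : 0 < sigma) (M : riemannian_manifold R m.+1)
  (X : asymptotically_conic sigma M) (w : M -> R) (hw : is_weight X w)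
  (mu : {measure set (borel M) -> \bar R}) (hmu : riemannian_measure mu).
Notation R0 := (conic_radius X).
Notation II := (II mu).

Lemma w_core x : conic_core X x -> R0 / 2 <= w x <= R0.
Proof. by have [_ _ h] := hw; exact: h. Qed.

Lemma w_end x : ~ conic_core X x -> R0 < w x.
Proof.
by move=> nx; have [_ h _] := hw; rewrite h//; have [] := conic_polarP nx.
Qed.

Lemma w_lower x : 1 / 2 <= w x.
Proof.
have h := conic_radius_gt1 X; have [cx|nx] := pselect (conic_core X x).
  by have /andP[h1 _] := w_core cx; apply: le_trans h1; rewrite ler_pM2r// ltW.
by have h1 := w_end nx; apply: ltW; apply: lt_trans h1; move: h; lra.
Qed.

Lemma w_gt0 x : 0 < w x.
Proof. by apply: lt_le_trans (w_lower x); rewrite divr_gt0. Qed.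

Lemma w_notcore x : R0 < w x -> ~ conic_core X x.
Proof. by move=> h /w_core/andP[_]; rewrite leNgt h. Qed.

Lemma w_compact (rho : R) : compact [set x | w x <= rho].
Proof.
apply: (@subclosed_compact _ _ _ _ (@conic_proper _ _ _ _ X rho)).
  rewrite (_ : [set x | _] = w @^-1` [set t | t <= rho])//.
  by apply: closed_comp => [y _|]; [exact: (sm_cont (sm_w hw))|exact: closed_le].
move=> x /= wx; have [cx|nx] := pselect (conic_core X x); first by left.
right; exists (conic_polar X x); last by have [_] := conic_polarP nx.
have [h1 _] := conic_polarP nx; split => //.
by have [_ h _] := hw; rewrite -h.
Qed.

Lemma w_onto (r : R) : R0 < r -> exists x, w x = r.
Proof.
move=> hr; have h := @conic_mapP _ _ _ _ X (r, point) hr.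
exists (@conic_map _ _ _ _ X (r, point)); have [_ e _] := hw.
by rewrite e; [rewrite h.2|exact: h.1].
Qed.

Lemma conic_estimate (V : M -> R) (CV lam1 lam2 rho : R) : 0 <= CV ->
  (forall x, `|V x| <= CV * w x `^ (- 1 - 2 * sigma)) -> 0 < lam1 ->
  exists2 C : R, 0 <= C &
  forall (lam eps : R) v1 v2 G1 G2, lam1 <= lam -> lam <= lam2 -> 0 < eps -> eps <= 1 ->
  hsol V lam 0 v1 v2 (fun=> 0) (fun=> 0) G1 G2 ->
  JJ mu [set x | w x <= rho] (e2 v1 v2) <= C * (eps * II (e2 v1 v2) + eps^-1 * II (e2 G1 G2)).
Proof.
move=> CV0 hV l10.
have [R1 [Cg [hR1 Cg0 geo]]] := end_geometry s0 hw hmu.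
(* So large that the loss [r^kap] in [wP_lower] stays strictly within the decay [r^(-2 sigma)]; the
   remaining exponent is [d]. *)
have [k k0 hk] : exists2 k : nat, (0 < k)%N & (4 * k)%:R^-1 < 2 * sigma.
  have q0 : 0 < (8 * sigma)^-1 by rewrite invr_gt0 mulr_gt0.
  have hb := archi_boundP (ltW q0); set k := Num.bound _ in hb.
  have k0 : 0 < k%:R :> R by exact: lt_trans hb.
  exists k; first by rewrite -(ltr0n R).
  rewrite natrM invfM -ltr_pdivlMl ?invr_gt0// invrK mulrA.
  rewrite -[ltLHS]mul1r ltr_pdivrMr//.
  by move: hb; rewrite -div1r ltr_pdivrMr ?mulr_gt0// mulrC; lra.
pose kap : R := (4 * k)%:R^-1; pose d := 2 * sigma - kap.
have d0 : 0 < d by rewrite subr_gt0.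
have m1 : 0 < 1 + m%:R :> R by rewrite ltr_pwDl.
(* Serves both smallness conditions of the exterior estimate, the second one relative to the lower
   end of the energy window. *)
pose delta := Num.min (1 / 8) (lam1 / 8) / (1 + m%:R).
have dl0 : 0 < delta by rewrite divr_gt0// lt_min !divr_gt0.
have dlm : delta * (1 + m%:R) = Num.min (1 / 8) (lam1 / 8) by rewrite divfK// gt_eqF.
have dl1 : delta * (1 + m%:R) <= 1 / 8 by rewrite dlm ge_min lexx.
have dl2 : delta * (1 + m%:R) <= lam1 / 8 by rewrite dlm ge_min lexx orbT.
have [R2 R21 hR2] := powR_decay d0 (mulr_ge0 (ler0n R 2) (addr_ge0 Cg0 CV0)) dl0.
have [Q eQ] : exists Q : R, Q = m%:R ^+ 2 + 10 * m%:R + 10 by exists (m%:R ^+ 2 + 10 * m%:R + 10).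
have Q0 : 0 <= Q by rewrite eQ !addr_ge0 ?sqr_ge0 ?mulr_ge0.
(* One summand per requirement: the geometry of the end, errors below [delta], and the two largeness
   conditions coming from [Bpot_alg]. *)
pose A := R1 + R2 + 256 * Q ^+ 2 / lam1 + 64 * Q / lam1.
have t1 : 0 <= 256 * Q ^+ 2 / lam1 by apply: divr_ge0; [exact: mulr_ge0 (ler0n _ _) (sqr_ge0 _)|exact: ltW].
have t2 : 0 <= 64 * Q / lam1 by apply: divr_ge0; [exact: mulr_ge0 (ler0n _ _) Q0|exact: ltW].
have R10 : 1 < R1 by apply: lt_trans hR1; exact: conic_radius_gt1.
have [A1 [AR1 AR2]] : 1 <= A /\ R1 <= A /\ R2 <= A by rewrite /A; split; [|split]; lra.
have bigA : 256 * Q ^+ 2 <= lam1 * A.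
  rewrite [lam1 * A]mulrC -ler_pdivrMr// /A; move: t1 t2 R10 R21.
  by move: (256 * Q ^+ 2 / lam1) (64 * Q / lam1) => *; lra.
have bigA' : 64 * Q <= lam1 * A.
  rewrite [lam1 * A]mulrC -ler_pdivrMr// /A; move: t1 t2 R10 R21.
  by move: (256 * Q ^+ 2 / lam1) (64 * Q / lam1) => *; lra.
rewrite eQ in bigA bigA'; clearbody A.
have far x : A < w x -> R1 < w x /\ ~ conic_core X x.
  move=> h; have h1 : R1 < w x by exact: le_lt_trans h.
  by split => //; apply: w_notcore; exact: lt_trans h1.
have wr x : w x * w x `^ (- 1 - 2 * sigma) = w x `^ (- (2 * sigma)).
  have e : w x * w x `^ (- 1 - 2 * sigma) = w x `^ 1 * w x `^ (- 1 - 2 * sigma) by rewrite powRr1 ?(ltW (w_gt0 x)).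
  rewrite e -powRD; last by rewrite (gt_eqF (w_gt0 x)) implybT.
  by congr (_ `^ _); ring.
have small x C : A < w x -> 0 <= C -> C <= Cg + CV -> C * w x `^ (- (2 * sigma)) <= delta * (2 * wS k (w x))^-1.
  move=> h C0 hC; have s0' := wS_gt0 k (w_gt0 x).
  rewrite ler_pdivlMr ?mulr_gt0//.
  have hw2 : R2 <= w x by apply: ltW; exact: le_lt_trans h.
  apply: le_trans (hR2 _ hw2).
  rewrite (_ : - d = - (2 * sigma) + kap); last by rewrite /d; ring.
  rewrite powRD; last by rewrite (gt_eqF (w_gt0 x)) implybT.
  rewrite -/(wS k (w x)) (_ : _ * (2 * _) = 2 * C * (w x `^ (- (2 * sigma)) * wS k (w x))); last by ring.
  by apply: ler_wpM2r; [rewrite mulr_ge0 ?powR_ge0|rewrite ler_pM2l].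
have w0 := w_gt0; have sw := sm_w hw.
have geoG x : A < w x -> Gam w w x = 1 by move=> /far[h1 h2]; have [] := geo x h2 h1.
have geoH x u : A < w x -> sm u -> 7 / 8 * (w x)^-1 * (Gam u u x - Gam w u x ^+ 2) <= Hs w u x.
  move=> Ax su; have [h1 h2] := far x Ax; have [g1 g2 _] := geo x h2 h1.
  have G0 : 0 <= Gam u u x - Gam w u x ^+ 2.
    by rewrite subr_ge0; apply: le_trans (Gam_cs w u x) _; rewrite g1 mul1r.
  have := g2 u su; rewrite ler_norml => /andP[h3 _].
  have wi : 0 < (w x)^-1 by rewrite invr_gt0.
  have h4 : Cg * w x `^ (- 1 - 2 * sigma) <= 1 / 8 * (w x)^-1.
    rewrite ler_pdivlMr// -mulrA [_ * w x]mulrC wr.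
    have CV' : Cg <= Cg + CV by rewrite lerDl.
    apply: le_trans (small x Cg Ax Cg0 CV') _.
    have hd : delta <= 1 / 8 by apply: le_trans dl1; rewrite ler_peMr ?(ltW dl0)// lerDl.
    apply: le_trans hd; apply: ler_piMr; first exact: ltW.
    have s1 : 1 <= wS k (w x) by apply: wS_ge1 => //; exact: le_trans A1 (ltW Ax).
    by rewrite invf_le1; lra.
  have h5 := ler_wpM2r G0 h4.
  move: h3 h5; move: (Cg * _) (Hs w u x) (_ - Gam w u x ^+ 2) (w x)^-1 => p H G i h3 h5; lra.
have geoL x : A < w x -> `|w x * (Lap w x - m%:R / w x)| <= delta * (2 * wS k (w x))^-1.
  move=> Ax; have [h1 h2] := far x Ax; have [_ _ g3] := geo x h2 h1.
  have CV' : Cg <= Cg + CV by rewrite lerDl.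
  apply: le_trans (small x Cg Ax Cg0 CV'); rewrite normrM gtr0_norm// -wr mulrCA.
  by apply: ler_wpM2l => //; exact: ltW.
have geoV x : A < w x -> `|w x * V x| <= delta * (2 * wS k (w x))^-1.
  move=> Ax; have CV' : CV <= Cg + CV by rewrite lerDr.
  apply: le_trans (small x CV Ax CV0 CV'); rewrite normrM gtr0_norm// -wr mulrCA.
  by apply: ler_wpM2l => //; exact: ltW.
have hVb x : `|V x| <= CV * (1 / 2) `^ (- 1 - 2 * sigma).
  apply: le_trans (hV x) _; apply: ler_wpM2l => //.
  have h12 : 0 < 1 / 2 :> R by rewrite divr_gt0.
  rewrite -opprD !powRN lef_pV2; [|exact: powR_gt0|exact: powR_gt0].
  apply: ge0_ler_powR; rewrite ?nnegrE ?(ltW (w0 x))//; last exact: w_lower.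
  by rewrite addr_ge0// mulr_ge0// ltW.
have ext := ext_carleman hmu sw w0 k0 A1 l10 (ltW dl0) dl1 dl2 geoG geoH geoL geoV bigA bigA' lam2 w_compact hVb.
apply: (quasimode_estimate hmu (sm_cont sw) w_compact hVb l10 (conic_connected X) _ ext).
have [x wx] : exists x, w x = A + 3 + 1 / 2.
  by apply: w_onto; apply: lt_trans hR1 _; apply: le_lt_trans AR1 _; lra.
by exists x; rewrite wx; split; lra.
Qed.

End ConicEstimate.

(** * Spectral measures of self-adjoint operators *)

Section RealInner.
Context {d : measure_display} {T : measurableType d} {R : realType}.
Variable mu : {measure set T -> \bar R}.
Local Notation Re := (@complex.Re R).
Local Notation Im := (@complex.Im R).
Implicit Types (u v w x y : T -> R[i]) (c : R).
Notation L2 := (L2 mu).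

(** The real part of the pointwise hermitian product. The spectral quantities below are real, so the
    complex inner product is used through its real part. *)
Definition prd u v t : R := Re (u t) * Re (v t) + Im (u t) * Im (v t).
Definition rip u v : R := \int[mu]_t prd u v t.
Definition N2 u : R := rip u u.

Lemma N2_rip u : N2 u = rip u u.
Proof. by []. Qed.

Lemma Re_inner u v : Re (inner mu u v) = rip u v.
Proof.
rewrite /inner /rip /=; apply: eq_Rintegral => t _; rewrite /prd.
by case: (u t) => a b; case: (v t) => p q /=; rewrite mulrN opprK.
Qed.

Lemma prd_meas u v : L2 u -> L2 v -> measurable_fun setT (prd u v).
Proof.
by move=> [m1 m2 _] [m3 m4 _]; apply: measurable_funD; exact: measurable_funM.
Qed.

Lemma N2_integrable u : L2 u -> mu.-integrable setT (EFin \o prd u u).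
Proof.
move=> hu; have [_ _ h] := hu; apply/integrableP; split.
  by apply/measurable_EFinP; exact: prd_meas.
apply: le_lt_trans h; rewrite /norm2; apply: le_of_eq.
apply: eq_integral => t _ /=; congr EFin; rewrite ger0_norm /prd -!expr2//.
by rewrite addr_ge0 ?sqr_ge0.
Qed.

Lemma prd_integrable u v : L2 u -> L2 v -> mu.-integrable setT (EFin \o prd u v).
Proof.
move=> hu hv; apply: (le_integrable measurableT _ _ (integrableD measurableT (N2_integrable hu) (N2_integrable hv))).
  by apply/measurable_EFinP; exact: prd_meas.
move=> t _ /=; rewrite lee_fin [leRHS]ger0_norm; last by rewrite /prd -!expr2 !addr_ge0 ?sqr_ge0.
rewrite ler_norml /prd; move: (Re (u t)) (Im (u t)) (Re (v t)) (Im (v t)) => a b p q.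
have h1 := sqr_ge0 (a - p); have h2 := sqr_ge0 (a + p); have h3 := sqr_ge0 (b - q); have h4 := sqr_ge0 (b + q).
by rewrite !sqrrB !sqrrD in h1 h2 h3 h4; apply/andP; split; move: h1 h2 h3 h4 (sqr_ge0 a) (sqr_ge0 b) (sqr_ge0 p) (sqr_ge0 q); rewrite -!expr2; move: (a * p) (b * q) (a ^+ 2) (b ^+ 2) (p ^+ 2) (q ^+ 2) => *; lra.
Qed.

Lemma N2E u : L2 u -> norm2 mu u = (N2 u)%:E.
Proof.
move=> hu; rewrite /N2 /rip /Rintegral fineK; last exact: integrable_fin_num (N2_integrable hu).
by apply: eq_integral => t _; rewrite /prd -!expr2.
Qed.

Lemma N2_ge0 u : 0 <= N2 u.
Proof. by apply: Rintegral_ge0 => t _; rewrite /prd -!expr2 addr_ge0 ?sqr_ge0. Qed.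

Lemma ripC u v : rip u v = rip v u.
Proof. by apply: eq_Rintegral => t _; rewrite /prd mulrC [Im _ * _]mulrC. Qed.

Lemma L2_int u : measurable_fun setT (Re \o u) -> measurable_fun setT (Im \o u) ->
  mu.-integrable setT (EFin \o prd u u) -> L2 u.
Proof.
move=> m1 m2 /integrableP[_ h]; split => //; apply: le_lt_trans h.
rewrite /norm2; apply: le_of_eq; apply: eq_integral => t _ /=; congr EFin.
by rewrite ger0_norm /prd -!expr2// addr_ge0 ?sqr_ge0.
Qed.

Lemma L2Z c u : L2 u -> L2 (fun t => c%:C%C * u t).
Proof.
move=> hu; have [m1 m2 _] := hu.
have e1 : Re \o (fun t => c%:C%C * u t) = (fun t => c * Re (u t)).
  by apply/funext => t /=; case: (u t) => a b /=; rewrite mul0r subr0.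
have e2 : Im \o (fun t => c%:C%C * u t) = (fun t => c * Im (u t)).
  by apply/funext => t /=; case: (u t) => a b /=; rewrite mul0r addr0.
apply: L2_int; [by rewrite e1; exact: measurable_funM|by rewrite e2; exact: measurable_funM|].
rewrite (_ : _ \o _ = (fun t => (c ^+ 2)%:E * (EFin \o prd u u) t)%E).
  by apply: integrableZl => //; exact: N2_integrable.
apply/funext => t /=; rewrite -EFinM; congr EFin; rewrite /prd.
by case: (u t) => a b /=; ring.
Qed.

Lemma L2D u v : L2 u -> L2 v -> L2 (fun t => u t + v t).
Proof.
move=> hu hv; have [m1 m2 _] := hu; have [m3 m4 _] := hv.
have e1 : Re \o (fun t => u t + v t) = (fun t => Re (u t) + Re (v t)).
  by apply/funext => t /=; case: (u t) => a b; case: (v t).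
have e2 : Im \o (fun t => u t + v t) = (fun t => Im (u t) + Im (v t)).
  by apply/funext => t /=; case: (u t) => a b; case: (v t).
have ma : measurable_fun setT (Re \o (fun t => u t + v t)) by rewrite e1; exact: measurable_funD.
have mb : measurable_fun setT (Im \o (fun t => u t + v t)) by rewrite e2; exact: measurable_funD.
apply: L2_int => //.
have h := integrableD measurableT (integrableD measurableT (N2_integrable hu) (N2_integrable hv))
  (integrableZl measurableT 2 (prd_integrable hu hv)).
apply: eq_integrable h => // t _ /=.
by rewrite -EFinM -!EFinD; congr EFin; rewrite /prd; case: (u t) => a b; case: (v t) => p q /=; ring.
Qed.

Lemma ripD u v w : L2 u -> L2 v -> L2 w -> rip (fun t => u t + v t) w = rip u w + rip v w.
Proof.
move=> hu hv hw; rewrite /rip -RintegralD//; try exact: prd_integrable.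
by apply: eq_Rintegral => t _; rewrite /prd; case: (u t) => a b; case: (v t) => p q /=; ring.
Qed.

Lemma ripZ c u w : L2 u -> L2 w -> rip (fun t => c%:C%C * u t) w = c * rip u w.
Proof.
move=> hu hw; rewrite /rip -RintegralZl//; last exact: prd_integrable.
by apply: eq_Rintegral => t _; rewrite /prd; case: (u t) => a b /=; ring.
Qed.

Lemma rip_ae u u' v : L2 u -> L2 u' -> L2 v -> {ae mu, forall t, u t = u' t} -> rip u v = rip u' v.
Proof.
move=> hu hu' hv h; rewrite /rip /Rintegral; congr fine; apply: ae_eq_integral => //.
- by apply/measurable_EFinP; exact: prd_meas.
- by apply/measurable_EFinP; exact: prd_meas.
by apply: filterS h => t e _ /=; rewrite /prd e.
Qed.

Definition lin a u b v t : R[i] := a%:C%C * u t + b%:C%C * v t.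

Lemma L2_lin a u b v : L2 u -> L2 v -> L2 (lin a u b v).
Proof. by move=> hu hv; apply: L2D; exact: L2Z. Qed.

Lemma rip_lin a u b v w : L2 u -> L2 v -> L2 w -> rip (lin a u b v) w = a * rip u w + b * rip v w.
Proof. by move=> hu hv hw; rewrite ripD ?ripZ//; exact: L2Z. Qed.

Lemma N2_lin a u b v : L2 u -> L2 v -> N2 (lin a u b v) = a ^+ 2 * N2 u + 2 * (a * b) * rip u v + b ^+ 2 * N2 v.
Proof.
move=> hu hv; have hl := L2_lin a b hu hv; rewrite /N2 rip_lin// ![rip _ (lin _ _ _ _)]ripC !rip_lin//.
by rewrite [rip v u]ripC; ring.
Qed.

Lemma N2_lin_le a u b v : L2 u -> L2 v -> N2 (lin a u b v) <= 2 * a ^+ 2 * N2 u + 2 * b ^+ 2 * N2 v.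
Proof.
move=> hu hv; have := N2_ge0 (lin a u (- b) v); rewrite !N2_lin//.
by move: (N2 u) (N2 v) (rip u v) => p q r; nra.
Qed.

Lemma rip_young s u v : 0 < s -> L2 u -> L2 v -> 2 * rip u v <= s * N2 u + s^-1 * N2 v.
Proof.
move=> s0 hu hv; have := mulr_ge0 (ltW s0) (N2_ge0 (lin 1 u (- s^-1) v)); rewrite N2_lin// => h.
rewrite -subr_ge0; apply: le_trans h _; apply: le_of_eq.
by field; rewrite gt_eqF.
Qed.

Definition cut (K : set T) u t : R[i] := (\1_K t)%:C%C * u t.

Lemma L2_cut K u : measurable K -> L2 u -> L2 (cut K u).
Proof.
move=> mK hu; have [m1 m2 _] := hu.
have e1 : Re \o cut K u = (fun t => \1_K t * Re (u t)).
  by apply/funext => t /=; rewrite /cut; case: (u t) => a b /=; rewrite mul0r subr0.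
have e2 : Im \o cut K u = (fun t => \1_K t * Im (u t)).
  by apply/funext => t /=; rewrite /cut; case: (u t) => a b /=; rewrite mul0r addr0.
have mc : measurable_fun setT (\1_K : T -> R) by exact: measurable_indic.
have ma : measurable_fun setT (Re \o cut K u) by rewrite e1; exact: measurable_funM.
have mb : measurable_fun setT (Im \o cut K u) by rewrite e2; exact: measurable_funM.
apply: L2_int => //; apply: (le_integrable measurableT _ _ (N2_integrable hu)).
  apply/measurable_EFinP; apply: measurable_funD; exact: measurable_funM.
move=> t _ /=; rewrite lee_fin !ger0_norm /prd -!expr2 ?addr_ge0 ?sqr_ge0//.
rewrite /cut; case: (u t) => a b /=; rewrite !mul0r subr0 addr0 !exprMn -mulrDr ler_piMl ?addr_ge0 ?sqr_ge0//.
Qed.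

Lemma N2_cut_le K u : measurable K -> L2 u -> N2 (cut K u) <= N2 u.
Proof.
move=> mK hu; apply: le_Rintegral => //; [exact: N2_integrable (L2_cut mK hu)|exact: N2_integrable|].
move=> t _; rewrite /prd /cut; case: (u t) => a b /=; rewrite !mul0r subr0 addr0 indicE.
by case: (_ \in _); rewrite ?mul1r// ?mul0r ?addr0// -!expr2 addr_ge0 ?sqr_ge0.
Qed.

Lemma rip_cut K u v : rip (cut K u) v = rip u (cut K v).
Proof.
apply: eq_Rintegral => t _; rewrite /prd /cut; case: (u t) => a b; case: (v t) => p q /=; ring.
Qed.

End RealInner.

Lemma adde_eq0_fin {R : realType} (p q s : \bar R) (a b : R) : (s = p + q -> s = a%:E -> p = a%:E -> q = b%:E -> q = 0)%E.
Proof. by move=> -> h1 h2 h3; move: h1; rewrite h2 h3 -EFinD => -[/eqP]; rewrite -subr_eq0 addrC addKr => /eqP ->. Qed.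

Definition sym_itv {R : realType} (n : R) : set R := [set l | `|l| <= n].

Lemma measurable_sym_itv {R : realType} (n : R) : measurable (sym_itv n : set (measurableTypeR R)).
Proof.
rewrite (_ : sym_itv n = `[- n, n]%classic); first exact: measurable_itv.
by apply/seteqP; split=> l /=; rewrite /sym_itv/= in_itv/= ler_norml.
Qed.

(** * Spectral localization and the bound on [(S - t) E(J) f] *)

Section Spectral.
Context {d : measure_display} {T : measurableType d} {R : realType}.
Variable mu : {measure set T -> \bar R}.
Local Notation Re := (@complex.Re R).
Local Notation Im := (@complex.Im R).
Implicit Types (u v w x y : T -> R[i]) (c : R).
Local Notation L2 := (L2 mu). Local Notation rip := (rip mu). Local Notation N2 := (N2 mu).
Local Notation mR := (measurableTypeR R).

Variables (S : @operator d T R) (E : set R -> (T -> R[i]) -> T -> R[i])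
  (nu : (T -> R[i]) -> {measure set mR -> \bar R}).
Hypotheses (sa : self_adjoint mu S) (sr : spectral_resolution mu S E nu).

Lemma S_L2 u w : S u w -> L2 u /\ L2 w.
Proof. by move=> /sa[]. Qed.

Lemma S_sym u w v z : S u w -> S v z -> rip w v = rip u z.
Proof.
move=> h1 /sa[_ _ h2]; have := congr1 (@complex.Re R) (h2 _ _ h1).
by rewrite !Re_inner.
Qed.

Lemma EL2 (A : set mR) u : measurable A -> L2 u -> L2 (E A u).
Proof. by move=> mA; exact: (proj_L2 (spec_proj sr mA)). Qed.

Lemma E_sym (A : set mR) u v : measurable A -> L2 u -> L2 v -> rip (E A u) v = rip u (E A v).
Proof.
by move=> mA hu hv; rewrite -!Re_inner (proj_sym (spec_proj sr mA) hu hv).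
Qed.

Lemma E_idem (A : set mR) u v : measurable A -> L2 u -> L2 v -> rip (E A (E A u)) v = rip (E A u) v.
Proof.
move=> mA hu hv; have h := EL2 mA hu.
by apply: rip_ae (proj_idem (spec_proj sr mA) hu) => //; exact: EL2.
Qed.

Lemma E_N2 (A : set mR) u : measurable A -> L2 u -> rip (E A u) u = N2 (E A u).
Proof. by move=> mA hu; have h := EL2 mA hu; rewrite N2_rip -E_sym// E_idem. Qed.

Lemma nuE u (A : set mR) : L2 u -> measurable A -> nu u A = (N2 (E A u))%:E.
Proof. by move=> hu mA; rewrite (spec_measure sr hu mA) Re_inner E_N2. Qed.

Lemma nuT u : L2 u -> nu u setT = (N2 u)%:E.
Proof.
move=> hu; rewrite (spec_measure sr hu measurableT) Re_inner; congr EFin.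
by apply: rip_ae (spec_total sr hu) => //; exact: EL2.
Qed.

Lemma E_lin (A : set mR) c u v x : measurable A -> L2 u -> L2 v -> L2 x ->
  rip (E A (lin c u 1 v)) x = c * rip (E A u) x + rip (E A v) x.
Proof.
move=> mA hu hv hx; have h := proj_linear (spec_proj sr mA) c%:C%C hu hv.
have -> : lin c u 1 v = (fun t => c%:C%C * u t + v t) by apply/funext => t; rewrite /lin mul1r.
have l1 : L2 (E A u) by exact: EL2.
have l2 : L2 (E A v) by exact: EL2.
rewrite (rip_ae _ _ hx h); first by rewrite ripD ?ripZ//; exact: L2Z.
  by apply: EL2 => //; apply: L2D => //; exact: L2Z.
by apply: L2D => //; exact: L2Z.
Qed.

(** The linear function [c |-> 2 c <u, v>] is bounded above by [N2 u], hence it is 0. *)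
Lemma rip0 u v : L2 u -> L2 v -> N2 v = 0 -> rip u v = 0.
Proof.
move=> hu hv v0; have key (c : R) : 2 * (c * rip u v) <= N2 u.
  have h := rip_young ltr01 hu (L2Z c hv).
  rewrite ripC ripZ// ripC in h; apply: le_trans h _.
  have -> : N2 (fun t => c%:C%C * v t) = 0.
    by rewrite N2_rip ripZ// 1?ripC ?ripZ ?v0//; [rewrite -N2_rip v0 !mulr0|exact: L2Z].
  by rewrite mulr0 addr0 mul1r.
have n0 := N2_ge0 mu u; apply/eqP; case: (ltrgt0P (rip u v)) => // hr.
  have := key ((N2 u + 1) / rip u v); rewrite divfK ?gt_eqF//; lra.
have := key ((N2 u + 1) / rip u v); rewrite divfK ?lt_eqF//; lra.
Qed.

(** [nu y A = 0] means that [E A y] has norm 0, and symmetry of the projection then removes the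
    cross terms. *)
Lemma nu_lin (A : set mR) c x y : measurable A -> L2 x -> L2 y -> nu y A = 0%E ->
  nu (lin c x 1 y) A = (c ^+ 2 * N2 (E A x))%:E.
Proof.
move=> mA hx hy; rewrite nuE// => -[y0]; have hl := L2_lin c 1 hx hy.
rewrite nuE//; congr EFin; rewrite -E_N2// E_lin//.
have h1 : rip (E A y) (lin c x 1 y) = 0.
  by rewrite ripC rip0//; exact: EL2.
rewrite h1 addr0 E_sym// ripC E_lin//.
have h2 : rip (E A y) x = 0 by rewrite ripC rip0//; exact: EL2.
by rewrite h2 addr0 E_N2//; ring.
Qed.

(** By idempotence [nu (E J f)] has the same mass on [J] as on the whole line, so additivity leaves
    0 for the complement. This takes the place of a product rule for [E], which is not part of
    [spectral_resolution]. *)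
Lemma nu_range (J : set mR) f : measurable J -> L2 f -> nu (E J f) (~` J) = 0%E.
Proof.
move=> mJ hf; have hy := EL2 mJ hf; have mJ' := measurableC mJ.
have h1 : nu (E J f) J = (N2 (E J f))%:E.
  by rewrite (spec_measure sr hy mJ) Re_inner E_idem.
have e : nu (E J f) (J `|` ~` J) = (N2 (E J f))%:E by rewrite setUCr; exact: nuT.
exact: adde_eq0_fin (measureU (nu (E J f)) mJ mJ' (setICr J)) e h1 (nuE hy mJ').
Qed.

Lemma spec_dom u (K : set mR) (n : R) : L2 u -> measurable K -> 0 <= n -> (forall l : R, K l -> `|l| <= n) ->
  nu u (~` K) = 0%E -> exists w, S u w.
Proof.
move=> hu mK n0 hK u0; apply/(spec_domain sr hu).
apply: (@le_lt_trans _ _ (\int[nu u]_l (n ^+ 2)%:E)%E); last first.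
  by rewrite integral_cst// nuT// -EFinM ltry.
apply: ae_ge0_le_integral => //.
- by move=> l _; rewrite lee_fin sqr_ge0.
- by apply/measurable_EFinP; apply: measurable_funX.
- by move=> l _; rewrite lee_fin sqr_ge0.
exists (~` K); split => //; first exact: measurableC.
move=> l /= h Kl; apply: h => _; rewrite lee_fin -real_normK ?num_real//.
by apply: lerXn2r; rewrite ?nnegrE//; exact: hK.
Qed.

Section Key.
Variables (t dl : R) (J : set mR).
Hypotheses (dl0 : 0 < dl) (mJ : measurable J) (hJ : forall l : R, J l -> `|l - t| <= dl).
Local Notation I_ u D := (\int[nu u]_(l in D) (l - t)).

Lemma nu_cst u (c : R) : L2 u -> (nu u).-integrable setT (EFin \o (fun _ : mR => c)).
Proof.
move=> hu; apply/integrableP; split; first by apply/measurable_EFinP.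
rewrite (eq_integral (cst (`|c|%:E))) ?integral_cst ?nuT// -?EFinM ?ltry//.
Qed.

Lemma int_l u w : S u w -> (nu u).-integrable setT (EFin \o (fun l : mR => l - t)).
Proof.
move=> hs; have [hu _] := S_L2 hs.
have h2 : (\int[nu u]_l (l ^+ 2)%:E < +oo)%E by apply/(spec_domain sr hu); exists w.
have i2 : (nu u).-integrable setT (EFin \o (fun l : mR => l ^+ 2)).
  apply/integrableP; split; first by apply/measurable_EFinP; exact: measurable_funX.
  apply: le_lt_trans h2; apply: le_of_eq; apply: eq_integral => l _ /=.
  by rewrite ger0_norm ?sqr_ge0.
have ic : (nu u).-integrable setT (EFin \o (fun l : mR => 1 + `|t|)).
  exact: nu_cst.
apply: (le_integrable measurableT _ _ (integrableD measurableT ic i2)).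
  by apply/measurable_EFinP; apply: measurable_funB.
move=> l _ /=; rewrite lee_fin [leRHS]ger0_norm ?addr_ge0 ?sqr_ge0//.
apply: le_trans (ler_normB _ _) _; rewrite -(real_normK (num_real l)).
have k (a b : R) : a + b <= 1 + b + a ^+ 2 by have := sqr_ge0 (a - 1); have := sqr_ge0 a; nra.
exact: k.
Qed.

Lemma nu_fin u (A : set mR) : L2 u -> measurable A -> (nu u A <= (N2 u)%:E)%E.
Proof. by move=> hu mA; rewrite -nuT//; apply: le_measure; rewrite ?inE. Qed.

Lemma q_split u w : S u w -> rip w u - t * N2 u = I_ u J + I_ u (~` J).
Proof.
move=> hs; have [hu hw] := S_L2 hs; have hi := int_l hs; have mJ' := measurableC mJ.
have hv := congr1 (@complex.Re R) (spec_value sr hs); rewrite Re_inner /= in hv.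
have e0 : \int[nu u]_(l in setT) (l - t) = I_ u J + I_ u (~` J).
  rewrite -(@Rintegral_setU _ _ _ _ J (~` J)) ?setUCr//.
  by apply/disj_setPS; rewrite setICr.
rewrite -e0 hv; have ic := nu_cst t hu.
have -> : \int[nu u]_l l = \int[nu u]_(l in setT) ((l - t) + t).
  by apply: eq_Rintegral => l _; rewrite subrK.
rewrite RintegralD// Rintegral_cst// nuT//= addrK//.
Qed.

Lemma q_bound u w : S u w -> `|I_ u J| <= dl * N2 u.
Proof.
move=> hs; have [hu hw] := S_L2 hs; have hi := int_l hs.
have iJ := integrableS measurableT mJ (@subsetT _ _) hi.
have iJc := integrableS measurableT mJ (@subsetT _ _) (nu_cst dl hu).
apply: le_trans (le_normr_Rintegral mJ iJ) _.
apply: (@le_trans _ _ (\int[nu u]_(l in J) dl)).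
  by apply: (le_Rintegral mJ (integrable_norm iJ) iJc) => l Jl; exact: hJ.
rewrite Rintegral_cst// ler_pM2l// -lee_fin fineK; first exact: nu_fin.
by rewrite nuE.
Qed.

Lemma I_eq (a b : T -> R[i]) : (forall A : set mR, measurable A -> A `<=` ~` J -> nu a A = nu b A) ->
  I_ a (~` J) = I_ b (~` J).
Proof.
by move=> h; rewrite /Rintegral; congr fine; apply: eq_measure_integral => A mA sA; exact: h.
Qed.

Lemma nu_sub0 u (A B : set mR) : measurable A -> measurable B -> A `<=` B -> nu u B = 0%E -> nu u A = 0%E.
Proof.
move=> mA mB sAB h; apply/eqP; rewrite eq_le measure_ge0 andbT -h.
by apply: le_measure; rewrite ?inE.
Qed.

Variable N : nat.
Hypothesis hN : forall l : R, J l -> `|l| <= N%:R.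

(* Polarization: with [x] spectrally bounded, [4 <(S - t) y, x>] is a difference
   of the quadratic form at [y + x] and [y - x], whose spectral measures agree
   off [J]; so only [J], where [|l - t| <= dl], contributes. *)
Lemma weak_bound y wy (K : set mR) x0 (x := E K x0) n :
  S y wy -> nu y (~` J) = 0%E -> L2 x0 -> measurable K -> 0 <= n -> (forall l : R, K l -> `|l| <= n) ->
  2 * rip (lin 1 wy (- t) y) x <= dl * (N2 x + N2 y).
Proof.
move=> hs y0 hx0 mK n0 hK; have [hy hwy] := S_L2 hs.
have hx : L2 x by exact: EL2.
have mJ' := measurableC mJ; have mK' := measurableC mK.
have x1 : nu x (~` K) = 0%E by exact: nu_range.
(* A bounded set containing [J] and [K]: both spectral measures vanish off it, which puts [x] and
   [y + x], [y - x] into the domain. *)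
pose L : set mR := sym_itv (n + N%:R).
have mL : measurable L by exact: measurable_sym_itv.
have sLK : ~` L `<=` ~` K.
  by move=> l h Kl; apply: h; apply: le_trans (hK _ Kl) _; rewrite lerDl.
have sLJ : ~` L `<=` ~` J.
  by move=> l h Kl; apply: h; apply: le_trans (hN Kl) _; rewrite lerDr.
have mL' := measurableC mL.
have xL : nu x (~` L) = 0%E by exact: nu_sub0 mL' mK' sLK x1.
have yL : nu y (~` L) = 0%E by exact: nu_sub0 mL' mJ' sLJ y0.
have EL (c : R) : nu (lin c x 1 y) (~` L) = 0%E.
  by rewrite nu_lin//; move: xL; rewrite nuE// => -[->]; rewrite mulr0.
have nN : 0 <= n + N%:R by rewrite addr_ge0.
have la : L2 (lin 1 x 1 y) by exact: L2_lin.
have lb : L2 (lin (- 1) x 1 y) by exact: L2_lin.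
have [wa ha] := spec_dom la mL nN (fun l h => h) (EL 1).
have [wb hb] := spec_dom lb mL nN (fun l h => h) (EL (-1)).
have [wx hxx] := spec_dom hx mL nN (fun l h => h) xL.
have [_ hwa] := S_L2 ha; have [_ hwb] := S_L2 hb; have [_ hwx] := S_L2 hxx.
have eI : I_ (lin 1 x 1 y) (~` J) = I_ (lin (- 1) x 1 y) (~` J).
  apply: I_eq => A mA sA; have yA := nu_sub0 mA mJ' sA y0.
  by rewrite !nu_lin// sqrrN.
have q1 := q_split ha; have q2 := q_split hb.
have b1 := q_bound ha; have b2 := q_bound hb.
move: b1 b2; rewrite !ler_norml => /andP[_ b1] /andP[b2 _].
have s1 := S_sym ha hs. have s2 := S_sym hb hs.
have s3 := S_sym ha hxx. have s4 := S_sym hb hxx. have s5 := S_sym hs hxx.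
have e1 : rip wa (lin 1 x 1 y) = rip (lin 1 x 1 y) wx + rip (lin 1 x 1 y) wy.
  by rewrite ripC rip_lin// ![rip _ wa]ripC s1 s3 !mul1r.
have e2 : rip wb (lin (- 1) x 1 y) = - rip (lin (- 1) x 1 y) wx + rip (lin (- 1) x 1 y) wy.
  by rewrite ripC rip_lin// ![rip _ wb]ripC s2 s4 mulN1r mul1r.
move: b1 b2 q1 q2; rewrite eI e1 e2 !rip_lin// !N2_lin// (ripC mu x wy) s5 (ripC mu x y).
move: (I_ _ (~` J)) (I_ _ J) (I_ _ J) (rip x wx) (rip y wx) (rip y wy) (rip y x) (N2 x) (N2 y).
by move=> *; lra.
Qed.

(** Duality: [weak_bound] is tested against the spectral truncations of [p' = (S - t) y / dl], since
    [(S - t) y] itself need not lie in the domain. It gives [2 N <= N + N2 y] for the squared norm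
    [N] of each truncation, and the truncations exhaust [p'] by countable additivity. *)
Lemma key y wy : S y wy -> nu y (~` J) = 0%E -> N2 (lin 1 wy (- t) y) <= dl ^+ 2 * N2 y.
Proof.
move=> hs y0; have [hy hwy] := S_L2 hs.
set p := lin 1 wy (- t) y; have hp : L2 p by exact: L2_lin.
have hp' : L2 (fun z => dl^-1%:C%C * p z) by exact: L2Z.
pose p' := fun z => dl^-1%:C%C * p z.
pose F (k : nat) : set mR := sym_itv k%:R.
have mF k : measurable (F k) by exact: measurable_sym_itv.
have bd k : (nu p' (F k) <= (N2 y)%:E)%E.
  rewrite nuE// lee_fin.
  have h0 := weak_bound hs y0 hp' (mF k) (ler0n _ k).
  have h : 2 * rip p (E (F k) p') <= dl * (N2 (E (F k) p') + N2 y).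
    exact: h0.
  have hE : L2 (E (F k) p') by exact: EL2.
  have e : rip p (E (F k) p') = dl * N2 (E (F k) p').
    rewrite -E_N2// [in RHS]ripC /p' ripZ// mulrA divff ?mul1r// gt_eqF//.
  rewrite e in h; rewrite -(ler_pM2l dl0); move: h; rewrite mulrDr; lra.
have lim : (fun k => nu p' (F k)) @ \oo --> nu p' (\bigcup_k F k).
  apply: nondecreasing_cvg_mu => //; first by apply: bigcupT_measurable.
  move=> a b ab; apply/subsetPset => l h; apply: le_trans h _.
  by rewrite ler_nat.
have eT : \bigcup_k F k = setT.
  apply/seteqP; split=> // l _; exists (Num.truncn `|l|).+1 => //=.
  by rewrite /F /sym_itv /= ltW// truncnS_gt.
have : (nu p' setT <= (N2 y)%:E)%E.
  rewrite -eT; rewrite -(cvg_lim _ lim)//; apply: lime_le; first by apply/cvg_ex; eexists; exact: lim.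
  by near=> k; exact: bd.
rewrite nuT// lee_fin N2_rip ripZ// ripC ripZ// => h.
rewrite -[leLHS]mul1r -(expr1n _ 2) -(mulfV (lt0r_neq0 dl0)) exprMn -mulrA ler_pM2l ?exprn_gt0//.
by apply: le_trans h; rewrite expr2 -mulrA.
Unshelve. all: by end_near.
Qed.

End Key.

End Spectral.

(** Lebesgue measure unfolds to an infimum over countable covers by half-open intervals. *)
Lemma lebesgue_null_cover {R : realType} (A : set (measurableTypeR R)) (e : R) : 0 < e -> lebesgue_measure A = 0%E ->
  exists F : nat -> set R, [/\ forall k, ocitv (F k), A `<=` \bigcup_k F k &
    (\sum_(k <oo) wlength (@idfun R) (F k) < e%:E)%E].
Proof.
move=> e0 A0; have h : (ereal_inf [set (\sum_(k <oo) wlength (@idfun R) (F k))%E | F in measurable_cover (A : set (ocitv_type R))] = 0)%E by exact: A0.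
have [||x [F [mF sF] <-] lF] := @lb_ereal_inf_adherent _ [set (\sum_(k <oo) wlength (@idfun R) (F k))%E | F in measurable_cover (A : set (ocitv_type R))] e.
- exact: e0.
- by rewrite h.
by rewrite h add0e in lF; exists F.
Qed.

Lemma le1_double_succ {R : realType} (C : R) : 0 <= C -> 1 <= 2 * (C + 1).
Proof. by lra. Qed.

(** * From the local estimate to absolute continuity *)

Section AbsoluteContinuity.
Context {d : measure_display} {T : measurableType d} {R : realType}.
Variable mu : {measure set T -> \bar R}.
Local Notation L2 := (L2 mu). Local Notation rip := (rip mu). Local Notation N2 := (N2 mu).
Local Notation mR := (measurableTypeR R).
Variables (S : @operator d T R) (E : set R -> (T -> R[i]) -> T -> R[i])
  (nu : (T -> R[i]) -> {measure set mR -> \bar R}).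
Hypotheses (sa : self_adjoint mu S) (sr : spectral_resolution mu S E nu).

Section Window.
Variables (K : set T) (l1 l2 C : R).
Hypotheses (mK : measurable K) (l10 : 0 < l1) (C0 : 0 <= C).
Hypothesis resolvent : forall (t eps : R) y wy, l1 <= t <= l2 -> 0 < eps <= 1 -> S y wy ->
  N2 (cut K y) <= C * (eps * N2 y + eps^-1 * N2 (lin 1 wy (- t) y)).
Variable f : T -> R[i].
Hypotheses (hf : L2 f) (fK : cut K f = f).

(** For [y = E J f] the squared norm is [<cut K y, f>], as [f] lives on [K]. By [key], [(S - t) y]
    has norm at most [eps] times that of [y], so the resolvent hypothesis bounds [N2 (cut K y)] by
    [2 C eps N2 y], and Young's inequality absorbs it. *)
Lemma window_bound (t eps : R) (J : set mR) : measurable J -> l1 <= t <= l2 -> 0 < eps ->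
  (forall l : R, J l -> `|l - t| <= eps) -> (nu f J <= (2 * (C + 1) * eps * N2 f)%:E)%E.
Proof.
move=> mJ ht e0 hJ; have n0 := N2_ge0 mu f; have C1 := le1_double_succ C0.
(* The hypothesis covers [eps <= 1] only; for larger [eps] the total mass is already below the
   bound, because [2 (C + 1) >= 1]. *)
have [e1|e1] := leP eps 1; last first.
  apply: le_trans (nu_fin sr hf mJ) _; rewrite lee_fin ler_peMl//; apply: (le_trans C1).
  by apply: ler_peMr; [exact: le_trans ler01 C1|exact: ltW].
set y := E J f; have hy : L2 y by exact: (EL2 sr mJ hf).
have y0 := nu_range sr mJ hf; rewrite -/y in y0.
have t0 : 0 <= t by case/andP: ht => h _; exact: le_trans (ltW l10) h.
have b0 : 0 <= t + eps by lra.
have bd (l : R) : J l -> `|l| <= t + eps.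
  by move=> /hJ; rewrite !ler_norml => /andP[h1 h2]; lra.
have [wy hs] := spec_dom sr hy mJ b0 bd y0.
pose N := (Num.truncn (t + eps)).+1.
have hN (l : R) : J l -> `|l| <= N%:R.
  by move=> Jl; apply: le_trans (bd _ Jl) _; rewrite ltW// truncnS_gt.
have hk := key sa sr e0 mJ hJ hN hs y0.
have e01 : 0 < eps <= 1 by rewrite e0.
have hl := resolvent ht e01 hs.
have ey : nu f J = (N2 y)%:E by rewrite (nuE sr).
have yf : N2 y = rip (cut K y) f by rewrite rip_cut fK -(E_N2 sr mJ hf).
have D0 : 0 < 2 * (C + 1) * eps by apply: mulr_gt0 => //; apply: lt_le_trans C1.
have hc : L2 (cut K y) by exact: L2_cut.
have hyo := @rip_young _ _ _ mu (2 * (C + 1) * eps)^-1 (cut K y) f.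
rewrite ey lee_fin; move: hyo; rewrite -yf invr_gt0 invrK => /(_ D0 hc hf).
have h3 : (2 * (C + 1) * eps)^-1 * N2 (cut K y) <= N2 y.
  rewrite mulrC ler_pdivrMr//; apply: le_trans hl _.
  have h4 : eps^-1 * N2 (lin 1 wy (- t) y) <= eps * N2 y.
    by rewrite mulrC ler_pdivrMr// mulrAC -expr2.
  have ny := N2_ge0 mu y; have h5 : 0 <= eps * N2 y by rewrite mulr_ge0// ltW.
  apply: (@le_trans _ _ (C * (eps * N2 y + eps * N2 y))).
    by rewrite ler_wpM2l// lerD2l.
  set z := eps * N2 y in h5 *; rewrite [leRHS](_ : _ = 2 * (C + 1) * z); [nra|rewrite /z; ring].
lra.
Qed.

(** Each interval of a cover of small total length contributes at most a constant times its length;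
    the constant is included in [D], whose [+ 1] keeps it positive. *)
Lemma window_null (A : set mR) : measurable A -> (forall l : R, A l -> l1 <= l <= l2) ->
  lebesgue_measure A = 0%E -> nu f A = 0%E.
Proof.
move=> mA sA A0; apply/eqP; rewrite eq_le measure_ge0 andbT.
apply/lee_addgt0Pr => e; rewrite -[e]/(e : R); move: (e : R) => {}e e0; rewrite add0e.
pose D := 2 * (C + 1) * N2 f + 1.
have n0 := N2_ge0 mu f; have C1 := le1_double_succ C0.
have D0 : 0 < D by apply: ltr_wpDl => //; apply: mulr_ge0 => //; apply: le_trans C1.
have [F [oF sF lF]] := lebesgue_null_cover (divr_gt0 e0 D0) A0.
have mF k : measurable (F k : set mR).
  by have [x _ <-] := oF k; exact: measurable_itv.
have mAF k : measurable (A `&` F k : set mR) by exact: measurableI.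
have cov : A `<=` \bigcup_k (A `&` F k).
  by move=> l Al; have [k _ Fl] := sF _ Al; exists k.
apply: le_trans (measure_sigma_subadditive (nu f) mAF mA cov) _.
apply: (@le_trans _ _ (\sum_(k <oo) (D%:E * wlength (@idfun R) (F k)))%E).
  apply: lee_nneseries => [k _ _|k _]; first exact: measure_ge0.
  (* A nonempty piece is centred at one of its own points, which belongs to [A] and therefore to the
     energy window, even if the interval sticks out of it. *)
  have [AF0|/set0P[t [At Ft]]] := eqVneq (A `&` F k) set0.
    by rewrite AF0 measure0 mule_ge0// ?lee_fin ?ltW//; exact: wlength_ge0.
  have [[a b] _ /= eF] := oF k.
  have : F k t by [].
  rewrite -eF /= in_itv /= => /andP[at_ tb].
  have ab : 0 < b - a by rewrite subr_gt0 (lt_le_trans at_).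
  have eL : wlength (@idfun R) (F k) = (b - a)%:E by rewrite -eF wlength_itv_bnd// -subr_ge0 ltW.
  have J1 (l : R) : (A `&` F k) l -> `|l - t| <= b - a.
    case=> _; rewrite -eF /= in_itv/= => /andP[h1 h2]; rewrite ler_norml.
    by apply/andP; split; lra.
  rewrite eF eL; apply: le_trans (window_bound (mAF k) (sA _ At) ab J1) _.
  rewrite -EFinM lee_fin (_ : D * (b - a) = 2 * (C + 1) * (b - a) * N2 f + (b - a)); last by rewrite /D; ring.
  by rewrite lerDl ltW.
rewrite nneseriesZl; last by move=> k _; exact: wlength_ge0.
rewrite muleC -lee_pdivlMr//; exact: ltW.
Qed.

End Window.

Lemma N2_exhaust (K : nat -> set T) y : L2 y -> (forall k, measurable (K k)) -> nondecreasing_seq K ->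
  \bigcup_k K k = setT -> (forall k, N2 (cut (K k) y) = 0) -> N2 y = 0.
Proof.
move=> hy mK ndK KT h0.
have mp : measurable_fun setT (EFin \o prd y y).
  by apply/measurable_EFinP; exact: (prd_meas hy hy).
have p0 t : (0 <= (prd y y t)%:E)%E by rewrite lee_fin /prd -!expr2 addr_ge0 ?sqr_ge0.
have h := @ge0_nondecreasing_set_cvg_integral _ _ _ K (EFin \o prd y y) mu ndK mK
  (fun k => measurable_funTS mp) (fun k x _ => p0 x).
have e k : (\int[mu]_(x in K k) (EFin \o prd y y) x = 0)%E.
  have hc := L2_cut (mK k) hy.
  transitivity (norm2 mu (cut (K k) y)); last by rewrite N2E// h0.
  rewrite integral_mkcond /norm2; apply: eq_integral => t _ /=.
  rewrite patchE /cut indicE /prd; case: (_ \in _) => /=; case: (y t) => a b /=.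
    by rewrite !mul0r subr0 addr0 !mul1r -!expr2.
  by rewrite !mul0r subr0 addr0 expr0n addr0.
rewrite KT (_ : (fun k => \int[mu]_(x in K k) (EFin \o prd y y) x)%E = cst 0%E) in h; last first.
  by apply/funext => k; exact: e.
have := cvg_unique _ h (cvg_cst _) => /(_ (@ereal_hausdorff _) _ _) h1.
by rewrite -[LHS]/(fine (\int[mu]_x (prd y y x)%:E)%E) -[RHS]/(fine 0%E); congr fine; exact: h1.
Qed.

(** With [y = E A u] and [c] its restriction to [K k], the hypothesis gives [E A c = 0] in norm;
    hence the squared norm of [c] is [<c, E A u> = <E A c, u> = 0] for every [k], and the sets [K k]
    exhaust the space. *)
Lemma null_nu (K : nat -> set T) (A : set mR) u : (forall k, measurable (K k)) -> nondecreasing_seq K ->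
  \bigcup_k K k = setT -> measurable A -> (forall k f, L2 f -> cut (K k) f = f -> nu f A = 0%E) ->
  L2 u -> nu u A = 0%E.
Proof.
move=> mK ndK KT mA h0 hu; set y := E A u; have hy : L2 y by exact: (EL2 sr mA hu).
rewrite (nuE sr)//; congr EFin; apply: (N2_exhaust hy mK ndK KT) => k.
have hc := L2_cut (mK k) hy.
have cc : cut (K k) (cut (K k) y) = cut (K k) y.
  apply/funext => t; rewrite /cut mulrA -rmorphM/=; congr (_%:C%C * _).
  by rewrite indicE; case: (_ \in _); rewrite /= ?mulr1 ?mulr0.
have := h0 k _ hc cc; rewrite (nuE sr)// => -[z].
rewrite N2_rip rip_cut cc (E_sym sr)//.
by apply: rip0 => //; exact: (EL2 sr mA hc).
Qed.

End AbsoluteContinuity.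

Theorem absolutely_continuous_criterion {d : measure_display} {T : measurableType d} {R : realType}
  (mu : {measure set T -> \bar R}) (S : @operator d T R) (K : nat -> set T) :
  self_adjoint mu S -> (forall k, measurable (K k)) -> nondecreasing_seq K -> \bigcup_k K k = setT ->
  (forall k (l1 l2 : R), 0 < l1 -> l1 < l2 -> exists2 C, 0 <= C & forall (t eps : R) y wy, l1 <= t <= l2 -> 0 < eps <= 1 ->
    S y wy -> N2 mu (cut (K k) y) <= C * (eps * N2 mu y + eps^-1 * N2 mu (lin 1 wy (- t) y))) ->
  purely_absolutely_continuous mu S `]0, +oo[.
Proof.
move=> sa mK ndK KT res E nu sr u A hu mA sA A0.
suff h k f : L2 mu f -> cut (K k) f = f -> nu f A = 0%E by exact: (null_nu sr mK ndK KT mA h hu).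
move=> hf fK.
(* Compact energy windows exhausting the half-line, as the constants of the estimate degenerate at 0
   and at infinity. *)
pose I (j : nat) : set (measurableTypeR R) := `[j.+1%:R^-1, j.+2%:R]%classic.
have mI j : measurable (I j) by exact: measurable_itv.
have AI : A `<=` \bigcup_j (A `&` I j).
  move=> l Al; have := sA _ Al; rewrite /= in_itv/= andbT => l0.
  pose j := maxn (Num.truncn l) (Num.truncn l^-1).
  exists j => //; split => //; rewrite /I /= in_itv/=; apply/andP; split.
    rewrite -[leRHS]invrK lef_pV2 ?posrE ?invr_gt0//.
    apply: le_trans (ltW (truncnS_gt _)) _; rewrite ler_nat ltnS leq_maxr//.
  apply: le_trans (ltW (truncnS_gt _)) _; rewrite ler_nat.
  by apply: leq_trans (leqnSn _); rewrite ltnS leq_maxl.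
have mAI j : measurable (A `&` I j) by exact: measurableI.
apply/eqP; rewrite eq_le measure_ge0 andbT.
apply: le_trans (measure_sigma_subadditive (nu f) mAI mA AI) _.
rewrite eseries0// => j _ _.
have l10 : 0 < (j.+1%:R^-1 : R) by rewrite invr_gt0.
have l12 : j.+1%:R^-1 < (j.+2%:R : R).
  by apply: le_lt_trans (_ : 1 < _); rewrite ?invf_le1 ?ler1n ?ltr1n.
have [C C0 hC] := res k _ _ l10 l12.
apply: (window_null sa sr (mK k) l10 C0 hC hf fK (mAI j)).
  by move=> l [_]; rewrite /I /= in_itv.
apply/eqP; rewrite eq_le measure_ge0 andbT -A0.
by apply: le_measure; rewrite ?inE//; exact: subIsetl.
Qed.

Lemma le_cvg0 {R : realType} (X Y p q : R) (a b : nat -> R) :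
  a @ \oo --> 0 -> b @ \oo --> 0 -> (forall k, X <= Y + p * a k + q * b k) -> X <= Y.
Proof.
move=> a0 b0 h.
have c : (fun k => Y + p * a k + q * b k) @ \oo --> Y.
  have cc (r : R) : (fun _ : nat => r) @ \oo --> r by exact: cvg_cst.
  have := cvgD (cvgD (cc Y) (cvgM (cc p) a0)) (cvgM (cc q) b0).
  by rewrite !mulr0 !addr0; exact.
rewrite -(cvg_lim (@Rhausdorff R) c); apply: limr_ge; first by apply/cvg_ex; exists Y.
exact: nearW.
Qed.

(** * Passage to the closure of the operator *)

Section Closure.
Context {d : measure_display} {T : measurableType d} {R : realType}.
Variable mu : {measure set T -> \bar R}.
Local Notation L2 := (L2 mu). Local Notation N2 := (N2 mu).
Variables (S : @operator d T R) (K : set T) (t eps C : R).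
Hypotheses (SL2 : forall u w, S u w -> L2 u /\ L2 w) (mK : measurable K) (e0 : 0 < eps) (C0 : 0 <= C).
Hypothesis est : forall u w, S u w -> N2 (cut K u) <= C * (eps * N2 u + eps^-1 * N2 (lin 1 w (- t) u)).

Lemma cvg_N2 (us : nat -> T -> R[i]) u : (forall k, L2 (us k)) -> L2 u -> L2_cvg mu us u ->
  (fun k => N2 (lin 1 (us k) (-1) u)) @ \oo --> 0.
Proof.
move=> hs hu h.
have e k : norm2 mu (fun x => us k x - u x) = (N2 (lin 1 (us k) (-1) u))%:E.
  rewrite -N2E; last exact: L2_lin.
  by congr norm2; apply/funext => x; rewrite /lin rmorphN1 mul1r mulN1r.
rewrite /L2_cvg (funext e) in h.
by apply: fine_cvg h.
Qed.

(** Convergence in norm with [N2_lin_le] used on both sides of the estimate; each use doubles the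
    constant, whence the factor 4. *)
Lemma closure_estimate u w : op_closure mu S u w ->
  N2 (cut K u) <= 4 * C * (eps * N2 u + eps^-1 * N2 (lin 1 w (- t) u)).
Proof.
move=> [hu hw [us [ws [hS cu cw]]]].
have hus k : L2 (us k) by have [] := SL2 (hS k).
have hws k : L2 (ws k) by have [] := SL2 (hS k).
have := cvg_N2 hws hw cw; have := cvg_N2 hus hu cu.
pose a k := lin 1 (us k) (-1) u; pose b k := lin 1 (ws k) (-1) w.
have ha k : L2 (a k) by exact: L2_lin.
have hb k : L2 (b k) by exact: L2_lin.
move=> c1 c2; apply: (le_cvg0 (p := 2 + 4 * C * eps + 8 * C * eps^-1 * t ^+ 2) (q := 8 * C * eps^-1) c1 c2) => k.
rewrite -/(a k) -/(b k); have i0 : 0 < eps^-1 by rewrite invr_gt0.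
have hl : L2 (lin 1 w (- t) u) by exact: L2_lin.
have hlk : L2 (lin 1 (b k) (- t) (a k)) by exact: L2_lin.
have q1 : N2 (cut K u) <= 2 * N2 (cut K (us k)) + 2 * N2 (a k).
  have -> : cut K u = lin 1 (cut K (us k)) (-1) (cut K (a k)).
    apply/funext => x; rewrite /cut /lin /a /lin rmorphN1; ring.
  apply: le_trans (N2_lin_le _ _ (L2_cut mK (hus k)) (L2_cut mK (ha k))) _.
  by rewrite sqrrN expr1n !mulr1 lerD2l ler_wpM2l// N2_cut_le.
have q2 : N2 (us k) <= 2 * N2 u + 2 * N2 (a k).
  have -> : us k = lin 1 u 1 (a k) by apply/funext => x; rewrite /a /lin rmorphN1; ring.
  by apply: le_trans (N2_lin_le _ _ hu (ha k)) _; rewrite expr1n !mulr1.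
have q3 : N2 (lin 1 (ws k) (- t) (us k)) <= 2 * N2 (lin 1 w (- t) u) + 2 * N2 (lin 1 (b k) (- t) (a k)).
  have -> : lin 1 (ws k) (- t) (us k) = lin 1 (lin 1 w (- t) u) 1 (lin 1 (b k) (- t) (a k)).
    by apply/funext => x; rewrite /a /b /lin !rmorphN1; ring.
  by apply: le_trans (N2_lin_le _ _ hl hlk) _; rewrite expr1n !mulr1.
have q4 := N2_lin_le 1 (- t) (hb k) (ha k); rewrite sqrrN expr1n mulr1 in q4.
have q5 := est (hS k).
have q6 := ler_wpM2l (ltW e0) q2.
have q7 := ler_wpM2l (ltW i0) (le_trans q3 (lerD (lexx _) (ler_wpM2l (ler0n R 2) q4))).
have q8 := ler_wpM2l C0 (lerD q6 q7).
have q9 := le_trans q1 (lerD (ler_wpM2l (ler0n R 2) (le_trans q5 q8)) (lexx _)).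
apply: le_trans q9 _; apply: le_of_eq; ring.
Qed.

End Closure.

Lemma Lfun_oo_bounded {d} {T : measurableType d} {R : realType} (mu : {measure set T -> \bar R}) (f : T -> R) :
  f \in Lfun mu +oo%E -> measurable_fun setT f /\ exists2 B : R, 0 <= B & {ae mu, forall x, `|f x| <= B}.
Proof.
move=> hf; have mf : measurable_fun setT f by have := sub_Lfun_mfun hf; rewrite inE.
split=> //; have := sub_Lfun_finLfun hf; rewrite inE /= /finite_norm unlock.
case: ifPn => [m0 h|m0 _]; last first.
  exists 0 => //; have m00 : mu setT = 0%E by apply/eqP; rewrite eq_le measure_ge0 leNgt m0.
  by exists setT.
have e1 := ess_sup_inf.ess_sup_ge mu (abse \o (EFin \o f)).
exists (Num.max 0 (fine (ess_sup_inf.ess_sup mu (abse \o (EFin \o f))))); first by rewrite le_max lexx.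
apply: filterS e1 => x /=; move: h; case: (ess_sup_inf.ess_sup _ _) => [r|//|//] _.
by rewrite lee_fin /= => h; rewrite le_max h orbT.
Qed.

Section L2Representatives.
Context {d : measure_display} {T : measurableType d} {R : realType}.
Variable mu : {measure set T -> \bar R}.
Local Notation Re := (@complex.Re R).
Local Notation Im := (@complex.Im R).

Lemma L2_ae u u' : L2 mu u -> measurable_fun setT (Re \o u') -> measurable_fun setT (Im \o u') ->
  {ae mu, forall x, u x = u' x} -> L2 mu u'.
Proof.
move=> [m1 m2 hu] m3 m4 e; split => //; move: hu; rewrite /norm2.
rewrite (@ae_eq_integral _ _ _ mu setT (fun x => (Re (u' x) ^+ 2 + Im (u' x) ^+ 2)%:E))//.
- by apply/measurable_EFinP; apply: measurable_funD; apply: measurable_funX.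
- by apply/measurable_EFinP; apply: measurable_funD; apply: measurable_funX.
by apply: filterS e => x ex _; rewrite ex.
Qed.

Lemma prd_lin (c : R) (u z : T -> R[i]) x : prd (lin 1 z c u) (lin 1 z c u) x =
  (Re (z x) + c * Re (u x)) ^+ 2 + (Im (z x) + c * Im (u x)) ^+ 2.
Proof. by rewrite /prd /lin; case: (u x) => a b; case: (z x) => p q /=; ring. Qed.

End L2Representatives.

(** * The Schroedinger operator *)

Section Schroedinger.
Context {R : realType} {m : nat} {sigma : R} (s0 : 0 < sigma) (M : riemannian_manifold R m.+1)
  (X : asymptotically_conic sigma M) (w : M -> R) (hw : is_weight X w)
  (mu : {measure set (borel M) -> \bar R}) (hmu : riemannian_measure mu).
Variables (V : M -> R) (hV : short_range sigma mu w V).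
Notation II := (II mu).
Local Notation Re := (@complex.Re R).
Local Notation Im := (@complex.Im R).
Local Notation BM := (borel M).

(** The essential bound holds off a null set, whereas the estimates ask for a pointwise one:
    truncation at the level [B] yields a measurable potential that agrees with [V] almost
    everywhere. *)
Lemma short_range_repr : measurable_fun [set: BM] (V : BM -> R) /\ exists2 V' : M -> R,
  measurable_fun [set: BM] (V' : BM -> R) /\ {ae mu, forall x : BM, V' x = V x} &
  exists2 CV, 0 <= CV & forall x, `|V' x| <= CV * w x `^ (- 1 - 2 * sigma).
Proof.
have [mf [B B0 hB]] := Lfun_oo_bounded hV.
have w0 := w_gt0 hw; set f : BM -> R := fun x => _ in mf hB.
have mw (c : R) : measurable_fun [set: BM] ((fun x => w x `^ c) : BM -> R).
  by apply: (@measurableT_comp _ _ _ _ _ _ (fun t : R => t `^ c)) => //; exact: sm_meas (sm_w hw).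
have ec : - 1 - 2 * sigma = - (1 + 2 * sigma) by ring.
have eV x : w x `^ (- 1 - 2 * sigma) * f x = V x.
  by rewrite /f mulrA ec powRN mulVf ?mul1r// gt_eqF// powR_gt0.
split.
  rewrite (_ : V = fun x => w x `^ (- 1 - 2 * sigma) * f x); first exact: measurable_funM.
  by apply/funext => x; rewrite eV.
exists (fun x => w x `^ (- 1 - 2 * sigma) * Num.max (- B) (Num.min B (f x))).
  split.
    apply: measurable_funM => //; apply: measurable_maxr => //; exact: measurable_minr.
  apply: filterS hB => x; rewrite ler_norml => /andP[h1 h2].
  by rewrite -[RHS]eV min_r// max_r.
exists B => // x; rewrite normrM ger0_norm ?powR_ge0// mulrC ler_wpM2r ?powR_ge0//.
rewrite ler_norml le_max lexx/= ge_max ge_min lexx andbT.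
by rewrite (le_trans _ B0)// oppr_le0.
Qed.

Lemma schroedinger_estimate (lam1 lam2 rho : R) : 0 < lam1 -> exists2 C : R, 0 <= C &
  forall (lam eps : R) u z, lam1 <= lam <= lam2 -> 0 < eps <= 1 -> schrodinger V u z ->
  [/\ L2 mu u, L2 mu z &
   N2 mu (cut ([set x | w x <= rho] : set BM) u) <= C * (eps * N2 mu u + eps^-1 * N2 mu (lin 1 z (- lam) u))].
Proof.
move=> l10; have [mV [V' [mV' aV] [CV CV0 hV']]] := short_range_repr.
have [C C0 hC] := conic_estimate s0 hw hmu lam2 rho CV0 hV' l10.
exists C => // lam eps u z /andP[h1 h2] /andP[e0 e1] [[su1 su2 [K cK uK]] [D [hD1 hD2] hz]].
set v1 : M -> R := Re \o u in su1 hD1; set v2 : M -> R := Im \o u in su2 hD2.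
have s1 : sm v1 by apply: (iffLR (smO_smooth_fun _)); exact: su1.
have s2 : sm v2 by apply: (iffLR (smO_smooth_fun _)); exact: su2.
have c1 : cs v1 by exists K => // x nK; rewrite /v1 /= uK.
have c2 : cs v2 by exists K => // x nK; rewrite /v2 /= uK.
have eD1 x : Re (D x) = Lap v1 x := laplacianE s1 hD1 x.
have eD2 x : Im (D x) = Lap v2 x := laplacianE s2 hD2 x.
have b1 := bcs_sm s1 c1; have b2 := bcs_sm s2 c2.
have bV' : exists C : R, forall x, `|V' x| <= C.
  exists (CV * (1 / 2) `^ (- 1 - 2 * sigma)) => x; apply: le_trans (hV' x) _; apply: ler_wpM2l => //.
  have h12 : 0 < 1 / 2 :> R by rewrite divr_gt0.
  have ww := w_gt0 hw; have wl := w_lower hw.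
  rewrite -opprD !powRN lef_pV2; [|exact: powR_gt0|exact: powR_gt0].
  apply: ge0_ler_powR; rewrite ?nnegrE ?(ltW (ww x))//.
  by rewrite addr_ge0// mulr_ge0// ltW.
(* The image of [u] computed with [V'] in place of [V]. It equals [z] almost everywhere, so the
   norms agree. *)
pose z' : BM -> R[i] := fun x => Complex (V' x * v1 x - Lap v1 x) (V' x * v2 x - Lap v2 x).
have bL v : sm v -> cs v -> bcs (fun x => V' x * v x - Lap v x).
  move=> sv cv; have bl : bcs (Lap v) := bcs_sm (sm_Lap hmu sv) (cs_Lap cv).
  by apply: bcsB => //; apply: bcsM => //; exact: bcs_sm.
have L2b y : bcs (Re \o y) -> bcs (Im \o y) -> L2 mu (y : BM -> R[i]).
  move=> hy1 hy2; apply: L2_int; [exact: bcs_meas hy1|exact: bcs_meas hy2|].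
  apply: (bcs_integrable hmu); exact: (bcs_e2_meas hy1 hy2).
have hu : L2 mu u by exact: L2b.
have hz' : L2 mu z' by apply: L2b; exact: bL.
have ez : {ae mu, forall x : BM, z' x = z x}.
  apply: filterS aV => x e; rewrite hz /z' e -eD1 -eD2 /v1 /v2 /=.
  by case: (u x) => a b; case: (D x) => p q /=; congr Complex; ring.
have mz1 : measurable_fun [set: BM] (Re \o z : BM -> R).
  rewrite (_ : _ \o _ = (fun x => V x * v1 x - Lap v1 x)).
    by apply: measurable_funB; [apply: measurable_funM => //; exact: bcs_meas b1|exact: sm_meas (sm_Lap hmu s1)].
  apply/funext => x; rewrite /= hz -eD1 /v1 /=.
  by case: (u x) => a b; case: (D x) => p q /=; ring.
have mz2 : measurable_fun [set: BM] (Im \o z : BM -> R).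
  rewrite (_ : _ \o _ = (fun x => V x * v2 x - Lap v2 x)).
    by apply: measurable_funB; [apply: measurable_funM => //; exact: bcs_meas b2|exact: sm_meas (sm_Lap hmu s2)].
  apply/funext => x; rewrite /= hz -eD2 /v2 /=.
  by case: (u x) => a b; case: (D x) => p q /=; ring.
have lz : L2 mu z by exact: L2_ae hz' mz1 mz2 ez.
split=> //; pose G1 x := V' x * v1 x - Lap v1 x - lam * v1 x; pose G2 x := V' x * v2 x - Lap v2 x - lam * v2 x.
have bG1 : bcs G1 by apply: bcsB; [exact: bL|exact: bcsZ].
have bG2 : bcs G2 by apply: bcsB; [exact: bL|exact: bcsZ].
have b0 : bcs (fun _ : M => 0 : R).
  by have := bcsZ 0 b1; congr bcs; apply/funext => x; rewrite mul0r.
have hs : hsol V' lam 0 v1 v2 (fun=> 0) (fun=> 0) G1 G2.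
  by apply: (Hsol s1 s2 c1 c2 b0 b0 bG1 bG2) => x; rewrite /G1 /G2; ring.
have := hC _ _ _ _ _ _ h1 h2 e0 e1 hs.
have -> : II (e2 v1 v2) = N2 mu u by [].
have -> : JJ mu [set x | w x <= rho] (e2 v1 v2) = N2 mu (cut ([set x | w x <= rho] : set BM) u).
  congr fine; apply: eq_integral => x _; congr EFin.
  rewrite /prd /cut /e2 /v1 /v2 /= indicE; case: (_ \in _); case: (u x) => a b /=; ring.
suff -> : II (e2 G1 G2) = N2 mu (lin 1 z (- lam) u) by [].
have -> : II (e2 G1 G2) = N2 mu (lin 1 z' (- lam) u).
  congr fine; apply: eq_integral => x _; congr EFin.
  rewrite prd_lin /e2 /G1 /G2 /z' /v1 /v2 /=.
  by rewrite !mulNr -!expr2.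
have l1 : L2 mu (lin 1 z' (- lam) u) by exact: L2_lin.
have l2 : L2 mu (lin 1 z (- lam) u) by exact: L2_lin.
have el : {ae mu, forall x, lin 1 z' (- lam) u x = lin 1 z (- lam) u x}.
  by apply: filterS ez => x e; rewrite /lin e.
by rewrite /N2 (rip_ae l1 l2 l1 el) ripC (rip_ae l1 l2 l2 el).
Qed.

End Schroedinger.

Theorem proposition1p31 (R : realType) (m : nat) (hn : (3 <= m.+1)%N)
  (sigma0 : R) (hsigma0 : 0 < sigma0)
  (M : riemannian_manifold R m.+1) (X : asymptotically_conic sigma0 M)
  (mu : {measure set (borel M) -> \bar R}) (hmu : riemannian_measure mu)
  (w : M -> R) (hw : is_weight X w)
  (V : M -> R) (hV : short_range sigma0 mu w V)
  (hH : essentially_self_adjoint mu (schrodinger V)) :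
  purely_absolutely_continuous mu (op_closure mu (schrodinger V)) `]0, +oo[.
Proof.
(* Sublevel sets of the weight: compact because the end is proper, and exhausting [M]. *)
pose K (k : nat) : set (borel M) := [set x | w x <= k%:R].
have mK k : measurable (K k) by apply: compact_borel; exact: w_compact hw _.
apply: (@absolutely_continuous_criterion _ _ _ mu _ K hH mK).
- by move=> a b ab; apply/subsetPset => x /= h; apply: le_trans h _; rewrite ler_nat.
- apply/seteqP; split=> // x _; exists (Num.truncn (w x)).+1 => //=.
  by rewrite /K /= ltW// truncnS_gt.
move=> k l1 l2 l10 _; have [C C0 hC] := schroedinger_estimate hsigma0 hw hmu hV l2 k%:R l10.
exists (4 * C); first exact: mulr_ge0.
move=> t eps y wy ht he hy; have /andP[e0 _] := he.
apply: (@closure_estimate _ _ _ mu (schrodinger V) (K k) t eps C _ (mK k) e0 C0 _ y wy hy).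
  by move=> u z hz; have [] := hC _ _ _ _ ht he hz.
by move=> u z hz; have [] := hC _ _ _ _ ht he hz.
Qed.
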